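(* Assume the setting below. For $v\in C_0^\eta(M,\mathbb R^d)$ let $v_t=\int_0^tv\circ T_s\,ds$ and $S_t=\int_0^t\int_0^s(v\circ T_r)\otimes(v\circ T_s)\,dr\,ds$. (a) If $H\in L^p(Y)$ for some $p\ge2$, then there is $C>0$ such that $|v_t|_{p-1}\le Ct^{1/2}\|v\|_\eta$ for all $v\in C_0^\eta(M,\mathbb R^d)$, $t>0$. (b) If $H\in L^p(Y)$ for some $p\ge4$, then there is $C>0$ such that $|S_t|_{(p-1)/2}\le Ct\|v\|_\eta^2$ for all $v\in C_0^\eta(M,\mathbb R^d)$, $t>0$.
   Context: Setting (nonuniformly hyperbolic flow with exponential contraction along stable leaves). Let $(M,d)$ be a bounded metric space, $Y\subset X\subset M$ Borel, $T_t:M\to M$ a measurable semiflow, $h:X\to(0,\infty)$ with $f(x)=T_{h(x)}x$ defining $f:X\to X$, and $\tau:Y\to\mathbb Z^+$ with $F(y)=f^{\tau(y)}y$ defining $F:Y\to Y$. Let $\mu_Y$ be a Borel ergodic $F$-invariant probability measure on $Y$ with $\tau$ integrable; let $\mu_X=\pi_*\mu^\tau$ where $\mu^\tau=(\mu_Y\times\text{counting})/\int\tau\,d\mu_Y$ on $\{(y,\ell):0\le\ell\le\tau(y)-1\}$ and $\pi(y,\ell)=f^\ell y$; assume $h\in L^1(\mu_X)$ and let $\mu_M$ be the image of $(\mu_X\times\text{Lebesgue})/\int h\,d\mu_X$ on $\{(x,u):0\le u\le h(x)\}$ under $(x,u)\mapsto T_ux$. Let $\mathcal W^s$ be a measurable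 partition of $Y$ into stable leaves $W^s_y\ni y$ with $F(W^s_y)\subset W^s_{Fy}$ and $\tau$ constant on stable leaves. Let $\bar\pi:Y\to\bar Y$ be the quotient by $\mathcal W^s$; the quotient map $\bar F:\bar Y\to\bar Y$ is assumed to be a Gibbs–Markov map (in the standard sense of Aaronson–Denker) with partition $\{\bar Y_j\}$ and ergodic invariant probability measure $\bar\mu=\bar\pi_*\mu_Y$. The separation time $s(y,y')$ on $\bar Y$ is the least $n\ge0$ with $\bar F^ny,\bar F^ny'$ in distinct $\bar Y_j$; set $Y_j=\bar\pi^{-1}\bar Y_j$ and $s(y,y')=s(\bar\pi y,\bar\pi y')$ on $Y$. Let $H(y)=\sum_{\ell=0}^{\tau(y)-1}h(f^\ell y)$, assumed integrable with $\inf H>0$; $H_n=\sum_{j=0}^{n-1}H\circ F^j$ and $J(t)(y)$ is the largest $n\ge0$ with $H_n(y)\le t$. There is a measurable $\hat Y\subset Y$ meeting each stable leaf in exactly one point, and constants $C\ge1$, $\gamma_0\in(0,1)$, $\eta\in(0,1]$ with: $|H(y)-H(y')|\le C(\inf_{Y_j}H)\gamma_0^{s(y,y')}$ for $y,y'\in\hat Y\cap Y_j$; $d(T_ty,T_{t'}y)\le C|t-t'|^\eta$ for $y\in\hat Y$, $t,t'\ge0$; $d(T_ty,T_ty')\le C\gamma_0^t$ for $y\in Y$, $y'\in W^s_y$, $t\ge0$; and $d(T_ty,T_ty')\le C\gamma_0^{s(y,y')-J(t)(y)}$ for $y,y'\in\hat Y\cap Y_j$, $t\ge0$. For $v:M\to\mathbb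 R^d$, $\|v\|_\eta=|v|_\infty+\sup_{x\ne x'}|v(x)-v(x')|/d(x,x')^\eta$; $C_0^\eta(M,\mathbb R^d)$ consists of $v$ with $\|v\|_\eta<\infty$ and $\int v\,d\mu_M=0$. $a\otimes b=ab^T$. Norms $|\cdot|_q$ in the conclusions are on $L^q(M,\mu_M)$. *)

(* Defs.v *)
From HB Require Import structures.
From mathcomp Require Import all_boot all_order all_algebra.
From mathcomp Require Import all_classical all_reals all_analysis.
Set Implicit Arguments. Unset Strict Implicit. Unset Printing Implicit Defensive.
Import Order.TTheory GRing.Theory Num.Theory.
Import numFieldNormedType.Exports.
Local Open Scope classical_set_scope.
Local Open Scope ring_scope.

Definition is_metric {M : Type} {R : realType} (dist : M -> M -> R) : Prop :=
  [/\ (forall x y, 0 <= dist x y),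
      (forall x y, dist x y = 0 <-> x = y),
      (forall x y, dist x y = dist y x) &
      (forall x y z, dist x z <= dist x y + dist y z)].

Definition metric_bounded {M : Type} {R : realType} (dist : M -> M -> R) : Prop :=
  exists D : R, forall x y, dist x y <= D.

Definition dist_open {M : Type} {R : realType} (dist : M -> M -> R) (A : set M) : Prop :=
  forall x, A x -> exists2 e : R, 0 < e & forall y, dist x y < e -> A y.

Definition borel_for {dM} {M : measurableType dM} {R : realType}
  (dist : M -> M -> R) : Prop :=
  forall A : set M, measurable A <-> (<<s dist_open dist >>) A.

Definition measurable_semiflow {dM} {M : measurableType dM} {R : realType}
  (T : R -> M -> M) : Prop :=
  [/\ (forall x, T 0 x = x),
      (forall s t x, 0 <= s -> 0 <= t -> T (s + t) x = T s (T t x)) &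
      measurable_fun [set p : R * M | 0 <= p.1] (fun p : R * M => T p.1 p.2)].

Definition flow_f {M : Type} {R : realType} (T : R -> M -> M) (h : M -> R) (x : M) : M :=
  T (h x) x.

Definition induced_F {M : Type} {R : realType} (T : R -> M -> M) (h : M -> R)
  (tau : M -> nat) (y : M) : M :=
  iter (tau y) (flow_f T h) y.

Definition roofH {M : Type} {R : realType} (T : R -> M -> M) (h : M -> R)
  (tau : M -> nat) (y : M) : R :=
  \sum_(l < tau y) h (iter l (flow_f T h) y).

Definition roofHn {M : Type} {R : realType} (T : R -> M -> M) (h : M -> R)
  (tau : M -> nat) (n : nat) (y : M) : R :=
  \sum_(j < n) roofH T h tau (iter j (induced_F T h tau) y).

(* J(t)(y) = largest n >= 0 with H_n(y) <= t  (as a real number; the set is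
   finite and contains 0 under the standing assumption inf H > 0) *)
Definition lapJ {M : Type} {R : realType} (T : R -> M -> M) (h : M -> R)
  (tau : M -> nat) (t : R) (y : M) : R :=
  sup [set (n%:R : R) | n in [set n : nat | roofHn T h tau n y <= t]].

Definition sep_ge {Yb : Type} (part : Yb -> nat) (Fb : Yb -> Yb) (y y' : Yb) (n : nat) : Prop :=
  forall k, (k < n)%N -> part (iter k Fb y) = part (iter k Fb y').

(* gamma^{s(y,y')}, with gamma^oo = 0 (for 0 < gamma < 1) *)
Definition gpow_sep {Yb : Type} {R : realType} (gamma : R) (part : Yb -> nat)
  (Fb : Yb -> Yb) (y y' : Yb) : R :=
  inf [set gamma ^+ n | n in [set n : nat | sep_ge part Fb y y' n]].

(* partition {Yb_j} given by the index map part : Yb -> nat, Yb_j = part^-1 j *)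
Definition gibbs_markov {dY} {Yb : measurableType dY} {R : realType}
  (Fb : Yb -> Yb) (mu : probability Yb R) (part : Yb -> nat) : Prop :=
  measurable_fun setT Fb /\
  measurable_fun setT part /\
  (forall y y', part y = part y' -> Fb y = Fb y' -> y = y') /\
  (forall j (A : set Yb), measurable A -> A `<=` part @^-1` [set j] ->
      measurable (Fb @` A)) /\
  (forall j y, (Fb @` (part @^-1` [set j])) y ->
      part @^-1` [set part y] `<=` Fb @` (part @^-1` [set j])) /\
  (exists2 c : R, 0 < c & forall j, (0 < mu (part @^-1` [set j]))%E ->
      (c%:E <= mu (Fb @` (part @^-1` [set j])))%E) /\
  (* distortion: zeta = d mu / d (mu o Fb) on each partition element,
     log zeta is Lipschitz w.r.t. the separation time *)
  (exists zeta : Yb -> R, exists K : R, exists2 gam : R, 0 < gam < 1 &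
     [/\ (forall y, 0 < zeta y),
         (forall j (A : set Yb), measurable A -> A `<=` part @^-1` [set j] ->
            mu (Fb @` A) = (\int[mu]_(y in A) ((zeta y)^-1)%:E)%E) &
         (forall y y', part y = part y' ->
            `|ln (zeta y) - ln (zeta y')| <= K * gpow_sep gam part Fb y y')]) /\
  (forall y y', y <> y' -> exists n, part (iter n Fb y) <> part (iter n Fb y')).

Definition mnorm {R : realType} {m n : nat} (A : 'M[R]_(m, n)) : R :=
  Num.sqrt (\sum_(i < m) \sum_(j < n) A i j ^+ 2).

(* ||v||_eta = |v|_oo + sup_{x<>x'} |v(x)-v(x')| / d(x,x')^eta  (sup of empty set read as 0) *)
Definition holder_norm {M : Type} {R : realType} {d : nat} (dist : M -> M -> R) (eta : R)
  (v : M -> 'cV[R]_d) : \bar R :=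
  (ereal_sup ([set 0%E] `|` [set (mnorm (v x))%:E | x in [set: M]]) +
   ereal_sup ([set 0%E] `|`
     [set (mnorm (v p.1 - v p.2) / (dist p.1 p.2 `^ eta))%:E
        | p in [set p : M * M | p.1 <> p.2]]))%E.

Definition vint {dM} {M : measurableType dM} {R : realType} {d : nat}
  (T : R -> M -> M) (v : M -> 'cV[R]_d) (t : R) (x : M) : 'cV[R]_d :=
  \col_i (\int[@lebesgue_measure R]_(s in `[0, t]) (v (T s x) i 0)).

Definition Sint {dM} {M : measurableType dM} {R : realType} {d : nat}
  (T : R -> M -> M) (v : M -> 'cV[R]_d) (t : R) (x : M) : 'M[R]_d :=
  \matrix_(i, j) (\int[@lebesgue_measure R]_(s in `[0, t])
      ((\int[@lebesgue_measure R]_(r in `[0, s]) (v (T r x) i 0)) * v (T s x) j 0)).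

(* Main.v *)
Require Import Defs.
From HB Require Import structures.
From mathcomp Require Import all_boot all_order all_algebra.
From mathcomp Require Import all_classical all_reals all_analysis.
From mathcomp Require Import measurable_realfun ring lra.
Import Order.TTheory GRing.Theory Num.Theory.
Import numFieldNormedType.Exports.
Local Open Scope classical_set_scope.
Local Open Scope ring_scope.

(** The stable leaves contract exponentially, so up to a bounded error the
   integral of the observable along the flow is a Birkhoff sum over the quotient
   Gibbs-Markov map of a function [Vhat], locally Lipschitz with constants
   comparable to the roof [H].  The return time of the flow, however, is [H] itself
   and not its value on the chosen section, which leads to a dichotomy.

   If [H] is almost surely constant along stable leaves, a Doeblin estimate for the
   transfer operator writes [Vhat] as a martingale difference plus a coboundary
   with a remainder as small as wished.  Burkholder and Doob type inequalities in
   [L^p] then bound the Birkhoff sums and, through Chen's relation and summation by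
   parts, the iterated sums.  One factor [H] is lost (whence [p - 1]) in passing
   from the base to the flow, by Young's inequality.

   If [H] differs along stable leaves on a set of positive measure, an orbit
   starting there is asymptotically periodic, so its integral grows linearly or
   stays bounded by a constant that depends only on the flow.  Linear growth is
   excluded by the maximal ergodic theorem and ergodicity makes the bound hold
   almost everywhere. *)

(** * Martingale inequalities *)

(** The map on the quotient is not invertible, so the martingales run backwards:
    [M (k + 1) x = m k x + M k (F x)], where [m k] is orthogonal to functions of [F x]. Running
    maxima are therefore taken over the ends of an orbit segment, and sums from its start are
    recovered from them by additivity. The quotient map is only known to be ergodic and may be
    periodic, hence the contraction is proved for averages of iterates and not for a single iterate.
    The induced observables are unbounded, of the size of the roof, but one application of the
    transfer operator makes them bounded. For [n] laps the remainder is taken of size [1 / n]: its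
    sum stays below 1, and the Poisson equation never has to be solved exactly. After division by
    the Hölder norm all observables lie in one unit ball, which makes the constants uniform in
    [v]. *)

Section pointwise_inequalities.
Context {R : realType}.
Implicit Types (x y q a b : R).

Lemma powR_split x a b : 0 <= a -> 0 <= b -> 0 < a + b ->
  x `^ (a + b) = x `^ a * x `^ b.
Proof.
move=> a0 b0 ab0; rewrite powRD//; apply/implyP => /eqP e.
by move: ab0; rewrite e ltxx.
Qed.

(** Young's inequality with constant 1: replacing the smaller base by the larger one turns the
    product into a single power. *)
Lemma powR_mix_le x y a b : 0 <= x -> 0 <= y -> 0 <= a -> 0 <= b -> 0 < a + b ->
  x `^ a * y `^ b <= x `^ (a + b) + y `^ (a + b).
Proof.
move=> x0 y0 a0 b0 ab0; have [xy|/ltW yx] := leP x y.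
- rewrite (powR_split y)//; apply: (@le_trans _ _ (y `^ a * y `^ b)).
    by apply: ler_wpM2r; rewrite ?powR_ge0// ge0_ler_powR.
  by rewrite lerDr powR_ge0.
- rewrite (powR_split x)//; apply: (@le_trans _ _ (x `^ a * x `^ b)).
    by apply: ler_wpM2l; rewrite ?powR_ge0// ge0_ler_powR.
  by rewrite lerDl powR_ge0.
Qed.

Lemma powRD_le x y q : 0 <= x -> 0 <= y -> 0 <= q ->
  (x + y) `^ q <= 2 `^ q * (x `^ q + y `^ q).
Proof.
move=> x0 y0 q0; wlog xy : x y x0 y0 / x <= y.
  by have [xy h|/ltW yx h] := leP x y; [exact: h|rewrite addrC [X in _ * X]addrC; exact: h].
apply: (@le_trans _ _ ((2 * y) `^ q)).
  by apply: ge0_ler_powR; rewrite ?nnegrE//; lra.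
by rewrite powRM// ler_wpM2l ?powR_ge0// lerDr powR_ge0.
Qed.

Lemma expR_le_quadratic x : expR x <= 1 + x + x ^+ 2 * expR `|x|.
Proof.
have [x0|x0] := leP 0 x.
- have h : expR x - 1 <= x * expR x.
    have := expR_ge1Dx (- x); rewrite expRN => h.
    have e0 := expR_gt0 x.
    have : (1 - x) * expR x <= 1.
      by rewrite -ler_pdivlMr// div1r.
    lra.
  rewrite (ger0_norm x0) expr2; nra.
- have [z0 e] : 0 < - x /\ - x = - x by split => //; lra.
  move: {e} (- x) z0 (opprK x) => z z0 <-.
  apply: (@le_trans _ _ (1 - z + z ^+ 2)).
    rewrite expRN -[leRHS]divr1 ler_pdivlMr// mulrC ler_pdivrMr ?expR_gt0//.
    have := expR_ge1Dx z; rewrite mulrC => h.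
    have h2 : 0 < 1 - z + z ^+ 2 by nra.
    nra.
  rewrite sqrrN lerD2l; rewrite ler_peMr ?sqr_ge0//.
  by rewrite -[leLHS]expR0 ler_expR.
Qed.

Lemma powR_taylor2_near r q : 2 <= q -> `|r| <= 2^-1 ->
  (1 + r) `^ q <= 1 + q * r + (q ^+ 2 * expR q) * r ^+ 2.
Proof.
move=> q2 r2.
have [r1 r1'] : - 2^-1 <= r /\ r <= 2^-1 by split; move: r2; rewrite ler_norml => /andP[].
apply: (@le_trans _ _ (expR (q * r))).
  rewrite mulrC expRM; apply: ge0_ler_powR; rewrite ?nnegrE ?expR_ge0//; [lra|lra|].
  exact: expR_ge1Dx.
apply: (le_trans (expR_le_quadratic _)); rewrite lerD2l exprMn.
rewrite mulrAC ler_wpM2r ?sqr_ge0// ler_wpM2l ?sqr_ge0// ler_expR normrM.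
rewrite ger0_norm; last lra.
have : 0 <= `|r| by []. nra.
Qed.

(** The term linear in [y] is kept exact because it integrates to zero when [y] is a martingale
    difference. For [|y| < |x| / 2] this is the Taylor expansion of [(1 + y / x) ^ q]; otherwise
    [|x + y| ^ q] and the linear term are at most multiples of [|y| ^ q]. *)
Lemma powR_taylor2 q : 2 <= q -> exists2 c : R, 0 < c & forall x y,
  `|x + y| `^ q <= `|x| `^ q + q * `|x| `^ (q - 2) * x * y
     + c * (`|x| `^ (q - 2) * y ^+ 2 + `|y| `^ q).
Proof.
move=> q2; have q0 : 0 <= q by lra.
pose c0 := q ^+ 2 * expR q; have c00 : 0 < c0.
  by rewrite mulr_gt0 ?expR_gt0// exprn_gt0//; lra.
pose c1 := 3 `^ q + q * 2 `^ (q - 1).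
have c10 : 0 <= c1 by rewrite addr_ge0 ?powR_ge0// mulr_ge0 ?powR_ge0.
exists (c0 + c1); first lra.
move=> x y.
have t1 : 0 <= `|x| `^ (q - 2) * y ^+ 2 by rewrite mulr_ge0 ?powR_ge0 ?sqr_ge0.
have t2 : 0 <= `|y| `^ q by rewrite powR_ge0.
have e2 : `|x| `^ (q - 1) = `|x| `^ (q - 2) * `|x|.
  have -> : q - 1 = (q - 2) + 1 by ring.
  by rewrite powR_split ?powRr1//; lra.
have e3 : `|x| `^ q = `|x| `^ (q - 1) * `|x|.
  have -> : q = (q - 1) + 1 by ring.
  by rewrite powR_split ?powRr1//; [congr (_ `^ _ * _); ring|lra..].
have [yx|xy] := ltP (`|y|) (`|x| / 2).
- have x0 : 0 < `|x| by have := normr_ge0 y; lra.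
  have xn0 : x != 0 by rewrite -normr_gt0.
  have -> : x + y = x * (1 + y / x) by rewrite mulrDr mulr1 mulrCA divff// mulr1.
  have hr : `|y / x| <= 2^-1.
    by rewrite normrM normfV ler_pdivrMr//; lra.
  have h1 : 0 <= 1 + y / x.
    by move: hr; rewrite ler_norml => /andP[h _]; lra.
  rewrite normrM powRM// (ger0_norm h1).
  have := powR_taylor2_near _ _ q2 hr; rewrite -/c0 => h.
  apply: (@le_trans _ _ (`|x| `^ q * (1 + q * (y / x) + c0 * (y / x) ^+ 2))).
    by rewrite ler_wpM2l ?powR_ge0.
  have E : `|x| `^ q = `|x| `^ (q - 2) * x ^+ 2.
    by rewrite e3 e2 -mulrA -expr2 real_normK// num_real.
  have -> : `|x| `^ q * (1 + q * (y / x) + c0 * (y / x) ^+ 2) =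
     `|x| `^ q + q * `|x| `^ (q - 2) * x * y + c0 * (`|x| `^ (q - 2) * y ^+ 2).
    by rewrite E; field.
  nra.
- have h1 : `|x + y| `^ q <= 3 `^ q * `|y| `^ q.
    rewrite -powRM//; apply: ge0_ler_powR; rewrite ?nnegrE ?mulr_ge0//.
    apply: (le_trans (ler_normD _ _)); lra.
  have h2 : - (q * `|x| `^ (q - 2) * x * y) <= q * 2 `^ (q - 1) * `|y| `^ q.
    apply: (le_trans (ler_norm _)); rewrite normrN !normrM (ger0_norm q0).
    rewrite (ger0_norm (powR_ge0 _ _)) -!mulrA ler_wpM2l//.
    rewrite mulrA -e2.
    have -> : `|y| `^ q = `|y| `^ (q - 1) * `|y|.
      have {1}-> : q = (q - 1) + 1 by ring.
      by rewrite powR_split ?powRr1//; lra.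
    rewrite mulrA ler_wpM2r// -powRM//; apply: ge0_ler_powR; rewrite ?nnegrE//.
    + lra.
    + lra.
  have h3 : 0 <= `|x| `^ q by rewrite powR_ge0.
  rewrite mulrDl !mulrDr.
  have : 0 <= c0 * (`|x| `^ (q - 2) * y ^+ 2) by nra.
  have : 0 <= c0 * `|y| `^ q by nra.
  have : 0 <= c1 * (`|x| `^ (q - 2) * y ^+ 2) by nra.
  rewrite /c1 [X in _ + (_ + X)]mulrDl; lra.
Qed.

(** The power lies above its tangent at 1. Writing [x ^ q = x * exp ((q - 1) * ln x)] reduces this
    to [1 + s <= exp s] and [1 - 1 / x <= ln x]. *)
Lemma bernoulli_powR x q : 0 <= x -> 1 <= q -> q * x - (q - 1) <= x `^ q.
Proof.
move=> x0 q1; have [->|xn0] := eqVneq x 0.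
  by rewrite mulr0 powR0 ?lt0r_neq0//; lra.
have {x0 xn0} x0 : 0 < x by rewrite lt_neqAle eq_sym xn0.
pose f := fun t : R => t.
have h := expR_ge1Dx (ln x).
have e : x `^ q = x * expR ((q - 1) * ln x).
  rewrite -[X in _ = X * _](lnK x0) -expRD /powR gt_eqF//; congr expR; ring.
have h3 : 1 - x^-1 <= ln x.
  have := expR_ge1Dx (- ln x); rewrite expRN lnK ?posrE//; lra.
have h2 := expR_ge1Dx ((q - 1) * ln x).
have h4 : (q - 1) * (1 - x^-1) <= (q - 1) * ln x by rewrite ler_wpM2l//; lra.
rewrite e; apply: (@le_trans _ _ (x * (1 + (q - 1) * (1 - x^-1)))); last first.
  by rewrite ler_wpM2l ?(ltW x0)//; lra.
by rewrite le_eqVlt; apply/orP; left; apply/eqP; field; rewrite gt_eqF.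
Qed.

(* A Bellman function for Doob's inequality: integrating [doob_bellman_step]
   against a martingale difference [d] shows that its expectation decreases. *)
Definition doob_bellman q x (u : R) : R :=
  u `^ q - q / (q - 1) * (u `^ (q - 1) * `|x|).

Lemma doob_bellman_step q x (u d : R) : 1 < q -> 0 <= u -> `|x| <= u ->
  doob_bellman q (d + x) (Num.max `|d + x| u) <=
  doob_bellman q x u - q / (q - 1) * (u `^ (q - 1) * Num.sg x) * d.
Proof.
move=> q1 u0 xu; set k := q / (q - 1).
have k0 : 0 <= k by rewrite divr_ge0//; lra.
have conv : `|x| + Num.sg x * d <= `|d + x|.
  rewrite [in X in X + _]normrEsg -mulrDr addrC.
  apply: (le_trans (ler_norm _)); rewrite normrM addrC.
  by rewrite ler_piMl// normr_sg; case: (x != 0).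
have A : 0 <= k * u `^ (q - 1) by rewrite mulr_ge0// powR_ge0.
have lin : u `^ q - k * (u `^ (q - 1) * `|d + x|) <=
   doob_bellman q x u - k * (u `^ (q - 1) * Num.sg x) * d.
  rewrite /doob_bellman -/k.
  have : (k * u `^ (q - 1)) * (`|x| + Num.sg x * d) <= (k * u `^ (q - 1)) * `|d + x|.
    by rewrite ler_wpM2l.
  lra.
have [xu'|ux] := leP (`|d + x|) u; first exact: le_trans lin.
(* When the new value [r] exceeds [u], the left side is [- r ^ q / (q - 1)], and Bernoulli's
   inequality at [r / u] puts it below the linear bound. *)
apply: le_trans lin; rewrite /doob_bellman -/k.
set r := `|d + x| in ux *; have r0 : 0 < r by lra.
have rr : r `^ (q - 1) * r = r `^ q by rewrite mulrC mulr_powRB1//; lra.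
rewrite rr.
have q10 : 0 < q - 1 by lra.
have kE : k = 1 + (q - 1)^-1 by rewrite /k; field; rewrite gt_eqF.
have [->|un0] := eqVneq u 0.
  rewrite !powR0 ?gt_eqF//; last lra.
  rewrite mul0r mulr0 subr0.
  have := powR_ge0 r q; rewrite kE.
  have : 0 <= (q - 1)^-1 by rewrite invr_ge0 ltW.
  nra.
have {un0} u0' : 0 < u by rewrite lt_neqAle eq_sym un0.
have h := bernoulli_powR (r / u) q (divr_ge0 (ltW r0) (ltW u0')) (ltW q1).
have e1 : (r / u) `^ q * u `^ q = r `^ q.
  by rewrite -powRM ?divr_ge0 ?ltW// mulfVK// gt_eqF.
have e2 : u `^ q = u `^ (q - 1) * u by rewrite mulrC mulr_powRB1//; lra.
have P : 0 < u `^ q by rewrite powR_gt0.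
have h2 : (q * (r / u) - (q - 1)) * u `^ q <= r `^ q.
  by rewrite -e1 ler_wpM2r// ltW.
have h3 : q * (u `^ (q - 1) * r) - (q - 1) * u `^ q <= r `^ q.
  apply: le_trans h2; rewrite le_eqVlt; apply/orP; left; apply/eqP.
  by rewrite e2; field; rewrite gt_eqF.
have -> : r `^ q - k * r `^ q = - (r `^ q / (q - 1)) by rewrite kE; ring.
have -> : u `^ q - k * (u `^ (q - 1) * r) =
   - ((q * (u `^ (q - 1) * r) - (q - 1) * u `^ q) / (q - 1)).
  by rewrite /k; field; rewrite gt_eqF.
by rewrite lerN2 ler_pM2r ?invr_gt0.
Qed.

(** The cases are [y ^ 2 <= x ^ 2 / N] and its negation. With [N] the number of steps, the first
    term amplifies a moment by [1 + c / N] per step, which stays bounded over [N] steps. *)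
Lemma powR_weight_le N x y q : 1 <= N -> 0 <= x -> 0 <= y -> 2 <= q ->
  x `^ (q - 2) * y ^+ 2 <= N^-1 * x `^ q + N `^ (q / 2 - 1) * y `^ q.
Proof.
move=> N1 x0 y0 q2; have N0 : 0 < N by lra.
have sq z : 0 <= z -> z `^ q = z `^ (q - 2) * z ^+ 2.
  move=> z0; rewrite -powR_mulrn// -powR_split; [congr (_ `^ _); ring|lra..].
have A : 0 <= N^-1 * x `^ q by rewrite mulr_ge0 ?powR_ge0// invr_ge0 ltW.
have B : 0 <= N `^ (q / 2 - 1) * y `^ q by rewrite mulr_ge0 ?powR_ge0.
have [h|h] := leP (y ^+ 2) (N^-1 * x ^+ 2).
- apply: (@le_trans _ _ (N^-1 * x `^ q)); last by rewrite lerDl.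
  by rewrite (sq x x0) [leRHS]mulrCA ler_wpM2l ?powR_ge0.
- apply: (@le_trans _ _ (N `^ (q / 2 - 1) * y `^ q)); last by rewrite lerDr.
  rewrite (sq y)// mulrA ler_wpM2r ?sqr_ge0//.
  have : x <= N `^ (2^-1) * y.
    rewrite -(@ler_pXn2r _ 2)// ?nnegrE ?mulr_ge0 ?powR_ge0//.
    rewrite exprMn -[in leRHS]powR_mulrn ?powR_ge0// -powRrM mulVf// powRr1 ?(ltW N0)//.
    by rewrite -ler_pdivrMl// ltW.
  move=> h2; apply: (@le_trans _ _ ((N `^ 2^-1 * y) `^ (q - 2))).
    by apply: ge0_ler_powR; rewrite ?nnegrE ?mulr_ge0 ?powR_ge0//; lra.
  rewrite powRM ?powR_ge0// -powRrM le_eqVlt; apply/orP; left; apply/eqP.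
  by congr (_ `^ _ * _); field.
Qed.

Lemma powR_cross_le u v w q : 1 <= q -> 0 <= u -> 0 <= v -> w <= v + u ->
  u `^ (q - 1) * w <= 2 `^ q * (u `^ q + (v `^ q + u `^ q)).
Proof.
move=> q1 u0 v0 wvu; have q0 : 0 <= q by lra.
have q10 : 0 <= q - 1 by lra.
have vu0 : 0 <= v + u by rewrite addr_ge0.
apply: (@le_trans _ _ (u `^ (q - 1) * (v + u) `^ 1)).
  by rewrite powRr1// ler_wpM2l ?powR_ge0.
have h := powR_mix_le u (v + u) (q - 1) 1 u0 vu0 q10 ler01.
rewrite subrK in h; apply: (le_trans (h _)); first by lra.
have t1 := powRD_le v u q v0 u0 q0.
have t2 : 1 <= 2 `^ q by rewrite -[leLHS](powRr0 2) ler_powR//; lra.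
have t3 := powR_ge0 u q.
nra.
Qed.

(** The coefficient [1/2] lets the maximal function be absorbed into the left side of Doob's
    estimate. *)
Lemma powR_absorb_le k q : 0 <= k -> 1 <= q -> exists2 K : R, 0 < K &
  forall u y, 0 <= u -> 0 <= y ->
    k * (u `^ (q - 1) * y) <= 2^-1 * u `^ q + K * y `^ q.
Proof.
move=> k0 q1; exists (k * (2 * k) `^ (q - 1) + 1).
  by rewrite ltr_wpDl// mulr_ge0 ?powR_ge0.
move=> u y u0 y0; have q0 : 0 < q by lra.
have A : 0 <= u `^ q by rewrite powR_ge0.
have B : 0 <= y `^ q by rewrite powR_ge0.
have C : 0 <= k * (2 * k) `^ (q - 1) by rewrite mulr_ge0 ?powR_ge0.
have D : 0 <= u `^ (q - 1) by rewrite powR_ge0.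
have [h|h] := leP (k * y) (2^-1 * u).
- apply: (@le_trans _ _ (2^-1 * u `^ q)); last nra.
  rewrite -(mulr_powRB1 u0 q0) [leRHS]mulrA [leRHS]mulrC mulrCA.
  by rewrite ler_wpM2l.
- apply: (@le_trans _ _ (k * (2 * k) `^ (q - 1) * y `^ q)); last nra.
  rewrite -mulrA ler_wpM2l// -(mulr_powRB1 y0 q0) mulrCA [leLHS]mulrC ler_wpM2l//.
  rewrite -powRM ?mulr_ge0//; apply: ge0_ler_powR; rewrite ?nnegrE ?mulr_ge0//; lra.
Qed.

End pointwise_inequalities.

(** * Reverse martingales over a measure-preserving map *)

Section stationary.
Context {R : realType} {d : measure_display} {T : measurableType d}.
Variables (mu : probability T R) (F : T -> T).
Hypothesis mF : measurable_fun setT F.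
Hypothesis invF : forall A, measurable A -> mu (F @^-1` A) = mu A.

Lemma measurable_powRf (q : R) (f : T -> R) : measurable_fun setT f ->
  measurable_fun setT (fun x => f x `^ q).
Proof. by move=> mf; apply: (measurableT_comp (measurable_powR q)). Qed.

Lemma measurable_scalef (k : R) (f : T -> R) : measurable_fun setT f ->
  measurable_fun setT (fun x => k * f x).
Proof. by move=> mf; apply: measurable_funM. Qed.

Lemma measurable_normf (f : T -> R) : measurable_fun setT f ->
  measurable_fun setT (fun x => `|f x|).
Proof. by move=> mf; apply: measurableT_comp. Qed.

Lemma integral_invariant (f : T -> \bar R) :
  measurable_fun setT f -> (forall x, 0 <= f x)%E ->
  (\int[mu]_x f (F x) = \int[mu]_x f x)%E.
Proof.
move=> mf f0.
have -> : (\int[mu]_x f x = \int[pushforward mu F]_x f x)%E.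
  by apply: eq_measure_integral => A mA _; exact: esym (invF _ mA).
by rewrite ge0_integral_pushforward.
Qed.

Lemma integral_invariantR (f : T -> R) :
  measurable_fun setT f -> (forall x, 0 <= f x) ->
  (\int[mu]_x (f (F x))%:E = \int[mu]_x (f x)%:E)%E.
Proof.
move=> mf f0; apply: (integral_invariant (EFin \o f)); first exact/measurable_EFinP.
by move=> x; rewrite lee_fin.
Qed.

(** Integrates a pointwise bound whose last term has no sign but zero mean; [z] will be a martingale
    difference times a function of the image point. *)
Lemma integral_le_add0 (f b z : T -> R) :
  measurable_fun setT f -> measurable_fun setT b ->
  (forall x, 0 <= f x) -> (forall x, 0 <= b x) ->
  (\int[mu]_x (b x)%:E < +oo)%E ->
  mu.-integrable setT (EFin \o z) -> (\int[mu]_x (z x)%:E = 0)%E ->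
  (forall x, f x <= b x + z x) ->
  (\int[mu]_x (f x)%:E <= \int[mu]_x (b x)%:E)%E.
Proof.
move=> mf mb f0 b0 boo iz z0 fbz.
have ib : mu.-integrable setT (EFin \o b).
  apply/integrableP; split; first exact/measurable_EFinP.
  by under eq_integral do rewrite /= ger0_norm//.
have ibz : mu.-integrable setT (fun x => (b x)%:E + (z x)%:E)%E.
  exact: (integrableD measurableT ib iz).
have if_ : mu.-integrable setT (EFin \o f).
  apply: (le_integrable measurableT _ _ ibz); first exact/measurable_EFinP.
  move=> x _ /=; rewrite lee_fin !ger0_norm//; exact: le_trans (fbz x).
have -> : (\int[mu]_x (b x)%:E = \int[mu]_x ((b x)%:E + (z x)%:E))%E.
  by rewrite (integralD measurableT ib iz) /= z0 adde0.
by apply: le_integral => // x _; rewrite lee_fin.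
Qed.

(** The conditional expectation of [m] given the image point [F x] vanishes. Testing against every
    [g \o F] with integrable product expresses this without conditional expectations and admits
    unbounded multipliers such as powers of the martingale. *)
Definition mart_diff (m : T -> R) := measurable_fun setT m /\
  forall g : T -> R, measurable_fun setT g ->
    mu.-integrable setT (fun x => (m x * g (F x))%:E) ->
    (\int[mu]_x (m x * g (F x))%:E = 0)%E.

Lemma integral_sum2 (f g : T -> R) : measurable_fun setT f -> measurable_fun setT g ->
  (forall x, 0 <= f x) -> (forall x, 0 <= g x) ->
  (\int[mu]_x (f x + g x)%:E = \int[mu]_x (f x)%:E + \int[mu]_x (g x)%:E)%E.
Proof.
move=> mf mg f0 g0; under eq_integral do rewrite EFinD.
by rewrite ge0_integralD//; [move=> x _; rewrite lee_fin|exact/measurable_EFinP|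
  move=> x _; rewrite lee_fin|exact/measurable_EFinP].
Qed.

Lemma integral_scale (k : R) (f : T -> R) : 0 <= k -> measurable_fun setT f ->
  (forall x, 0 <= f x) ->
  (\int[mu]_x (k * f x)%:E = k%:E * \int[mu]_x (f x)%:E)%E.
Proof.
move=> k0 mf f0; under eq_integral do rewrite EFinM.
rewrite ge0_integralZl_EFin//; first by move=> x _; rewrite lee_fin.
exact/measurable_EFinP.
Qed.

Lemma integral_mono (f g : T -> R) : measurable_fun setT f -> measurable_fun setT g ->
  (forall x, 0 <= f x) -> (forall x, f x <= g x) ->
  (\int[mu]_x (f x)%:E <= \int[mu]_x (g x)%:E)%E.
Proof.
move=> mf mg f0 fg; apply: ge0_le_integral => //.
- by move=> x _; rewrite lee_fin.
- exact/measurable_EFinP.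
- exact/measurable_EFinP.
- by move=> x _; rewrite lee_fin.
Qed.

Lemma integrable_dominated (f b : T -> R) : measurable_fun setT f ->
  measurable_fun setT b -> (forall x, `|f x| <= b x) ->
  (\int[mu]_x (b x)%:E < +oo)%E -> mu.-integrable setT (EFin \o f).
Proof.
move=> mf mb fb boo; apply/integrableP; split; first exact/measurable_EFinP.
apply: le_lt_trans boo; apply: integral_mono => //; exact: measurable_normf.
Qed.

Lemma integral_ge0E (f : T -> R) : (forall x, 0 <= f x) ->
  (0 <= \int[mu]_x (f x)%:E)%E.
Proof. by move=> f0; apply: integral_ge0 => x _; rewrite lee_fin. Qed.

Section martingale.
Variables (q : R).
Hypothesis q2 : 2 <= q.
Variables (m M : nat -> T -> R).
Hypothesis md : forall k, mart_diff (m k).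
Hypothesis M0 : forall x, M 0 x = 0.
Hypothesis MS : forall k x, M k.+1 x = m k x + M k (F x).

Lemma mart_measurable k : measurable_fun setT (M k).
Proof.
elim: k => [|k ih].
  by rewrite (_ : M 0 = cst 0)//; apply/funext.
rewrite (_ : M k.+1 = (fun x => m k x + M k (F x))); last by apply/funext.
by apply: measurable_funD; [exact: (md k).1|exact: measurableT_comp].
Qed.

(** In the second-order expansion around [M k (F x)] the linear term is [m k] times a function of
    [F x] and drops out. The weight [n + 1] is the time horizon, not the current time [k]. *)
Lemma mart_moment_step (c a s : R) n k : 0 < c -> 0 <= s ->
  (forall x y : R,
   `|x + y| `^ q <= `|x| `^ q + q * `|x| `^ (q - 2) * x * y
     + c * (`|x| `^ (q - 2) * y ^+ 2 + `|y| `^ q)) ->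
  (\int[mu]_x (`|m k x| `^ q)%:E <= s%:E)%E ->
  (\int[mu]_x (`|M k x| `^ q)%:E <= a%:E)%E ->
  (\int[mu]_x (`|M k.+1 x| `^ q)%:E <=
    ((1 + c / n.+1%:R) * a + c * (n.+1%:R `^ (q / 2 - 1) + 1) * s)%:E)%E.
Proof.
move=> c0 s0 cE ms Ma; have q2' := q2; have q0 : 0 <= q by lra.
set N : R := n.+1%:R; have N1 : 1 <= N by rewrite ler1n.
have mM := mart_measurable.
have mk := (md k).1.
set A := fun x => `|M k x| `^ q.
have mA : measurable_fun setT A.
  exact/measurable_powRf/measurable_normf.
have A0 x : 0 <= A x by exact: powR_ge0.
have mAF : measurable_fun setT (A \o F) by exact: measurableT_comp.
set D := fun x => `|m k x| `^ q.
have mD : measurable_fun setT D.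
  exact/measurable_powRf/measurable_normf.
have D0 x : 0 <= D x by exact: powR_ge0.
have intAF : (\int[mu]_x (A (F x))%:E <= a%:E)%E.
  by rewrite (integral_invariantR A).
set p1 := 1 + c / N; set p2 := c * (N `^ (q / 2 - 1) + 1).
have p10 : 0 <= p1 by rewrite /p1 addr_ge0// divr_ge0//; lra.
have p20 : 0 <= p2 by rewrite /p2 mulr_ge0 ?addr_ge0 ?powR_ge0//; lra.
pose b x := p1 * A (F x) + p2 * D x.
pose g x := q * `|M k x| `^ (q - 2) * M k x.
have mg : measurable_fun setT g.
  apply: measurable_funM => //; apply: measurable_funM => //.
  exact/measurable_powRf/measurable_normf.
have mb : measurable_fun setT b.
  by apply: measurable_funD; apply: measurable_funM.
have b0 x : 0 <= b x by rewrite /b addr_ge0// mulr_ge0.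
have intb : (\int[mu]_x (b x)%:E <= (p1 * a + p2 * s)%:E)%E.
  rewrite integral_sum2; [|exact: measurable_funM|exact: measurable_funM|
     by move=> x; rewrite mulr_ge0|by move=> x; rewrite mulr_ge0].
  have -> : (\int[mu]_x (p1 * A (F x))%:E = p1%:E * \int[mu]_x (A (F x))%:E)%E.
    by apply: (integral_scale p1 (A \o F)) => // x; exact: A0.
  rewrite (integral_scale p2 D)// [leRHS]EFinD (EFinM p1) (EFinM p2).
  by apply: leeD; apply: lee_wpmul2l; rewrite ?lee_fin.
have mz : measurable_fun setT (fun x => m k x * g (F x)).
  by apply: measurable_funM => //; apply: measurableT_comp.
have iz : mu.-integrable setT (fun x => (m k x * g (F x))%:E).
  apply: (@integrable_dominated _ (fun x => q * (A (F x) + D x))) => //.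
  - by apply: measurable_funM => //; apply: measurable_funD.
  - move=> x; rewrite /g !normrM (ger0_norm q0) (ger0_norm (powR_ge0 _ _)).
    have -> : `|m k x| * (q * `|M k (F x)| `^ (q - 2) * `|M k (F x)|) =
       q * (`|M k (F x)| `^ (q - 1) * `|m k x| `^ 1).
      rewrite powRr1//.
      have -> : q - 1 = (q - 2) + 1 by ring.
      rewrite (powR_split _ (q - 2) 1)// ?powRr1//; [ring|lra..].
    rewrite ler_wpM2l//.
    have -> : A (F x) + D x = `|M k (F x)| `^ (q - 1 + 1) + `|m k x| `^ (q - 1 + 1).
      by rewrite subrK.
    apply: powR_mix_le => //; lra.
  - rewrite integral_scale//; [|exact: measurable_funD|by move=> x; rewrite addr_ge0].
    rewrite integral_sum2//.
    apply: (@le_lt_trans _ _ (q%:E * (a%:E + s%:E))%E); last by rewrite -EFinD -EFinM ltry.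
    by apply: lee_wpmul2l; rewrite ?lee_fin// leeD.
have z0 := (md k).2 g mg iz.
apply: (le_trans _ intb).
apply: (@integral_le_add0 _ b (fun x => m k x * g (F x))) => //.
- exact/measurable_powRf/measurable_normf.
- by apply: (le_lt_trans intb); rewrite ltry.
- move=> x; rewrite MS addrC; apply: (le_trans (cE _ _)).
  have := powR_weight_le N _ _ _ N1 (normr_ge0 (M k (F x))) (normr_ge0 (m k x)) q2.
  rewrite real_normK ?num_real// /b /g /p1 /p2 /A /D => h.
  have : c * (`|M k (F x)| `^ (q - 2) * m k x ^+ 2) <=
     c * (N^-1 * `|M k (F x)| `^ q + N `^ (q / 2 - 1) * `|m k x| `^ q).
    by rewrite ler_wpM2l// ltW.
  rewrite -subr_ge0 -[in X in _ -> X]subr_ge0 => /le_trans; apply.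
  by rewrite le_eqVlt; apply/orP; left; apply/eqP; ring.
Qed.

End martingale.

(** Each of the [n] steps adds about [n ^ (q / 2 - 1) * s] and amplifies by [1 + c / n], whose
    [n]-th power is at most [exp c]. The differences may vary with [k], as those of iterated sums
    do. *)
Lemma mart_moment (q : R) : 2 <= q -> exists2 K : R, 0 < K &
  forall (n : nat) (m M : nat -> T -> R) (s : R), 0 <= s ->
  (forall k, mart_diff (m k)) -> (forall x, M 0 x = 0) ->
  (forall k x, M k.+1 x = m k x + M k (F x)) ->
  (forall k, (k < n)%N -> (\int[mu]_x (`|m k x| `^ q)%:E <= s%:E)%E) ->
  forall k, (k <= n)%N ->
    (\int[mu]_x (`|M k x| `^ q)%:E <= (K * n%:R `^ (q / 2) * s)%:E)%E.
Proof.
move=> q2; have [c c0 cE] := powR_taylor2 q q2.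
exists (2 * c * expR c); first by rewrite !mulr_gt0 ?expR_gt0.
move=> [|n] m M s s0 md M0 MS ms k kn.
  move: kn; rewrite leqn0 => /eqP ->.
  rewrite integral0_eq ?lee_fin; last first.
    by move=> x _; rewrite M0 normr0 powR0// gt_eqF//; lra.
  rewrite !mulr_ge0 ?powR_ge0 ?expR_ge0//; lra.
set N : R := n.+1%:R; have N1 : 1 <= N by rewrite ler1n.
pose la := 1 + c / N; pose b := c * (N `^ (q / 2 - 1) + 1) * s.
have la1 : 1 <= la by rewrite /la lerDl divr_ge0//; lra.
have b0 : 0 <= b by rewrite /b !mulr_ge0 ?addr_ge0 ?powR_ge0//; lra.
have H j : (j <= n.+1)%N ->
    (\int[mu]_x (`|M j x| `^ q)%:E <= (j%:R * la ^+ j * b)%:E)%E.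
  elim: j => [_|j ih jn].
    rewrite integral0_eq ?mul0r// => x _.
    by rewrite M0 normr0 powR0// gt_eqF//; lra.
  have := mart_moment_step q q2 m M md M0 MS c _ s n j c0 s0 cE (ms j jn) (ih (ltnW jn)).
  move=> /le_trans; apply; rewrite lee_fin -/N -/la -/b.
  rewrite -natr1 exprS.
  have : 1 <= la * la ^+ j by rewrite -exprS exprn_ege1.
  nra.
apply: (le_trans (H k kn)); rewrite lee_fin.
have kN : k%:R <= N by rewrite ler_nat.
have laE : la ^+ k <= expR c.
  apply: (@le_trans _ _ (la ^+ n.+1)); first by rewrite ler_weXn2l.
  have -> : expR c = expR (c / N) ^+ n.+1.
    by rewrite -expRM_natl mulrC divfK// gt_eqF//; lra.
  by apply: lerXn2r; rewrite ?nnegrE ?expR_ge0 ?expR_ge1Dx//; lra.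
have NE : N `^ (q / 2) = N * N `^ (q / 2 - 1).
  by rewrite mulr_powRB1//; lra.
have N2 : 1 <= N `^ (q / 2 - 1).
  by rewrite -[leLHS](powRr0 N) ler_powR//; lra.
have bE : b <= 2 * c * N `^ (q / 2 - 1) * s.
  rewrite /b ler_wpM2r// mulrC [leRHS]mulrAC mulrC; nra.
rewrite NE.
have -> : 2 * c * expR c * (N * N `^ (q / 2 - 1)) * s =
  N * expR c * (2 * c * N `^ (q / 2 - 1) * s) by ring.
apply: ler_pM => //.
  by rewrite mulr_ge0// exprn_ge0//; lra.
by apply: ler_pM => //; rewrite exprn_ge0//; lra.
Qed.

(** The maximum over [j <= k] of [|M (k - j)|] at the [j]-th iterate of [x]: the values taken by the
    reverse martingale along one orbit segment. *)
Fixpoint tail_max (M : nat -> T -> R) (k : nat) (x : T) : R :=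
  if k is k'.+1 then Num.max `|M k x| (tail_max M k' (F x)) else `|M 0 x|.

Lemma tail_max_ge0 M k x : 0 <= tail_max M k x.
Proof. by case: k => [|k] /=; rewrite ?le_max ?normr_ge0. Qed.

Lemma tail_max_ge M k x : `|M k x| <= tail_max M k x.
Proof. by case: k => [|k] //=; rewrite le_max lexx. Qed.

Lemma tail_max_iter M n k x : (k <= n)%N -> `|M (n - k)%N (iter k F x)| <= tail_max M n x.
Proof.
elim: k n x => [|k ih] n x kn; first by rewrite subn0 tail_max_ge.
case: n kn => // n kn; rewrite subSS iterSr /=.
by rewrite le_max ih ?orbT.
Qed.

Lemma lee_half_absorb (K : R) (a b : \bar R) : a \is a fin_num -> b \is a fin_num ->
  (a <= 2^-1%:E * a + K%:E * b)%E -> (a <= (2 * K)%:E * b)%E.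
Proof.
case: a b => [a| |] [b| |] // _ _; rewrite -!EFinM -EFinD !lee_fin; lra.
Qed.

(** By invariance the terms composed with [F] have the integrals of the previous step, and the
    induction hypothesis cancels them; finiteness permits the subtraction. *)
Lemma integral_bellman_step (ka : R) (P Q P' Q' z : T -> R) : 0 <= ka ->
  measurable_fun setT P -> measurable_fun setT Q ->
  measurable_fun setT P' -> measurable_fun setT Q' ->
  (forall x, 0 <= P x) -> (forall x, 0 <= Q x) ->
  (forall x, 0 <= P' x) -> (forall x, 0 <= Q' x) ->
  (\int[mu]_x (P x)%:E < +oo)%E -> (\int[mu]_x (Q x)%:E < +oo)%E ->
  (\int[mu]_x (Q' x)%:E < +oo)%E ->
  mu.-integrable setT (EFin \o z) -> (\int[mu]_x (z x)%:E = 0)%E ->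
  (forall x, P' x + ka * Q (F x) <= ka * Q' x + P (F x) + z x) ->
  (\int[mu]_x (P x)%:E <= ka%:E * \int[mu]_x (Q x)%:E)%E ->
  (\int[mu]_x (P' x)%:E <= ka%:E * \int[mu]_x (Q' x)%:E)%E.
Proof.
move=> ka0 mP mQ mP' mQ' P0 Q0 P'0 Q'0 Pfin Qfin Q'fin iz z0 step ih.
have mQF : measurable_fun setT (fun x => ka * Q (F x)).
  exact: measurable_scalef (measurableT_comp mQ mF).
have mPF : measurable_fun setT (P \o F) by exact: measurableT_comp.
have mkQ' := measurable_scalef ka Q' mQ'.
have kQ0 x : 0 <= ka * Q (F x) by exact: mulr_ge0.
have kQ'0 x : 0 <= ka * Q' x by exact: mulr_ge0.
have PF0 x : 0 <= P (F x) by exact: P0.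
have e1 : (\int[mu]_x (ka * Q (F x))%:E = ka%:E * \int[mu]_x (Q x)%:E)%E.
  rewrite (integral_scale ka (Q \o F) ka0 (measurableT_comp mQ mF) (fun x => Q0 (F x))).
  by rewrite (integral_invariantR Q mQ Q0).
have e2 := integral_scale ka Q' ka0 mQ' Q'0.
have e3 := integral_invariantR P mP P0.
have kQfin : (ka%:E * \int[mu]_x (Q x)%:E < +oo)%E.
  by apply: lte_mul_pinfty; rewrite ?lee_fin.
have kQ'fin : (ka%:E * \int[mu]_x (Q' x)%:E < +oo)%E.
  by apply: lte_mul_pinfty; rewrite ?lee_fin.
have s1 := integral_sum2 _ _ mP' mQF P'0 kQ0.
have s2 := integral_sum2 _ _ mkQ' mPF kQ'0 PF0.
have fE : (\int[mu]_x (P' x + ka * Q (F x))%:E <=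
           \int[mu]_x (ka * Q' x + P (F x))%:E)%E.
  apply: (integral_le_add0 _ _ z (measurable_funD mP' mQF) (measurable_funD mkQ' mPF) _ _ _ iz z0 step).
  - by move=> x /=; apply: addr_ge0; [exact: P'0|exact: kQ0].
  - by move=> x /=; apply: addr_ge0; [exact: kQ'0|exact: PF0].
  - have sfin := lte_add_pinfty kQ'fin Pfin.
    by rewrite -e2 -e3 -s2 in sfin.
rewrite s1 s2 e1 e2 e3 in fE.
have fQ : (ka%:E * \int[mu]_x (Q x)%:E)%E \is a fin_num.
  by rewrite ge0_fin_numE ?mule_ge0 ?lee_fin ?integral_ge0E.
by rewrite -(leeD2rE _ _ fQ); apply: (le_trans fE); rewrite leeD2l.
Qed.

(** For the maximum [U] the Bellman function gives [E[U ^ q] <= q / (q - 1) *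
    E[U ^ (q - 1) * |M n|]], and half of the left side absorbs [U ^ (q - 1)]. The absorption
    requires [E[U ^ q]] to be finite, which follows by bounding a maximum by a sum. *)
Lemma mart_maximal (q : R) : 2 <= q -> exists2 K : R, 0 < K &
  forall (m M : nat -> T -> R),
  (forall k, mart_diff (m k)) -> (forall x, M 0 x = 0) ->
  (forall k x, M k.+1 x = m k x + M k (F x)) ->
  forall n, (forall k, (k <= n)%N -> (\int[mu]_x (`|M k x| `^ q)%:E < +oo)%E) ->
  (\int[mu]_x (tail_max M n x `^ q)%:E <=
    K%:E * \int[mu]_x (`|M n x| `^ q)%:E)%E.
Proof.
move=> q2; have q1 : 1 < q by lra.
have q0 : 0 <= q by lra.
have ka0 : 0 <= q / (q - 1) by rewrite divr_ge0//; lra.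
have [K K0 KE] := powR_absorb_le _ q ka0 (ltW q1).
exists (2 * K); first by rewrite mulr_gt0.
move=> m M md M0 MS n Mfin.
have mM := mart_measurable m M md M0 MS.
have mU k : measurable_fun setT (tail_max M k).
  elim: k => [|k ih] /=; first exact: measurable_normf.
  by apply: measurable_maxr; [exact: measurable_normf|exact: measurableT_comp].
have U0 := tail_max_ge0 M.
pose P k x := tail_max M k x `^ q.
pose Q k x := tail_max M k x `^ (q - 1) * `|M k x|.
have mP k : measurable_fun setT (P k) by exact: measurable_powRf.
have mQ k : measurable_fun setT (Q k).
  by apply: measurable_funM; [exact: measurable_powRf|exact: measurable_normf].
have P0 k x : 0 <= P k x by exact: powR_ge0.
have Q0 k x : 0 <= Q k x by rewrite mulr_ge0 ?powR_ge0.
have QP k x : Q k x <= P k x.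
  have q0' : 0 < q by lra.
  rewrite /P /Q -(mulr_powRB1 (U0 k x) q0').
  by rewrite [leRHS]mulrC ler_wpM2l ?powR_ge0// tail_max_ge.
have Pfin k : (k <= n)%N -> (\int[mu]_x (P k x)%:E < +oo)%E.
  elim: k => [|k ih] kn; first exact: Mfin.
  have mMq : measurable_fun setT (fun x => `|M k.+1 x| `^ q).
    exact/measurable_powRf/measurable_normf.
  have mPF : measurable_fun setT (P k \o F) by exact: measurableT_comp.
  apply: (@le_lt_trans _ _ (\int[mu]_x (`|M k.+1 x| `^ q + P k (F x))%:E)%E).
    apply: integral_mono => //.
      exact: measurable_funD.
    move=> x; rewrite /P /= maxEle; case: ifP => _.
      by rewrite lerDr powR_ge0.
    by rewrite lerDl powR_ge0.
  rewrite integral_sum2//.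
  rewrite (integral_invariantR (P k))//.
  by rewrite lte_add_pinfty ?Mfin ?ih ?(ltnW kn).
have Qfin k : (k <= n)%N -> (\int[mu]_x (Q k x)%:E < +oo)%E.
  by move=> kn; apply: le_lt_trans (Pfin k kn); exact: integral_mono.
have main k : (k <= n)%N ->
    (\int[mu]_x (P k x)%:E <= (q / (q - 1))%:E * \int[mu]_x (Q k x)%:E)%E.
  elim: k => [|k ih] kn.
    rewrite [leLHS](_ : _ = 0)%E; last first.
      apply: integral0_eq => x _; rewrite /P /= M0 normr0 powR0// gt_eqF//; lra.
    by rewrite mule_ge0 ?lee_fin// integral_ge0E.
  have mPF : measurable_fun setT (P k \o F) by exact: measurableT_comp.
  have mQF : measurable_fun setT (Q k \o F) by exact: measurableT_comp.
  have iP : (\int[mu]_x (P k (F x))%:E = \int[mu]_x (P k x)%:E)%E.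
    by rewrite (integral_invariantR (P k)).
  have iQ : (\int[mu]_x (Q k (F x))%:E = \int[mu]_x (Q k x)%:E)%E.
    by rewrite (integral_invariantR (Q k)).
  pose ka := q / (q - 1).
  pose g x := - (ka * (tail_max M k x `^ (q - 1) * Num.sg (M k x))).
  have msg : measurable_fun setT (@Num.sg R).
    apply: measurable_fun_ifT; [exact: measurable_fun_eqr|exact: measurable_cst|].
    by apply: measurable_fun_ifT; [exact: measurable_fun_ltr|exact: measurable_cst..].
  have mg : measurable_fun setT g.
    apply: (measurableT_comp (@oppr_measurable R setT)); apply: measurable_scalef.
    apply: measurable_funM; first exact/measurable_powRf/mU.
    exact: (measurableT_comp msg (mM k)).
  have mz : measurable_fun setT (fun x => m k x * g (F x)).
    by apply: measurable_funM; [exact: (md k).1|exact: measurableT_comp].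
  have mmq : measurable_fun setT (fun x => `|M k.+1 x| `^ q).
    exact/measurable_powRf/measurable_normf.
  pose b x := ka * (2 `^ q * (P k (F x) + (`|M k.+1 x| `^ q + P k (F x)))).
  have mb : measurable_fun setT b.
    apply: measurable_scalef; apply: measurable_scalef.
    apply: measurable_funD; [exact: mPF|exact: (measurable_funD mmq mPF)].
  have bfin : (\int[mu]_x (b x)%:E < +oo)%E.
    have S0 x : 0 <= `|M k.+1 x| `^ q + P k (F x) by rewrite addr_ge0 ?powR_ge0.
    have S1 x : 0 <= P k (F x) + (`|M k.+1 x| `^ q + P k (F x)).
      by rewrite addr_ge0.
    have mS : measurable_fun setT (fun x => `|M k.+1 x| `^ q + P k (F x)).
      exact: measurable_funD.
    have mS' : measurable_fun setT (fun x => P k (F x) + (`|M k.+1 x| `^ q + P k (F x))).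
      exact: measurable_funD.
    rewrite (integral_scale ka _ ka0); [|exact: measurable_scalef|
      by move=> x; rewrite mulr_ge0 ?powR_ge0 ?S1].
    rewrite (integral_scale _ _ (powR_ge0 2 q) mS' S1).
    rewrite !integral_sum2//.
    rewrite iP; apply: lte_mul_pinfty; rewrite ?lee_fin//.
    apply: lte_mul_pinfty; rewrite ?lee_fin ?powR_ge0//.
    have h1 := Pfin k (ltnW kn); have h2 := Mfin k.+1 kn.
    exact: (lte_add_pinfty h1 (lte_add_pinfty h2 h1)).
  have iz : mu.-integrable setT (fun x => (m k x * g (F x))%:E).
    apply: (integrable_dominated _ b) => // x.
    have -> : m k x = M k.+1 x - M k (F x) by rewrite MS addrK.
    rewrite /g normrM normrN normrM (ger0_norm ka0) -/ka normrM (ger0_norm (powR_ge0 _ _)).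
    rewrite mulrCA /b ler_wpM2l// mulrCA.
    apply: powR_cross_le; [exact: ltW|exact: U0|exact: normr_ge0|].
    apply: (@le_trans _ _ `|M k.+1 x - M k (F x)|).
      by rewrite ler_piMr// normr_sg; case: eqP.
    by apply: (le_trans (ler_normB _ _)); rewrite lerD2l; exact: tail_max_ge.
  have z0 := (md k).2 g mg iz.
  apply: (integral_bellman_step ka _ _ _ _ _ ka0 (mP k) (mQ k) (mP k.+1) (mQ k.+1) (P0 k) (Q0 k)
    (P0 k.+1) (Q0 k.+1) (Pfin k (ltnW kn)) (Qfin k (ltnW kn)) (Qfin k.+1 kn) iz z0 _ (ih (ltnW kn))).
  move=> x.
  have := doob_bellman_step q (M k (F x)) (tail_max M k (F x)) (m k x) q1 (U0 _ _) (tail_max_ge _ _ _).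
  rewrite -MS /doob_bellman -/ka /P /Q /g /=; lra.
have fU : (\int[mu]_x (P n x)%:E)%E \is a fin_num.
  by rewrite ge0_fin_numE ?Pfin// integral_ge0E.
have mMn : measurable_fun setT (fun x => `|M n x| `^ q).
  exact/measurable_powRf/measurable_normf.
have h2 : 0 <= 2^-1 :> R by [].
have Mn0 x : 0 <= `|M n x| `^ q by exact: powR_ge0.
have fM : (\int[mu]_x (`|M n x| `^ q)%:E)%E \is a fin_num.
  by rewrite ge0_fin_numE ?Mfin// integral_ge0E// => x; rewrite powR_ge0.
apply: (lee_half_absorb _ _ _ fU fM).
apply: (le_trans (main n (leqnn n))).
rewrite -(integral_scale _ _ ka0 (mQ n) (Q0 n)) -(integral_scale _ _ h2 (mP n) (P0 n)).
rewrite -(integral_scale _ _ (ltW K0) mMn Mn0).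
have m1 := measurable_scalef 2^-1 _ (mP n).
have m2 := measurable_scalef K _ mMn.
rewrite -(integral_sum2 _ _ m1 m2 (fun x => mulr_ge0 h2 (P0 n x)) (fun x => mulr_ge0 (ltW K0) (Mn0 x))).
apply: (integral_mono _ _ (measurable_scalef _ _ (mQ n)) (measurable_funD m1 m2)
  (fun x => mulr_ge0 ka0 (Q0 n x))).
move=> x; exact: KE (U0 _ _) (normr_ge0 _).
Qed.

End stationary.

(** * Transfer operators of Gibbs-Markov maps *)

Section mixture.
Import HBNNSimple.
Context {R : realType} {d d' : measure_display} {T : measurableType d}
  {T' : measurableType d'}.
Variables (mu : {measure set T -> \bar R}) (D : set T) (mD : measurable D).
Variables (ka : T -> {measure set T' -> \bar R}) (nu : {measure set T' -> \bar R}).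
Hypothesis mka : forall A, measurable A -> measurable_fun D (fun x => ka x A).
Hypothesis nuE : forall A, measurable A -> nu A = (\int[mu]_(x in D) ka x A)%E.

Let sintE (f : {nnsfun T' >-> R}) (m : {measure set T' -> \bar R}) :
  (\int[m]_y (f y)%:E = \sum_(r \in range f) r%:E * m (f @^-1` [set r]))%E.
Proof. by rewrite integralT_nnsfun sintegralE. Qed.

Let mterm (f : {nnsfun T' >-> R}) r :
  measurable_fun D (fun x => r%:E * ka x (f @^-1` [set r]))%E.
Proof. by apply: measurable_funeM; exact: mka. Qed.

Let term0 (f : {nnsfun T' >-> R}) r (m : {measure set T' -> \bar R}) :
  (0 <= r%:E * m (f @^-1` [set r]))%E.
Proof. exact: nnsfun_mulemu_ge0. Qed.

Let mixture_nnsfun (f : {nnsfun T' >-> R}) :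
  measurable_fun D (fun x => \int[ka x]_y (f y)%:E)%E /\
  (\int[nu]_y (f y)%:E = \int[mu]_(x in D) \int[ka x]_y (f y)%:E)%E.
Proof.
have E : (fun x => \int[ka x]_y (f y)%:E)%E =
   (fun x => \sum_(r \in range f) r%:E * ka x (f @^-1` [set r]))%E.
  by apply/funext => x; rewrite sintE.
split.
  by rewrite E; apply: emeasurable_fsum => // r; exact: mterm.
rewrite sintE; under [RHS]eq_integral do rewrite sintE.
rewrite ge0_integral_fsum//.
apply: eq_fsbigr => r _; rewrite nuE//.
have [r0|r0] := leP 0 r.
  rewrite ge0_integralZl_EFin//; exact: mka.
have e : f @^-1` [set r] = set0 by rewrite preimage_nnfun0.
by rewrite e !integral0_eq ?mule0// => x _; rewrite measure0 ?mule0.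
Qed.

(** Simple functions and monotone convergence. The changes of variables for inverse branches, the
    tower, the suspension and the quotient are all instances, with Dirac or occupation measures for
    [ka]. *)
Lemma integral_mixture (f : T' -> \bar R) : measurable_fun setT f ->
  (forall y, 0 <= f y)%E ->
  measurable_fun D (fun x => \int[ka x]_y f y)%E /\
  (\int[nu]_y f y = \int[mu]_(x in D) \int[ka x]_y f y)%E.
Proof.
move=> mf f0; pose f_ := nnsfun_approx measurableT mf.
have nd y : {homo (fun n => (f_ n y)%:E) : m n / (m <= n)%N >-> (m <= n)%E}.
  by move=> m n mn; rewrite lee_fin; exact/lefP/nd_nnsfun_approx.
have lim (m : {measure set T' -> \bar R}) :
    (\int[m]_y f y = limn (fun n => \int[m]_y (f_ n y)%:E))%E.
  rewrite -monotone_convergence//.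
  - apply: eq_integral => y _; apply/esym/cvg_lim => //.
    by apply: cvg_nnsfun_approx.
  - by move=> n; exact/measurable_EFinP.
  - by move=> n y _; rewrite lee_fin.
have ndi (m : {measure set T' -> \bar R}) :
    {homo (fun n => \int[m]_y (f_ n y)%:E)%E : k n / (k <= n)%N >-> (k <= n)%E}.
  move=> k n kn; apply: ge0_le_integral => //.
  - by move=> y _; rewrite lee_fin.
  - exact/measurable_EFinP.
  - exact/measurable_EFinP.
  - by move=> y _; exact: nd.
have mi n : measurable_fun D (fun x => \int[ka x]_y (f_ n y)%:E)%E by case: (mixture_nnsfun (f_ n)).
split.
- apply: (@emeasurable_fun_cvg _ _ _ D (fun n x => \int[ka x]_y (f_ n y)%:E)%E).
    by move=> n; exact: mi.
  move=> x Dx; rewrite lim; apply: ereal_nondecreasing_is_cvgn.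
  by move=> k n kn; exact: ndi.
- rewrite lim; under eq_fun do rewrite (mixture_nnsfun _).2.
  rewrite -monotone_convergence//.
  + by apply: eq_integral => x _; rewrite lim.
  + by move=> n x _; apply: integral_ge0 => y _; rewrite lee_fin.
Qed.

End mixture.

(** * Inverse branches and duality *)

Section branches.
Context {R : realType} {d : measure_display} {Yb : measurableType d}.
Variables (mu : probability Yb R) (F : Yb -> Yb) (part : Yb -> nat).
Hypothesis mF : measurable_fun setT F.
Hypothesis mpart : measurable_fun setT part.
Hypothesis injF : forall y y', part y = part y' -> F y = F y' -> y = y'.
Hypothesis mimg : forall j (A : set Yb), measurable A -> A `<=` part @^-1` [set j] ->
      measurable (F @` A).
Variable zeta : Yb -> R.
Hypothesis zeta0 : forall y, 0 < zeta y.
Hypothesis mzeta : measurable_fun setT zeta.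
Hypothesis jac : forall j (A : set Yb), measurable A -> A `<=` part @^-1` [set j] ->
            mu (F @` A) = (\int[mu]_(y in A) ((zeta y)^-1)%:E)%E.

Definition cell j : set Yb := part @^-1` [set j].
Definition cell_image j : set Yb := F @` (cell j).
(** Off [cell_image j] the value is the default [z], which [branch_weight] multiplies by 0. *)
Definition inverse_branch j z : Yb := xget z [set y | part y = j /\ F y = z].
Definition branch_weight j z : R := zeta (inverse_branch j z) * \1_(cell_image j) z.

Lemma mPj j : measurable (cell j).
Proof. by rewrite /cell -[X in measurable X]setTI; exact: mpart. Qed.

Lemma mIj j : measurable (cell_image j).
Proof. by apply: (mimg j) => //; exact: mPj. Qed.

Lemma brP j z : cell_image j z -> part (inverse_branch j z) = j /\ F (inverse_branch j z) = z.
Proof.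
by move=> [y /= yj Fy]; rewrite /inverse_branch; case: xgetP => [y' _ //|/(_ y)] /=; case.
Qed.

Lemma br_F j y : part y = j -> inverse_branch j (F y) = y.
Proof.
move=> yj; have [|h1 h2] := brP j (F y); first by exists y.
by apply: injF => //; rewrite h1.
Qed.

Lemma Ij_F j y : part y = j -> cell_image j (F y).
Proof. by move=> yj; exists y. Qed.

Lemma wt_ge0 j z : 0 <= branch_weight j z.
Proof. by rewrite /branch_weight mulr_ge0// ltW. Qed.

Lemma wt_out j z : ~ cell_image j z -> branch_weight j z = 0.
Proof. by move=> h; rewrite /branch_weight indicE memNset// mulr0. Qed.

Lemma wt_in j z : cell_image j z -> branch_weight j z = zeta (inverse_branch j z).
Proof. by move=> h; rewrite /branch_weight indicE mem_set// mulr1. Qed.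

(** The preimage of a set under an inverse branch is the image under [F] of a measurable piece of
    the cell, and such images are measurable by [mimg]. *)
Lemma measurable_br (u : Yb -> R) j : measurable_fun setT u ->
  measurable_fun setT (fun z => u (inverse_branch j z) * \1_(cell_image j) z).
Proof.
move=> mu_.
rewrite (_ : (fun z => _) = (fun z => u (inverse_branch j z)) \_ (cell_image j)); last first.
  by apply/funext => z; rewrite patchE indicE; case: ifP => _; rewrite ?mulr1 ?mulr0.
apply/(measurable_restrictT _ (mIj j)) => _ B mB.
rewrite (_ : _ `&` _ = F @` (cell j `&` (u @^-1` B))).
  apply: (mimg j); last by move=> y [].
  apply: measurableI; first exact: mPj.
  by rewrite -[X in measurable X]setTI; exact: mu_.
apply/seteqP; split => [z [Iz Bz]|z [y [yj yB] <-]].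
- by have [h1 h2] := brP j z Iz; exists (inverse_branch j z).
- by split; [exact: Ij_F|rewrite /= br_F].
Qed.

(** The hypothesis [jac] presents the measure on the image of a cell as a mixture of Dirac masses at
    [F y] with weight the inverse of [zeta y]. *)
Lemma jacobian_branch (f : Yb -> \bar R) j : measurable_fun setT f ->
  (forall z, 0 <= f z)%E ->
  (\int[mu]_(z in cell_image j) f z = \int[mu]_(y in cell j) ((zeta y)^-1%:E * f (F y)))%E.
Proof.
move=> mf f0.
have zi0 y : 0 <= (zeta y)^-1 by rewrite invr_ge0 ltW.
pose ka (y : Yb) : {measure set Yb -> \bar R} := mscale (NngNum (zi0 y)) (dirac (F y)).
have kaE y A : ka y A = ((zeta y)^-1%:E * (\1_A (F y))%:E)%E.
  by rewrite /ka /mscale /= /dirac.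
have mzi : measurable_fun (cell j) (fun y => (zeta y)^-1).
  apply: (measurable_funS measurableT) => //.
  rewrite (_ : (fun y => _) = (fun y => zeta y `^ (-1))); last first.
    by apply/funext => y; rewrite powR_inv1// ltW.
  exact: measurable_powRf.
have mka A : measurable A -> measurable_fun (cell j) (fun x => ka x A).
  move=> mA; under eq_fun do rewrite kaE -EFinM.
  apply/measurable_EFinP; apply: measurable_funM => //.
  apply: (measurable_funS measurableT) => //.
  rewrite (_ : (fun x => _) = \1_(F @^-1` A)); last first.
    by apply/funext => y; rewrite !indicE; congr ((_ : bool)%:R); apply/idP/idP; rewrite !inE.
  apply: measurable_indic; rewrite -[X in measurable X]setTI; exact: mF.
pose nu : {measure set Yb -> \bar R} := mrestr mu (mIj j).
have nuE A : measurable A -> nu A = (\int[mu]_(x in cell j) ka x A)%E.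
  move=> mA; rewrite /nu /= /mrestr.
  have -> : A `&` cell_image j = F @` (cell j `&` F @^-1` A).
    apply/seteqP; split => [z [Az [y yj Fyz]]|z [y [yj yA] <-]].
      by exists y => //; split => //; rewrite /preimage /= Fyz.
    by split => //; exists y.
  have mFA : measurable (F @^-1` A) by rewrite -[X in measurable X]setTI; exact: mF.
  rewrite (jac j); [|by apply: measurableI => //; exact: mPj|by move=> y []].
  rewrite integral_mkcondr; apply: eq_integral => y _.
  have e : (y \in F @^-1` A) = (F y \in A) by apply/idP/idP; rewrite !in_setE.
  by rewrite kaE patchE indicE e; case: (F y \in A); rewrite ?mule1 ?mule0.
have mfI : measurable_fun setT (f \_ (cell_image j)).
  by apply/(measurable_restrictT _ (mIj j)); exact: (measurable_funS measurableT).
have fI0 z : (0 <= (f \_ (cell_image j)) z)%E by rewrite patchE; case: ifP.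
have [_] := integral_mixture mu (cell j) (mPj j) ka nu mka nuE _ mfI fI0.
rewrite -integral_mkcond.
rewrite (eq_measure_integral mu); last first.
  by move=> A mA AI; rewrite /nu /= /mrestr setIidl.
move=> ->; apply: eq_integral => y; rewrite in_setE => yj.
rewrite ge0_integral_mscale//= integral_dirac//= diracT mul1e patchE mem_set//; exact: Ij_F.
Qed.

Lemma branch_integral (u g : Yb -> R) j : measurable_fun setT u ->
  measurable_fun setT g -> (forall y, 0 <= u y) -> (forall y, 0 <= g y) ->
  (\int[mu]_(y in cell j) (u y * g (F y))%:E =
   \int[mu]_z (branch_weight j z * u (inverse_branch j z) * g z)%:E)%E.
Proof.
move=> mu_ mg u0 g0.
pose f z : \bar R := (branch_weight j z * u (inverse_branch j z) * g z)%:E.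
have mf : measurable_fun setT f.
  apply/measurable_EFinP; apply: measurable_funM => //.
  rewrite (_ : (fun z => _) = (fun z => (zeta (inverse_branch j z) * u (inverse_branch j z)) * \1_(cell_image j) z)).
    by apply: (measurable_br (fun y => zeta y * u y)); exact: measurable_funM.
  by apply/funext => z; rewrite /branch_weight mulrAC.
have f0 z : (0 <= f z)%E by rewrite lee_fin (mulr_ge0 (mulr_ge0 (wt_ge0 _ _) (u0 _)) (g0 _)).
transitivity (\int[mu]_(z in cell_image j) f z)%E; last first.
  rewrite integral_mkcond; apply: eq_integral => z _; rewrite patchE /f.
  case: ifPn => //; rewrite notin_setE => h.
  by rewrite wt_out ?mul0r.
rewrite jacobian_branch//; apply: eq_integral => y; rewrite in_setE => yj.
have Iy := Ij_F _ _ yj.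
rewrite /f wt_in// br_F// -EFinM; congr (_%:E).
by field; rewrite gt_eqF.
Qed.

(** The transfer operator, dual to composition with [F]. Extended values keep duality for
    nonnegative functions free of summability conditions. *)
Definition transfer_sum (u : Yb -> R) (z : Yb) : \bar R :=
  (\int[counting]_j (branch_weight j z * u (inverse_branch j z))%:E)%E.

Lemma Te_duality (u g : Yb -> R) : measurable_fun setT u ->
  measurable_fun setT g -> (forall y, 0 <= u y) -> (forall y, 0 <= g y) ->
  (\int[mu]_y (u y * g (F y))%:E = \int[mu]_z (transfer_sum u z * (g z)%:E))%E.
Proof.
move=> mu_ mg u0 g0.
have cov : \bigcup_j cell j = setT.
  by apply/seteqP; split => // y _; exists (part y).
have mug : measurable_fun setT (fun y => (u y * g (F y))%:E).
  by apply/measurable_EFinP; apply: measurable_funM => //; apply: measurableT_comp.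
rewrite -cov ge0_integral_bigcup//; last 4 first.
- by move=> k; exact: mPj.
- by rewrite cov.
- by move=> x _; rewrite lee_fin mulr_ge0.
- by move=> i j _ _ [y [/= <- <-]].
rewrite (eq_eseriesr (fun j _ => branch_integral u g j mu_ mg u0 g0)).
rewrite cov -integral_nneseries//; last 2 first.
- move=> j; apply/measurable_EFinP; apply: measurable_funM => //.
  rewrite (_ : (fun z => _) = (fun z => (zeta (inverse_branch j z) * u (inverse_branch j z)) * \1_(cell_image j) z)).
    by apply: (measurable_br (fun y => zeta y * u y)); exact: measurable_funM.
  by apply/funext => z; rewrite /branch_weight mulrAC.
- by move=> j z _; rewrite lee_fin (mulr_ge0 (mulr_ge0 (wt_ge0 _ _) (u0 _)) (g0 _)).
apply: eq_integral => z _.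
rewrite -ge0_integral_count; last by move=> j; rewrite lee_fin (mulr_ge0 (mulr_ge0 (wt_ge0 _ _) (u0 _)) (g0 _)).
rewrite /transfer_sum -ge0_integralZr//.
- by move=> j _; rewrite lee_fin (mulr_ge0 (wt_ge0 _ _) (u0 _)).
- by rewrite lee_fin.
Qed.

End branches.

(** * Cylinders and continuity in the separation time *)

Section cylinders.
Context {R : realType} {d : measure_display} {Yb : measurableType d}.
Variables (F : Yb -> Yb) (part : Yb -> nat).
Hypothesis mF : measurable_fun setT F.
Hypothesis mpart : measurable_fun setT part.

Lemma sep_ge_trans y y' y'' n :
  sep_ge part F y y' n -> sep_ge part F y' y'' n -> sep_ge part F y y'' n.
Proof. by move=> h h' k kn; rewrite h// h'. Qed.

Lemma sep_geW y y' n m : (m <= n)%N -> sep_ge part F y y' n -> sep_ge part F y y' m.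
Proof. by move=> mn h k km; apply: h; exact: leq_trans mn. Qed.

Lemma sep_geS y y' n : sep_ge part F y y' n.+1 <->
  part y = part y' /\ sep_ge part F (F y) (F y') n.
Proof.
split=> [h|[h0 h] [|k] kn//].
  by split => [|k kn]; [exact: (h 0%N)|rewrite -!iterSr; exact: h].
by rewrite !iterSr; exact: h.
Qed.

Lemma measurable_iterF k : measurable_fun setT (iter k F).
Proof.
elim: k => [|k ih]; first exact: measurable_id.
exact: (measurableT_comp mF ih).
Qed.

Lemma measurable_cylinder y n : measurable [set y' | sep_ge part F y y' n].
Proof.
elim: n => [|n ih].
  by rewrite (_ : [set _ | _] = setT)//; apply/seteqP; split => // z _ k.
rewrite (_ : [set _ | _] = [set y' | sep_ge part F y y' n] `&`
   ((part \o iter n F) @^-1` [set part (iter n F y)])).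
  apply: measurableI => //; rewrite -[X in measurable X]setTI.
  by apply: (measurableT_comp mpart (measurable_iterF n)).
apply/seteqP; split => z /=.
  by move=> h; split; [exact: sep_geW h|rewrite /= (h n)].
by move=> [h1 h2] k; rewrite ltnS leq_eqVlt => /orP[/eqP ->//|]; exact: h1.
Qed.

(** Such a set is a union of cylinders of length [n], and these are indexed by finite words, hence
    countably many. *)
Lemma measurable_saturated n (S : set Yb) :
  (forall z z', S z -> sep_ge part F z z' n -> S z') -> measurable S.
Proof.
move=> satS.
pose code z : seq nat := [seq part (iter k F z) | k <- iota 0 n].
have codeP z z' : code z = code z' <-> sep_ge part F z z' n.
  split=> [/eq_in_map h k kn|h].
    by apply: (h k); rewrite mem_iota.
  by apply/eq_in_map => k; rewrite mem_iota => /andP[_]; exact: h.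
rewrite (_ : S = \bigcup_i [set z | S z /\ pickle (code z) = i]); last first.
  by apply/seteqP; split => [z Sz|z [i _ []//]]; exists (pickle (code z)).
apply: bigcupT_measurable => i.
have [[z0 [Sz0 z0i]]|h] := pselect (exists z, S z /\ pickle (code z) = i).
  rewrite (_ : [set _ | _] = [set z | sep_ge part F z0 z n]).
    exact: measurable_cylinder.
  apply/seteqP; split => z /=.
    move=> [Sz]; rewrite -z0i => /(pcan_inj pickleK) h.
    by apply/codeP.
  move=> h; split; first exact: satS h.
  by rewrite -z0i; congr pickle; apply/esym/codeP.
rewrite (_ : [set _ | _] = set0)//; apply/seteqP; split => z //= hz.
by case: h; exists z.
Qed.

(** Each superlevel set is a countable union of sets saturated by cylinders. This is how functions
    built from a pointwise choice of section are shown to be measurable. *)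
Lemma measurable_sep_continuous (G : set Yb) (u : Yb -> R) : measurable G ->
  (forall z (e : R), G z -> 0 < e -> exists n, forall z', G z' ->
     sep_ge part F z z' n -> `|u z - u z'| < e) ->
  measurable_fun G u.
Proof.
move=> mG cu; move=> _.
apply: (measurability _ (RGenOInfty.measurableE R)) => // _ [_ [x ->] <-].
rewrite (_ : _ `&` _ = G `&` \bigcup_n [set z | forall z', G z' ->
   sep_ge part F z z' n -> x < u z']).
  apply: measurableI => //; apply: bigcupT_measurable => n.
  apply: (@measurable_saturated n) => z z' h zz' z'' Gz'' z'z''.
  by apply: h => //; exact: sep_ge_trans z'z''.
apply/seteqP; split => z [Gz].
  rewrite /= in_itv/= andbT => xu; split => //.
  have [n hn] := cu z (u z - x) Gz (ltac:(by rewrite subr_gt0)).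
  exists n => // z' Gz' h; have := hn z' Gz' h.
  by rewrite ltr_norml => /andP[_]; lra.
by move=> [n _ /= h]; split => //=; rewrite in_itv/= andbT; exact: h.
Qed.

End cylinders.

(** * Contraction of the transfer operator and the Poisson equation *)

Section transfer_operator.
Context {R : realType} {d : measure_display} {Yb : measurableType d}.
Variables (mu : probability Yb R) (F : Yb -> Yb) (part : Yb -> nat).
Hypothesis mF : measurable_fun setT F.
Hypothesis mpart : measurable_fun setT part.
Hypothesis injF : forall y y', part y = part y' -> F y = F y' -> y = y'.
Hypothesis mimg : forall j (A : set Yb), measurable A -> A `<=` part @^-1` [set j] ->
      measurable (F @` A).
Variable zeta : Yb -> R.
Hypothesis zeta0 : forall y, 0 < zeta y.
Hypothesis mzeta : measurable_fun setT zeta.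
Hypothesis jac : forall j (A : set Yb), measurable A -> A `<=` part @^-1` [set j] ->
            mu (F @` A) = (\int[mu]_(y in A) ((zeta y)^-1)%:E)%E.
Hypothesis markov : forall j z z', cell_image F part j z -> part z = part z' -> cell_image F part j z'.
Variables (th K0 c : R).
Hypotheses (th0 : 0 < th) (th1 : th < 1) (K00 : 0 <= K0) (c0 : 0 < c).
Hypothesis distortion : forall y y' n, part y = part y' -> sep_ge part F y y' n ->
  `|ln (zeta y) - ln (zeta y')| <= K0 * th ^+ n.
Hypothesis big : forall j, (0 < mu (part @^-1` [set j]))%E ->
      (c%:E <= mu (F @` (part @^-1` [set j])))%E.
Hypothesis invF : forall A, measurable A -> mu (F @^-1` A) = mu A.

Local Notation Pj := (cell part).
Local Notation Ij := (cell_image F part).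
Local Notation br := (inverse_branch F part).
Local Notation wt := (branch_weight F part zeta).
Local Notation Te := (transfer_sum F part zeta).
Local Notation sep := (sep_ge part F).

Let wt_pos := wt_ge0 F part zeta zeta0.
Let mP := mPj part mpart.

Lemma expR_sub1_le (x : R) : `|expR x - 1| <= `|x| * expR `|x|.
Proof.
have h1 := expR_ge1Dx x; have h2 := expR_ge1Dx (- x).
have e0 := expR_gt0 x; rewrite expRN in h2.
have h3 : (1 - x) * expR x <= 1 by rewrite -ler_pdivlMr// div1r.
have [x0|x0] := leP 0 x.
  rewrite ger0_norm; last lra.
  by rewrite ger0_norm//; nra.
have : expR x < 1 by rewrite expR_lt1.
move=> ex; rewrite ltr0_norm; last lra.
rewrite ltr0_norm//; have : 1 < expR (- x) by rewrite expR_gt1 oppr_gt0.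
nra.
Qed.

Definition K1 : R := K0 * expR K0.

Lemma K1_ge0 : 0 <= K1. Proof. by rewrite mulr_ge0 ?expR_ge0. Qed.

Lemma zeta_diff y y' n : part y = part y' -> sep y y' n ->
  `|zeta y - zeta y'| <= K1 * th ^+ n * zeta y'.
Proof.
move=> yy' s; have := distortion y y' n yy' s.
set a := ln (zeta y) - ln (zeta y') => ha.
have zE : zeta y = zeta y' * expR a.
  by rewrite expRD expRN !lnK ?posrE// mulrCA divff ?mulr1// gt_eqF.
have t0 : 0 <= th ^+ n by rewrite exprn_ge0// ltW.
have t1 : th ^+ n <= 1 by rewrite exprn_ile1// ltW.
rewrite {1}zE -[X in _ - X]mulr1 -mulrBr normrM (gtr0_norm (zeta0 _)) mulrC.
apply: ler_wpM2r; first exact: ltW.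
apply: (le_trans (expR_sub1_le a)).
rewrite /K1 mulrAC; apply: ler_pM => //.
by rewrite ler_expR; apply: (le_trans ha); rewrite ler_piMr.
Qed.

Lemma zeta_comp y y' : part y = part y' -> zeta y <= expR K0 * zeta y'.
Proof.
move=> yy'; have := distortion y y' 0%N yy' (ltac:(by [])); rewrite expr0 mulr1 => h.
have zE z : zeta z = expR (ln (zeta z)) by rewrite lnK ?posrE.
rewrite (zE y) (zE y') -expRD ler_expR.
by move: h; rewrite ler_norml => /andP[_]; lra.
Qed.

Lemma integral_Pj_series (f : Yb -> R) : measurable_fun setT f -> (forall y, 0 <= f y) ->
  (\int[mu]_y (f y)%:E = \sum_(j <oo) \int[mu]_(y in Pj j) (f y)%:E)%E.
Proof.
move=> mf f0.
have cov : \bigcup_j Pj j = setT.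
  by apply/seteqP; split => // y _; exists (part y).
rewrite -{1}cov ge0_integral_bigcup ?cov//.
- exact/measurable_EFinP.
- by move=> y _; rewrite lee_fin.
- by move=> i j _ _ [y [/= <- <-]].
Qed.

Lemma mzetaV D : measurable_fun D (fun y => ((zeta y)^-1)%:E).
Proof.
apply/measurable_EFinP; apply: (measurable_funS measurableT) => //.
rewrite (_ : (fun y => _) = (fun y => zeta y `^ (-1))); last first.
  by apply/funext => y; rewrite powR_inv1// ltW.
exact: measurable_powRf.
Qed.

Section comparable.
Variables (rho : Yb -> R) (Cr : R).
Hypotheses (mrho : measurable_fun setT rho) (rho0 : forall y, 0 <= rho y) (Cr0 : 0 <= Cr).
Hypothesis rhoC : forall y y', part y = part y' -> rho y <= Cr * rho y'.

(** Bounded distortion compares [zeta] at the branch point with [zeta] on the whole cell, and the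
    image of the cell has measure at least [c]. So a branch weight is at most a constant times the
    measure of its cell, and [rho] is comparable along the cell. *)
Lemma wt_le_int j z : (0 < mu (Pj j))%E ->
  ((wt j z * rho (br j z))%:E <=
    (Cr * expR K0 / c)%:E * \int[mu]_(y in Pj j) (rho y)%:E)%E.
Proof.
move=> muj; have kk0 : 0 <= Cr * expR K0 / c.
  by rewrite divr_ge0 ?(ltW c0)// mulr_ge0 ?expR_ge0.
have [Iz|Iz] := pselect (Ij j z); last first.
  rewrite wt_out// mul0r mule_ge0// ?lee_fin//.
  by apply: integral_ge0 => y _; rewrite lee_fin.
rewrite wt_in//; have [pj _] := brP F part j z Iz.
set y0 := br j z in pj *.
set a := zeta y0 * rho y0; have a0 : 0 <= a by exact: mulr_ge0 (ltW (zeta0 _)) (rho0 _).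
have mrj : measurable_fun (Pj j) (fun y => (rho y)%:E).
  by apply/measurable_EFinP; exact: (measurable_funS measurableT).
have mzi := mzetaV (Pj j).
have h1 : (c%:E * a%:E <= \int[mu]_(y in Pj j) ((zeta y)^-1)%:E * a%:E)%E.
  apply: lee_wpmul2r; rewrite ?lee_fin//.
  by rewrite -(jac j (Pj j))//; exact: big.
have h2 : (\int[mu]_(y in Pj j) ((zeta y)^-1)%:E * a%:E <=
     (Cr * expR K0)%:E * \int[mu]_(y in Pj j) (rho y)%:E)%E.
  rewrite -ge0_integralZr//; last by move=> y _; rewrite lee_fin invr_ge0 ltW.
  rewrite -ge0_integralZl//; last 2 first.
    by move=> y _; rewrite lee_fin.
    by rewrite lee_fin mulr_ge0 ?expR_ge0.
  apply: ge0_le_integral => //.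
  - by move=> y _; rewrite -EFinM lee_fin mulr_ge0// invr_ge0 ltW.
  - exact: emeasurable_funM.
  - exact: emeasurable_funM.
  - move=> y yj; rewrite -!EFinM lee_fin.
    have hz := zeta_comp y0 y (ltac:(by rewrite pj yj)).
    have hr := rhoC y0 y (ltac:(by rewrite pj yj)).
    rewrite mulrC ler_pdivrMr// /a.
    have -> : Cr * expR K0 * rho y * zeta y = (expR K0 * zeta y) * (Cr * rho y) by ring.
    by apply: ler_pM => //; exact: ltW.
have h3 := le_trans h1 h2.
rewrite (_ : a%:E = (c^-1)%:E * (c%:E * a%:E))%E; last first.
  by rewrite -!EFinM mulrA mulVf ?mul1r// gt_eqF.
rewrite [X in (_ <= X)%E](_ : _ =
   (c^-1)%:E * ((Cr * expR K0)%:E * \int[mu]_(y in Pj j) (rho y)%:E))%E; last first.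
  by rewrite !muleA -!EFinM; congr (_%:E * _)%E; ring.
by apply: lee_wpmul2l => //; rewrite lee_fin invr_ge0 ltW.
Qed.

End comparable.

Definition N0 : set Yb := [set z | Te (cst 1) z <> 1%E] `|`
  [set z | mu (Pj (part z)) = 0%E].
Fixpoint Nk k : set Yb := if k is k'.+1 then F @` (Nk k') else N0.
(** Deleting all forward images of the exceptional set [N0] leaves a set of full measure that
    contains the preimages of its points. Identities valid on it pass through inverse branches
    pointwise, for any number of iterates. *)
Definition G : set Yb := ~` \bigcup_k Nk k.

Lemma measurable_Te (u : Yb -> R) : measurable_fun setT u -> (forall y, 0 <= u y) ->
  measurable_fun setT (Te u).
Proof.
move=> mu_ u0.
rewrite (_ : Te u = fun z => \sum_(j <oo) (wt j z * u (br j z))%:E)%E; last first.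
  apply/funext => z; rewrite /Te ge0_integral_count// => j.
  by rewrite lee_fin (mulr_ge0 (wt_pos _ _) (u0 _)).
apply: ge0_emeasurable_sum => j.
  by move=> z _ _; rewrite lee_fin (mulr_ge0 (wt_pos _ _) (u0 _)).
move=> _; apply/measurable_EFinP.
rewrite (_ : (fun z => _) = (fun z => (zeta (br j z) * u (br j z)) * \1_(Ij j) z)).
  by apply: (measurable_br F part mpart injF mimg (fun y => zeta y * u y)); exact: measurable_funM.
by apply/funext => z; rewrite /branch_weight mulrAC.
Qed.

Lemma Te_ge0 (u : Yb -> R) z : (forall y, 0 <= u y) -> (0 <= Te u z)%E.
Proof.
move=> u0; apply: integral_ge0 => j _.
by rewrite lee_fin (mulr_ge0 (wt_pos _ _) (u0 _)).
Qed.

Let dual := Te_duality mu F part mF mpart injF mimg zeta zeta0 mzeta jac.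

Lemma mN0 : measurable N0.
Proof.
apply: measurableU.
  rewrite (_ : [set z | _] = ~` (Te (cst 1) @^-1` [set 1%E])); last first.
    by apply/seteqP; split.
  apply: measurableC; rewrite -[X in measurable X]setTI.
  by apply: measurable_Te => //; exact: emeasurable_set1.
apply: (measurable_saturated F part mF mpart 1%N) => z z' /= h s.
by rewrite -(s 0%N).
Qed.

Lemma muN0 : mu N0 = 0%E.
Proof.
have mT := measurable_Te (cst 1) (measurable_cst _) (fun=> ler01).
have T0 z := Te_ge0 (cst 1) z (fun=> ler01).
have m1 : measurable [set z | Te (cst 1) z <> 1%E].
  rewrite (_ : [set z | _] = ~` (Te (cst 1) @^-1` [set 1%E])); last first.
    by apply/seteqP; split.
  apply: measurableC; rewrite -[X in measurable X]setTI.
  by apply: mT => //; exact: emeasurable_set1.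
have m2 : measurable [set z | mu (Pj (part z)) = 0%E].
  apply: (measurable_saturated F part mF mpart 1%N) => z z' /= h s.
  by rewrite -(s 0%N).
have z1 : mu [set z | Te (cst 1) z <> 1%E] = 0%E.
  (* Duality with [u = 1] and invariance of the measure: the image of the constant 1 has the same
     integral as 1 over every measurable set. *)
  have H A : measurable A -> (\int[mu]_(z in A) Te (cst 1%R) z = \int[mu]_(z in A) 1)%E.
    move=> mA.
    have mI : measurable_fun setT (\1_A : Yb -> R) by exact: measurable_indic.
    have I0 y : 0 <= (\1_A : Yb -> R) y by rewrite indicE.
    have := dual (cst 1) (\1_A) (measurable_cst _) mI (fun=> ler01) I0.
    rewrite [X in _ = X -> _](_ : _ = \int[mu]_(z in A) Te (cst 1%R) z)%E; last first.
      rewrite [RHS]integral_mkcond; apply: eq_integral => z _.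
      rewrite patchE indicE; case: ifP => _; by rewrite ?mule1 ?mule0.
    move=> <-; rewrite (integral_cst mu mA) mul1e.
    under eq_integral do rewrite mul1r.
    by rewrite (integral_invariantR mu F mF invF (\1_A)) ?integral_indic ?setIT.
  apply/(negligibleP mu m1).
  have h : ae_eq mu setT (cst 1%E) (Te (cst 1)).
    apply: integral_ae_eq => //.
      exact: finite_measure_integrable_cst.
    by move=> E _ mE; rewrite H.
  apply: negligibleS h => z /= hz h; apply: hz; exact/esym/h.
have z2 : mu [set z | mu (Pj (part z)) = 0%E] = 0%E.
  apply: measure_negligible => //.
  apply: (@negligibleS _ _ _ _ (\bigcup_j (if mu (Pj j) == 0%E then Pj j else set0))).
    by move=> z /= hz; exists (part z) => //; rewrite hz eqxx.
  apply: negligible_bigcup => j; case: ifPn => [/eqP h|_]; last exact: negligible_set0.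
  exact/(negligibleP mu (mP j)).
by apply: measure_negligible; [exact: mN0|apply: negligibleU; exact/negligibleP].
Qed.

Lemma measurable_img A : measurable A -> measurable (F @` A).
Proof.
move=> mA; rewrite (_ : F @` A = \bigcup_j (F @` (A `&` Pj j))).
  apply: bigcupT_measurable => j; apply: (mimg j); last by move=> y [].
  exact: measurableI.
apply/seteqP; split => [z [y Ay <-]|z [j _ [y [Ay _] <-]]]; last by exists y.
by exists (part y) => //; exists y.
Qed.

Lemma img_null A : measurable A -> mu A = 0%E -> mu (F @` A) = 0%E.
Proof.
move=> mA A0; apply: measure_negligible; first exact: measurable_img.
apply: (@negligibleS _ _ _ _ (\bigcup_j (F @` (A `&` Pj j)))).
  by move=> z [y Ay <-]; exists (part y) => //; exists y.
apply: negligible_bigcup => j.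
have mj : measurable (A `&` Pj j) by exact: measurableI.
apply/negligibleP; first by apply: (mimg j) => // y [].
apply: (etrans (jac j _ mj _)); first by move=> y [].
apply: null_set_integral => //.
  exact: mzetaV.
by apply: (subset_measure0 mj mA _ A0) => y [].
Qed.

Lemma mNk k : measurable (Nk k).
Proof. by elim: k => [|k ih] /=; [exact: mN0|exact: measurable_img]. Qed.

Lemma muNk k : mu (Nk k) = 0%E.
Proof. by elim: k => [|k ih] /=; [exact: muN0|apply: img_null => //; exact: mNk]. Qed.

Lemma mG : measurable G.
Proof. by apply: measurableC; apply: bigcupT_measurable => k; exact: mNk. Qed.

Lemma muGC : mu (~` G) = 0%E.
Proof.
apply: measure_negligible; first exact: measurableC mG.
rewrite /G setCK; apply: negligible_bigcup => k; apply/negligibleP; [exact: mNk|exact: muNk].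
Qed.

Lemma G_preimage y : G (F y) -> G y.
Proof. by move=> h [k _ yk]; apply: h; exists k.+1 => //; exists y. Qed.

Lemma G_Te1 z : G z -> Te (cst 1) z = 1%E.
Proof.
by move=> h; apply/eqP; apply: contrapT => /negP/eqP h'; apply: h; exists 0%N => //; left.
Qed.

Lemma G_pos z : G z -> (0 < mu (Pj (part z)))%E.
Proof.
move=> h; rewrite lt0e measure_ge0 andbT; apply/eqP => h'.
by apply: h; exists 0%N => //; right.
Qed.

Lemma G_br j z : G z -> Ij j z -> G (br j z) /\ part (br j z) = j.
Proof.
move=> Gz Iz; have [h1 h2] := brP F part j z Iz; split => //.
by apply: G_preimage; rewrite h2.
Qed.

Lemma wt_null j z : G z -> ~ (0 < mu (Pj j))%E -> wt j z = 0.
Proof.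
move=> Gz mj; apply: wt_out => Iz; have [h1 h2] := G_br j z Gz Iz.
by apply: mj; have := G_pos _ h1; rewrite h2.
Qed.

(** Summing [wt_le_int] over the cells bounds the operator pointwise by an integral; this is why the
    image of the integrable roof is bounded. *)
Lemma Te_le_int (rho : Yb -> R) (Cr : R) z : measurable_fun setT rho ->
  (forall y, 0 <= rho y) -> 0 <= Cr ->
  (forall y y', part y = part y' -> rho y <= Cr * rho y') -> G z ->
  (Te rho z <= (Cr * expR K0 / c)%:E * \int[mu]_y (rho y)%:E)%E.
Proof.
move=> mrho rho0 Cr0 rhoC Gz.
have kk0 : 0 <= Cr * expR K0 / c.
  by rewrite divr_ge0 ?(ltW c0)// mulr_ge0 ?expR_ge0.
rewrite integral_Pj_series// -nneseriesZl; last first.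
  by move=> j _; apply: integral_ge0 => y _; rewrite lee_fin.
rewrite /transfer_sum ge0_integral_count; last first.
  by move=> j; rewrite lee_fin (mulr_ge0 (wt_pos _ _) (rho0 _)).
apply: lee_nneseries.
  by move=> j _ _; rewrite lee_fin (mulr_ge0 (wt_pos _ _) (rho0 _)).
move=> j _; have [h|h] := pselect (0 < mu (Pj j))%E; first exact: wt_le_int.
rewrite wt_null// mul0r mule_ge0 ?lee_fin//.
by apply: integral_ge0 => y _; rewrite lee_fin.
Qed.

Variables (Hh : Yb -> R) (h0 CH : R).
Hypotheses (mHh : measurable_fun setT Hh) (h00 : 0 < h0) (HhL : forall y, h0 <= Hh y).
Hypotheses (CH0 : 0 <= CH) (HhC : forall y y', part y = part y' -> Hh y <= CH * Hh y').
Hypothesis HhI : (\int[mu]_y (Hh y)%:E < +oo)%E.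

Let Hh0 y : 0 <= Hh y := le_trans (ltW h00) (HhL y).

Local Notation cnt := (@counting nat R).
Local Notation summable_seq a := (cnt.-integrable setT (fun j => (a j)%:E)).

Definition dom (u : Yb -> R) (B : R) := forall y, `|u y| <= B * Hh y.

(** The transfer operator with real values, set to 0 off [G], where the sum over branches may
    diverge or fail to preserve constants. *)
Definition Pop (u : Yb -> R) (z : Yb) : R :=
  \1_G z * \int[cnt]_j (wt j z * u (br j z)).

Lemma summable_le (a b : nat -> R) : summable_seq b -> (forall j, `|a j| <= b j) ->
  summable_seq a.
Proof.
move=> ib ab; apply: (le_integrable measurableT _ _ ib).
  exact/measurable_EFinP.
by move=> j _ /=; rewrite lee_fin; apply: (le_trans (ab j)); exact: ler_norm.
Qed.

Lemma summable_Hh z : G z -> summable_seq (fun j => wt j z * Hh (br j z)).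
Proof.
move=> Gz; apply/integrableP; split; first exact/measurable_EFinP.
apply: (@le_lt_trans _ _ (Te Hh z)).
  rewrite /transfer_sum le_eqVlt; apply/orP; left; apply/eqP; apply: eq_integral => j _ /=.
  by rewrite ger0_norm// mulr_ge0// wt_pos.
apply: (le_lt_trans (Te_le_int Hh CH z mHh Hh0 CH0 HhC Gz)).
apply: lte_mul_pinfty => //; rewrite lee_fin.
by rewrite divr_ge0 ?(ltW c0)// mulr_ge0 ?expR_ge0.
Qed.

Lemma summable_dom u B z : G z -> dom u B -> summable_seq (fun j => wt j z * u (br j z)).
Proof.
move=> Gz uB.
apply: (@summable_le _ (fun j => B * (wt j z * Hh (br j z)))).
  have := integrableZl measurableT B (summable_Hh z Gz).
  by apply: eq_integrable => // j _; rewrite EFinM.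
move=> j; rewrite normrM (ger0_norm (wt_pos j z)) mulrCA.
by apply: ler_wpM2l => //; exact: wt_pos.
Qed.

Lemma Pop_in u z : G z -> Pop u z = \int[cnt]_j (wt j z * u (br j z)).
Proof. by move=> Gz; rewrite /Pop indicE mem_set// mul1r. Qed.

Lemma Pop_out u z : ~ G z -> Pop u z = 0.
Proof. by move=> Gz; rewrite /Pop indicE memNset// mul0r. Qed.

Lemma dom_cst (k : R) : dom (cst k) (`|k| / h0).
Proof.
move=> y /=; rewrite -mulrA ler_peMr//.
by rewrite mulrC ler_pdivlMr// mul1r.
Qed.

Lemma dom_bnd (u : Yb -> R) B : (forall y, `|u y| <= B) -> dom u (B / h0).
Proof.
move=> uB y; have B0 : 0 <= B := le_trans (normr_ge0 _) (uB y).
apply: (le_trans (uB y)); rewrite -mulrA ler_peMr//.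
by rewrite mulrC ler_pdivlMr// mul1r.
Qed.

Lemma dom_lin a b u v Bu Bv : dom u Bu -> dom v Bv ->
  dom (fun y => a * u y + b * v y) (`|a| * Bu + `|b| * Bv).
Proof.
move=> hu hv y; apply: (le_trans (ler_normD _ _)); rewrite !normrM mulrDl -!mulrA.
by apply: lerD; apply: ler_wpM2l.
Qed.

Lemma dom_Hh : dom Hh 1.
Proof. by move=> y; rewrite mul1r ger0_norm. Qed.

Lemma Pop_lin a b u v Bu Bv z : dom u Bu -> dom v Bv ->
  Pop (fun y => a * u y + b * v y) z = a * Pop u z + b * Pop v z.
Proof.
move=> hu hv; have [Gz|Gz] := pselect (G z); last first.
  by rewrite !Pop_out// !mulr0 addr0.
have su := summable_dom u Bu z Gz hu; have sv := summable_dom v Bv z Gz hv.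
rewrite !Pop_in// -!RintegralZl// -RintegralD//.
- by apply: eq_Rintegral => j _; ring.
- have := integrableZl measurableT a su.
  by apply: eq_integrable => // j _; rewrite /= EFinM.
- have := integrableZl measurableT b sv.
  by apply: eq_integrable => // j _; rewrite /= EFinM.
Qed.

Lemma wt_br_mono (u v : Yb -> R) j z : G z -> (forall y, G y -> u y <= v y) ->
  wt j z * u (br j z) <= wt j z * v (br j z).
Proof.
move=> Gz uv; have [Iz|Iz] := pselect (Ij j z); last by rewrite wt_out// !mul0r.
by apply: ler_wpM2l; [exact: wt_pos|apply: uv; have [] := G_br j z Gz Iz].
Qed.

Lemma Pop_mono u v Bu Bv z : dom u Bu -> dom v Bv ->
  (forall y, G y -> u y <= v y) -> Pop u z <= Pop v z.
Proof.
move=> hu hv uv; have [Gz|Gz] := pselect (G z); last by rewrite !Pop_out.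
rewrite !Pop_in//; apply: le_Rintegral => //.
- exact: summable_dom hu.
- exact: summable_dom hv.
- by move=> j _; exact: wt_br_mono.
Qed.

Lemma Pop_ext u v z : (forall y, G y -> u y = v y) -> Pop u z = Pop v z.
Proof.
move=> uv; have [Gz|Gz] := pselect (G z); last by rewrite !Pop_out.
rewrite !Pop_in//; apply: eq_Rintegral => j _.
by apply/eqP; rewrite eq_le; apply/andP; split; apply: wt_br_mono => // y Gy; rewrite uv.
Qed.

Lemma Pop_Te (u : Yb -> R) B z : dom u B -> (forall y, 0 <= u y) -> G z -> (Pop u z)%:E = Te u z.
Proof.
move=> hu u0 Gz; rewrite Pop_in// /transfer_sum /Rintegral fineK//.
exact: (integrable_fin_num measurableT (summable_dom u B z Gz hu)).
Qed.

Lemma Pop_cst (k : R) z : G z -> Pop (cst k) z = k.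
Proof.
move=> Gz.
have e1 : Pop (cst 1) z = 1.
  have := Pop_Te (cst 1) _ z (dom_cst 1) (fun=> ler01) Gz.
  by rewrite G_Te1// => -[].
rewrite -[RHS]mulr1 -[X in _ = k * X]e1 -[RHS]addr0 -(mul0r (Pop (cst 1) z)).
rewrite -(Pop_lin _ _ _ _ _ _ z (dom_cst 1) (dom_cst 1)).
by apply: Pop_ext => y _ /=; rewrite mulr1 mul0r addr0.
Qed.

Lemma Pop_comp (u g : Yb -> R) B z : dom u B ->
  G z -> Pop (fun y => u y * g (F y)) z = g z * Pop u z.
Proof.
move=> hu Gz; rewrite !Pop_in// -RintegralZl//; last exact: summable_dom hu.
apply: eq_Rintegral => j _.
have [Iz|Iz] := pselect (Ij j z); last by rewrite wt_out// !mul0r mulr0.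
by have [_ ->] := brP F part j z Iz; ring.
Qed.

Lemma Pop_norm u v B Bv z : dom u B -> dom v Bv ->
  (forall y, G y -> `|u y| <= v y) -> `|Pop u z| <= Pop v z.
Proof.
move=> hu hv uv; rewrite ler_norml; apply/andP; split.
  rewrite lerNl -[- _]addr0 -(mul0r (Pop u z)) -mulN1r -(Pop_lin _ _ _ _ _ _ z hu hu).
  apply: (Pop_mono _ _ _ _ _ (dom_lin _ _ _ _ _ _ hu hu) hv) => y Gy.
  by rewrite mul0r addr0 mulN1r; have := uv y Gy; rewrite ler_norml lerNl => /andP[].
apply: (Pop_mono _ _ _ _ _ hu hv) => y Gy.
by have := uv y Gy; rewrite ler_norml => /andP[].
Qed.

Definition CP : R := CH * expR K0 / c * fine (\int[mu]_y (Hh y)%:E).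

Lemma CP_ge0 : 0 <= CP.
Proof.
rewrite mulr_ge0//; first by rewrite divr_ge0 ?(ltW c0)// mulr_ge0 ?expR_ge0.
by apply: fine_ge0; apply: integral_ge0 => y _; rewrite lee_fin.
Qed.

Lemma Pop_Hh_le z : Pop Hh z <= CP.
Proof.
have [Gz|Gz] := pselect (G z); last by rewrite Pop_out// CP_ge0.
rewrite -lee_fin (Pop_Te Hh _ _ dom_Hh)// /CP EFinM fineK.
  exact: Te_le_int.
by rewrite ge0_fin_numE// integral_ge0// => y _; rewrite lee_fin.
Qed.

(** A Lasota-Yorke inequality. Matching preimages of [z] and [z'] separate one step later, which
    yields the extra factor [th]; the variation of the branch weights costs the term with [K1]. *)
Lemma Pop_lipschitz (u rho : Yb -> R) B L Br z z' n : 0 <= B -> 0 <= L ->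
  dom u Br -> dom rho Br -> (forall y, 0 <= rho y) ->
  (forall y, G y -> `|u y| <= B * rho y) ->
  (forall y y' k, G y -> G y' -> (0 < k)%N -> sep y y' k ->
     `|u y - u y'| <= L * rho y * th ^+ k) ->
  G z -> G z' -> (0 < n)%N -> sep z z' n ->
  `|Pop u z - Pop u z'| <= th ^+ n.+1 * (L * Pop rho z + B * K1 * Pop rho z').
Proof.
move=> B0 L0 hu hr rho0 uB uL Gz Gz' n0 s.
have pz : part z = part z' by have := s 0%N n0.
have su := summable_dom u Br z Gz hu; have su' := summable_dom u Br z' Gz' hu.
have sr := summable_dom rho Br z Gz hr; have sr' := summable_dom rho Br z' Gz' hr.
have t0 : 0 <= th ^+ n.+1 by rewrite exprn_ge0// ltW.
have term j : `|wt j z * u (br j z) - wt j z' * u (br j z')| <=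
    th ^+ n.+1 * L * (wt j z * rho (br j z)) + th ^+ n.+1 * (B * K1) * (wt j z' * rho (br j z')).
  have [Iz|Iz] := pselect (Ij j z); last first.
    have Iz' : ~ Ij j z' by move=> h; apply: Iz; exact: (markov _ _ _ h (esym pz)).
    by rewrite !(wt_out _ _ _ j)// !mul0r !mulr0 subr0 normr0 addr0.
  have Iz' := markov _ _ _ Iz pz.
  have [Gy yj] := G_br j z Gz Iz; have [Gy' yj'] := G_br j z' Gz' Iz'.
  have [_ Fy] := brP F part j z Iz; have [_ Fy'] := brP F part j z' Iz'.
  rewrite !wt_in//; set y := br j z in Gy yj Fy *; set y' := br j z' in Gy' yj' Fy' *.
  have s' : sep y y' n.+1.
    by apply/(sep_geS F part); split; [rewrite yj yj'|rewrite Fy Fy'].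
  have -> : zeta y * u y - zeta y' * u y' = zeta y * (u y - u y') + (zeta y - zeta y') * u y' by ring.
  apply: (le_trans (ler_normD _ _)); rewrite !normrM (gtr0_norm (zeta0 y)).
  apply: lerD.
    apply: (le_trans (ler_wpM2l (ltW (zeta0 y)) (uL y y' n.+1 Gy Gy' isT s'))).
    by rewrite le_eqVlt; apply/orP; left; apply/eqP; ring.
  apply: (@le_trans _ _ ((K1 * th ^+ n.+1 * zeta y') * (B * rho y'))).
    by apply: ler_pM => //; [apply: zeta_diff => //; rewrite yj yj'|exact: uB].
  by rewrite le_eqVlt; apply/orP; left; apply/eqP; ring.
have srL : summable_seq (fun j => th ^+ n.+1 * L * (wt j z * rho (br j z))).
  have := integrableZl measurableT (th ^+ n.+1 * L) sr.
  by apply: eq_integrable => // j _; rewrite /= EFinM.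
have srB : summable_seq (fun j => th ^+ n.+1 * (B * K1) * (wt j z' * rho (br j z'))).
  have := integrableZl measurableT (th ^+ n.+1 * (B * K1)) sr'.
  by apply: eq_integrable => // j _; rewrite /= EFinM.
have sD : summable_seq (fun j => th ^+ n.+1 * L * (wt j z * rho (br j z)) +
      th ^+ n.+1 * (B * K1) * (wt j z' * rho (br j z'))).
  by have := integrableD measurableT srL srB.
have sB : summable_seq (fun j => wt j z * u (br j z) - wt j z' * u (br j z')).
  by have := integrableB measurableT su su'.
rewrite !Pop_in// -RintegralB//.
apply: (le_trans (le_normr_Rintegral _ sB)) => //.
have -> : th ^+ n.+1 * (L * \int[cnt]_j (wt j z * rho (br j z)) +
     B * K1 * \int[cnt]_j (wt j z' * rho (br j z'))) =
   \int[cnt]_j (th ^+ n.+1 * L * (wt j z * rho (br j z)) +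
      th ^+ n.+1 * (B * K1) * (wt j z' * rho (br j z'))).
  by rewrite RintegralD// !RintegralZl//; ring.
apply: le_Rintegral => //.
by have := integrable_abse sB.
Qed.

Lemma exists_expr_lt (L e : R) : 0 < e -> exists2 n, (0 < n)%N & L * th ^+ n < e.
Proof.
move=> e0; have cv : (`|L| * th ^+ n) @[n --> \oo] --> (0 : R).
  rewrite -[X in _ --> X](mulr0 `|L|); apply: cvgMr; apply: cvg_expr.
  by rewrite ger0_norm// ltW.
have /cvgrPdist_lt/(_ _ e0) := cv.
case=> N _ hN; exists N.+1 => //; have := hN N.+1 (leqnSn N).
rewrite /= sub0r normrN => /(le_lt_trans (ler_norm _)).
by apply: le_lt_trans; rewrite ler_wpM2r ?exprn_ge0 ?(ltW th0)// ler_norm.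
Qed.

Implicit Types (u v w g : Yb -> R) (B L : R).

(** The condition [0 < n] restricts the Lipschitz bound to pairs in one cell; the variation between
    cells is controlled by [B]. *)
Definition bl u B L := [/\ (forall y, ~ G y -> u y = 0), (forall y, `|u y| <= B) &
  forall y y' n, G y -> G y' -> (0 < n)%N -> sep y y' n -> `|u y - u y'| <= L * th ^+ n].

Lemma Pop_bnd u B : (forall y, `|u y| <= B) -> forall y, `|Pop u y| <= B.
Proof.
move=> uB y; have B0 : 0 <= B := le_trans (normr_ge0 _) (uB y).
have [Gy|Gy] := pselect (G y); last by rewrite Pop_out// normr0.
rewrite -(Pop_cst B y Gy).
by apply: (Pop_norm _ _ _ _ _ (dom_bnd _ _ uB) (dom_cst B)) => z _; exact: uB.
Qed.

Lemma domW u B B' : B <= B' -> dom u B -> dom u B'.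
Proof. by move=> BB' h y; apply: (le_trans (h y)); exact: ler_wpM2r. Qed.

Lemma Pop_bl u B L : 0 <= L -> bl u B L -> bl (Pop u) B (th * (L + K1 * B)).
Proof.
move=> L0 [u0 uB uL]; split; [exact: Pop_out|exact: Pop_bnd|].
move=> y y' n Gy Gy' n0 s.
have B0 : 0 <= B := le_trans (normr_ge0 _) (uB y).
have h1 : dom u (B / h0 + 1 / h0).
  by apply: (domW _ _ _ _ (dom_bnd _ _ uB)); rewrite lerDl divr_ge0// ltW.
have h2 : dom (cst 1) (B / h0 + 1 / h0).
  apply: (domW _ _ _ _ (dom_cst 1)); rewrite normr1 lerDr divr_ge0// ltW//.
have := Pop_lipschitz u (cst 1) B L _ y y' n B0 L0 h1 h2 (fun=> ler01) _ _ Gy Gy' n0 s.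
rewrite !Pop_cst// => h; apply: (le_trans (h _ _)).
- by move=> z _; rewrite mulr1.
- by move=> z z' k Gz Gz' k0 sk; rewrite mulr1; exact: uL.
- by rewrite le_eqVlt; apply/orP; left; apply/eqP; rewrite exprS; ring.
Qed.

Lemma measurable_bl u B L : bl u B L -> measurable_fun setT u.
Proof.
move=> [u0 uB uL]; have -> : u = u \_ G.
  apply/funext => y; rewrite patchE; case: ifPn => //.
  by rewrite notin_setE => /u0.
apply/(measurable_restrictT _ mG).
apply: (measurable_sep_continuous F part mF mpart) => //; first exact: mG.
move=> z e Gz e0; have [n n0 hn] := exists_expr_lt L e e0.
by exists n => z' Gz' s; apply: (le_lt_trans _ hn); exact: uL.
Qed.

Lemma measurable_Pop_ge0 u B : measurable_fun setT u -> dom u B -> (forall y, 0 <= u y) ->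
  measurable_fun setT (Pop u).
Proof.
move=> mu_ hu u0; apply/measurable_EFinP.
rewrite (_ : EFin \o Pop u = (Te u) \_ G).
  by apply/(measurable_restrictT _ mG); apply: (measurable_funS measurableT) => //; exact: measurable_Te.
apply/funext => z; rewrite /= patchE; case: ifPn => [|].
  by rewrite in_setE => Gz; exact: (Pop_Te _ B).
by rewrite notin_setE => Gz; rewrite Pop_out.
Qed.

Lemma Pop_ge0 (u : Yb -> R) z : (forall y, 0 <= u y) -> 0 <= Pop u z.
Proof.
move=> u0; rewrite /Pop mulr_ge0//.
by apply: Rintegral_ge0 => j _; rewrite mulr_ge0// wt_pos.
Qed.

Lemma ae_G (Q : Yb -> Prop) : (forall y, G y -> Q y) -> {ae mu, forall y, Q y}.
Proof.
move=> h; exists (~` G); split; [exact: measurableC mG|exact: muGC|].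
by move=> y /= nQ Gy; apply: nQ; exact: h.
Qed.

Lemma Pop_duality (u g : Yb -> R) B : measurable_fun setT u -> dom u B ->
  measurable_fun setT g -> (forall y, 0 <= u y) -> (forall y, 0 <= g y) ->
  (\int[mu]_y (u y * g (F y))%:E = \int[mu]_y (Pop u y * g y)%:E)%E.
Proof.
move=> mu_ hu mg u0 g0; rewrite dual//.
apply: ge0_ae_eq_integral => //.
- by apply: emeasurable_funM; [exact: measurable_Te|exact/measurable_EFinP].
- apply/measurable_EFinP; apply: measurable_funM => //.
  exact: (measurable_Pop_ge0 u B).
- by move=> y _; rewrite mule_ge0 ?Te_ge0 ?lee_fin.
- by move=> y _; rewrite lee_fin mulr_ge0// Pop_ge0.
- by apply: ae_G => y Gy _; rewrite EFinM (Pop_Te u B).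
Qed.

Lemma dom_integrable u B : measurable_fun setT u -> dom u B ->
  mu.-integrable setT (fun y => (u y)%:E).
Proof.
move=> mu_ hu; have hB y : B * Hh y <= `|B| * Hh y by rewrite ler_wpM2r// ler_norm.
apply: (integrable_dominated mu u (fun y => `|B| * Hh y)) => //.
- exact: measurable_scalef.
- by move=> y; exact: le_trans (hB y).
- by rewrite integral_scale//; apply: lte_mul_pinfty.
Qed.

Lemma measurable_Pop u B : measurable_fun setT u -> dom u B -> measurable_fun setT (Pop u).
Proof.
move=> mu_ hu.
pose v y := 1 * u y + B * Hh y.
have hv := dom_lin 1 B u Hh B 1 hu dom_Hh.
have v0 y : 0 <= v y.
  by rewrite /v mul1r; have := hu y; rewrite ler_norml => /andP[]; lra.
have mv : measurable_fun setT v.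
  by apply: measurable_funD; exact: measurable_scalef.
rewrite (_ : Pop u = (fun y => Pop v y - B * Pop Hh y)).
  apply: measurable_funB; first exact: measurable_Pop_ge0 hv v0.
  by apply: measurable_scalef; exact: measurable_Pop_ge0 dom_Hh Hh0.
by apply/funext => y; rewrite /v (Pop_lin _ _ _ _ _ _ y hu dom_Hh) mul1r addrK.
Qed.

Lemma Pop_dom u B : 0 <= B -> dom u B -> forall y, `|Pop u y| <= B * CP.
Proof.
move=> B0 hu y.
have hB : dom (fun y => B * Hh y + 0 * Hh y) (`|B| * 1 + `|0 : R| * 1).
  exact: (dom_lin B 0 Hh Hh 1 1 dom_Hh dom_Hh).
apply: (@le_trans _ _ (B * Pop Hh y)); last by rewrite ler_wpM2l// Pop_Hh_le.
have := Pop_norm u _ _ _ y hu hB.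
rewrite (Pop_lin _ _ _ _ _ _ y dom_Hh dom_Hh) mul0r addr0; apply => z _.
by rewrite mul0r addr0.
Qed.

Lemma Pop_integral u B : 0 <= B -> measurable_fun setT u -> dom u B ->
  (\int[mu]_y (Pop u y)%:E = \int[mu]_y (u y)%:E)%E.
Proof.
move=> B0 mu_ hu.
pose v y := 1 * u y + B * Hh y.
have hv := dom_lin 1 B u Hh B 1 hu dom_Hh.
have v0 y : 0 <= v y.
  by rewrite /v mul1r; have := hu y; rewrite ler_norml => /andP[]; lra.
have mv : measurable_fun setT v.
  by apply: measurable_funD; exact: measurable_scalef.
have iu := dom_integrable u B mu_ hu.
have iH := dom_integrable _ _ mHh dom_Hh.
have mPu := measurable_Pop u B mu_ hu.
have mPH := measurable_Pop _ _ mHh dom_Hh.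
have iPu : mu.-integrable setT (fun y => (Pop u y)%:E).
  by apply: (dom_integrable _ (B * CP / h0)) => //; exact: dom_bnd (Pop_dom _ _ B0 hu).
have iPH : mu.-integrable setT (fun y => (Pop Hh y)%:E).
  by apply: (dom_integrable _ (1 * CP / h0)) => //; exact: dom_bnd (Pop_dom _ _ ler01 dom_Hh).
have D w Bw : measurable_fun setT w -> dom w Bw -> (forall y, 0 <= w y) ->
    (\int[mu]_y (Pop w y)%:E = \int[mu]_y (w y)%:E)%E.
  move=> mw hw w0; have := Pop_duality w (cst 1) Bw mw hw (measurable_cst _) w0 (fun=> ler01).
  have e1 y : w y * (cst 1 : Yb -> R) (F y) = w y by exact: mulr1.
  have e2 y : Pop w y * (cst 1 : Yb -> R) y = Pop w y by exact: mulr1.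
  by under eq_integral do rewrite e1; under [X in _ = X]eq_integral do rewrite e2; move=> ->.
have e1 := D v _ mv hv v0.
have e2 := D Hh _ mHh dom_Hh Hh0.
have iBH : mu.-integrable setT (fun y => (B * Hh y)%:E).
  by have := integrableZl measurableT B iH; apply: eq_integrable => // y _; rewrite EFinM.
have iBPH : mu.-integrable setT (fun y => (B * Pop Hh y)%:E).
  by have := integrableZl measurableT B iPH; apply: eq_integrable => // y _; rewrite EFinM.
have e3 : (\int[mu]_y (v y)%:E = \int[mu]_y (u y)%:E + B%:E * \int[mu]_y (Hh y)%:E)%E.
  rewrite -integralZl// -integralD//; apply: eq_integral => y _.
  by rewrite /v mul1r.
have e4 : (\int[mu]_y (Pop v y)%:E = \int[mu]_y (Pop u y)%:E + B%:E * \int[mu]_y (Pop Hh y)%:E)%E.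
  rewrite -integralZl// -integralD//; apply: eq_integral => y _.
  by rewrite (Pop_lin _ _ _ _ _ _ y hu dom_Hh) mul1r.
move: e1; rewrite e3 e4 e2.
have f1 := integrable_fin_num measurableT iu.
have f2 := integrable_fin_num measurableT iPu.
have f3 : (B%:E * \int[mu]_y (Hh y)%:E)%E \is a fin_num.
  by have f4 := integrable_fin_num measurableT iH; apply: fin_numM.
by move=> /(congr1 (fun x => x - B%:E * \int[mu]_y (Hh y)%:E)%E); rewrite !addeK.
Qed.

(** Functions annihilated by the transfer operator are reverse martingale differences. Duality is
    available for nonnegative functions only, hence the splitting of [m] and [g] into positive and
    negative parts. *)
Lemma Pop_mart_diff m B : measurable_fun setT m -> dom m B ->
  (forall z, G z -> Pop m z = 0) -> mart_diff mu F m.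
Proof.
move=> mm hm Pm; split=> // g mg ig.
pose mp y : R := Num.max (m y) 0; pose mn y : R := Num.max (- m y) 0.
pose gp y : R := Num.max (g y) 0; pose gn y : R := Num.max (- g y) 0.
have mmp : measurable_fun setT mp by exact: measurable_maxr.
have mmn : measurable_fun setT mn by apply: measurable_maxr => //; exact: measurable_funN.
have mgp : measurable_fun setT gp by exact: measurable_maxr.
have mgn : measurable_fun setT gn by apply: measurable_maxr => //; exact: measurable_funN.
have p0 (f : Yb -> R) y : 0 <= Num.max (f y) 0 by rewrite le_max lexx orbT.
have pnle (x : R) : `|Num.max x 0| <= `|x|.
  by rewrite maxEle; case: ifP; rewrite ?normr0.
have hmp : dom mp B by move=> y; exact: le_trans (pnle _) (hm y).
have hmn : dom mn B by move=> y; apply: (le_trans (pnle _)); rewrite normrN; exact: hm.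
have dec (x : R) : x = Num.max x 0 - Num.max (- x) 0.
  rewrite !maxEle oppr_le0; have [x0|x0|->] := ltgtP x 0; lra.
have Ppn z : Pop mp z = Pop mn z.
  have [Gz|Gz] := pselect (G z); last by rewrite !Pop_out.
  apply/eqP; rewrite -subr_eq0 -(Pm z Gz) -[Pop mp z]mul1r -mulN1r.
  rewrite -(Pop_lin _ _ _ _ _ _ z hmp hmn); apply/eqP; apply: Pop_ext => y _.
  by rewrite [RHS](dec (m y)) mul1r mulN1r.
have key (f : Yb -> R) : measurable_fun setT f -> (forall y, 0 <= f y) ->
   (\int[mu]_y (mp y * f (F y))%:E = \int[mu]_y (mn y * f (F y))%:E)%E.
  move=> mf f0; have e1 := Pop_duality mp f B mmp hmp mf (p0 m) f0.
  have e2 := Pop_duality mn f B mmn hmn mf (p0 (fun y => - m y)) f0.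
  by rewrite e1 e2; apply: eq_integral => y _; rewrite Ppn.
have int (a b : Yb -> R) : measurable_fun setT a -> measurable_fun setT b ->
   (forall y, `|a y| <= `|m y|) -> (forall y, `|b y| <= `|g y|) ->
   mu.-integrable setT (fun y => (a y * b (F y))%:E).
  move=> ma mb am bg.
  have mf : measurable_fun setT (fun y => a y * b (F y)).
    by apply: measurable_funM => //; apply: measurableT_comp.
  apply: (le_integrable measurableT _ _ ig); first exact/measurable_EFinP.
  by move=> y _ /=; rewrite lee_fin !normrM ler_pM.
have i1 : mu.-integrable setT (fun y => (mp y * gp (F y))%:E) by apply: int => // y; exact: pnle.
have i2 : mu.-integrable setT (fun y => (mn y * gp (F y))%:E).
  by apply: int => // y; [apply: (le_trans (pnle _)); rewrite normrN|exact: pnle].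
have i3 : mu.-integrable setT (fun y => (mp y * gn (F y))%:E).
  by apply: int => // y; [exact: pnle|apply: (le_trans (pnle _)); rewrite normrN].
have i4 : mu.-integrable setT (fun y => (mn y * gn (F y))%:E).
  by apply: int => // y; apply: (le_trans (pnle _)); rewrite normrN.
have i12 : mu.-integrable setT (fun y => (mp y * gp (F y))%:E - (mn y * gp (F y))%:E)%E.
  exact: integrableB.
have i34 : mu.-integrable setT (fun y => (mp y * gn (F y))%:E - (mn y * gn (F y))%:E)%E.
  exact: integrableB.
transitivity (\int[mu]_y (((mp y * gp (F y))%:E - (mn y * gp (F y))%:E) -
   ((mp y * gn (F y))%:E - (mn y * gn (F y))%:E)))%E.
  apply: eq_integral => y _; rewrite -!EFinB; congr (_%:E).
  by rewrite {1}(dec (m y)) {1}(dec (g (F y))) /mp /mn /gp /gn; ring.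
rewrite (integralB measurableT i12 i34) (integralB measurableT i1 i2) (integralB measurableT i3 i4).
have k1 := key gp mgp (p0 g); have k2 := key gn mgn (p0 (fun y => - g y)).
rewrite k1 k2.
by rewrite !subee ?oppe0 ?adde0// (integrable_fin_num measurableT).
Qed.

Lemma dom_iter u B k : (forall y, `|u y| <= B) -> forall y, `|iter k Pop u y| <= B.
Proof. by move=> uB; elim: k => [//|k ih]; exact: Pop_bnd. Qed.

Lemma iter_mono u v B B' k z : (forall y, `|u y| <= B) -> (forall y, `|v y| <= B') ->
  (forall y, G y -> u y <= v y) -> G z -> iter k Pop u z <= iter k Pop v z.
Proof.
move=> uB vB uv; elim: k z => [z Gz|k ih z Gz]; first exact: uv.
exact: (Pop_mono _ _ _ _ z (dom_bnd _ _ (dom_iter u B k uB)) (dom_bnd _ _ (dom_iter v B' k vB)) ih).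
Qed.

Lemma iter_lin a b u v B B' k z : (forall y, `|u y| <= B) -> (forall y, `|v y| <= B') -> G z ->
  iter k Pop (fun y => a * u y + b * v y) z = a * iter k Pop u z + b * iter k Pop v z.
Proof.
move=> uB vB; elim: k z => [//|k ih z Gz].
have hu := dom_bnd _ _ (dom_iter u B k uB); have hv := dom_bnd _ _ (dom_iter v B' k vB).
by rewrite !iterS -(Pop_lin a b _ _ _ _ z hu hv); exact: Pop_ext.
Qed.

Lemma iter_cst (a : R) k z : G z -> iter k Pop (cst a) z = a.
Proof.
move=> Gz; elim: k z Gz => [//|k ih z Gz].
by rewrite iterS (Pop_ext _ (cst a)) ?Pop_cst.
Qed.

Lemma iter_ge0 u B k z : (forall y, 0 <= u y) -> 0 <= iter k Pop u z.
Proof. by move=> u0; elim: k z => [//|k ih z]; exact: Pop_ge0. Qed.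

Lemma measurable_iter u B k : (forall y, `|u y| <= B) -> measurable_fun setT u ->
  measurable_fun setT (iter k Pop u).
Proof.
move=> uB mu_; elim: k => [//|k ih].
exact: (measurable_Pop _ _ ih (dom_bnd _ _ (dom_iter u B k uB))).
Qed.

Lemma iter_duality u g B k : measurable_fun setT u -> (forall y, `|u y| <= B) ->
  measurable_fun setT g -> (forall y, 0 <= u y) -> (forall y, 0 <= g y) ->
  (\int[mu]_y (u y * g (iter k F y))%:E = \int[mu]_y (iter k Pop u y * g y)%:E)%E.
Proof.
move=> mu_ uB mg u0 g0; elim: k g mg g0 => [//|k ih g mg g0].
have mgF : measurable_fun setT (g \o F) by exact: measurableT_comp.
rewrite [LHS](ih (g \o F) mgF (fun y => g0 (F y))).
apply: (Pop_duality (iter k Pop u) g (B / h0)) => //.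
- exact: measurable_iter.
- exact: dom_bnd (dom_iter u B k uB).
- by move=> y; exact: iter_ge0.
Qed.

(** The fixed point of [x |-> th * (K0 + x)]: the log-Lipschitz constant that the operator
    reproduces. *)
Definition kap : R := th * K0 / (1 - th).

Lemma kapE : th * (K0 + kap) = kap.
Proof. by rewrite /kap; field; rewrite subr_eq0 gt_eqF. Qed.

Lemma kap_ge0 : 0 <= kap.
Proof. by rewrite /kap divr_ge0 ?mulr_ge0 ?(ltW th0)// subr_ge0 ltW. Qed.

(* Bounded distortion propagates: the iterates of the indicator of a union of
   cylinders of length [n0] become uniformly log-Lipschitz after [n0] steps. *)
Definition loglip (w : Yb -> R) m := forall z z' n, G z -> G z' -> (0 < n)%N -> (m <= n)%N ->
  sep z z' n -> w z <= expR (kap * th ^+ n) * w z'.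

(** Preimages separate one step later, so the constant becomes [th * (K0 + kap) = kap] and the
    separation that must be assumed drops by one. *)
Lemma Pop_loglip w B m : (forall y, `|w y| <= B) -> (forall y, 0 <= w y) ->
  loglip w m.+1 -> loglip (Pop w) m.
Proof.
move=> wB w0 wl z z' n Gz Gz' n0 mn s.
have pz : part z = part z' by have := s 0%N n0.
have sw := summable_dom w _ z Gz (dom_bnd _ _ wB).
have sw' := summable_dom w _ z' Gz' (dom_bnd _ _ wB).
rewrite !Pop_in// -RintegralZl//; apply: le_Rintegral => //.
  by have := integrableZl measurableT (expR (kap * th ^+ n)) sw'; apply: eq_integrable => // j _; rewrite /= EFinM.
move=> j _; have [Iz|Iz] := pselect (Ij j z); last first.
  have Iz' : ~ Ij j z' by move=> h; apply: Iz; exact: (markov _ _ _ h (esym pz)).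
  by rewrite !(wt_out _ _ _ j)// !mul0r mulr0.
have Iz' := markov _ _ _ Iz pz.
have [Gy yj] := G_br j z Gz Iz; have [Gy' yj'] := G_br j z' Gz' Iz'.
have [_ Fy] := brP F part j z Iz; have [_ Fy'] := brP F part j z' Iz'.
rewrite !wt_in//; set y := br j z in Gy yj Fy *; set y' := br j z' in Gy' yj' Fy' *.
have yy' : part y = part y' by rewrite yj yj'.
have s' : sep y y' n.+1.
  by apply/(sep_geS F part); split => //; rewrite Fy Fy'.
have h1 : zeta y <= expR (K0 * th ^+ n.+1) * zeta y'.
  have zE x : zeta x = expR (ln (zeta x)) by rewrite lnK ?posrE.
  rewrite (zE y) (zE y') -expRD ler_expR.
  by have := distortion y y' n.+1 yy' s'; rewrite ler_norml => /andP[_]; lra.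
have h2 := wl y y' n.+1 Gy Gy' isT (ltac:(by rewrite ltnS)) s'.
apply: (le_trans (ler_pM (ltW (zeta0 y)) (w0 y) h1 h2)).
rewrite mulrACA -expRD le_eqVlt; apply/orP; left; apply/eqP; congr (expR _ * _).
by rewrite -[X in _ = X * _]kapE exprS; ring.
Qed.

Lemma iter_loglip w B n0 k : (forall y, `|w y| <= B) -> (forall y, 0 <= w y) ->
  loglip w n0 -> loglip (iter k Pop w) (n0 - k).
Proof.
move=> wB w0 wl; elim: k => [|k ih]; first by rewrite subn0.
apply: (Pop_loglip _ B); first exact: dom_iter.
  by move=> y; exact: (iter_ge0 _ B).
have [h|h] := leqP n0 k; last by rewrite -subSn.
move=> z z' n Gz Gz' n_0 _ s; apply: ih => //.
by rewrite (eqP h).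
Qed.

Hypothesis ergF : forall B : set Yb, measurable B -> F @^-1` B = B -> mu B = 0%E \/ mu B = 1%E.

(** The sets of points that visit the cell at some time at least [i] decrease with [i], and each is
    the preimage of the previous one, so they have equal measure. Their intersection is invariant,
    has at least the measure of the cell, and is therefore full. *)
Lemma ergodic_hit j n0 : (0 < mu (Pj j))%E ->
  mu (\bigcup_k (iter (n0 + k) F @^-1` Pj j)) = 1%E.
Proof.
move=> muj; pose B i := \bigcup_k (iter (i + k) F @^-1` Pj j).
have mpre k : measurable (iter k F @^-1` Pj j).
  by rewrite -[X in measurable X]setTI; exact: (measurable_iterF F mF k).
have mB i : measurable (B i) by exact: bigcupT_measurable.
have BS i : F @^-1` (B i) = B i.+1.
  have e k y : iter (i.+1 + k) F y = iter (i + k) F (F y) by rewrite addSn iterSr.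
  apply/seteqP; split => y [k _ h]; exists k => //.
    by change (Pj j (iter (i.+1 + k) F y)); rewrite e.
  by change (Pj j (iter (i + k) F (F y))); rewrite -e.
have Bsub i : B i.+1 `<=` B i.
  by move=> y [k _ h]; exists k.+1 => //; rewrite addnS -addSn.
have muBi i : mu (B i) = mu (B 0%N) by elim: i => [//|i <-]; rewrite -BS invF.
have mBi : measurable (\bigcap_i B i) by exact: bigcapT_measurable.
have muBinf : mu (\bigcap_i B i) = mu (B 0%N).
  have cv : mu \o B @ \oo --> mu (\bigcap_i B i).
    apply: nonincreasing_cvg_mu => //.
      by rewrite (le_lt_trans (probability_le1 mu (mB 0%N)))// ltry.
    apply/nonincreasing_seqP => n; apply/subsetPset; exact: Bsub.
  have cv2 : mu \o B @ \oo --> mu (B 0%N).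
    rewrite (_ : mu \o B = cst (mu (B 0%N))); first exact: cvg_cst.
    by apply/funext => i; exact: muBi.
  exact: (cvg_unique _ cv cv2).
have inv : F @^-1` (\bigcap_i B i) = \bigcap_i B i.
  rewrite preimage_bigcap; apply/seteqP; split => y h i _.
    by have := h i I; rewrite BS; exact: Bsub.
  by rewrite BS; exact: h.
have [h|h] := ergF _ mBi inv.
  have sub : Pj j `<=` B 0%N by move=> y yj; exists 0%N.
  have le0 : (mu (Pj j) <= mu (B 0%N))%E := le_measure mu (mem_set (mP j)) (mem_set (mB 0%N)) sub.
  by move: le0; rewrite -muBinf h leNgt muj.
by rewrite -/(B n0) muBi -muBinf.
Qed.

(** Some [k >= n0] carries a part of [A] of positive measure into cell [j], so the [k]-th iterate is
    positive at one point of the cell. Since [k >= n0], that iterate is log-Lipschitz on pairs of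
    one cell, which spreads the lower bound over the cell. *)
Lemma positive_iterate (A : set Yb) n0 j : (0 < n0)%N ->
  (forall y y', A y -> sep y y' n0 -> A y') -> (0 < mu A)%E -> (0 < mu (Pj j))%E ->
  exists k, exists2 e : R, 0 < e & forall z, G z -> part z = j -> e <= iter k Pop \1_A z.
Proof.
move=> n00 Asat muA muj.
have mA : measurable A by exact: (measurable_saturated F part mF mpart n0).
have mpre k : measurable (iter k F @^-1` Pj j).
  by rewrite -[X in measurable X]setTI; exact: (measurable_iterF F mF k).
have A1 y : `|(\1_A : Yb -> R) y| <= 1.
  by rewrite indicE; case: (_ \in _); rewrite ?normr1 ?normr0.
have A0 y : 0 <= (\1_A : Yb -> R) y by rewrite indicE.
have [k kn0 muk] : exists2 k, (n0 <= k)%N & (0 < mu (A `&` iter k F @^-1` Pj j))%E.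
  apply: contrapT => h.
  have z k : mu (A `&` iter (n0 + k) F @^-1` Pj j) = 0%E.
    apply/eqP; apply: contrapT => /negP h'; apply: h; exists (n0 + k)%N; first exact: leq_addr.
    by rewrite lt0e h' measure_ge0.
  have e := ergodic_hit j n0 muj.
  set U := \bigcup_k _ in e.
  have mU : measurable U by apply: bigcupT_measurable => k; exact: mpre.
  have AU : mu (A `&` U) = 0%E.
    rewrite setI_bigcupr; apply: measure_negligible.
      by apply: bigcupT_measurable => k; apply: measurableI => //; exact: mpre.
    apply: negligible_bigcup => k; apply/negligibleP; last exact: z.
    by apply: measurableI => //; exact: mpre.
  have AUc : mu (A `\` U) = 0%E.
    have UC : mu (~` U) = 0%E by rewrite probability_setC// e subee.
    apply: (subset_measure0 _ _ _ UC); first exact: measurableD.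
      exact: measurableC.
    by move=> y [].
  have : mu A = 0%E.
    apply: measure_negligible => //.
    apply: (@negligibleS _ _ _ _ ((A `&` U) `|` (A `\` U))); first by rewrite setUIDK.
    apply: negligibleU; apply/negligibleP => //; first exact: measurableI.
    exact: measurableD.
  by move=> h0_; rewrite h0_ ltxx in muA.
exists k.
have mI : measurable_fun setT (\1_A : Yb -> R) by exact: measurable_indic.
have mJ : measurable_fun setT (\1_(Pj j) : Yb -> R) by exact: measurable_indic.
have [z0 [Gz0 z0j] z0p] : exists2 z, G z /\ part z = j & 0 < iter k Pop \1_A z.
  apply: contrapT => h.
  have := iter_duality (\1_A) (\1_(Pj j)) 1 k mI A1 mJ A0 (fun y => ltac:(by rewrite indicE)).
  rewrite (_ : (\int[mu]_y (\1_A y * \1_(Pj j) (iter k F y))%:E)%E = mu (A `&` iter k F @^-1` Pj j)).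
    rewrite (_ : (\int[mu]_y _)%E = 0%E) => [h'|]; first by rewrite h' ltxx in muk.
    rewrite (ge0_negligible_integral (measurableC mG) measurableT _ _ muGC).
    - apply: integral0_eq => y [_ /contrapT Gy].
      have [yj|yj] := pselect (part y = j); last by rewrite indicE memNset ?mulr0.
      suff -> : iter k Pop \1_A y = 0 by rewrite mul0r.
      apply/eqP; rewrite eq_le (iter_ge0 _ 1)// andbT leNgt; apply/negP => h'.
      by apply: h; exists y.
    - apply/measurable_EFinP; apply: measurable_funM => //; exact: (measurable_iter _ 1).
    - by move=> y _; rewrite lee_fin mulr_ge0// ?(iter_ge0 _ 1).
  transitivity (\int[mu]_y (\1_(A `&` iter k F @^-1` Pj j) y)%:E)%E; last first.
    by rewrite integral_indic ?setIT//; apply: measurableI => //; exact: mpre.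
  apply: eq_integral => y _; congr (_%:E).
  rewrite !indicE -natrM mulnb; congr ((_ : bool)%:R).
  by apply/andP/idP; rewrite !inE.
pose w := iter k Pop \1_A.
exists (expR (- (kap * th ^+ 1)) * w z0); first by rewrite mulr_gt0// expR_gt0.
move=> z Gz zj; rewrite expRN mulrC ler_pdivrMr ?expR_gt0// mulrC.
have ll : loglip \1_A n0.
  move=> y y' n Gy Gy' n_0 n0n s.
  have [Ay|Ay] := pselect (A y); last by rewrite {1}indicE memNset//= mulr_ge0// expR_ge0.
  rewrite !indicE !mem_set//; last by apply: (Asat y) => //; exact: sep_geW s.
  by rewrite mulr1 -[leLHS]expR0 ler_expR mulr_ge0 ?kap_ge0// exprn_ge0// ltW.
have := iter_loglip \1_A 1 n0 k A1 A0 ll z0 z 1%N Gz0 Gz isT.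
apply; first by rewrite (eqP kn0).
by move=> i; rewrite ltnS leqn0 => /eqP -> /=; rewrite z0j zj.
Qed.

Lemma small_tail (B : nat -> set Yb) (e : R) : (forall i, measurable (B i)) ->
  (forall i, B i.+1 `<=` B i) -> \bigcap_i B i = set0 -> 0 < e ->
  exists J, (mu (B J) <= e%:E)%E.
Proof.
move=> mB Bsub B0 e0.
have cv : mu \o B @ \oo --> mu (\bigcap_i B i).
  apply: nonincreasing_cvg_mu => //.
  - by rewrite (le_lt_trans (probability_le1 mu (mB 0%N)))// ltry.
  - exact: bigcapT_measurable.
  - apply/nonincreasing_seqP => n; apply/subsetPset; exact: Bsub.
rewrite B0 measure0 in cv.
have [_ /cvgrPdist_lt/(_ _ e0)] := (fine_cvgP _ _).1 cv.
case=> N _ hN; exists N; have := hN N (leqnn N).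
rewrite /= sub0r normrN => h.
have f : mu (B N) \is a fin_num by exact: fin_num_measure.
rewrite -(fineK f) lee_fin; apply/ltW/(le_lt_trans _ h); exact: ler_norm.
Qed.

Lemma Pop_bigsum (f : nat -> Yb -> R) (b : nat -> R) N z :
  (forall k, dom (f k) (b k)) ->
  Pop (fun y => \sum_(k < N) f k y) z = \sum_(k < N) Pop (f k) z.
Proof.
move=> fb.
have hd n : dom (fun y => \sum_(k < n) f k y) (\sum_(k < n) b k).
  move=> y; apply: (le_trans (ler_norm_sum _ _ _)); rewrite mulr_suml.
  by apply: ler_sum => k _; exact: fb.
elim: N => [|N ih].
  rewrite big_ord0 (Pop_ext _ (fun y => 0 * Hh y + 0 * Hh y)).
    by rewrite (Pop_lin _ _ _ _ _ _ z dom_Hh dom_Hh) !mul0r addr0.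
  by move=> y _; rewrite big_ord0 !mul0r addr0.
rewrite big_ord_recr /= -ih -[X in _ = X + _]mul1r -[X in _ = _ + X]mul1r.
rewrite -(Pop_lin 1 1 _ _ _ _ z (hd N) (fb N)); apply: Pop_ext => y _.
by rewrite big_ord_recr /= !mul1r.
Qed.

Lemma indic_bnd (A : set Yb) y : `|(\1_A : Yb -> R) y| <= 1.
Proof. by rewrite indicE; case: (_ \in _); rewrite ?normr1 ?normr0. Qed.

Lemma indic_pos (A : set Yb) y : 0 <= (\1_A : Yb -> R) y.
Proof. by rewrite indicE. Qed.

Lemma sum_iter_mono u B N N' z : (forall y, `|u y| <= B) -> (forall y, 0 <= u y) ->
  (N <= N')%N -> \sum_(k < N) iter k Pop u z <= \sum_(k < N') iter k Pop u z.
Proof.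
move=> uB u0 NN'; rewrite -(subnKC NN') big_split_ord /= lerDl.
by apply: sumr_ge0 => k _; exact: (iter_ge0 _ B).
Qed.

Lemma sum_iterS_mono u B N N' z : (forall y, `|u y| <= B) -> (forall y, 0 <= u y) ->
  (N <= N')%N -> \sum_(k < N) iter k.+1 Pop u z <= \sum_(k < N') iter k.+1 Pop u z.
Proof.
move=> uB u0 NN'; rewrite -(subnKC NN') big_split_ord /= lerDl.
by apply: sumr_ge0 => k _; apply: Pop_ge0 => y; exact: (iter_ge0 _ B).
Qed.

(** Finitely many cells are handled by [positive_iterate]. The cells of large index have so little
    total mass that one application of the operator sends at most half of its weight there; this
    application accounts for the shift [k.+1]. *)
Lemma minorization (A : set Yb) n0 : (0 < n0)%N ->
  (forall y y', A y -> sep y y' n0 -> A y') -> (0 < mu A)%E ->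
  exists N, exists2 e : R, 0 < e & forall z, G z ->
    e <= \sum_(k < N) iter k.+1 Pop \1_A z.
Proof.
move=> n00 Asat muA.
have step1 J : exists N, exists2 e : R, 0 < e & forall z, G z -> (part z < J)%N ->
    e <= \sum_(k < N) iter k Pop \1_A z.
  elim: J => [|J [N [e e0 he]]]; first by exists 0%N; exists 1.
  have [muJ|muJ] := pselect (0 < mu (Pj J))%E; last first.
    exists N; exists e => // z Gz; rewrite ltnS leq_eqVlt => /orP[/eqP zJ|]; last exact: he.
    by case: muJ; rewrite -zJ; exact: G_pos.
  have [k [e' e'0 he']] := positive_iterate A n0 J n00 Asat muA muJ.
  exists (maxn N k.+1); exists (Num.min e e'); first by rewrite lt_min e0.
  move=> z Gz; rewrite ltnS leq_eqVlt => /orP[/eqP zJ|zJ].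
    rewrite ge_min; apply/orP; right; apply: (le_trans (he' z Gz zJ)).
    apply: (le_trans _ (sum_iter_mono _ 1 k.+1 _ z (indic_bnd A) (indic_pos A) (leq_maxr _ _))).
    rewrite big_ord_recr /= lerDr; apply: sumr_ge0 => i _; exact: (iter_ge0 _ 1 _ _ (indic_pos A)).
  rewrite ge_min; apply/orP; left; apply: (le_trans (he z Gz zJ)).
  exact: (sum_iter_mono _ 1 _ _ z (indic_bnd A) (indic_pos A) (leq_maxl _ _)).
pose T J : set Yb := [set z | (J <= part z)%N].
have mT J : measurable (T J).
  apply: (measurable_saturated F part mF mpart 1%N) => z z' /= h s.
  by rewrite /T /= -(s 0%N).
have kk0 : 0 < 1 * expR K0 / c by rewrite mul1r divr_gt0// expR_gt0.
have [J hJ] : exists J, (mu (T J) <= ((2 * (1 * expR K0 / c))^-1)%:E)%E.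
  apply: small_tail => //.
  - by move=> i z; exact: ltnW.
  - apply/seteqP; split => // z /= h.
    by have := h (part z).+1 I; rewrite /T /= ltnn.
  - by rewrite invr_gt0 mulr_gt0.
have PT z : G z -> Pop \1_(T J) z <= 2^-1.
  move=> Gz; have hd := dom_bnd _ _ (indic_bnd (T J)).
  rewrite -lee_fin (Pop_Te _ _ z hd (indic_pos (T J)) Gz).
  have comp y y' : part y = part y' -> (\1_(T J) : Yb -> R) y <= 1 * \1_(T J) y'.
    move=> yy'; rewrite mul1r !indicE.
    suff -> : (y \in T J) = (y' \in T J) by [].
    by apply/idP/idP; rewrite !inE /T /= yy'.
  apply: (le_trans (Te_le_int _ 1 z _ (indic_pos (T J)) ler01 comp Gz)); first exact: measurable_indic.
  rewrite integral_indic// setIT.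
  apply: (@le_trans _ _ ((1 * expR K0 / c)%:E * ((2 * (1 * expR K0 / c))^-1)%:E)%E).
    by apply: lee_wpmul2l => //; rewrite lee_fin ltW.
  by rewrite -EFinM lee_fin invfM mulrCA divff ?mulr1// gt_eqF.
have [N [e e0 he]] := step1 J.
exists N; exists (e / 2); first by rewrite divr_gt0.
move=> z Gz.
have db k : dom (iter k Pop \1_A) (1 / h0) by exact: dom_bnd (dom_iter _ _ k (indic_bnd A)).
rewrite -(Pop_bigsum (fun k => iter k Pop \1_A) (fun=> 1 / h0))//.
have hdT := dom_bnd _ _ (indic_bnd (T J)).
have hl := dom_lin e (- e) (cst 1) (\1_(T J)) _ _ (dom_cst 1) hdT.
have hs : dom (fun y => \sum_(k < N) iter k Pop \1_A y) (\sum_(k < N) 1 / h0).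
  move=> y; apply: (le_trans (ler_norm_sum _ _ _)); rewrite mulr_suml.
  by apply: ler_sum => k _; exact: db.
apply: (@le_trans _ _ (Pop (fun y => e * cst 1 y + - e * \1_(T J) y) z)).
  rewrite (Pop_lin _ _ _ _ _ _ z (dom_cst 1) hdT) Pop_cst//.
  have := PT z Gz; nra.
apply: (Pop_mono _ _ _ _ z hl hs) => y Gy /=.
rewrite indicE; have [h|h] := leqP J (part y).
  rewrite mem_set//= mulr1 mulr1 subrr.
  by apply: sumr_ge0 => k _; exact: (iter_ge0 _ 1 _ _ (indic_pos A)).
rewrite memNset; last by rewrite /T /= leqNgt h.
by rewrite mulr0 addr0 mulr1; exact: he.
Qed.

Lemma uniform_choice (I : finType) (Q : I -> nat -> R -> Prop) :
  (forall i N N' e e', (N <= N')%N -> e' <= e -> Q i N e -> Q i N' e') ->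
  (forall i, exists N, exists2 e, 0 < e & Q i N e) ->
  exists N, exists2 e, 0 < e & forall i, Q i N e.
Proof.
move=> Qm Qi.
suff [N [e e0 h]] : exists N, exists2 e, 0 < e & forall i, i \in enum I -> Q i N e.
  by exists N; exists e => // i; apply: h; rewrite mem_enum.
elim: (enum I) => [|i s [N [e e0 h]]]; first by exists 0%N; exists 1.
have [N' [e' e'0 h']] := Qi i.
exists (maxn N N'); exists (Num.min e e'); first by rewrite lt_min e0.
move=> k; rewrite inE => /orP[/eqP ->|ks].
  by apply: Qm h'; [exact: leq_maxr|rewrite ge_min lexx orbT].
by apply: Qm (h k ks); [exact: leq_maxl|rewrite ge_min lexx].
Qed.

(** Up to measure [1/8] the space is covered by finitely many cylinders on which [u] varies by less
    than [1/16]. One of positive measure has [u >= 1/4] throughout, and [minorization] for its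
    indicator gives a bound that does not depend on [u]. *)
Lemma doeblin L : 0 <= L -> exists2 N, (0 < N)%N & exists2 e : R, 0 < e &
  forall u, measurable_fun setT u -> (forall y, `|u y| <= 1) ->
  (forall y, G y -> 0 <= u y) ->
  (forall y y' n, G y -> G y' -> (0 < n)%N -> sep y y' n -> `|u y - u y'| <= L * th ^+ n) ->
  (2^-1%:E <= \int[mu]_y (u y)%:E)%E ->
  forall z, G z -> e <= \sum_(k < N) iter k.+1 Pop u z.
Proof.
move=> L0; have [m m0 hm] := exists_expr_lt L (16^-1) (ltac:(by [])).
pose B J : set Yb := [set z | exists2 k, (k < m)%N & (J <= part (iter k F z))%N].
have mB J : measurable (B J).
  apply: (measurable_saturated F part mF mpart m) => z z' [k km h] s.
  by exists k => //; rewrite -s.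
have [J hJ] : exists J, (mu (B J) <= 8^-1%:E)%E.
  apply: small_tail => //.
  - by move=> i z [k km h]; exists k => //; exact: ltnW.
  - apply/seteqP; split => // z /= h.
    pose M := (\sum_(k < m) part (iter k F z)).+1.
    have [k km] := h M I; rewrite leqNgt ltnS /= => /negP; apply.
    by rewrite (bigD1 (Ordinal km))//= leq_addr.
pose Cy (b : {ffun 'I_m -> 'I_J}) : set Yb :=
  [set z | forall k : 'I_m, part (iter k F z) = b k].
have Csat b z z' : Cy b z -> sep z z' m -> Cy b z'.
  by move=> h s k; rewrite -(h k) (s k).
have mC b : measurable (Cy b) by exact: (measurable_saturated F part mF mpart m _ (Csat b)).
have CyE b z z' : Cy b z -> Cy b z' -> sep z z' m.
  by move=> h h' k km; rewrite (h (Ordinal km)) (h' (Ordinal km)).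
pose Q (b : {ffun 'I_m -> 'I_J}) N (e : R) := (0 < mu (Cy b))%E -> forall z, G z ->
  e <= \sum_(k < N) iter k.+1 Pop \1_(Cy b) z.
have [N [e e0 hQ]] : exists N, exists2 e, 0 < e & forall b, Q b N e.
  apply: uniform_choice.
    move=> b N N' e e' NN' ee' h muC z Gz; apply: (le_trans ee'); apply: (le_trans (h muC z Gz)).
    exact: (sum_iterS_mono _ 1 _ _ _ (indic_bnd _) (indic_pos _)).
  move=> b; have [muC|muC] := pselect (0 < mu (Cy b))%E.
    have [N [e e0 h]] := minorization (Cy b) m m0 (Csat b) muC.
    by exists N; exists e => // _; exact: h.
  by exists 0%N; exists 1 => // /muC.
(* The extra iterate makes the number of iterates positive, as [N] may be 0; the factor [1/4] is the
   lower bound of [u] on the chosen cylinder. *)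
exists N.+1 => //; exists (e / 4); first by rewrite divr_gt0.
move=> u mu_ u1 u0 uL iu z Gz.
(* Otherwise [u] would be at most [1/4 + 1/16 = 5/16] outside a set of measure at most [1/8], and
   its integral at most [7/16]. *)
have [b0 [muC hc]] : exists b, (0 < mu (Cy b))%E /\ forall y, G y -> Cy b y -> 4^-1 <= u y.
  apply: contrapT => h.
  have low b y : (0 < mu (Cy b))%E -> G y -> Cy b y -> u y <= 5 / 16.
    move=> muC Gy yC; apply: contrapT => /negP; rewrite -ltNge => hy.
    apply: h; exists b; split=> // y' Gy' y'C.
    have := uL y y' m Gy Gy' m0 (CyE _ _ _ yC y'C).
    rewrite ler_norml => /andP[_]; lra.
  pose Bad2 : set Yb := \bigcup_(i in [set: nat]) (if unpickle i is Some b then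
     (if mu (Cy b) == 0%E then Cy b else set0) else set0).
  pose Bad : set Yb := B J `|` (Bad2 `|` ~` G).
  have mBad2 : measurable Bad2.
    by apply: bigcupT_measurable => i; case: unpickle => // b; case: ifP.
  have mBad3 : measurable (Bad2 `|` ~` G).
    by apply: measurableU => //; apply: measurableC; exact: mG.
  have mBad : measurable Bad by exact: measurableU.
  have muBad : (mu Bad <= 8^-1%:E)%E.
    apply: (le_trans (measureU2 _ _ _)) => //.
    have Z : mu (Bad2 `|` ~` G) = 0%E.
      apply: measure_negligible => //; apply: negligibleU; last first.
        by apply/negligibleP; [apply: measurableC; exact: mG|exact: muGC].
      apply: negligible_bigcup => i; case: unpickle => [b|]; last exact: negligible_set0.
      by case: ifPn => [/eqP hb|_]; [exact/negligibleP|exact: negligible_set0].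
    by rewrite -[leRHS]adde0; apply: leeD; [exact: hJ|rewrite [leLHS]Z].
  have bound y : u y <= 5 / 16 + \1_Bad y.
    have [yB|yB] := pselect (Bad y).
      rewrite indicE mem_set//=; have := u1 y; rewrite ler_norml => /andP[_]; lra.
    rewrite indicE memNset// addr0.
    have Gy : G y by apply: contrapT => nG; apply: yB; right; right.
    have hk (k : 'I_m) : (part (iter k F y) < J)%N.
      by rewrite ltnNge; apply/negP => h'; apply: yB; left; exists k.
    pose b : {ffun 'I_m -> 'I_J} := [ffun k => Ordinal (hk k)].
    have yC : Cy b y by move=> k; rewrite ffunE.
    apply: (low b y) => //; rewrite lt0e measure_ge0 andbT; apply/eqP => h0_.
    by apply: yB; right; left; exists (pickle b) => //; rewrite pickleK h0_ eqxx.
  have := iu; apply/negP; rewrite -ltNge.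
  have mBd : measurable_fun setT (fun y => 5 / 16 + (\1_Bad : Yb -> R) y).
    by apply: measurable_funD => //; exact: measurable_indic.
  have pBd y : 0 <= 5 / 16 + (\1_Bad : Yb -> R) y by rewrite addr_ge0// indicE.
  have iU : mu.-integrable setT (fun y => (u y)%:E) by exact: dom_integrable (dom_bnd _ _ u1).
  have bBd y : `|5 / 16 + (\1_Bad : Yb -> R) y| <= 2.
    rewrite ger0_norm//; have := indic_bnd Bad y; rewrite ler_norml => /andP[_]; lra.
  apply: (@le_lt_trans _ _ (\int[mu]_y (5 / 16 + \1_Bad y)%:E)%E).
    apply: le_integral => //; first exact: dom_integrable mBd (dom_bnd _ _ bBd).
    by move=> y _; rewrite lee_fin.
  rewrite integral_sum2//.
  rewrite integral_cst//= probability_setT mule1 integral_indic// setIT.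
  apply: (@le_lt_trans _ _ ((5 / 16)%:E + 8^-1%:E)%E); first by rewrite leeD2l.
  rewrite -EFinD lte_fin; lra.
have key k y : G y -> 4^-1 * iter k Pop \1_(Cy b0) y <= iter k Pop u y.
  move=> Gy; pose v x := 4^-1 * (\1_(Cy b0) : Yb -> R) x + 0 * (\1_(Cy b0) : Yb -> R) x.
  have -> : 4^-1 * iter k Pop \1_(Cy b0) y = iter k Pop v y.
    by rewrite (iter_lin _ _ _ _ _ _ _ _ (indic_bnd (Cy b0)) (indic_bnd (Cy b0)))// mul0r addr0.
  apply: (iter_mono v u 1 1) => //.
    move=> x; rewrite /v mul0r addr0 normrM ger0_norm//.
    have := indic_bnd (Cy b0) x; lra.
  move=> x Gx; rewrite /v mul0r addr0 indicE; have [h|h] := pselect (Cy b0 x).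
    by rewrite mem_set// mulr1; exact: hc.
  by rewrite memNset// mulr0; exact: u0.
rewrite mulrC; apply: (@le_trans _ _ (4^-1 * \sum_(k < N) iter k.+1 Pop \1_(Cy b0) z)).
  by rewrite ler_wpM2l//; exact: hQ.
rewrite mulr_sumr big_ord_recr /= -[leLHS]addr0; apply: lerD.
  by apply: ler_sum => k _; exact: (key k.+1 z Gz).
apply: (le_trans _ (key N.+1 z Gz)); rewrite mulr_ge0//.
by apply: Pop_ge0 => y; exact: (iter_ge0 _ 1 _ _ (indic_pos _)).
Qed.

(** The ratio of Lipschitz constant to supremum for which one application of the operator lowers the
    Lipschitz constant by the factor [(1 + th) / 2]. *)
Definition L0 : R := 2 * th * K1 / (1 - th) + 1.

Lemma L0_ge1 : 1 <= L0.
Proof.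
rewrite /L0 lerDr divr_ge0 ?subr_ge0 ?(ltW th1)//.
by rewrite !mulr_ge0 ?K1_ge0// ltW.
Qed.

Lemma L0_contract t : 0 <= t -> th * (L0 * t + K1 * t) <= L0 * ((1 + th) / 2 * t).
Proof.
move=> t0; have h : th * K1 = (L0 - 1) * (1 - th) / 2.
  by rewrite /L0; field; rewrite subr_eq0 gt_eqF.
have -> : th * (L0 * t + K1 * t) = (th * L0 + th * K1) * t by ring.
rewrite h mulrA ler_wpM2r//; have := L0_ge1; have := th1; nra.
Qed.

Lemma bl_weak u B B' L L' : B <= B' -> L <= L' -> bl u B L -> bl u B' L'.
Proof.
move=> BB LL [u0 uB uL]; split=> // [y|y y' n Gy Gy' n0 s].
  exact: le_trans BB.
apply: (le_trans (uL y y' n Gy Gy' n0 s)).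
exact: ler_wpM2r (exprn_ge0 n (ltW th0)) _ _ LL.
Qed.

Lemma iterS_bl u t k : 0 <= t -> bl u t (L0 * t) ->
  bl (iter k.+1 Pop u) t (L0 * ((1 + th) / 2 * t)).
Proof.
move=> t0 hu; have L00 : 0 <= L0 by have := L0_ge1; lra.
have half : (1 + th) / 2 * t <= t.
  by rewrite ler_piMl//; have := th1; lra.
elim: k => [|k ih].
  have := Pop_bl u t (L0 * t) (mulr_ge0 L00 t0) hu.
  by apply: bl_weak => //; exact: L0_contract.
have ih' : bl (iter k.+1 Pop u) t (L0 * t).
  by apply: (bl_weak _ _ _ _ _ _ _ ih) => //; exact: ler_wpM2l.
have := Pop_bl _ t (L0 * t) (mulr_ge0 L00 t0) ih'.
by apply: bl_weak => //; exact: L0_contract.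
Qed.

(** A Cesaro average, because ergodicity bounds a sum of iterates from below but not a single one:
    the map may permute finitely many pieces cyclically. *)
Definition Aop N u z : R := N%:R^-1 * \sum_(k < N) iter k.+1 Pop u z.

Lemma bl_measurable_bnd u B L : bl u B L -> measurable_fun setT u /\ forall y, `|u y| <= B.
Proof. by move=> h; split; [exact: measurable_bl h|case: h]. Qed.

Lemma iter_integral u B k : (forall y, `|u y| <= B) -> measurable_fun setT u ->
  (\int[mu]_y (iter k Pop u y)%:E = \int[mu]_y (u y)%:E)%E.
Proof.
move=> uB mu_; elim: k => [//|k <-] /=.
have hB := dom_iter u B k uB.
have [|y0] := pselect (exists y : Yb, True); last first.
  by apply: eq_integral => y _; case: y0; exists y.
move=> [y _]; have B0 : 0 <= B := le_trans (normr_ge0 _) (uB y).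
apply: (Pop_integral _ (B / h0)); first by rewrite divr_ge0// ltW.
  exact: (measurable_iter u B).
exact: dom_bnd.
Qed.

(** The Doeblin bound lowers the supremum by the factor [1 - 2 * e / N] and the Lasota-Yorke
    inequality lowers the Lipschitz constant by [(1 + th) / 2]. The fixed ratio [L0] lets one factor
    [r] serve for both. *)
Lemma contraction : exists2 N, (0 < N)%N & exists2 r : R, 0 < r < 1 &
  forall u t, 0 <= t -> bl u t (L0 * t) -> (\int[mu]_y (u y)%:E = 0)%E ->
    bl (Aop N u) (r * t) (L0 * (r * t)) /\ (\int[mu]_y (Aop N u y)%:E = 0)%E.
Proof.
have L00 : 0 <= L0 by have := L0_ge1; lra.
have [N N0 [e e0 hD]] := doeblin L0 L00.
have NR : 0 < N%:R :> R by rewrite ltr0n.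
exists N => //; pose r := Num.max (1 - 2 * e / N%:R) ((1 + th) / 2).
have rth : (1 + th) / 2 <= r by rewrite /r le_max lexx orbT.
have re : 1 - 2 * e / N%:R <= r by rewrite /r le_max lexx.
have th_0 := th0; have th_1 := th1.
exists r.
  apply/andP; split; first by apply: lt_le_trans rth; lra.
  rewrite /r gt_max; apply/andP; split; last lra.
  by rewrite ltrBlDr ltrDl divr_gt0// mulr_gt0.
have low u t z : 0 < t -> bl u t (L0 * t) -> (\int[mu]_y (u y)%:E = 0)%E -> G z ->
    - (r * t * N%:R) <= \sum_(k < N) iter k.+1 Pop u z.
  move=> t0 hu iu Gz; have [mu_ ub] := bl_measurable_bnd _ _ _ hu.
  have [_ _ uL] := hu.
  pose a := (2 * t)^-1; have a0 : 0 < a by rewrite invr_gt0 mulr_gt0.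
  (* The affine image of [u] with values in [[0, 1]] and mean [1/2]; its Lipschitz constant is
     [L0 / 2], so the Doeblin estimate applies. *)
  pose v y := a * u y + 2^-1 * (cst 1 : Yb -> R) y.
  have au y : `|a * u y| <= 2^-1.
    rewrite normrM gtr0_norm// /a invfM mulrAC -mulrA.
    by rewrite ler_piMr// ler_pdivrMr// mul1r.
  have v01 y : 0 <= v y <= 1.
    by have := au y; rewrite ler_norml /v /= => /andP[? ?]; apply/andP; split; lra.
  have mv : measurable_fun setT v.
    by apply: measurable_funD; exact: measurable_scalef.
  have iu' : mu.-integrable setT (fun y => (u y)%:E) by exact: dom_integrable (dom_bnd _ _ ub).
  have hv := hD v mv _ _ _ _ z Gz.
  have c1 y : `|(cst 1 : Yb -> R) y| <= 1 by rewrite /= normr1.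
  have E : \sum_(k < N) iter k.+1 Pop v z = a * \sum_(k < N) iter k.+1 Pop u z + N%:R / 2.
    rewrite mulr_sumr.
    have -> : N%:R / 2 = \sum_(k < N) (2^-1 : R).
      by rewrite mulr_natl sumr_const card_ord.
    rewrite -big_split /=; apply: eq_bigr => k _.
    have e1 := iter_lin a 2^-1 u (cst 1) t 1 k.+1 z ub c1 Gz.
    have e2 := iter_cst 1 k.+1 z Gz.
    by rewrite [LHS]e1 [X in _ + _ * X]e2 mulr1.
  have : e <= \sum_(k < N) iter k.+1 Pop v z.
    apply: hv.
    - by move=> y; have /andP[h1 h2] := v01 y; rewrite ger0_norm.
    - by move=> y _; have /andP[] := v01 y.
    - move=> y y' n Gy Gy' n0 s; rewrite /v /= opprD addrACA subrr addr0 -mulrBr normrM gtr0_norm//.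
      apply: (@le_trans _ _ (a * (L0 * t * th ^+ n))); first by rewrite ler_wpM2l ?(ltW a0)// uL.
      have -> : a * (L0 * t * th ^+ n) = 2^-1 * (L0 * th ^+ n).
        by rewrite /a; field; rewrite gt_eqF.
      by rewrite ler_piMl// ?mulr_ge0// ?exprn_ge0 ?(ltW th0)//; lra.
    - rewrite [leRHS](_ : _ = 2^-1%:E)//.
      under eq_integral do rewrite EFinD EFinM.
      rewrite integralD//; last 2 first.
      + by have := integrableZl measurableT a iu'; apply: eq_integrable.
      + by apply: (dom_integrable (fun=> 2^-1 * 1) (2^-1 / h0)); [exact: measurable_cst|apply: dom_bnd => y; rewrite mulr1 ger0_norm].
      rewrite integralZl// iu mule0 add0e.
      have -> : (\int[mu]_x (2^-1 * cst 1 x)%:E = \int[mu]_x (cst (2^-1)%:E x))%E.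
        by apply: eq_integral => x _; rewrite /= mulr1.
      by rewrite integral_cst//= probability_setT mule1.
  rewrite E => hh.
  set S := \sum_(k < N) _ in hh *.
  have h2 : e - N%:R / 2 <= a * S by lra.
  have h3 : (e - N%:R / 2) * (2 * t) <= S.
    by move: h2; rewrite [a * S]mulrC => h2; rewrite -ler_pdivlMr ?mulr_gt0.
  apply: le_trans h3.
  have h4 : (1 - 2 * e / N%:R) * N%:R = N%:R - 2 * e by field; rewrite gt_eqF.
  have h5 : (1 - 2 * e / N%:R) * N%:R <= r * N%:R by rewrite ler_wpM2r ?(ltW NR).
  rewrite h4 in h5; have h6 := ler_wpM2r (ltW t0) h5; lra.
move=> u t t0 hu iu; have [mu_ ub] := bl_measurable_bnd _ _ _ hu.
have hit k : bl (iter k.+1 Pop u) t (L0 * (r * t)).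
  apply: (bl_weak _ _ _ _ _ _ _ (iterS_bl u t k t0 hu)) => //.
  by apply: ler_wpM2l => //; apply: ler_wpM2r.
have r0 : 0 <= r by apply: le_trans rth; lra.
split; last first.
  have ii k : mu.-integrable setT (fun y => (iter k.+1 Pop u y)%:E).
    by have [m1 m2] := bl_measurable_bnd _ _ _ (hit k); exact: dom_integrable (dom_bnd _ _ m2).
  have hS n : mu.-integrable setT (fun y => (\sum_(k < n) iter k.+1 Pop u y)%:E) /\
      (\int[mu]_y (\sum_(k < n) iter k.+1 Pop u y)%:E = 0)%E.
    elim: n => [|n [i1 i2]].
      have eq0 : (fun y => (\sum_(k < 0) iter k.+1 Pop u y)%:E) = cst 0%E.
        by apply/funext => y; rewrite big_ord0.
      by split; rewrite eq0 ?integral0//; exact: integrable0.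
    have e1 : (fun y => (\sum_(k < n.+1) iter k.+1 Pop u y)%:E) =
      (fun y => (\sum_(k < n) iter k.+1 Pop u y)%:E + (iter n.+1 Pop u y)%:E)%E.
      by apply/funext => y; rewrite big_ord_recr.
    split; rewrite e1; first by apply: integrableD.
    rewrite integralD// i2 add0e.
    by have := iter_integral u t n.+1 ub mu_; rewrite iu.
  have [i1 i2] := hS N.
  by rewrite /Aop; under eq_integral do rewrite EFinM; rewrite integralZl// i2 mule0.
split.
- by move=> y nGy; rewrite /Aop big1 ?mulr0// => k _; exact: Pop_out.
- move=> y; have [t00|tn0] := eqVneq t 0.
    rewrite t00 mulr0 /Aop big1 ?mulr0 ?normr0// => k _.
    have [_ h _] := hit k; apply/eqP; rewrite -normr_le0 -t00; exact: h.
  have tp : 0 < t by rewrite lt_neqAle eq_sym tn0.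
  have [Gy|nGy] := pselect (G y); last first.
    by rewrite /Aop big1 ?mulr0 ?normr0 ?mulr_ge0// => k _; exact: Pop_out.
  rewrite /Aop normrM normfV (gtr0_norm NR) mulrC ler_pdivrMr//.
  rewrite ler_norml low//=.
  pose nu_ x := -1 * u x + 0 * u x.
  have nE x : nu_ x = - u x by rewrite /nu_ mul0r addr0 mulN1r.
  have hn : bl nu_ t (L0 * t).
    have [a1 a2 a3] := hu; split.
    + by move=> x nGx; rewrite nE a1// oppr0.
    + by move=> x; rewrite nE normrN.
    + by move=> x x' n Gx Gx' n0 s; rewrite !nE -opprD normrN; exact: a3.
  have in_ : (\int[mu]_y (nu_ y)%:E = 0)%E.
    under eq_integral do rewrite nE EFinN.
    have iu_ : mu.-integrable setT (fun y => (u y)%:E) := dom_integrable u _ mu_ (dom_bnd _ _ ub).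
    rewrite integralN /= ?iu ?oppe0//; exact: integrable_add_def.
  have := low nu_ t y tp hn in_ Gy; rewrite lerNl => h.
  apply: le_trans h; rewrite -sumrN; apply: ler_sum => k _.
  by rewrite (iter_lin _ _ _ _ _ _ k.+1 y ub ub)// mul0r addr0 mulN1r opprK.
- move=> y y' n Gy Gy' n0 s; rewrite /Aop -mulrBr normrM normfV (gtr0_norm NR).
  rewrite mulrC ler_pdivrMr// -sumrB; apply: (le_trans (ler_norm_sum _ _ _)).
  apply: (@le_trans _ _ (\sum_(k < N) (L0 * (r * t) * th ^+ n))).
    by apply: ler_sum => k _; have [_ _] := hit k; apply.
  by rewrite sumr_const card_ord [leRHS]mulr_natr.
Qed.

(** Averaged partial sums of the Neumann series, arranged so that [Wop N u - Pop (Wop N u)]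
    telescopes to [u - Aop N u]. *)
Definition Wop N u z : R := N%:R^-1 * \sum_(k < N) \sum_(l < k.+1) iter l Pop u z.

Lemma sum_shift (f : nat -> R) n :
  \sum_(l < n) f l - \sum_(l < n) f l.+1 = f 0%N - f n.
Proof.
elim: n => [|n ih]; first by rewrite !big_ord0 !subrr.
by rewrite !big_ord_recr /= opprD addrACA ih; ring.
Qed.

Lemma Wop_poisson N u B z : (0 < N)%N -> (forall y, `|u y| <= B) -> G z ->
  Wop N u z - Pop (Wop N u) z = u z - Aop N u z.
Proof.
move=> N0 uB Gz; have NR : N%:R != 0 :> R by rewrite pnatr_eq0 -lt0n.
have hb l : dom (iter l Pop u) (B / h0) := dom_bnd _ _ (dom_iter u B l uB).
have hbk k : dom (fun y => \sum_(l < k.+1) iter l Pop u y) (\sum_(l < k.+1) B / h0).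
  move=> y; apply: (le_trans (ler_norm_sum _ _ _)); rewrite mulr_suml.
  by apply: ler_sum => l _; exact: hb.
have hN : dom (fun y => \sum_(k < N) \sum_(l < k.+1) iter l Pop u y)
     (\sum_(k < N) \sum_(l < k.+1) B / h0).
  move=> y; apply: (le_trans (ler_norm_sum _ _ _)); rewrite mulr_suml.
  by apply: ler_sum => k _; exact: hbk.
have -> : Pop (Wop N u) z = N%:R^-1 * \sum_(k < N) \sum_(l < k.+1) iter l.+1 Pop u z.
  rewrite (Pop_ext _ (fun y => N%:R^-1 * (\sum_(k < N) \sum_(l < k.+1) iter l Pop u y) + 0 * Hh y)); last first.
    by move=> y _; rewrite mul0r addr0.
  rewrite (Pop_lin _ _ _ _ _ _ z hN dom_Hh) mul0r addr0; congr (_ * _).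
  rewrite (Pop_bigsum (fun k y => \sum_(l < k.+1) iter l Pop u y) _ N z hbk).
  by apply: eq_bigr => k _; rewrite (Pop_bigsum (fun l => iter l Pop u) _ k.+1 z hb).
rewrite /Wop /Aop -mulrBr -sumrB.
have -> : \sum_(k < N) (\sum_(l < k.+1) iter l Pop u z - \sum_(l < k.+1) iter l.+1 Pop u z) =
   \sum_(k < N) (u z - iter k.+1 Pop u z).
  by apply: eq_bigr => k _; rewrite (sum_shift (fun l => iter l Pop u z)).
rewrite sumrB sumr_const card_ord -[X in X - _]mulr_natl; field.
exact: NR.
Qed.

(* The Neumann series of the contraction [Aop N], truncated once its tail is
   below the tolerance [eps], solves the Poisson equation up to [eps]. *)
Lemma poisson : exists2 C : R, 0 < C & forall (phi : Yb -> R) (t eps : R), 0 <= t -> 0 < eps ->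
  bl phi t (L0 * t) -> (\int[mu]_y (phi y)%:E = 0)%E ->
  exists g e : Yb -> R, [/\ measurable_fun setT g, measurable_fun setT e,
    (forall y, `|g y| <= C * t), (forall y, `|e y| <= eps) &
    forall z, G z -> g z - Pop g z = phi z - e z].
Proof.
have [N N0 [r /andP[r0 r1] hA]] := contraction.
have NR : 0 < N%:R :> R by rewrite ltr0n.
exists (N%:R / (1 - r)); first by rewrite divr_gt0// subr_gt0.
move=> phi t eps t0 eps0 hphi iphi.
pose A i := iter i (Aop N) phi.
have hAi i : bl (A i) (r ^+ i * t) (L0 * (r ^+ i * t)) /\ (\int[mu]_y (A i y)%:E = 0)%E.
  elim: i => [|i [ih1 ih2]]; first by rewrite expr0 mul1r.
  have := hA _ _ (mulr_ge0 (exprn_ge0 i (ltW r0)) t0) ih1 ih2.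
  by rewrite (_ : r * (r ^+ i * t) = r ^+ i.+1 * t)// exprS mulrA.
have mA i : measurable_fun setT (A i) := measurable_bl _ _ _ (hAi i).1.
have bA i y : `|A i y| <= r ^+ i * t by have [[_ h _] _] := hAi i; exact: h.
have cv : (t * r ^+ n) @[n --> \oo] --> (0 : R).
  rewrite -[X in _ --> X](mulr0 t); apply: cvgMr; apply: cvg_expr.
  by rewrite ger0_norm// ltW.
have [n hn] : exists n, t * r ^+ n <= eps.
  have /cvgrPdist_lt/(_ _ eps0) := cv.
  case=> n _ hN; exists n; have := hN n (leqnn n).
  rewrite /= sub0r normrN => /ltW; apply: le_trans; exact: ler_norm.
pose g y := \sum_(i < n) Wop N (A i) y.
exists g; exists (A n).
have mW i : measurable_fun setT (Wop N (A i)).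
  apply: measurable_scalef; apply: measurable_sum => k; apply: measurable_sum => l.
  exact: (measurable_iter _ (r ^+ i * t)).
have bW i y : `|Wop N (A i) y| <= N%:R * (r ^+ i * t).
  rewrite /Wop normrM normfV (gtr0_norm NR) mulrC ler_pdivrMr//.
  apply: (le_trans (ler_norm_sum _ _ _)).
  apply: (@le_trans _ _ (\sum_(k < N) (N%:R * (r ^+ i * t)))); last first.
    by rewrite sumr_const card_ord [leRHS]mulr_natr.
  apply: ler_sum => k _; apply: (le_trans (ler_norm_sum _ _ _)).
  apply: (@le_trans _ _ (\sum_(l < k.+1) (r ^+ i * t))).
    by apply: ler_sum => l _; exact: dom_iter.
  rewrite sumr_const card_ord -[leLHS]mulr_natl ler_wpM2r ?mulr_ge0 ?exprn_ge0 ?(ltW r0)//.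
  by rewrite ler_nat.
have dW i : dom (Wop N (A i)) (N%:R * (r ^+ i * t) / h0) := dom_bnd _ _ (bW i).
split=> //.
- exact: measurable_sum.
- move=> y; apply: (le_trans (ler_norm_sum _ _ _)).
  apply: (@le_trans _ _ (N%:R * t * \sum_(i < n) r ^+ i)).
    rewrite mulr_sumr; apply: ler_sum => i _; apply: (le_trans (bW i y)).
    by rewrite le_eqVlt; apply/orP; left; apply/eqP; ring.
  have -> : N%:R / (1 - r) * t = N%:R * t * (1 - r)^-1 by rewrite mulrAC.
  rewrite ler_wpM2l ?mulr_ge0 ?(ltW NR)//.
  have : (1 - r) * \sum_(i < n) r ^+ i = 1 - r ^+ n.
    elim: n {hn g} => [|k ih]; first by rewrite big_ord0 mulr0 expr0 subrr.
    by rewrite big_ord_recr /= mulrDr ih exprS; ring.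
  move=> h; rewrite -[X in _ <= X]mul1r ler_pdivlMr ?subr_gt0// mulrC h.
  by rewrite lerBlDr lerDl exprn_ge0// ltW.
- by move=> y; apply: (le_trans (bA n y)); rewrite mulrC.
- move=> z Gz; rewrite /g (Pop_bigsum (fun i => Wop N (A i)) _ n z dW) -sumrB.
  have -> : \sum_(i < n) (Wop N (A i) z - Pop (Wop N (A i)) z) = \sum_(i < n) (A i z - A i.+1 z).
    by apply: eq_bigr => i _; exact: (Wop_poisson _ _ _ _ N0 (bA i) Gz).
  by rewrite sumrB (sum_shift (fun i => A i z)).
Qed.

(** Gordin's decomposition. Although [V] is unbounded, [Pop V] is bounded and Lipschitz, so
    [g - Pop g = Pop V - e] can be solved; then [m = V + g - (g + e) \o F] is annihilated by the
    operator. The error enters composed with [F] because it is pulled out of [Pop]. *)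
Theorem martingale_coboundary : exists2 C : R, 0 < C &
  forall (V : Yb -> R) (eps : R), 0 < eps -> eps <= 1 -> measurable_fun setT V ->
  (forall y, `|V y| <= Hh y) ->
  (forall y y' n, (0 < n)%N -> sep y y' n -> `|V y - V y'| <= Hh y * th ^+ n) ->
  (\int[mu]_y (V y)%:E = 0)%E ->
  exists m g e : Yb -> R, [/\ mart_diff mu F m, (forall y, `|m y| <= C * Hh y),
    (forall y, `|g y| <= C), (forall y, `|e y| <= eps) &
    forall y, V y = m y + g (F y) - g y + e (F y)].
Proof.
have [C C0 hP] := poisson.
have CP0 := CP_ge0; have K10 := K1_ge0.
(* Covers both the supremum [CP] of [Pop V] and its Lipschitz constant [CP * th * (1 + K1)]; the
   ratio [L0 >= 1] then suits both. *)
pose t := CP * (1 + th * (1 + K1)).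
have th_0 := th0.
have q0 : 0 <= th * (1 + K1) by rewrite mulr_ge0 ?addr_ge0// ltW.
have t0 : 0 <= t by rewrite mulr_ge0// addr_ge0.
have Ct0 : 0 <= C * t by rewrite mulr_ge0// ltW.
exists (1 + (2 * (C * t) + 1) / h0 + C * t).
  by rewrite ltr_wpDr// ltr_wpDr// divr_ge0 ?(ltW h00)// addr_ge0// mulr_ge0.
move=> V eps eps0 eps1 mV Vb VL iV.
have hV : dom V 1 by move=> y; rewrite mul1r.
pose phi := Pop V.
have bphi : bl phi t (L0 * t).
  split; first exact: Pop_out.
    move=> y; apply: (le_trans (Pop_dom V 1 ler01 hV y)); rewrite mul1r /t.
    by rewrite ler_peMr// lerDl.
  move=> y y' n Gy Gy' n0 s.
  have := Pop_lipschitz V Hh 1 1 1 y y' n ler01 ler01 hV dom_Hh Hh0 _ _ Gy Gy' n0 s.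
  move=> h; apply: (le_trans (h _ _)).
  - by move=> z _; rewrite mul1r.
  - by move=> z z' k _ _ k0 sk; rewrite mul1r; exact: VL.
  rewrite mul1r mul1r exprSr -mulrA mulrC ler_wpM2r ?exprn_ge0 ?(ltW th0)//.
  apply: (@le_trans _ _ (th * (CP + K1 * CP))).
    rewrite ler_wpM2l ?(ltW th0)//; apply: lerD; first exact: Pop_Hh_le.
    by apply: ler_wpM2l => //; exact: Pop_Hh_le.
  have L1 := L0_ge1; apply: (@le_trans _ _ t); last by rewrite ler_peMl.
  have -> : th * (CP + K1 * CP) = CP * (th * (1 + K1)) by ring.
  by rewrite /t ler_wpM2l// lerDr.
have iphi : (\int[mu]_y (phi y)%:E = 0)%E by rewrite (Pop_integral V 1 ler01 mV hV).
have [g [e [mg me gb eb gP]]] := hP phi t eps t0 eps0 bphi iphi.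
have mgF : measurable_fun setT (g \o F) by exact: measurableT_comp.
have meF : measurable_fun setT (e \o F) by exact: measurableT_comp.
pose m y := (V y + g y) - (g (F y) + e (F y)).
have cb : 2 * (C * t) + 1 <= (2 * (C * t) + 1) / h0 * h0 by rewrite divfK// gt_eqF.
have mb y : `|m y| <= (1 + (2 * (C * t) + 1) / h0) * Hh y.
  rewrite mulrDl mul1r.
  have h1 : (2 * (C * t) + 1) / h0 * h0 <= (2 * (C * t) + 1) / h0 * Hh y.
    by rewrite ler_wpM2l// divr_ge0 ?(ltW h00)// addr_ge0// mulr_ge0.
  apply: (le_trans (ler_normB _ _)).
  have n1 := ler_normD (V y) (g y); have n2 := ler_normD (g (F y)) (e (F y)).
  have := Vb y; have := gb y; have := gb (F y); have := eb (F y); lra.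
have mm : measurable_fun setT m.
  by apply: measurable_funB; apply: measurable_funD.
exists m; exists g; exists e; split=> //.
- apply: (Pop_mart_diff m _ mm mb) => z Gz.
  have dg := dom_bnd _ _ gb; have de := dom_bnd _ _ eb.
  have d1 : dom (fun y => 1 * V y + 1 * g y) (`|1| * 1 + `|1| * (C * t / h0)) := dom_lin 1 1 V g _ _ hV dg.
  have d2 : dom (fun y => 1 * g (F y) + 1 * e (F y)) (`|1| * (C * t / h0) + `|1| * (eps / h0)).
    apply: (dom_lin 1 1 (g \o F) (e \o F)); apply: dom_bnd => y /=; [exact: gb|exact: eb].
  rewrite (Pop_ext _ (fun y => 1 * (1 * V y + 1 * g y) + (-1) * (1 * g (F y) + 1 * e (F y)))); last first.
    by move=> y _; rewrite /m; ring.
  rewrite (Pop_lin _ _ _ _ _ _ z d1 d2) (Pop_lin _ _ _ _ _ _ z hV dg).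
  have -> : Pop (fun y => 1 * g (F y) + 1 * e (F y)) z = g z + e z.
    rewrite (Pop_ext _ (fun y => cst 1 y * (fun x => g x + e x) (F y))); last first.
      by move=> y _ /=; ring.
    by rewrite (Pop_comp (cst 1) (fun x => g x + e x) _ z (dom_cst 1) Gz) Pop_cst// mulr1.
  by have := gP z Gz; rewrite /phi; lra.
- move=> y; apply: (le_trans (mb y)); rewrite ler_wpM2r//.
  by rewrite lerDl.
- move=> y; apply: (le_trans (gb y)); rewrite lerDr addr_ge0//.
  by rewrite divr_ge0 ?(ltW h00)// addr_ge0// mulr_ge0.
- by move=> y; rewrite /m; ring.
Qed.

End transfer_operator.

(** * Integrals along the semiflow *)

Section lebesgue_shift.
Context {R : realType}.
Local Notation leb := (@lebesgue_measure R).

Lemma lebesgue_measure_shift (a : R) (A : set (measurableTypeR R)) : measurable A ->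
  pushforward leb (fun x : measurableTypeR R => (x + a : measurableTypeR R)) A = leb A.
Proof.
have ms : measurable_fun setT (fun x : measurableTypeR R => (x + a : measurableTypeR R)).
  by apply: measurable_funD.
pose mx := isMeasurableFun.Build _ _ _ _ _ ms.
pose sh : {mfun measurableTypeR R >-> measurableTypeR R} :=
  HB.pack (fun x : measurableTypeR R => (x + a : measurableTypeR R)) mx.
move=> mA; apply/esym; rewrite -[X in pushforward _ X]/(sh : _ -> _).
apply: lebesgue_measure_unique => //= _ [[x y]] _ <-.
rewrite /pushforward (_ : _ @^-1` _ = `]x - a, y - a]%classic); last first.
  by apply/seteqP; split => z /=; rewrite !in_itv /= ltrBlDr lerBrDr.
rewrite !lebesgue_measure_itv /= !lte_fin ltrD2r -!EFinB.
by case: ifP => // _; congr EFin; ring.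
Qed.

Lemma integral_shift (a : R) (D : set R) (f : R -> \bar R) : measurable D ->
  measurable_fun setT f ->
  (\int[leb]_(x in D) f x = \int[leb]_(x in (fun x => x + a)%R @^-1` D) f (x + a)%R)%E.
Proof.
move=> mD mf.
have ms : measurable_fun setT (fun x : measurableTypeR R => (x + a : measurableTypeR R)).
  by apply: measurable_funD.
have ge0 (g : R -> \bar R) : measurable_fun setT g -> (forall x, (0 <= g x)%E) ->
    (\int[leb]_(x in D) g x = \int[leb]_(x in (fun x => x + a)%R @^-1` D) g (x + a)%R)%E.
  move=> mg g0.
  rewrite -[RHS](@ge0_integral_pushforward _ _ _ _ R _ ms leb D g mD)//; last first.
    by apply: measurable_funTS.
  by apply: eq_measure_integral => A mA _; exact/esym/lebesgue_measure_shift.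
rewrite integralE [RHS]integralE; congr (_ - _)%E.
  have h := ge0 (f^\+)%E (measurable_funepos mf) (funepos_ge0 f).
  by rewrite h; apply: eq_integral => x _; rewrite !funeposE.
have h := ge0 (f^\-)%E (measurable_funeneg mf) (funeneg_ge0 f).
by rewrite h; apply: eq_integral => x _; rewrite !funenegE.
Qed.

Lemma bounded_integrable (f : R -> R) (B s : R) : measurable_fun setT f ->
  (forall r, 0 <= r <= s -> `|f r| <= B) -> leb.-integrable `[0, s] (EFin \o f).
Proof.
move=> mf fB; apply: measurable_bounded_integrable => //.
- have h : (leb `[0%R, s] <= (`|s|)%:E)%E.
    rewrite lebesgue_measure_itv /= lte_fin.
    by case: ifP => _; rewrite -?EFinB lee_fin ?subr0 ?ler_norm.
  exact: (le_lt_trans h (ltry _)).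
- exact: measurable_funTS.
- exists B; split; first exact: num_real.
  by move=> x Bx r /=; rewrite in_itv /= => rs; apply: ltW; apply: le_lt_trans Bx; exact: fB.
Qed.

Lemma Rintegral_bound (f : R -> R) (B s : R) : measurable_fun setT f -> 0 <= s ->
  (forall r, 0 <= r <= s -> `|f r| <= B) -> `|\int[leb]_(r in `[0, s]) f r| <= s * B.
Proof.
move=> mf s0 fB; have If := bounded_integrable f B s mf fB.
apply: (le_trans (le_normr_Rintegral _ _)) => //.
apply: (@le_trans _ _ (\int[leb]_(r in `[0, s]) B)).
  apply: le_Rintegral => //.
  - by apply: (bounded_integrable (fun x => `|f x|) B s) => [|r rs];
      [exact: measurableT_comp|rewrite normr_id fB].
  - by apply: (bounded_integrable (cst B) `|B| s) => //; exact: measurable_cst.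
have -> : \int[leb]_(r in `[0, s]) B = B * fine (leb `[0%R, s]) by rewrite Rintegral_cst.
rewrite lebesgue_measure_itv /= lte_fin mulrC; case: ifPn => [_|].
  by rewrite -EFinB subr0.
by rewrite -leNgt => s0'; have -> : s = 0 by lra; rewrite /= mul0r.
Qed.

Lemma Rintegral_chasles (f : R -> R) (B s t : R) : measurable_fun setT f -> 0 <= s -> 0 <= t ->
  (forall r, 0 <= r <= s + t -> `|f r| <= B) ->
  \int[leb]_(r in `[0, s + t]) f r = \int[leb]_(r in `[0, s]) f r + \int[leb]_(r in `[0, t]) f (r + s).
Proof.
move=> mf s0 t0 fB; have If := bounded_integrable f B (s + t) mf fB.
have e := @Rintegral_itvB R f (BLeft 0) (BRight (s + t)) s If.
have mm (D : set R) : measurable D -> measurable_fun D (fun r => f (r + s)).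
  by move=> mD; apply: measurable_funTS; apply: measurableT_comp => //; apply: measurable_funD.
have e2 : \int[leb]_(r in `]s, s + t]) f r = \int[leb]_(r in `]0, t]) f (r + s).
  rewrite /Rintegral (integral_shift s)//; last exact/measurable_EFinP.
  congr (fine (integral _ _ _)).
  by apply/seteqP; split => z /=; rewrite !in_itv /= [s + t]addrC lerD2r ltrDr.
have <- : \int[leb]_(r in `]0, t]) f (r + s) = \int[leb]_(r in `[0, t]) f (r + s).
  rewrite Rintegral_itv_obnd_cbnd//.
  apply: (@integrableS _ _ _ leb `[0, t]) => //; first exact: subset_itv_oc_cc.
  apply: (bounded_integrable _ B); first exact: mm.
  by move=> r /andP[r0 rt]; apply: fB; rewrite addr_ge0//= [s + t]addrC lerD2r.
have b1 : (BLeft 0 <= BRight s)%O by rewrite bnd_simp.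
have b2 : (BRight s <= BRight (s + t))%O by rewrite bnd_simp lerDl.
by have h := e b1 b2; rewrite -e2 -h [RHS]addrC subrK.
Qed.

(** The variable endpoint is moved into the integrand as an indicator, so that Tonelli applies to
    the positive and negative parts over a fixed domain. *)
Lemma measurable_Rintegral_param {d} {T : measurableType d} (f : R * T -> R) :
  measurable_fun setT f ->
  measurable_fun setT (fun p : R * T => \int[leb]_(r in `[0, p.1]) f (r, p.2)).
Proof.
move=> mf.
pose g (q : (R * T) * R) : \bar R := (f (q.2, q.1.2) * (if (0 <= q.2) && (q.2 <= q.1.1) then 1 else 0))%:E.
have mg : measurable_fun setT g.
  apply/measurable_EFinP; apply: measurable_funM.
    apply: measurableT_comp => //; apply/measurable_fun_pairP; split => /=.
      exact: measurable_snd.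
    exact: (measurableT_comp measurable_snd measurable_fst).
  apply: measurable_fun_ifT => //; apply: measurable_and.
    by apply: measurable_fun_ler => //; exact: measurable_snd.
  apply: measurable_fun_ler; first exact: measurable_snd.
  exact: (measurableT_comp measurable_fst measurable_fst).
have e p : \int[leb]_(r in `[0, p.1]) f (r, p.2) =
    fine (\int[leb]_r g^\+%E (p, r) - \int[leb]_r g^\-%E (p, r))%E.
  rewrite /Rintegral integral_mkcond integralE; congr (fine (_ - _)%E).
    apply: eq_integral => r _; rewrite !funeposE; congr maxe.
    rewrite /g patchE /= mem_setE in_itv /=.
    by case: ifP => _; rewrite ?mulr1 ?mulr0.
  apply: eq_integral => r _; rewrite !funenegE; congr (maxe (- _) _)%E.
  rewrite /g patchE /= mem_setE in_itv /=.
  by case: ifP => _; rewrite ?mulr1 ?mulr0.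
rewrite (_ : (fun p => _) = fun p => fine (\int[leb]_r g^\+%E (p, r) - \int[leb]_r g^\-%E (p, r))%E); last exact/funext.
apply: (measurableT_comp (@fine_measurable _ setT measurableT)).
apply: emeasurable_funB.
  by apply: (@measurable_fun_fubini_tonelli_F _ _ _ _ _ leb (g^\+)%E) => //; exact: measurable_funepos.
by apply: (@measurable_fun_fubini_tonelli_F _ _ _ _ _ leb (g^\-)%E) => //; exact: measurable_funeneg.
Qed.

End lebesgue_shift.

Lemma measurable_fun_pair_in {d d1 d2} {T : measurableType d} {T1 : measurableType d1}
    {T2 : measurableType d2} (D : set T) (f : T -> T1) (g : T -> T2) : measurable D ->
  measurable_fun D f -> measurable_fun D g -> measurable_fun D (fun x => (f x, g x)).
Proof.
move=> mD mf mg _ A mA.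
have : @measurable _ (T1 * T2)%type `<=`
    image_set_system D (fun x => (f x, g x)) measurable.
  apply: smallest_sub.
    apply: sigma_algebra_image; split => //.
    - by move=> B mB; exact: measurableD.
    - by move=> B mB; exact: bigcupT_measurable.
  move=> _ [] [B mB <-]; rewrite /image_set_system /=.
    by have := mf mD B mB; rewrite setTI.
  by have := mg mD B mB; rewrite setTI.
by move/(_ A mA).
Qed.

Section flow_integral.
Context {R : realType} {dM : measure_display} {M : measurableType dM}.
Variable T : R -> M -> M.
Hypothesis hT : measurable_semiflow T.
Local Notation leb := (@lebesgue_measure R).

Let T0 x : T 0 x = x. Proof. by have [h _ _] := hT. Qed.

Let TD s t x : 0 <= s -> 0 <= t -> T (s + t) x = T s (T t x).
Proof. by move=> *; have [_ h _] := hT; exact: h. Qed.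

(* The semiflow is only controlled for nonnegative times, so measurability is
   obtained after clipping the time at 0. *)
Definition clip (p : R * M) : M := T (Num.max p.1 0) p.2.

Lemma measurable_clip : measurable_fun setT clip.
Proof.
have [_ _ mT] := hT.
have mD : measurable [set p : R * M | 0 <= p.1].
  rewrite (_ : [set p : R * M | 0 <= p.1] = fst @^-1` `[0, +oo[%classic); last first.
    by apply/seteqP; split => p /=; rewrite in_itv /= andbT.
  by rewrite -[X in measurable X]setTI; apply: measurable_fst.
apply: (@measurable_comp _ _ _ _ _ _ [set p : R * M | 0 <= p.1] (fun p => T p.1 p.2) setT
   (fun p : R * M => (Num.max p.1 0, p.2))) => //.
  by move=> _ [p _ <-] /=; rewrite le_max lexx orbT.
apply/measurable_fun_pairP; split => /=; last exact: measurable_snd.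
by apply: measurable_maxr => //; exact: measurable_fst.
Qed.

Lemma clipE r x : 0 <= r -> clip (r, x) = T r x.
Proof. by move=> r0; rewrite /clip /= max_l. Qed.

Lemma measurable_orbit (f : M -> R) x : measurable_fun setT f ->
  measurable_fun setT (fun r => f (clip (r, x))).
Proof.
move=> mf; apply: measurableT_comp => //.
apply: measurableT_comp; first exact: measurable_clip.
exact: pair2_measurable.
Qed.

Definition flow_int (w : M -> R) (s : R) (x : M) : R := \int[leb]_(r in `[0, s]) w (T r x).

Lemma flow_int_clip w s x : flow_int w s x = \int[leb]_(r in `[0, s]) w (clip (r, x)).
Proof.
apply: eq_Rintegral => r; rewrite inE /= in_itv /= => /andP[r0 _].
by rewrite clipE.
Qed.

Lemma measurable_flow_int w : measurable_fun setT w ->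
  measurable_fun setT (fun p : R * M => flow_int w p.1 p.2).
Proof.
move=> mw; rewrite (_ : (fun p => _) = (fun p => \int[leb]_(r in `[0, p.1]) (w \o clip) (r, p.2))).
  by apply: measurable_Rintegral_param; apply: measurableT_comp => //; exact: measurable_clip.
by apply/funext => p; rewrite flow_int_clip.
Qed.

Lemma measurable_flow_int1 w s : measurable_fun setT w -> measurable_fun setT (flow_int w s).
Proof.
move=> mw; rewrite (_ : flow_int w s = (fun p : R * M => flow_int w p.1 p.2) \o (fun x => (s, x))) //.
apply: measurableT_comp; last exact: pair1_measurable.
exact: measurable_flow_int.
Qed.

Section observable.
Variable w : M -> R.
Hypothesis mw : measurable_fun setT w.
Hypothesis w1 : forall x, `|w x| <= 1.

Lemma flow_int0 x : flow_int w 0 x = 0.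
Proof. by rewrite /flow_int set_itv1 Rintegral_set1. Qed.

Lemma flow_intD s t x : 0 <= s -> 0 <= t ->
  flow_int w (s + t) x = flow_int w s x + flow_int w t (T s x).
Proof.
move=> s0 t0; rewrite !flow_int_clip.
rewrite (Rintegral_chasles (fun r => w (clip (r, x))) 1 s t (measurable_orbit w x mw))//.
congr (_ + _); apply: eq_Rintegral => r; rewrite inE /= in_itv /= => /andP[r0 _].
by rewrite !clipE ?addr_ge0// TD.
Qed.

Lemma flow_int_le s x : 0 <= s -> `|flow_int w s x| <= s.
Proof.
move=> s0; rewrite flow_int_clip -[leRHS]mulr1.
by apply: Rintegral_bound => //; exact: measurable_orbit.
Qed.

Lemma flow_int_lip s t x : 0 <= s -> s <= t -> `|flow_int w t x - flow_int w s x| <= t - s.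
Proof.
move=> s0 st; have ts : 0 <= t - s by rewrite subr_ge0.
have -> : t = s + (t - s) by rewrite addrC subrK.
by rewrite flow_intD// addrAC subrr add0r addrAC subrr add0r flow_int_le.
Qed.

Lemma flow_int_dist B s x y : 0 <= s ->
  (forall u, 0 <= u <= s -> `|w (T u x) - w (T u y)| <= B) ->
  `|flow_int w s x - flow_int w s y| <= s * B.
Proof.
move=> s0 h; have mx := measurable_orbit w x mw; have my := measurable_orbit w y mw.
rewrite !flow_int_clip -RintegralB//; last 2 first.
- by apply: (bounded_integrable _ 1).
- by apply: (bounded_integrable _ 1).
apply: Rintegral_bound => //; first exact: measurable_funB.
by move=> r rs; have /andP[r0 _] := rs; rewrite !clipE//; exact: h.
Qed.

Lemma flow_int_measurable_comp {d} {Z : measurableType d} (D : set Z) (f : Z -> R) (g : Z -> M) :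
  measurable D -> measurable_fun D f -> measurable_fun D g ->
  measurable_fun D (fun z => flow_int w (f z) (g z)).
Proof.
move=> mD mf mg.
rewrite (_ : (fun z => _) = (fun p : R * M => flow_int w p.1 p.2) \o (fun z => (f z, g z))) //.
apply: measurableT_comp; first exact: measurable_flow_int.
exact: measurable_fun_pair_in.
Qed.

End observable.

Section second_integral.
Variables w1 w2 : M -> R.
Hypothesis mw1 : measurable_fun setT w1.
Hypothesis mw2 : measurable_fun setT w2.
Hypothesis w11 : forall x, `|w1 x| <= 1.
Hypothesis w21 : forall x, `|w2 x| <= 1.

Definition flow_int2 (s : R) (x : M) : R :=
  \int[leb]_(r in `[0, s]) (flow_int w1 r x * w2 (T r x)).

Let integrand (p : R * M) : R := flow_int w1 p.1 p.2 * w2 (clip p).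

Let measurable_integrand : measurable_fun setT integrand.
Proof.
apply: measurable_funM; first exact: measurable_flow_int.
by apply: measurableT_comp => //; exact: measurable_clip.
Qed.

Let measurable_integrand1 x : measurable_fun setT (fun r => integrand (r, x)).
Proof. by apply: measurableT_comp => //; exact: pair2_measurable. Qed.

Lemma flow_int2_clip s x : flow_int2 s x = \int[leb]_(r in `[0, s]) integrand (r, x).
Proof.
apply: eq_Rintegral => r; rewrite inE /= in_itv /= => /andP[r0 _].
by rewrite /integrand clipE.
Qed.

Lemma measurable_flow_int2 s : measurable_fun setT (flow_int2 s).
Proof.
rewrite (_ : flow_int2 s = (fun p => \int[leb]_(r in `[0, p.1]) integrand (r, p.2)) \o (fun x => (s, x))).
  apply: measurableT_comp; last exact: pair1_measurable.
  exact: measurable_Rintegral_param.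
by apply/funext => x; rewrite flow_int2_clip.
Qed.

Lemma flow_int2_le B s x : 0 <= s -> (forall r, 0 <= r <= s -> `|flow_int w1 r x| <= B) ->
  `|flow_int2 s x| <= s * B.
Proof.
move=> s0 h; rewrite flow_int2_clip; apply: Rintegral_bound => // r rs.
rewrite /integrand normrM; apply: (@le_trans _ _ (`|flow_int w1 r x| * 1)).
  by rewrite ler_wpM2l.
by rewrite mulr1; exact: h.
Qed.

Lemma flow_int2_sqr_le s x : 0 <= s -> `|flow_int2 s x| <= s ^+ 2.
Proof.
move=> s0; rewrite expr2; apply: flow_int2_le => // r /andP[r0 rs].
by apply: le_trans rs; exact: flow_int_le.
Qed.

(* Chen's relation for the iterated integrals of an additive path. *)
Lemma flow_int2D s t x : 0 <= s -> 0 <= t ->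
  flow_int2 (s + t) x =
  flow_int2 s x + flow_int2 t (T s x) + flow_int w1 s x * flow_int w2 t (T s x).
Proof.
move=> s0 t0; have st0 : 0 <= s + t by rewrite addr_ge0.
have bd z r u : 0 <= r <= u -> `|integrand (r, z)| <= u.
  move=> /andP[r0 ru]; rewrite /integrand normrM; apply: (@le_trans _ _ (`|flow_int w1 r z| * 1)).
    by rewrite ler_wpM2l.
  by rewrite mulr1; apply: le_trans ru; exact: flow_int_le.
rewrite !flow_int2_clip (Rintegral_chasles _ (s + t) _ _ (measurable_integrand1 x))//; last first.
  by move=> r rst; exact: bd.
rewrite -addrA; congr (_ + _).
have m2 : measurable_fun setT (fun r => w2 (clip (r, T s x))) by exact: measurable_orbit.
have i2 : leb.-integrable `[0, t] (EFin \o (fun r => w2 (clip (r, T s x)))).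
  by apply: (bounded_integrable _ 1).
rewrite [flow_int w2 _ _]flow_int_clip -RintegralZl//.
rewrite -RintegralD//; first last.
- apply: (bounded_integrable (fun r => flow_int w1 s x * w2 (clip (r, T s x))) (`|flow_int w1 s x|)).
    by apply: measurable_funM.
  by move=> r _; rewrite normrM ler_piMr.
- by apply: (bounded_integrable _ t) => // r; exact: bd.
apply: eq_Rintegral => r; rewrite inE /= in_itv /= => /andP[r0 _].
have rs0 : 0 <= r + s by rewrite addr_ge0.
rewrite /integrand /= !clipE// TD// -mulrDl; congr (_ * _).
by rewrite [r + s]addrC flow_intD// addrC.
Qed.

End second_integral.
End flow_integral.

Lemma measurable_fun_nat_slices {d d'} {T : measurableType d} {T' : measurableType d'}
    (D : set T) (n : T -> nat) (f : nat -> T -> T') :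
  (forall k, measurable (D `&` [set x | n x = k])) ->
  (forall k, measurable_fun D (f k)) -> measurable_fun D (fun x => f (n x) x).
Proof.
move=> mn mf mD A mA.
rewrite (_ : D `&` _ = \bigcup_k ((D `&` [set x | n x = k]) `&` (D `&` f k @^-1` A))).
  by apply: bigcupT_measurable => k; apply: measurableI => //; exact: mf.
apply/seteqP; split => [x [Dx Ax]|x [k _ [[Dx nx] [_ Ax]]]].
  by exists (n x).
by split => //=; rewrite nx.
Qed.

Lemma ge0_integral_chasles {R : realType} (f : R -> \bar R) (s t : R) : measurable_fun setT f ->
  (forall x, 0 <= f x)%E -> 0 <= s -> 0 <= t ->
  (\int[@lebesgue_measure R]_(r in `[0%R, (s + t)%R]) f r =
   \int[@lebesgue_measure R]_(r in `[0%R, s]) f r + \int[@lebesgue_measure R]_(r in `[0%R, t]) f (r + s)%R)%E.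
Proof.
move=> mf f0 s0 t0.
have e : `[0, s + t]%classic = `[0, s] `|` `]s, s + t] :> set R.
  by rewrite -itv_bndbnd_setU// bnd_simp// lerDl.
rewrite e ge0_integral_setU//; last 2 first.
- exact: measurable_funTS.
- apply/disj_setPS => r /=; rewrite !in_itv /= => -[/andP[_ h1] /andP[h2 _]].
  by move: h1; rewrite leNgt h2.
congr (_ + _)%E; rewrite [LHS](integral_shift s)//.
have -> : (fun x => x + s) @^-1` `]s, s + t] = `]0, t]%classic.
  by apply/seteqP; split => z /=; rewrite !in_itv /= [s + t]addrC lerD2r ltrDr.
rewrite integral_itv_obnd_cbnd//.
by apply: measurable_funTS; apply: measurableT_comp => //; exact: measurable_funD.
Qed.

(** * The suspension over the induced map *)

Section occupation.
Context {R : realType} {dM : measure_display} {M : measurableType dM}.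
Variable T : R -> M -> M.
Hypothesis hT : measurable_semiflow T.
Local Notation leb := (@lebesgue_measure R).
Local Notation clip := (clip T).

Lemma measurable_clip_orbit x : measurable_fun setT (fun r => clip (r, x)).
Proof.
apply: measurableT_comp; first exact: measurable_clip.
exact: pair2_measurable.
Qed.

(** The image of Lebesgue measure on [[0, t]] under the orbit map, packaged as a measure so that
    [integral_mixture] computes integrals for [muM]. *)
Lemma occupation_measure (x : M) (t : R) : exists ka : {measure set M -> \bar R},
  (forall A, measurable A -> ka A = leb (((fun u => clip (u, x)) @^-1` A) `&` `[0, t])) /\
  (forall g : M -> \bar R, measurable_fun setT g -> (forall y, 0 <= g y)%E ->
    (\int[ka]_y g y = \int[leb]_(u in `[0%R, t]) g (clip (u, x)))%E).
Proof.
have mI : measurable (`[0, t]%classic : set R) by [].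
pose m0 : {measure set (measurableTypeR R) -> \bar R} :=
  measure_function_mrestr__canonical__measure_function_Measure leb mI.
exists (measure_function_pushforward__canonical__measure_function_Measure m0 (measurable_clip_orbit x)).
split => // g mg g0.
have mo : measurable_fun setT (fun u => g (clip (u, x))).
  by apply: measurableT_comp => //; exact: measurable_clip_orbit.
have e := @ge0_integral_pushforward _ _ (measurableTypeR R) M R _ (measurable_clip_orbit x) m0 setT g
  measurableT mg (fun y _ => g0 y).
apply: (etrans e); rewrite preimage_setT.
have mN : measurable (~` `[0, t]%classic : set (measurableTypeR R)) by exact: measurableC.
have N0 : m0 (~` `[0, t]%classic) = 0%E by rewrite /m0 /= /mrestr setICl measure0.
have e2 := @ge0_negligible_integral _ (measurableTypeR R) R m0 setT (~` `[0, t])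
  (fun u => g (clip (u, x))) mN measurableT mo (fun u _ => g0 _) N0.
apply: (etrans e2); rewrite setTD setCK; apply: eq_measure_integral => A mA AI.
by rewrite /m0 /= /mrestr; congr (leb _); apply/setIidl.
Qed.

End occupation.

Section suspension.
Context {R : realType} {dM : measure_display} {M : measurableType dM}.
Variables (T : R -> M -> M) (h : M -> R) (tau : M -> nat) (X Y : set M).
Variables (muY : probability M R) (muX muM : {measure set M -> \bar R}).
Hypothesis hT : measurable_semiflow T.
Hypotheses (hX : measurable X) (hY : measurable Y) (hYX : Y `<=` X).
Hypothesis hh : forall x, X x -> 0 < h x.
Hypothesis hhm : measurable_fun X h.
Hypothesis hfX : forall x, X x -> X (flow_f T h x).
Hypothesis htau : forall y, Y y -> (0 < tau y)%N.
Hypothesis htaum : measurable_fun Y (fun y => (tau y)%:R : R).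
Hypothesis hmuY : muY Y = 1%E.
Hypothesis htauint : muY.-integrable Y (fun y => ((tau y)%:R : R)%:E).
Hypothesis hmuX : forall A, measurable A ->
     muX A = (\int[muY]_(y in Y)
                 (\sum_(l < tau y) \1_A (iter l (flow_f T h) y))%:E
              * ((fine (\int[muY]_(y in Y) ((tau y)%:R : R)%:E))^-1)%:E)%E.
Hypothesis hhint : muX.-integrable X (EFin \o h).
Hypothesis hmuM : forall A, measurable A ->
     muM A = (\int[muX]_(x in X)
                 (@lebesgue_measure R) ([set u : R | (0 <= u <= h x)%R] `&` [set u : R | A (T u x)])
              * ((fine (\int[muX]_(x in X) (h x)%:E))^-1)%:E)%E.
Hypothesis hHint : muY.-integrable Y (EFin \o roofH T h tau).
Hypothesis hHinf : exists2 c : R, 0 < c & forall y, Y y -> c <= roofH T h tau y.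

Local Notation leb := (@lebesgue_measure R).
Local Notation f := (flow_f T h).
Local Notation H := (roofH T h tau).
Local Notation clip := (clip T).

Lemma roofH_gt0 y : Y y -> 0 < H y.
Proof. by move=> Yy; have [c c0 /(_ y Yy)] := hHinf; exact: lt_le_trans. Qed.

Let T0 x : T 0 x = x. Proof. by have [t0 _ _] := hT. Qed.

Let TD s t x : 0 <= s -> 0 <= t -> T (s + t) x = T s (T t x).
Proof. by move=> *; have [_ tD _] := hT; exact: tD. Qed.

Lemma iter_flow_f_X l y : Y y -> X (iter l f y).
Proof. by move=> Yy; elim: l => [|l ih]; [exact: hYX|exact: hfX]. Qed.

Lemma measurable_flow_f : measurable_fun X f.
Proof.
apply: (eq_measurable_fun (clip \o (fun x => (h x, x)))).
  by move=> x /set_mem Xx; rewrite /= clipE// ltW// hh.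
apply: measurableT_comp; first exact: measurable_clip.
exact: measurable_fun_pair_in.
Qed.

Lemma measurable_iter_flow_f l : measurable_fun Y (iter l f).
Proof.
elim: l => [|l ih]; first exact: measurable_id.
apply: (measurable_comp hX _ measurable_flow_f ih).
by move=> _ [y Yy <-]; exact: iter_flow_f_X.
Qed.

Lemma lap_sum_ge0 n y : Y y -> 0 <= \sum_(l < n) h (iter l f y).
Proof. by move=> Yy; apply: sumr_ge0 => l _; rewrite ltW// hh//; exact: iter_flow_f_X. Qed.

Lemma iter_flow_f_flow n y : Y y -> iter n f y = T (\sum_(l < n) h (iter l f y)) y.
Proof.
move=> Yy; elim: n => [|n ih]; first by rewrite big_ord0 T0.
rewrite big_ord_recr /= addrC TD ?lap_sum_ge0// -?ih//.
by rewrite ltW// hh//; exact: iter_flow_f_X.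
Qed.

Lemma induced_F_flow y : Y y -> induced_F T h tau y = T (H y) y.
Proof. exact: iter_flow_f_flow. Qed.

Lemma measurable_roofH : measurable_fun Y H.
Proof. by apply/measurable_EFinP; exact: measurable_int hHint. Qed.

Lemma measurable_induced_F : measurable_fun Y (induced_F T h tau).
Proof.
apply: (eq_measurable_fun (clip \o (fun x => (H x, x)))).
  by move=> y /set_mem Yy; rewrite /= clipE ?induced_F_flow// ltW// roofH_gt0.
apply: measurableT_comp; first exact: measurable_clip.
by apply: measurable_fun_pair_in => //; exact: measurable_roofH.
Qed.

Let occ (g : M -> \bar R) (t : R) (x : M) : \bar R := (\int[leb]_(u in `[0%R, t]) g (clip (u, x)))%E.

Lemma occ_iter (g : M -> \bar R) n y : measurable_fun setT g -> (forall x, 0 <= g x)%E -> Y y ->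
  (\sum_(l < n) occ g (h (iter l f y)) (iter l f y) = occ g (\sum_(l < n) h (iter l f y))%R y)%E.
Proof.
move=> mg g0 Yy; elim: n => [|n ih].
  by rewrite !big_ord0 /occ set_itv1 integral_set1.
have hn : 0 <= h (iter n f y) by rewrite ltW// hh//; exact: iter_flow_f_X.
rewrite !big_ord_recr /= ih /occ ge0_integral_chasles ?lap_sum_ge0//; last first.
  by apply: measurableT_comp => //; exact: measurable_clip_orbit.
congr (_ + _)%E; apply: eq_integral => u; rewrite inE /= in_itv /= => /andP[u0 _].
by rewrite !clipE ?addr_ge0 ?lap_sum_ge0// TD ?lap_sum_ge0// -iter_flow_f_flow.
Qed.

Lemma tau_slice k : measurable (Y `&` [set y | tau y = k]).
Proof.
have m1 : measurable ([set k%:R] : set R) by [].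
have := htaum hY _ m1; congr (measurable (_ `&` _)).
by apply/seteqP; split => y /= => [/eqP|->//]; rewrite eqr_nat => /eqP.
Qed.

Let kap := (fine (\int[muY]_(y in Y) ((tau y)%:R : R)%:E)%E)^-1.

Lemma kap_gt0 : 0 < kap.
Proof.
rewrite invr_gt0; apply: fine_gt0; apply/andP; split.
  apply: (@lt_le_trans _ _ (\int[muY]_(y in Y) (cst 1%:E y))%E).
    rewrite (_ : (\int[muY]_(y in Y) (cst 1%:E y) = 1)%E) ?lte01//.
    by rewrite integral_cst// mul1e; exact: hmuY.
  apply: ge0_le_integral => //.
  - exact/measurable_EFinP.
  - by move=> y Yy; rewrite lee_fin ler1n; exact: htau.
by have := integrable_fin_num hY htauint; rewrite fin_numElt => /andP[].
Qed.

Lemma integral_muX (g : M -> \bar R) : measurable_fun setT g -> (forall x, 0 <= g x)%E ->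
  (\int[muX]_x g x = kap%:E * \int[muY]_(y in Y) \sum_(l < tau y) g (iter l f y))%E /\
  measurable_fun Y (fun y => \sum_(l < tau y) g (iter l f y))%E.
Proof.
move=> mg g0; have k0 := kap_gt0.
pose k' := NngNum (ltW k0).
have msl (u : M -> \bar R) : measurable_fun setT u -> 
    measurable_fun Y (fun y => \sum_(l < tau y) u (iter l f y))%E.
  move=> mu_; apply: (measurable_fun_nat_slices Y tau (fun k y => \sum_(l < k) u (iter l f y))%E).
    exact: tau_slice.
  move=> k; apply: emeasurable_sum => l.
  by apply: measurableT_comp => //; exact: measurable_iter_flow_f.
have m1 (A : set M) : measurable A -> measurable_fun setT (fun x => (\1_A x : R)%:E).
  by move=> mA; apply/measurable_EFinP; exact: measurable_indic.
pose ka y : {measure set M -> \bar R} :=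
  mscale k' (msum (fun l => dirac (iter l f y)) (tau y)).
have kaE y A : ka y A = (kap%:E * \sum_(l < tau y) (\1_A (iter l f y) : R)%:E)%E by [].
have [] := @integral_mixture _ _ _ _ _ muY Y hY ka muX _ _ g mg g0.
- move=> A mA; under eq_fun do rewrite kaE.
  exact: (measurable_funeM _ (msl (fun x => (\1_A x : R)%:E) (m1 A mA))).
- move=> A mA; rewrite hmuX// muleC -/kap -ge0_integralZl ?lee_fin ?ltW//.
  + by apply: eq_integral => y _; rewrite kaE sumEFin.
  + have := msl _ (m1 A mA); apply: eq_measurable_fun => y _.
    by rewrite sumEFin.
  + by move=> y _; rewrite lee_fin; apply: sumr_ge0 => l _.
move=> _ ->; split; last exact: msl.
rewrite -ge0_integralZl ?lee_fin ?ltW//; first last.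
- by move=> y _; apply: sume_ge0.
- exact: msl.
apply: eq_integral => y _.
rewrite ge0_integral_mscale//; congr (_ * _)%E.
rewrite ge0_integral_measure_sum//; apply: eq_bigr => l _.
by rewrite integral_dirac// diracT mul1e.
Qed.

Lemma integral_roof :
  (\int[muX]_(x in X) (h x)%:E = kap%:E * \int[muY]_(y in Y) (H y)%:E)%E.
Proof.
rewrite integral_mkcond.
have mh : measurable_fun setT ((EFin \o h) \_ X).
  by apply/(measurable_restrictT _ hX)/measurable_EFinP.
have h0 x : (0 <= ((EFin \o h) \_ X) x)%E.
  by rewrite patchE; case: ifPn => // /set_mem Xx; rewrite lee_fin ltW// hh.
have [e _] := integral_muX _ mh h0.
rewrite [LHS]e; congr (_ * _)%E; apply: eq_integral => y /set_mem Yy.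
rewrite -sumEFin; apply: eq_bigr => l _.
by rewrite patchE mem_set//; exact: iter_flow_f_X.
Qed.

Lemma integral_roof_fin : (\int[muY]_(y in Y) (H y)%:E)%E \is a fin_num.
Proof. exact: integrable_fin_num hHint. Qed.

Lemma integral_roof_gt0 : (0 < \int[muY]_(y in Y) (H y)%:E)%E.
Proof.
have [c c0 cH] := hHinf.
apply: (@lt_le_trans _ _ (\int[muY]_(y in Y) (cst c%:E y))%E).
  rewrite (_ : (\int[muY]_(y in Y) (cst c%:E y) = c%:E)%E) ?lte_fin//.
  rewrite integral_cst// -[RHS]mule1; congr (_ * _)%E; exact: hmuY.
apply: ge0_le_integral => //.
- by move=> y _; rewrite lee_fin ltW.
- by apply/measurable_EFinP; exact: measurable_roofH.
Qed.

Let kap2 := (fine (\int[muX]_(x in X) (h x)%:E)%E)^-1.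

Lemma kap2_gt0 : 0 < kap2.
Proof.
rewrite invr_gt0; apply: fine_gt0; rewrite integral_roof; apply/andP; split.
  by rewrite mule_gt0 ?lte_fin ?kap_gt0// integral_roof_gt0.
by rewrite -(fineK integral_roof_fin) -EFinM ltry.
Qed.

Lemma measurable_occ_indic (A : set M) : measurable A ->
  measurable_fun X (fun x => \int[leb]_(u in `[0%R, h x]) (\1_A (clip (u, x)) : R)%:E)%E.
Proof.
move=> mA; have mI : measurable_fun setT (\1_A : M -> R) by exact: measurable_indic.
apply: (eq_measurable_fun (EFin \o (fun x => flow_int T \1_A (h x) x))); last first.
  by apply/measurable_EFinP; apply: flow_int_measurable_comp.
move=> x /set_mem Xx; rewrite /= flow_int_clip /Rintegral fineK//.
apply: integrable_fin_num => //.
apply: (bounded_integrable (fun u => \1_A (clip (u, x)) : R) 1).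
  exact: measurable_orbit.
by move=> r _; rewrite indicE; case: (_ \in _); rewrite ?normr1 ?normr0.
Qed.

(** The tower of height [tau] and the suspension under [h] collapse into one suspension over [Y]
    with roof [H], because successive laps under [h] concatenate to one lap under [H]. *)
Lemma suspension_integral : exists2 k : R, 0 < k & forall g : M -> \bar R,
  measurable_fun setT g -> (forall x, 0 <= g x)%E ->
  measurable_fun Y (fun y => \int[leb]_(u in `[0%R, H y]) g (clip (u, y)))%E /\
  (\int[muM]_x g x = k%:E * \int[muY]_(y in Y) \int[leb]_(u in `[0%R, H y]) g (clip (u, y)))%E.
Proof.
have k1 := kap_gt0; have k2 := kap2_gt0.
exists (kap2 * kap); first exact: mulr_gt0.
move=> g mg g0.
have /choice[ka hka] : forall x, exists ka : {measure set M -> \bar R},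
  (forall A, measurable A -> ka A = leb (((fun u => clip (u, x)) @^-1` A) `&` `[0, h x])) /\
  (forall g : M -> \bar R, measurable_fun setT g -> (forall y, 0 <= g y)%E ->
    (\int[ka]_y g y = \int[leb]_(u in `[0%R, h x]) g (clip (u, x)))%E).
  by move=> x; exact: occupation_measure.
pose kb x : {measure set M -> \bar R} := mscale (NngNum (ltW k2)) (ka x).
have kbE x A : kb x A = (kap2%:E * ka x A)%E by [].
have mkaA A : measurable A -> measurable_fun X (fun x => ka x A).
  move=> mA; apply: (eq_measurable_fun _ _ (measurable_occ_indic A mA)) => x _.
  have [_ hi] := hka x; rewrite -(hi (fun x => (\1_A x : R)%:E)).
  - by rewrite integral_indic// setIT.
  - by apply/measurable_EFinP; exact: measurable_indic.
  - by move=> y; rewrite lee_fin.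
have [] := @integral_mixture _ _ _ _ _ muX X hX kb muM _ _ g mg g0.
- by move=> A mA; exact: (measurable_funeM _ (mkaA A mA)).
- move=> A mA; rewrite hmuM// muleC -/kap2 -ge0_integralZl ?lee_fin ?ltW//.
  + apply: eq_integral => x _; rewrite kbE (hka x).1//.
    congr (_ * leb _)%E; apply/seteqP; split => u /=; rewrite in_itv /=.
      by move=> [u0 Au]; rewrite clipE//; case/andP: u0.
    by move=> [Au u0]; split => //; move: Au; rewrite clipE//; case/andP: u0.
  + apply: (eq_measurable_fun _ _ (mkaA A mA)) => x _; rewrite (hka x).1//.
    congr (leb _); apply/seteqP; split => u /=; rewrite in_itv /=.
      by move=> [Au u0]; split => //; move: Au; rewrite clipE//; case/andP: u0.
    by move=> [u0 Au]; rewrite clipE//; case/andP: u0.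
have kbi x : (\int[kb x]_y g y = kap2%:E * occ g (h x) x)%E.
  by rewrite ge0_integral_mscale//; congr (_ * _)%E; exact: (hka x).2.
under eq_fun do rewrite kbi.
have occ0 t x : (0 <= occ g t x)%E by exact: integral_ge0.
move=> mo ->.
have mo' : measurable_fun X (fun x => occ g (h x) x).
  have := measurable_funeM (kap2^-1)%:E mo; apply: eq_measurable_fun => x _.
  by rewrite muleA -EFinM mulVf ?gt_eqF// mul1e.
rewrite ge0_integralZl ?lee_fin ?ltW//.
have mo2 : measurable_fun setT ((fun x => occ g (h x) x) \_ X) by exact/(measurable_restrictT _ hX).
have o2 x : (0 <= ((fun x => occ g (h x) x) \_ X) x)%E.
  by rewrite patchE; case: ifP.
have [e m3] := integral_muX _ mo2 o2.
have e3 y : Y y -> (\sum_(l < tau y) ((fun x => occ g (h x) x) \_ X) (iter l f y) = occ g (H y) y)%E.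
  move=> Yy; rewrite -occ_iter//; apply: eq_bigr => l _.
  by rewrite patchE mem_set//; exact: iter_flow_f_X.
split; first by apply: (eq_measurable_fun _ _ m3) => y /set_mem; exact: e3.
rewrite integral_mkcond [X in (_ * X)%E]e muleA -EFinM; congr (_ * _)%E.
by apply: eq_integral => y /set_mem; exact: e3.
Qed.

Lemma integral_set_null_compl (g : M -> \bar R) (N : set M) : measurable N -> muY N = 0%E ->
  measurable_fun Y g -> (forall y, Y y -> 0 <= g y)%E ->
  (\int[muY]_(y in Y) g y = \int[muY]_(y in Y `\` N) g y)%E.
Proof. by move=> mN N0 mg g0; exact: ge0_negligible_integral. Qed.

Lemma integral_cst_interval (t : R) (c : R) : 0 <= t -> 
  (\int[leb]_(u in `[0%R, t]) (cst c%:E u) = (t * c)%:E)%E.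
Proof.
move=> t0; rewrite integral_cst//; transitivity (c%:E * leb `[0%R, t])%E; first by [].
have -> : leb `[0%R, t] = t%:E.
  rewrite lebesgue_measure_itv /= lte_fin; case: ifPn => [_|]; first by rewrite -EFinB subr0.
  by rewrite -leNgt => t0'; congr EFin; lra.
by rewrite -EFinM mulrC.
Qed.

(** The weight [H] on the right is the time spent above a base point; it is the factor for which the
    moment order drops. *)
Lemma suspension_bound : exists2 k : R, 0 < k & forall (g B : M -> R) (N : set M),
  measurable_fun setT g -> (forall x, 0 <= g x) -> measurable_fun Y B ->
  measurable N -> muY N = 0%E ->
  (forall y u, Y y -> ~ N y -> 0 <= u <= H y -> g (T u y) <= B y) ->
  (\int[muM]_x (g x)%:E <= k%:E * \int[muY]_(y in Y `\` N) (H y * B y)%:E)%E.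
Proof.
have [k k0 hk] := suspension_integral; exists k => // g B N mg g0 mB mN N0 gB.
have mg' : measurable_fun setT (EFin \o g) by exact/measurable_EFinP.
have g0' x : (0 <= (EFin \o g) x)%E by rewrite lee_fin.
have [mi e] := hk _ mg' g0'; rewrite [leLHS]e lee_pmul2l ?lte_fin//.
rewrite (integral_set_null_compl _ N)//; last by move=> y _; exact: integral_ge0.
have mD : measurable (Y `\` N) by exact: measurableD.
have sD : Y `\` N `<=` Y by move=> y [].
apply: ge0_le_integral => //.
- by move=> y _; exact: integral_ge0.
- exact: measurable_funS mi.
- apply/measurable_EFinP; apply: measurable_funM.
    by apply: measurable_funS measurable_roofH.
  exact: measurable_funS mB.
move=> y [Yy Ny]; have H0 := ltW (roofH_gt0 y Yy).
rewrite -integral_cst_interval//; apply: ge0_le_integral => //.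
- by apply/measurable_EFinP; apply: measurable_funTS; exact: measurable_orbit.
- by move=> u /=; rewrite in_itv /= => uH; rewrite clipE ?lee_fin ?gB//; case/andP: uH.
Qed.

(** The suspension formula holds for nonnegative functions, so it is applied to [w + 1] and to 1,
    and the finite integrals are subtracted. *)
Lemma suspension_mean_zero (w : M -> R) : measurable_fun setT w -> (forall x, `|w x| <= 1) ->
  (\int[muM]_x (w x)%:E = 0)%E -> (\int[muY]_(y in Y) (flow_int T w (H y) y)%:E = 0)%E.
Proof.
move=> mw w1 iw; have [k k0 hk] := suspension_integral.
have fH := integral_roof_fin.
have iM : (muM setT = k%:E * \int[muY]_(y in Y) (H y)%:E)%E.
  have [_] := hk (cst 1%E) (measurable_cst _) (fun=> lee01); rewrite integral_cst// mul1e => ->.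
  congr (_ * _)%E; apply: eq_integral => y /set_mem Yy.
  by rewrite integral_cst_interval ?mulr1// ltW// roofH_gt0.
have fM : (muM setT < +oo)%E by rewrite iM -(fineK fH) -EFinM ltry.
have Iw : muM.-integrable setT (EFin \o w).
  apply: measurable_bounded_integrable => //.
  exists 1; split; first exact: num_real.
  by move=> x x1 y _; apply: ltW; exact: le_lt_trans x1.
have I1 : muM.-integrable setT (EFin \o (cst 1 : M -> R)).
  apply: measurable_bounded_integrable => //.
  exists 1; split; first exact: num_real.
  by move=> x x1 y _; rewrite /= normr1 ltW.
have mw1 : measurable_fun setT (EFin \o (fun x => w x + 1)).
  by apply/measurable_EFinP; exact: measurable_funD.
have w10 x : (0 <= (EFin \o (fun x => (w x + 1)%R)) x)%E.
  by rewrite lee_fin; have := w1 x; rewrite ler_norml => /andP[]; lra.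
have [_ e] := hk _ mw1 w10.
have mV : measurable_fun Y (fun y => flow_int T w (H y) y).
  by apply: flow_int_measurable_comp => //; exact: measurable_roofH.
have IV : muY.-integrable Y (fun y => (flow_int T w (H y) y)%:E).
  apply: (le_integrable hY _ _ hHint); first exact/measurable_EFinP.
  move=> y Yy; have H0 := ltW (roofH_gt0 y Yy).
  by rewrite /= lee_fin [leRHS]ger0_norm// flow_int_le.
have e2 : (\int[muM]_x (EFin \o (fun x => (w x + 1)%R)) x = muM setT)%E.
  under eq_integral do rewrite /= EFinD.
  by rewrite (integralD measurableT Iw I1) /= iw add0e integral_cst// mul1e.
have e3 : (\int[muY]_(y in Y) \int[leb]_(u in `[0%R, H y]) (EFin \o (fun x => (w x + 1)%R)) (clip (u, y)) =
  \int[muY]_(y in Y) (flow_int T w (H y) y)%:E + \int[muY]_(y in Y) (H y)%:E)%E.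
  rewrite -integralD//; apply: eq_integral => y /set_mem Yy.
  have H0 := ltW (roofH_gt0 y Yy).
  have i1 : leb.-integrable `[0, H y] (EFin \o (fun u => w (clip (u, y)))).
    by apply: (bounded_integrable _ 1) => //; exact: measurable_orbit.
  have i2 : leb.-integrable `[0, H y] (EFin \o (cst 1 : R -> R)).
    by apply: (bounded_integrable _ 1) => // r _; rewrite /= normr1.
  under eq_integral do rewrite /= EFinD.
  rewrite (integralD _ i1 i2)//; congr (_ + _)%E.
    by rewrite flow_int_clip /Rintegral fineK// integrable_fin_num.
  by rewrite integral_cst_interval// mulr1.
move: e; rewrite e2 iM e3 -(fineK fH) -(fineK (integrable_fin_num hY IV)) -EFinD -!EFinM => -[].
move=> /(mulfI (lt0r_neq0 k0)) eh.
by congr EFin; apply: (addIr (fine (\int[muY]_(y in Y) (H y)%:E)%E)); rewrite add0r -eh.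
Qed.

End suspension.

Definition birkhoff {A : Type} {R : realType} (F : A -> A) (u : A -> R) (k : nat) (x : A) : R :=
  \sum_(i < k) u (iter i F x).

(** * Shadowing by Birkhoff sums on the quotient *)

Section birkhoff_sums.
Context {A : Type} {R : realType}.
Variables (F : A -> A) (u : A -> R).

Lemma birkhoff0 x : birkhoff F u 0 x = 0. Proof. exact: big_ord0. Qed.

Lemma birkhoffSr k x : birkhoff F u k.+1 x = birkhoff F u k x + u (iter k F x).
Proof. exact: big_ord_recr. Qed.

Lemma birkhoffSl k x : birkhoff F u k.+1 x = u x + birkhoff F u k (F x).
Proof.
rewrite /birkhoff big_ord_recl; congr (_ + _); apply: eq_bigr => i _.
by rewrite -iterSr.
Qed.

Lemma birkhoffD k l x : birkhoff F u (k + l) x = birkhoff F u k x + birkhoff F u l (iter k F x).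
Proof.
elim: l => [|l ih]; first by rewrite addn0 birkhoff0 addr0.
by rewrite addnS !birkhoffSr ih addrA -iterD addnC.
Qed.

Lemma birkhoff_ge (c : R) k x : (forall i, c <= u (iter i F x)) -> k%:R * c <= birkhoff F u k x.
Proof.
move=> h; rewrite mulr_natl -[X in _ *+ X]card_ord -sumr_const.
by apply: ler_sum => i _; exact: h.
Qed.

Lemma birkhoff_homo k l x : (forall i, 0 <= u (iter i F x)) -> (k <= l)%N ->
  birkhoff F u k x <= birkhoff F u l x.
Proof.
move=> h kl; rewrite -(subnKC kl) birkhoffD lerDl.
by apply: sumr_ge0 => i _; rewrite -iterD; exact: h.
Qed.

End birkhoff_sums.

(** The left side is at most [1 + q + ... + q ^ (m - 1)], each term being at least [q ^ m]. It
    absorbs linear factors and gives explicit decay. *)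
Lemma natr_mul_exp_le {R : realType} (q : R) (m : nat) : 0 <= q -> q < 1 ->
  m%:R * q ^+ m <= (1 - q)^-1.
Proof.
move=> q0 q1; have d0 : 0 < 1 - q by rewrite subr_gt0.
rewrite -[leRHS]mul1r ler_pdivlMr//.
have : m%:R * q ^+ m * (1 - q) <= 1 - q ^+ m.
  elim: m => [|m ih]; first by rewrite !mul0r expr0 subrr.
  have e0 : 0 <= q ^+ m by rewrite exprn_ge0.
  have e1 : q ^+ m <= 1 by rewrite exprn_ile1// ltW.
  have m0 : 0 <= m%:R :> R by rewrite ler0n.
  have h : m%:R * q ^+ m * (1 - q) * q <= (1 - q ^+ m) * q by rewrite ler_wpM2r.
  have h2 : 0 <= (1 - q) * (1 - q * q ^+ m).
    by rewrite mulr_ge0 ?(ltW d0)// subr_ge0 mulr_ile1// ltW.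
  rewrite exprS -natr1; lra.
by move=> /le_trans; apply; rewrite gerBl exprn_ge0.
Qed.

Lemma powR_lt1 {R : realType} (a r : R) : 0 < a -> a < 1 -> 0 < r -> a `^ r < 1.
Proof.
move=> a0 a1 r0; have := @gt0_ltr_powR R r r0 a 1; rewrite powR1; apply=> //.
- by rewrite nnegrE ltW.
- by rewrite nnegrE.
Qed.

Section flow_estimates.
Context {R : realType} {dM : measure_display} {M : measurableType dM} {Yb : Type}.
Variables (T : R -> M -> M) (Y : set M) (F : M -> M) (H : M -> R).
Variables (pib : M -> Yb) (Fb : Yb -> Yb) (part : Yb -> nat) (sec : Yb -> M).
Variables (dist : M -> M -> R) (C g0 eta c : R).
Hypothesis hT : measurable_semiflow T.
Hypothesis dist_ge0 : forall x y, 0 <= dist x y.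
Hypothesis FY : forall y, Y y -> Y (F y).
Hypothesis F_flow : forall y, Y y -> F y = T (H y) y.
Hypotheses (c0 : 0 < c) (Hc : forall y, Y y -> c <= H y).
Hypothesis pibF : forall y, Y y -> pib (F y) = Fb (pib y).
Hypothesis secY : forall z, Y (sec z).
Hypothesis secK : forall z, pib (sec z) = z.
Hypotheses (C1 : 1 <= C) (g0_gt0 : 0 < g0) (g0_lt1 : g0 < 1) (eta0 : 0 < eta) (eta1 : eta <= 1).
Local Notation Hh := (fun z => H (sec z)).
Local Notation sep := (sep_ge part Fb).
Hypothesis Hh_lip : forall z z' n, part z = part z' -> sep z z' n ->
  `|Hh z - Hh z'| <= C * Hh z * g0 ^+ n.
Hypothesis stable : forall y y' t, Y y -> Y y' -> pib y' = pib y -> 0 <= t ->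
  dist (T t y) (T t y') <= C * g0 `^ t.
Hypothesis unstable : forall z z' n K t, part z = part z' -> sep z z' n ->
  0 <= K -> 0 <= t -> t <= K ->
  dist (T t (sec z)) (T t (sec z')) <= C * g0 `^ (n%:R - K / c).
Hypothesis unstable_lap : forall z z' n K t, part z = part z' -> sep z z' n.+1 ->
  0 <= K -> 0 <= t -> t <= K + Hh z ->
  dist (T t (sec z)) (T t (sec z')) <= C * g0 `^ (n%:R - K / c).

Definition contr_rate : R := g0 `^ eta.
Local Notation g1 := contr_rate.

Lemma contr_rate_gt0 : 0 < g1. Proof. exact: powR_gt0. Qed.

Lemma contr_rate_lt1 : g1 < 1. Proof. exact: powR_lt1. Qed.

Let Tadd s t x : 0 <= s -> 0 <= t -> T (s + t) x = T s (T t x).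
Proof. by move=> *; have [_ h _] := hT; exact: h. Qed.

Let g1pow (r s : R) : 0 <= r -> r <= s -> g1 `^ s <= g1 `^ r.
Proof.
move=> r0 rs; apply: ger_powR => //.
by rewrite contr_rate_gt0 ltW// contr_rate_lt1.
Qed.

Let powD (a r s : R) : 0 < a -> a `^ (r + s) = a `^ r * a `^ s.
Proof. by move=> a0; rewrite powRD//; apply/implyP => _; rewrite gt_eqF. Qed.

(** The geometric sum of the errors made in unit time intervals, used through [B1 = C + B1 * g1]. *)
Definition contr_const : R := C / (1 - g1).
Local Notation B1 := contr_const.

Let B1E : B1 = C + B1 * g1.
Proof.
have := contr_rate_lt1; rewrite /B1 => h.
by field; rewrite subr_eq0 gt_eqF.
Qed.

Let B1C : C <= B1.
Proof.
rewrite [leRHS]B1E lerDl; apply: mulr_ge0; last exact: ltW contr_rate_gt0.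
apply: divr_ge0; first exact: le_trans C1.
by rewrite subr_ge0 ltW// contr_rate_lt1.
Qed.

Lemma contr_const_ge0 : 0 <= B1.
Proof. by apply: le_trans B1C; exact: le_trans C1. Qed.

Variable w : M -> R.
Hypothesis mw : measurable_fun setT w.
Hypothesis w1 : forall x, `|w x| <= 1.
Hypothesis w_hol : forall x y, `|w x - w y| <= dist x y `^ eta.
Local Notation W := (flow_int T w).

Let WD s t x : 0 <= s -> 0 <= t -> W (s + t) x = W s x + W t (T s x) := flow_intD T hT w mw w1 s t x.

Let w_le x y a r : 0 <= r -> dist x y <= C * a `^ r -> 0 <= a -> `|w x - w y| <= C * (a `^ eta) `^ r.
Proof.
move=> r0 h a0; apply: (le_trans (w_hol x y)).
have C0 : 0 <= C by exact: le_trans C1.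
apply: (@le_trans _ _ ((C * a `^ r) `^ eta)).
  by apply: ge0_ler_powR; rewrite ?nnegrE ?mulr_ge0 ?powR_ge0 ?(ltW eta0).
rewrite (powRM eta C0 (powR_ge0 a r)) powRAC.
by apply: ler_wpM2r; [exact: powR_ge0|exact: ler1_powR].
Qed.

(** In a unit of time starting at [r] the difference of the two integrals changes by at most
    [C * g1 ^ r]; these changes form a geometric series. *)
Lemma stable_tail y y' r s : Y y -> Y y' -> pib y' = pib y -> 0 <= r -> r <= s ->
  `|(W s y - W s y') - (W r y - W r y')| <= B1 * g1 `^ r.
Proof.
move=> Yy Yy' e r0 rs.
have step r' s' : 0 <= r' -> r' <= s' -> s' <= r' + 1 ->
    `|(W s' y - W s' y') - (W r' y - W r' y')| <= C * g1 `^ r'.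
  move=> r'0 rs' s1; have d0 : 0 <= s' - r' by rewrite subr_ge0.
  have es : s' = r' + (s' - r') by rewrite addrC subrK.
  have eW x : W s' x = W r' x + W (s' - r') (T r' x) by rewrite -WD// -es.
  rewrite !eW.
  have -> (a b a' b' : R) : a + b - (a' + b') - (a - a') = b - b' by ring.
  apply: (@le_trans _ _ ((s' - r') * (C * g1 `^ r'))).
    apply: (flow_int_dist T hT w mw w1) => // u /andP[u0 us].
    rewrite -!Tadd//; apply: (le_trans (w_le _ _ g0 (u + r') _ _ _)).
    - by rewrite addr_ge0.
    - by apply: stable => //; rewrite addr_ge0.
    - exact: ltW.
    - by rewrite ler_wpM2l ?(le_trans ler01 C1)// g1pow// lerDr.
  by rewrite ler_piMl ?mulr_ge0 ?powR_ge0 ?(le_trans ler01 C1)//; lra.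
have [n hn] : exists n : nat, s <= r + n%:R.
  by exists (Num.trunc (s - r)).+1; rewrite -lerBlDl ltW// truncnS_gt.
elim: n r r0 rs hn => [|n ih] r r0 rs hn.
  have -> : s = r by lra.
  by rewrite subrr normr0 mulr_ge0 ?powR_ge0 ?contr_const_ge0.
have [h|h] := leP s (r + 1).
  by apply: (le_trans (step _ _ r0 rs h)); rewrite ler_wpM2r ?powR_ge0.
have r10 : 0 <= r + 1 by lra.
have h1 := ih (r + 1) r10 (ltW h).
have h1' : s <= r + 1 + n%:R by move: hn; rewrite -natr1; lra.
have h2 := step r (r + 1) r0 _ (lexx _).
have h3 : r <= r + 1 by lra.
apply: (le_trans (ler_distD (W (r + 1) y - W (r + 1) y') _ _)).
apply: (le_trans (lerD (h1 h1') (h2 h3))).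
rewrite powD ?contr_rate_gt0// powRr1 ?(ltW contr_rate_gt0)//.
have -> : B1 * (g1 `^ r * g1) + C * g1 `^ r = (C + B1 * g1) * g1 `^ r by ring.
by rewrite -B1E.
Qed.

Let gap (y : M) (r : R) := W r y - W r (sec (pib y)).

Let gap_cauchy y r s : Y y -> 0 <= r -> 0 <= s ->
  gap y s - B1 * g1 `^ s <= gap y r + B1 * g1 `^ r.
Proof.
move=> Yy r0 s0; have b1 : 0 <= B1 * g1 `^ r by rewrite mulr_ge0 ?powR_ge0 ?contr_const_ge0.
have b2 : 0 <= B1 * g1 `^ s by rewrite mulr_ge0 ?powR_ge0 ?contr_const_ge0.
have Ys := secY (pib y); have e := secK (pib y).
have [rs|sr] := leP r s.
  have := stable_tail y _ r s Yy Ys e r0 rs; rewrite ler_norml /gap => /andP[_]; lra.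
have := stable_tail y _ s r Yy Ys e s0 (ltW sr); rewrite ler_norml /gap => /andP[]; lra.
Qed.

(* The limit of [gap y r] as [r] tends to infinity, written as a supremum of
   lower bounds so that no completeness argument is needed. *)
Definition stable_gap (y : M) : R := sup [set gap y s - B1 * g1 `^ s | s in [set s : R | 0 <= s]].

Lemma stable_gapP y r : Y y -> 0 <= r ->
  `|stable_gap y - (W r y - W r (sec (pib y)))| <= B1 * g1 `^ r.
Proof.
move=> Yy r0.
have ub q : 0 <= q -> ubound [set gap y s - B1 * g1 `^ s | s in [set s : R | 0 <= s]]
    (gap y q + B1 * g1 `^ q).
  by move=> q0 _ [s /= s0 <-]; exact: gap_cauchy.
have ne : [set gap y s - B1 * g1 `^ s | s in [set s : R | 0 <= s]] !=set0.
  by exists (gap y 0 - B1 * g1 `^ 0); exists 0 => /=.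
have h1 : stable_gap y <= gap y r + B1 * g1 `^ r by apply: ge_sup => //; exact: ub.
have h2 : gap y r - B1 * g1 `^ r <= stable_gap y.
  by apply: ub_le_sup; [exists (gap y 0 + B1 * g1 `^ 0); exact: ub|exists r].
rewrite ler_norml -/(gap y r); lra.
Qed.

(** The orbit of [sec z] returns to the leaf of [sec (Fb z)] but not to that point, and [stable_gap]
    is the total cost of switching orbits. Thus [Vhat z] is the limit of
    [W (K + Hh z) (sec z) - W K (sec (Fb z))] as [K] grows, and it depends on the quotient point
    alone. *)
Definition Vhat (z : Yb) : R := W (Hh z) (sec z) + stable_gap (F (sec z)).

Let Hh0 z : 0 <= Hh z. Proof. by apply: le_trans (Hc _ (secY z)); exact: ltW. Qed.

Lemma Vhat_approx z K : 0 <= K ->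
  `|Vhat z - (W (K + Hh z) (sec z) - W K (sec (Fb z)))| <= B1 * g1 `^ K.
Proof.
move=> K0; have Ys := secY z.
have := stable_gapP (F (sec z)) K (FY _ Ys) K0.
rewrite pibF// secK; congr (`|_| <= _).
rewrite /Vhat [K + _]addrC WD// -F_flow//; ring.
Qed.

Lemma Vhat_bound z : `|Vhat z| <= Hh z + B1.
Proof.
have := Vhat_approx z 0 (lexx _); rewrite powRr0 mulr1 add0r flow_int0 subr0.
have := flow_int_le T hT w mw w1 (Hh z) (sec z) (Hh0 z).
rewrite !ler_norml => /andP[? ?] /andP[? ?]; apply/andP; split; lra.
Qed.

Definition shadow_const : R := B1 / (1 - g1 `^ c).
Local Notation B2 := shadow_const.

Let g1c : g1 `^ c < 1. Proof. exact: powR_lt1 contr_rate_gt0 contr_rate_lt1 c0. Qed.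

Let B2E : B2 = B1 + B2 * g1 `^ c.
Proof. by rewrite /B2; field; rewrite subr_eq0 gt_eqF. Qed.

Lemma shadow_const_ge0 : 0 <= B2.
Proof. by rewrite divr_ge0 ?contr_const_ge0// subr_ge0 ltW. Qed.

Local Notation sig := (birkhoff Fb Hh).

Lemma birkhoff_Hh_ge0 k z : 0 <= sig k z.
Proof. by apply: sumr_ge0. Qed.

(** The extra time [r] carries the induction: seen from lap [k], the errors of earlier laps have
    contracted by at least [g1 ^ c] per lap, so they sum to a constant independent of [k]. *)
Lemma section_shadow k z r : 0 <= r ->
  `|W (sig k z + r) (sec z) - W r (sec (iter k Fb z)) - birkhoff Fb Vhat k z| <= B2 * g1 `^ r.
Proof.
elim: k r => [|k ih] r r0.
  rewrite !birkhoff0 add0r subrr subr0 normr0.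
  by rewrite mulr_ge0 ?powR_ge0 ?shadow_const_ge0.
rewrite !birkhoffSr; set zk := iter k Fb z.
have rH : 0 <= r + Hh zk by rewrite addr_ge0.
have h1 := ih _ rH; rewrite distrC in h1; have h2 := Vhat_approx zk r r0.
have h3 : B2 * g1 `^ (r + Hh zk) <= B2 * (g1 `^ r * g1 `^ c).
  rewrite ler_wpM2l ?shadow_const_ge0// powD ?contr_rate_gt0//.
  by rewrite ler_wpM2l ?powR_ge0// g1pow ?(ltW c0)//; exact: Hc.
have h4 : B2 * g1 `^ r = B1 * g1 `^ r + B2 * (g1 `^ r * g1 `^ c) by rewrite {1}B2E; ring.
rewrite h4; have h5 := lerD h2 (le_trans h1 h3).
apply: le_trans h5; rewrite -/zk -[leLHS]normrN.
have -> : sig k z + Hh zk + r = sig k z + (r + Hh zk) by ring.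
apply: le_trans (ler_normD _ _); rewrite le_eqVlt; apply/orP; left; apply/eqP.
by congr `|_|; rewrite -[iter k.+1 Fb z]/(Fb zk); ring.
Qed.

Definition orbit_const : R := B1 + B2.

Lemma orbit_shadow k y s : Y y -> sig k (pib y) <= s ->
  `|W s y - birkhoff Fb Vhat k (pib y)| <= orbit_const + (s - sig k (pib y)).
Proof.
move=> Yy ks; set z := pib y; have s0 : 0 <= s := le_trans (birkhoff_Hh_ge0 k z) ks.
have h1 := section_shadow k z 0 (lexx _); rewrite addr0 flow_int0 subr0 powRr0 mulr1 in h1.
have h2 := flow_int_lip T hT w mw w1 _ _ (sec z) (birkhoff_Hh_ge0 k z) ks.
have h3 := stable_tail y (sec z) 0 s Yy (secY z) (secK z) (lexx _) s0.
rewrite !flow_int0 subrr subr0 powRr0 mulr1 in h3.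
have -> : W s y - birkhoff Fb Vhat k z = (W s y - W s (sec z)) +
   ((W s (sec z) - W (sig k z) (sec z)) + (W (sig k z) (sec z) - birkhoff Fb Vhat k z)) by ring.
apply: (le_trans (ler_normD _ _)); apply: (le_trans (lerD h3 (ler_normD _ _))).
by apply: (le_trans (lerD (lexx _) (lerD h2 h1))); rewrite /orbit_const; lra.
Qed.

(** Collects two truncation errors along stable leaves, the difference of roofs, the separation
    during one lap and the separation up to time [K]. Bounded errors become multiples of [Hh]
    through [c <= Hh]. *)
Definition lip_const : R := 2 * B1 / c + 2 * C + C / (1 - g1 `^ 4^-1).

Lemma Vhat_lip th z z' m : 0 < th -> th < 1 -> g0 <= th -> g1 `^ (c / 2) <= th -> g1 `^ 4^-1 <= th ->
  sep z z' m.+1 -> `|Vhat z - Vhat z'| <= lip_const * Hh z * th ^+ m.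
Proof.
move=> th0 th1 gth q1 q3 s.
have g1_0 := contr_rate_gt0; have g1_1 := contr_rate_lt1.
have C0 : 0 <= C by exact: le_trans C1.
have p0 : part z = part z' by exact: (s 0%N).
(* At most [m / 2] laps fit into time [K], so about [m / 2] steps of separation survive, while
   truncating at [K] costs [g1 ^ K]; both errors are exponentially small in [m]. *)
set K := c * m%:R / 2; have m0 : 0 <= m%:R :> R by rewrite ler0n.
have K0 : 0 <= K by rewrite /K divr_ge0// mulr_ge0// ltW.
have Kc : K / c = m%:R / 2 by rewrite /K; field; rewrite gt_eqF.
pose t3 := g1 `^ 4^-1.
have t30 : 0 <= t3 by exact: powR_ge0.
have t31 : t3 < 1 by apply: powR_lt1 => //; rewrite invr_gt0.
have thm : 0 <= th ^+ m by rewrite exprn_ge0// ltW.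
have e1 : g1 `^ K <= th ^+ m.
  rewrite (_ : K = c / 2 * m%:R); last by rewrite /K; field.
  by rewrite powRrM powR_mulrn ?powR_ge0// lerXn2r// nnegrE ?powR_ge0 ?(ltW th0).
have e2 : g1 `^ (m%:R - K / c) = t3 ^+ m * t3 ^+ m.
  rewrite -exprD -(powR_mulrn (m + m) t30) /t3 -powRrM; congr (_ `^ _).
  by rewrite Kc natrD; field.
have e3 : t3 ^+ m <= th ^+ m by rewrite lerXn2r// nnegrE// ltW.
have e4 : t3 ^+ m <= 1 by rewrite exprn_ile1// ltW.
have e5 : m%:R * t3 ^+ m <= (1 - t3)^-1 by exact: natr_mul_exp_le.
have t3m : 0 <= t3 ^+ m by rewrite exprn_ge0.
have mK : 0 <= m%:R - K / c by rewrite Kc; lra.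
have a1 := Vhat_approx z K K0; have a2 := Vhat_approx z' K K0.
have KH : 0 <= K + Hh z by rewrite addr_ge0.
have KH' : 0 <= K + Hh z' by rewrite addr_ge0.
have a3 : `|W (K + Hh z) (sec z) - W (K + Hh z) (sec z')| <= (K + Hh z) * (C * (t3 ^+ m * t3 ^+ m)).
  apply: (flow_int_dist T hT w mw w1) => // u /andP[u0 us].
  rewrite -e2; apply: w_le; rewrite ?(ltW g0_gt0)//; exact: unstable_lap.
have a4 : `|W (K + Hh z) (sec z') - W (K + Hh z') (sec z')| <= C * Hh z * th ^+ m.
  apply: (@le_trans _ _ `|Hh z - Hh z'|).
    have [h|h] := leP (Hh z) (Hh z').
      rewrite distrC; apply: (le_trans (flow_int_lip T hT w mw w1 _ _ _ KH _)); first lra.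
      by rewrite distrC ger0_norm; lra.
    apply: (le_trans (flow_int_lip T hT w mw w1 _ _ _ KH' _)); first lra.
    by rewrite ger0_norm; lra.
  apply: (le_trans (Hh_lip z z' m.+1 p0 s)); rewrite ler_wpM2l ?mulr_ge0//.
  apply: (@le_trans _ _ (g0 ^+ m)); last by rewrite lerXn2r// nnegrE ltW.
  by rewrite exprS ler_piMl ?exprn_ge0 ?(ltW g0_gt0)// ltW.
have a5 : `|W K (sec (Fb z)) - W K (sec (Fb z'))| <= K * (C * (t3 ^+ m * t3 ^+ m)).
  case: (posnP m) => [m00|mp].
    by rewrite /K m00 mulr0 mul0r !flow_int0 subrr normr0 mul0r.
  have sF : sep (Fb z) (Fb z') m by move=> k km; have := s k.+1 km; rewrite !iterSr.
  apply: (flow_int_dist T hT w mw w1) => // u /andP[u0 us].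
  rewrite -e2; apply: w_le; rewrite ?(ltW g0_gt0)//.
  by apply: unstable => //; exact: (sF 0%N).
have a6 : K * (C * (t3 ^+ m * t3 ^+ m)) <= c / 2 * (C / (1 - t3)) * th ^+ m.
  rewrite (_ : K * _ = c / 2 * C * (m%:R * t3 ^+ m) * t3 ^+ m); last by rewrite /K; ring.
  rewrite (_ : c / 2 * (C / (1 - t3)) = c / 2 * C * (1 - t3)^-1); last by ring.
  have x0 : 0 <= c / 2 * C by rewrite mulr_ge0// divr_ge0// ltW.
  apply: ler_pM => //; last exact: ler_wpM2l.
  by apply: mulr_ge0 => //; exact: mulr_ge0.
have a7 : Hh z * (C * (t3 ^+ m * t3 ^+ m)) <= Hh z * C * th ^+ m.
  rewrite mulrA ler_wpM2l ?mulr_ge0//; apply: le_trans e3.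
  by rewrite ler_piMl.
have a8 : 1 <= Hh z / c by rewrite ler_pdivlMr// mul1r Hc.
have b1 : B1 * g1 `^ K <= B1 * th ^+ m by rewrite ler_wpM2l ?contr_const_ge0.
set A := C / (1 - t3) in a6 *.
have A0 : 0 <= A by rewrite divr_ge0// subr_ge0 ltW.
have b2 : 2 * (B1 * th ^+ m) <= Hh z * (2 * B1 / c) * th ^+ m.
  rewrite (_ : Hh z * _ * _ = 2 * (B1 * th ^+ m) * (Hh z / c)); last by ring.
  by rewrite ler_peMr// mulr_ge0// mulr_ge0// contr_const_ge0.
have b3 : c * A * th ^+ m <= Hh z * A * th ^+ m.
  by rewrite ler_wpM2r// ler_wpM2r//; exact: Hc.
have -> : lip_const * Hh z * th ^+ m =
   Hh z * (2 * B1 / c) * th ^+ m + (C * Hh z * th ^+ m + Hh z * C * th ^+ m) + Hh z * A * th ^+ m.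
  by rewrite /lip_const -/t3 -/A; ring.
rewrite mulrDl in a3; move: a1 a2 a3 a4 a5; rewrite !ler_norml.
move=> /andP[? ?] /andP[? ?] /andP[? ?] /andP[? ?] /andP[? ?].
apply/andP; split; lra.
Qed.

End flow_estimates.

(** * Roofs that vary along stable leaves *)

Section maximal_ergodic.
Context {R : realType} {d : measure_display} {T : measurableType d}.
Variables (mu : probability T R) (F : T -> T).
Hypothesis mF : measurable_fun setT F.
Hypothesis invF : forall A, measurable A -> mu (F @^-1` A) = mu A.
Variable phi : T -> R.
Hypothesis iphi : mu.-integrable setT (EFin \o phi).

(** The maximum of the Birkhoff sums of lengths 0 to [n], in the recursive form that Garsia's
    argument uses. *)
Fixpoint garsia_max (n : nat) (x : T) : R :=
  if n is n'.+1 then Num.max 0 (phi x + garsia_max n' (F x)) else 0.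

Lemma garsia_max_ge0 n x : 0 <= garsia_max n x.
Proof. by case: n => //= n; rewrite le_max lexx. Qed.

Lemma garsia_maxS n x : garsia_max n x <= garsia_max n.+1 x.
Proof.
elim: n x => [|n ih] x; first exact: garsia_max_ge0.
by rewrite [leRHS]/= ge_max le_max lexx /= le_max lerD2l ih orbT.
Qed.

Lemma garsia_max_homo m n x : (m <= n)%N -> garsia_max m x <= garsia_max n x.
Proof.
move=> mn; rewrite -(subnKC mn); elim: (n - m)%N => [|k ih]; first by rewrite addn0.
by rewrite addnS; apply: le_trans ih _; exact: garsia_maxS.
Qed.

Lemma birkhoff_le_garsia n x : birkhoff F phi n x <= garsia_max n x.
Proof.
elim: n x => [|n ih] x; first by rewrite birkhoff0.
by rewrite birkhoffSl /= le_max lerD2l ih orbT.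
Qed.

Let mphi : measurable_fun setT phi.
Proof. by apply/measurable_EFinP; exact: measurable_int iphi. Qed.

Lemma measurable_garsia n : measurable_fun setT (garsia_max n).
Proof.
elim: n => [|n ih] /=; first exact: measurable_cst.
apply: measurable_maxr; first exact: measurable_cst.
by apply: measurable_funD => //; exact: measurableT_comp.
Qed.

Lemma garsia_fin n : (\int[mu]_x (garsia_max n x)%:E < +oo)%E.
Proof.
elim: n => [|n ih]; first by rewrite /= integral0.
apply: (@le_lt_trans _ _ (\int[mu]_x (`|phi x| + garsia_max n (F x))%:E)%E).
  apply: integral_mono.
  - exact: measurable_garsia.
  - apply: measurable_funD; first exact: measurableT_comp.
    by apply: measurableT_comp => //; exact: measurable_garsia.
  - exact: garsia_max_ge0.
  move=> x /=; rewrite ge_max addr_ge0 ?garsia_max_ge0//=.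
  by rewrite lerD2r ler_norm.
rewrite (integral_sum2 mu (fun x => `|phi x|) (fun x => garsia_max n (F x))).
- apply: lte_add_pinfty.
    by have /integrableP[_] := iphi.
  rewrite (integral_invariantR mu F mF invF)//; first exact: measurable_garsia.
  exact: garsia_max_ge0.
- exact: measurableT_comp.
- by apply: measurableT_comp => //; exact: measurable_garsia.
- by [].
- by move=> x; exact: garsia_max_ge0.
Qed.

Lemma garsia_integrable n : mu.-integrable setT (EFin \o garsia_max n).
Proof.
apply/integrableP; split; first by apply/measurable_EFinP; exact: measurable_garsia.
by under eq_integral do rewrite /= ger0_norm ?garsia_max_ge0//; exact: garsia_fin.
Qed.

Let active n x : R := if 0 < garsia_max n x then phi x else 0.

(** Where the maximum is positive it equals [phi] plus the maximum of order [n - 1] at the image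
    point, which is at most the one of order [n]; elsewhere the left side is nonpositive. *)
Lemma garsia_pointwise n x : garsia_max n x - garsia_max n (F x) <= active n x.
Proof.
have h0 := garsia_max_ge0 n (F x); rewrite /active.
case: ltP => h; last lra.
case: n h h0 => [|n] h h0; first by rewrite /= ltxx in h.
have e : garsia_max n.+1 x = phi x + garsia_max n (F x).
  move: h => /=; rewrite maxEle; case: ifP => //; by rewrite ltxx.
by have := garsia_maxS n (F x); lra.
Qed.

Let mactive n : measurable_fun setT (active n).
Proof.
apply: measurable_fun_ifT => //; apply: measurable_fun_ltr => //.
exact: measurable_garsia.
Qed.

(** By invariance the left side of [garsia_pointwise] integrates to zero, so [phi] restricted to the
    set where a sum of length at most [n] is positive has nonnegative integral. These restrictions
    converge to [phi] almost everywhere, dominated by [|phi|]. *)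
Theorem maximal_ergodic (N : set T) : measurable N -> mu N = 0%E ->
  (forall x, ~ N x -> exists n, 0 < birkhoff F phi n x) -> (0 <= \int[mu]_x (phi x)%:E)%E.
Proof.
move=> mN N0 hpos.
pose f_ n x := (active n x)%:E.
have aephi : {ae mu, forall x, setT x -> f_ ^~ x @ \oo --> (phi x)%:E}.
  exists N; split => // x /=; apply: contra_notP => nNx _.
  have [n hn] := hpos x nNx; apply: cvg_near_cst; exists n => // m /= nm.
  rewrite /f_ /active (_ : 0 < garsia_max m x)//.
  apply: lt_le_trans (garsia_max_homo _ _ x nm).
  exact: lt_le_trans hn (birkhoff_le_garsia n x).
have mf n : measurable_fun setT (f_ n).
  by apply/measurable_EFinP; exact: mactive.
have bd n x : (`|f_ n x| <= `|(phi x)%:E|)%E.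
  by rewrite /f_ /active lee_fin; case: ltP => // _; rewrite normr0.
have ig : mu.-integrable setT (fun x => `|(phi x)%:E|)%E by exact: integrable_abse iphi.
have mphi' : measurable_fun setT (EFin \o phi) by exact: measurable_int iphi.
have [_ _ cv] := dominated_convergence measurableT mf mphi' aephi ig
   (aeW _ (fun x n _ => bd n x)).
have pos n : (0 <= \int[mu]_x f_ n x)%E.
  have i1 := garsia_integrable n.
  have i2 : mu.-integrable setT (EFin \o (fun x => garsia_max n (F x))).
    apply/integrableP; split.
      by apply/measurable_EFinP; apply: measurableT_comp => //; exact: measurable_garsia.
    under eq_integral do rewrite /= ger0_norm ?garsia_max_ge0//.
    rewrite (integral_invariantR mu F mF invF) ?garsia_fin//; first exact: measurable_garsia.
    exact: garsia_max_ge0.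
  have -> : (0 = \int[mu]_x ((garsia_max n x)%:E - (garsia_max n (F x))%:E))%E.
    rewrite (integralB measurableT i1 i2) /=.
    have e := integral_invariantR mu F mF invF (garsia_max n) (measurable_garsia n) (garsia_max_ge0 n).
    rewrite [X in (_ - X)%E]e subee//; exact: (integrable_fin_num measurableT i1).
  apply: le_integral => //.
  - exact: (integrableB measurableT i1 i2).
  - apply: (le_integrable measurableT (mf n) _ iphi) => x _; exact: bd.
  - by move=> x _; rewrite -EFinB lee_fin; exact: garsia_pointwise.
have lim0 := cvg_lim _ cv; rewrite -lim0//.
by apply: lime_ge; [apply/cvg_ex; eexists; exact: cv|exact: nearW].
Qed.

End maximal_ergodic.

(** * Integrals along asymptotically periodic orbits *)

Section periodic_orbit.
Context {R : realType} {dM : measure_display} {M : measurableType dM}.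
Variable T : R -> M -> M.
Hypothesis hT : measurable_semiflow T.
Variable w : M -> R.
Hypothesis mw : measurable_fun setT w.
Hypothesis w1 : forall x, `|w x| <= 1.
Local Notation W := (flow_int T w).
Variables (p : M) (delta A g1 : R).
Hypotheses (delta0 : 0 < delta) (A0 : 0 <= A) (g10 : 0 < g1) (g11 : g1 < 1).
Hypothesis asym : forall u, 0 <= u -> `|w (T (u + delta) p) - w (T u p)| <= A * g1 `^ u.

Let Tadd s t x : 0 <= s -> 0 <= t -> T (s + t) x = T s (T t x).
Proof. by move=> *; have [_ h _] := hT; exact: h. Qed.

Let WD s t x : 0 <= s -> 0 <= t -> W (s + t) x = W s x + W t (T s x) := flow_intD T hT w mw w1 s t x.

Let inc t : R := W (t + delta) p - W t p.

Let gd := g1 `^ delta.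

Let gd1 : gd < 1. Proof. exact: powR_lt1. Qed.

Let g1pow (r s : R) : 0 <= r -> r <= s -> g1 `^ s <= g1 `^ r.
Proof. by move=> r0 rs; apply: ger_powR => //; rewrite g10 ltW. Qed.

Let powD (r s : R) : g1 `^ (r + s) = g1 `^ r * g1 `^ s.
Proof. by rewrite powRD//; apply/implyP => _; rewrite gt_eqF. Qed.

Let B := delta * A / (1 - gd).

Let BE : B = delta * A + B * gd.
Proof. by rewrite /B; field; rewrite subr_eq0 gt_eqF. Qed.

Let B0 : 0 <= B.
Proof.
apply: divr_ge0; first exact: mulr_ge0 (ltW delta0) A0.
by rewrite subr_ge0 ltW.
Qed.

Let inc_step t : 0 <= t -> `|inc (t + delta) - inc t| <= delta * A * g1 `^ t.
Proof.
move=> t0; have td0 : 0 <= t + delta by rewrite addr_ge0// ltW.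
have dd := ltW delta0.
rewrite /inc !WD//.
have -> (a b c e : R) : a + b - a - (c + e - c) = b - e by ring.
rewrite -mulrA; apply: (flow_int_dist T hT w mw w1) => // u /andP[u0 _].
rewrite -!Tadd//; apply: (@le_trans _ _ (A * g1 `^ (u + t))).
  have -> : u + (t + delta) = (u + t) + delta by ring.
  by apply: asym; exact: addr_ge0.
by rewrite ler_wpM2l// g1pow// lerDr.
Qed.

Let inc_iter k t : 0 <= t -> `|inc (t + k%:R * delta) - inc t| <= B * g1 `^ t.
Proof.
elim: k t => [|k ih] t t0.
  by rewrite mul0r addr0 subrr normr0 mulr_ge0 ?powR_ge0.
have td0 : 0 <= t + delta by rewrite addr_ge0// ltW.
have h1 := ih _ td0; have h2 := inc_step t t0.
have -> : t + k.+1%:R * delta = t + delta + k%:R * delta by rewrite -natr1; ring.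
apply: (le_trans (ler_distD (inc (t + delta)) _ _)); apply: (le_trans (lerD h1 h2)).
rewrite powD -/gd.
have -> : B * (g1 `^ t * gd) + delta * A * g1 `^ t = (delta * A + B * gd) * g1 `^ t by ring.
by rewrite -BE.
Qed.

(** The integral over one period changes by at most [B * g1 ^ t0] in total after time [t0]. An
    excess over this bound therefore persists in every later period and forces growth at rate excess
    over [delta]. *)
Lemma periodic_growth t0 : 0 <= t0 -> B * g1 `^ t0 < inc t0 ->
  exists2 a : R, 0 < a & exists b : R, forall t, 0 <= t -> a * t - b <= W t p.
Proof.
move=> t00 hi; pose e := inc t0 - B * g1 `^ t0.
have e0 : 0 < e by rewrite subr_gt0.
have ie k : e <= inc (t0 + k%:R * delta).
  by have := inc_iter k t0 t00; rewrite ler_norml /e => /andP[]; lra.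
have Wk k : W t0 p + k%:R * e <= W (t0 + k%:R * delta) p.
  elim: k => [|k ih]; first by rewrite !mul0r !addr0.
  have := ie k; rewrite /inc.
  have -> : t0 + k%:R * delta + delta = t0 + k.+1%:R * delta by rewrite -natr1; ring.
  by rewrite -natr1; lra.
pose a := e / delta; have a0 : 0 < a by rewrite divr_gt0.
have ad : a * delta = e by rewrite /a; field; rewrite gt_eqF.
exists a => //; exists (2 * t0 + a * t0 + e + delta) => t t_ge0.
have h0 : - t0 <= W t0 p.
  by have := flow_int_le T hT w mw w1 _ p t00; rewrite ler_norml => /andP[].
have at0 : 0 <= a * t0 by rewrite mulr_ge0// ltW.
have [tt|tt] := leP t t0.
  have := flow_int_le T hT w mw w1 _ p t_ge0; rewrite ler_norml => /andP[h _].
  have : a * t <= a * t0 by rewrite ler_wpM2l// ltW.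
  by have dd := delta0; lra.
have q0 : 0 <= (t - t0) / delta by rewrite divr_ge0 ?ltW// subr_gt0.
pose k := Num.trunc ((t - t0) / delta).
have /andP[k1 k2] := truncn_itv q0; rewrite -/k in k1 k2.
have k1' : k%:R * delta <= t - t0 by rewrite -ler_pdivlMr.
have k2' : t - t0 < (k%:R + 1) * delta by rewrite natr1 -ltr_pdivrMr.
have kd0 : 0 <= t0 + k%:R * delta by rewrite addr_ge0// mulr_ge0// ltW.
have kt : t0 + k%:R * delta <= t by lra.
have := flow_int_lip T hT w mw w1 _ _ p kd0 kt; rewrite ler_norml => /andP[h _].
have h2 := Wk k.
have h3 : a * (t - t0) <= a * ((k%:R + 1) * delta) by rewrite ler_wpM2l ?ltW.
have h4 : a * ((k%:R + 1) * delta) = k%:R * e + e by rewrite -ad; ring.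
rewrite h4 mulrBr in h3; lra.
Qed.

(** Whole periods contribute a geometric series that is small at late times; the incomplete last
    period contributes at most [delta], since [|w| <= 1]. *)
Lemma periodic_oscillation : (forall t, 0 <= t -> `|inc t| <= B * g1 `^ t) ->
  forall s t, 0 <= t -> t <= s -> `|W s p - W t p| <= B / (1 - gd) * g1 `^ t + delta.
Proof.
move=> hi s t t0 ts; pose D := B / (1 - gd).
have D0 : 0 <= D by apply: divr_ge0 => //; rewrite subr_ge0 ltW.
have DE : D = B + D * gd by rewrite /D; field; rewrite subr_eq0 gt_eqF.
have Wk k t' : 0 <= t' -> `|W (t' + k%:R * delta) p - W t' p| <= D * g1 `^ t'.
  elim: k t' => [|k ih] t' t'0.
    by rewrite mul0r addr0 subrr normr0 mulr_ge0 ?powR_ge0.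
  have td0 : 0 <= t' + delta by rewrite addr_ge0// ltW.
  have -> : t' + k.+1%:R * delta = t' + delta + k%:R * delta by rewrite -natr1; ring.
  apply: (le_trans (ler_distD (W (t' + delta) p) _ _)).
  apply: (le_trans (lerD (ih _ td0) (hi _ t'0))).
  rewrite powD -/gd.
  have -> : D * (g1 `^ t' * gd) + B * g1 `^ t' = (B + D * gd) * g1 `^ t' by ring.
  by rewrite -DE.
have q0 : 0 <= (s - t) / delta by apply: divr_ge0; [rewrite subr_ge0|exact: ltW].
pose k := Num.trunc ((s - t) / delta).
have /andP[k1 k2] := truncn_itv q0; rewrite -/k in k1 k2.
have k1' : k%:R * delta <= s - t by rewrite -ler_pdivlMr.
have k2' : s - t < (k%:R + 1) * delta by rewrite natr1 -ltr_pdivrMr.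
have kd0 : 0 <= t + k%:R * delta by rewrite addr_ge0// mulr_ge0// ltW.
have kt : t + k%:R * delta <= s by lra.
have h1 := flow_int_lip T hT w mw w1 _ _ p kd0 kt.
apply: (le_trans (ler_distD (W (t + k%:R * delta) p) _ _)).
rewrite addrC; apply: lerD; first exact: Wk.
by apply: (le_trans h1); lra.
Qed.

End periodic_orbit.

Lemma measurable_fun_patch {d d'} {T : measurableType d} {T' : measurableType d'}
    (D : set T) (f g : T -> T') : measurable D -> measurable_fun D f -> measurable_fun setT g ->
  measurable_fun setT (fun x => if `[< D x >] then f x else g x).
Proof.
move=> mD mf mg _ A mA; rewrite setTI.
rewrite (_ : _ @^-1` A = (D `&` f @^-1` A) `|` (~` D `&` g @^-1` A)).
  apply: measurableU; first exact: mf.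
  by apply: measurableI; [exact: measurableC|rewrite -[X in measurable X]setTI; exact: mg].
apply/seteqP; split => x /=.
  by case: asboolP => Dx Ax; [left|right].
by case=> -[Dx Ax]; case: asboolP.
Qed.

Lemma measure_bigcup0 {d} {T : measurableType d} {R : realType} (mu : {measure set T -> \bar R})
    (A : (set T)^nat) : (forall n, measurable (A n)) -> (forall n, mu (A n) = 0%E) ->
  mu (\bigcup_n A n) = 0%E.
Proof.
move=> mA A0; apply/negligibleP; first exact: bigcupT_measurable.
by apply: negligible_bigcup => n; apply/negligibleP => //; exact: A0.
Qed.

(** * Growth and oscillation along orbits of the return map *)

Section section_return.
Context {R : realType} {dM : measure_display} {M : measurableType dM}.
Variables (T : R -> M -> M) (Y : set M) (F : M -> M) (H : M -> R) (muY : probability M R).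
Variable c : R.
Hypothesis hT : measurable_semiflow T.
Hypothesis mY : measurable Y.
Hypothesis muY1 : muY Y = 1%E.
Hypothesis FY : forall y, Y y -> Y (F y).
Hypothesis F_flow : forall y, Y y -> F y = T (H y) y.
Hypotheses (c0 : 0 < c) (Hc : forall y, Y y -> c <= H y).
Hypothesis mF : measurable_fun Y F.
Hypothesis mH : measurable_fun Y H.
Hypothesis iH : muY.-integrable Y (EFin \o H).
Hypothesis inv : forall A, measurable A -> A `<=` Y -> muY (Y `&` F @^-1` A) = muY A.
Hypothesis erg : forall A, measurable A -> A `<=` Y -> Y `&` F @^-1` A = A ->
  muY A = 0%E \/ muY A = 1%E.

(** Extends the return map by the identity off [Y], a null set, so that results for
    measure-preserving maps of the whole space apply. *)
Definition total_return (y : M) : M := if `[< Y y >] then F y else y.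
Local Notation Ft := total_return.

Lemma total_returnE y : Y y -> Ft y = F y.
Proof. by move=> Yy; rewrite /total_return; case: asboolP. Qed.

Lemma measurable_total_return : measurable_fun setT Ft.
Proof. by apply: measurable_fun_patch. Qed.

Lemma muY_compl : muY (~` Y) = 0%E.
Proof.
have h := probability_setC muY mY; rewrite [muY Y]muY1 in h.
by rewrite h subee.
Qed.

Lemma muY_setI A : measurable A -> muY (A `&` Y) = muY A.
Proof.
move=> mA; have m1 : measurable (A `&` Y) by exact: measurableI.
have m2 : measurable (A `&` ~` Y) by apply: measurableI => //; exact: measurableC.
have z : muY (A `&` ~` Y) = 0%E.
  by apply: subset_measure0 muY_compl => //; exact: measurableC.
have e : A = (A `&` Y) `|` (A `&` ~` Y) by rewrite -setIUr setUv setIT.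
have dj : (A `&` Y) `&` (A `&` ~` Y) = set0 by apply/seteqP; split => // y [[_ Yy] [_]].
by rewrite [in RHS]e measureU// [X in (_ + X)%E](_ : _ = 0%E) ?adde0.
Qed.

Lemma total_return_invariant A : measurable A -> muY (Ft @^-1` A) = muY A.
Proof.
move=> mA; have mP : measurable (Ft @^-1` A).
  by rewrite -[X in measurable X]setTI; exact: measurable_total_return.
rewrite -(muY_setI _ mP) -(muY_setI _ mA).
rewrite -(inv (A `&` Y)); [|exact: measurableI|by move=> y []].
congr (muY _); apply/seteqP; split => y /=.
  by case=> h Yy; rewrite total_returnE// in h; split => //; split => //; exact: FY.
by case=> Yy [h _]; rewrite total_returnE.
Qed.

Lemma iter_F_Y n y : Y y -> Y (iter n F y).
Proof. by move=> Yy; elim: n => //= n; exact: FY. Qed.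

Lemma iter_total_return n y : Y y -> iter n Ft y = iter n F y.
Proof.
by move=> Yy; elim: n => //= n ->; rewrite total_returnE//; exact: iter_F_Y.
Qed.

Lemma measurable_iter_F n : measurable_fun Y (iter n F).
Proof.
elim: n => [|n ih]; first exact: measurable_id.
by apply: (measurable_comp mY _ mF ih) => _ [y Yy <-]; exact: iter_F_Y.
Qed.

Let H0 y : Y y -> 0 <= H y. Proof. by move=> Yy; apply: le_trans (Hc _ Yy); exact: ltW. Qed.

Let Tadd s t x : 0 <= s -> 0 <= t -> T (s + t) x = T s (T t x).
Proof. by move=> *; have [_ h _] := hT; exact: h. Qed.

Lemma lap_time_ge0 n y : Y y -> 0 <= birkhoff F H n y.
Proof. by move=> Yy; apply: sumr_ge0 => i _; apply: H0; exact: iter_F_Y. Qed.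

Lemma lap_time_ge n y : Y y -> n%:R * c <= birkhoff F H n y.
Proof. by move=> Yy; apply: birkhoff_ge => i; apply: Hc; exact: iter_F_Y. Qed.

Lemma iter_F_flow n y : Y y -> iter n F y = T (birkhoff F H n y) y.
Proof.
move=> Yy; elim: n => [|n ih]; first by have [t0 _ _] := hT; rewrite birkhoff0 t0.
have Yn := iter_F_Y n y Yy.
by rewrite birkhoffSr /= F_flow// addrC Tadd ?lap_time_ge0 ?H0// -ih.
Qed.

Lemma birkhoff_total_return (u v : M -> R) n y : Y y -> (forall x, Y x -> u x = v x) ->
  birkhoff Ft u n y = birkhoff F v n y.
Proof.
move=> Yy uv; apply: eq_bigr => i _.
by rewrite iter_total_return// uv//; exact: iter_F_Y.
Qed.

Section observable.
Variable w : M -> R.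
Hypothesis mw : measurable_fun setT w.
Hypothesis w1 : forall x, `|w x| <= 1.
Local Notation W := (flow_int T w).

Let WD s t x : 0 <= s -> 0 <= t -> W (s + t) x = W s x + W t (T s x) := flow_intD T hT w mw w1 s t x.

Lemma birkhoff_flow_int n y : Y y -> birkhoff F (fun x => W (H x) x) n y = W (birkhoff F H n y) y.
Proof.
move=> Yy; elim: n => [|n ih]; first by rewrite !birkhoff0 flow_int0.
have Yn := iter_F_Y n y Yy.
by rewrite !birkhoffSr WD ?lap_time_ge0 ?H0// ih -iter_F_flow.
Qed.

Let near_nat t : 0 <= t -> exists n : nat, n%:R <= t /\ t <= (n%:R + 1 : R).
Proof.
move=> t0; exists (Num.trunc t); have /andP[h1 h2] := truncn_itv t0.
by rewrite natr1; split => //; exact: ltW.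
Qed.

(** Natural times and natural constants keep the set measurable; since the integral is Lipschitz in
    time, they describe linear growth at all real times. *)
Definition growth_set (a : R) : set M :=
  Y `&` \bigcup_(b : nat) \bigcap_(n : nat) [set y | a * n%:R - b%:R <= W n%:R y].

Lemma measurable_growth_set a : measurable (growth_set a).
Proof.
apply: measurableI => //; apply: bigcupT_measurable => b; apply: bigcapT_measurable => n.
rewrite (_ : [set y | _] = (W n%:R) @^-1` `[a * n%:R - b%:R, +oo[%classic); last first.
  by apply/seteqP; split => y /=; rewrite in_itv /= andbT.
by rewrite -[X in measurable X]setTI; exact: (measurable_flow_int1 T hT w n%:R mw).
Qed.

Lemma growth_set_real a y : 0 < a -> Y y ->
  growth_set a y <-> exists b : R, forall t, 0 <= t -> a * t - b <= W t y.
Proof.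
move=> a0 Yy; split.
  move=> [_ [b _ h]]; exists (b%:R + a + 1) => t t0.
  have [n [h1 h2]] := near_nat t t0.
  have n0 : 0 <= n%:R :> R by rewrite ler0n.
  have h3 := h n I; have h4 := flow_int_lip T hT w mw w1 _ _ y n0 h1.
  move: h4; rewrite ler_norml /= in h3 * => /andP[h4 _].
  have h5 : a * t <= a * (n%:R + 1) by rewrite ler_wpM2l// ltW.
  rewrite mulrDr mulr1 in h5; lra.
move=> [b h]; split => //; exists (Num.trunc `|b|).+1 => // n _ /=.
apply: le_trans (h n%:R (ler0n _ _)); rewrite lerB//.
apply: (le_trans (ler_norm b)); exact: ltW (truncnS_gt _).
Qed.

(** Adding or removing the first lap changes both the time and the integral by at most [H y], which
    only alters the constant [b]. *)
Lemma growth_set_invariant a : 0 < a -> Y `&` F @^-1` growth_set a = growth_set a.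
Proof.
move=> a0; apply/seteqP; split => y.
  move=> [Yy /= /(growth_set_real _ _ a0 (FY _ Yy))[b h]].
  apply/growth_set_real => //; exists (b + H y + a * H y) => t t0.
  have Hy := H0 y Yy; have [tH|tH] := leP t (H y).
    have := flow_int_le T hT w mw w1 _ y t0; rewrite ler_norml => /andP[h1 _].
    have h2 := h 0 (lexx _); rewrite flow_int0 mulr0 in h2.
    have h3 : a * t <= a * H y by rewrite ler_wpM2l// ltW.
    lra.
  have e : t = H y + (t - H y) by rewrite addrC subrK.
  have th : 0 <= t - H y by lra.
  rewrite [in W t y]e WD// -F_flow//.
  have := h _ th; have := flow_int_le T hT w mw w1 _ y Hy; rewrite ler_norml => /andP[h1 _].
  rewrite mulrBr; lra.
move=> gy; have [Yy _] := gy; split => //=; move: gy => /(growth_set_real _ _ a0 Yy)[b h].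
apply/growth_set_real; [by []|exact: FY|exists (b + H y) => t t0].
have Hy := H0 y Yy; have tH : 0 <= H y + t by lra.
have := h _ tH; rewrite WD// -F_flow//.
have := flow_int_le T hT w mw w1 _ y Hy; rewrite ler_norml => /andP[_ h1].
have aH : 0 <= a * H y by rewrite mulr_ge0// ltW.
rewrite mulrDr; lra.
Qed.

Hypothesis zero_mean : (\int[muY]_(y in Y) (W (H y) y)%:E = 0)%E.

(* Linear growth along almost every orbit would, by the maximal ergodic
   theorem, make the mean of [W (H y) y] positive. *)
Lemma growth_set_null a : 0 < a -> muY (growth_set a) = 0%E.
Proof.
move=> a0; have mG := measurable_growth_set a.
have GY : growth_set a `<=` Y by move=> y [].
have [//|G1] := erg _ mG GY (growth_set_invariant a a0).
exfalso.
pose e := a * c / 2; have e0 : 0 < e by rewrite divr_gt0// mulr_gt0.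
pose V y := W (H y) y.
pose phi y : R := if `[< Y y >] then V y - e else 0.
have phiE y : Y y -> phi y = V y - e by move=> Yy; rewrite /phi; case: asboolP.
have mV : measurable_fun Y V by exact: flow_int_measurable_comp.
have iV : muY.-integrable Y (EFin \o V).
  apply: (le_integrable mY _ _ iH); first exact/measurable_EFinP.
  by move=> y Yy; rewrite /= lee_fin [leRHS]ger0_norm ?H0// flow_int_le ?H0.
have ie : muY.-integrable Y (EFin \o (cst e : M -> R)).
  apply: measurable_bounded_integrable => //.
  - by apply: le_lt_trans (ltry 1); rewrite probability_le1.
  - exists `|e|; split; first exact: num_real.
    by move=> x ex y _; rewrite /= ltW.
have ephi : EFin \o phi = (EFin \o (fun y => V y - e)) \_ Y.
  apply/funext => y; rewrite patchE /phi /=.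
  by case: asboolP => Yy; [rewrite mem_set|rewrite memNset].
have iVe : muY.-integrable Y (EFin \o (fun y => V y - e)).
  by have := integrableB mY iV ie; apply: eq_integrable.
have iphi : muY.-integrable setT (EFin \o phi).
  by rewrite ephi; apply/(integrable_mkcond _ mY).
have G0 : muY (~` growth_set a) = 0%E.
  by have := probability_setC muY mG; rewrite [muY (growth_set a)]G1 => ->; rewrite subee.
have gpos x : ~ (~` growth_set a) x -> exists n, 0 < birkhoff Ft phi n x.
  move=> /contrapT gx; have [Yx _] := gx.
  have [b hb] := (growth_set_real a x a0 Yx).1 gx.
  exists (Num.trunc (`|b| / e)).+1; set n := _.+1.
  rewrite (birkhoff_total_return _ _ n x Yx phiE).
  have -> : birkhoff F (fun y => V y - e) n x = birkhoff F V n x - n%:R * e.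
    by rewrite /birkhoff sumrB sumr_const card_ord -[X in _ - X]mulr_natl.
  rewrite birkhoff_flow_int// subr_gt0.
  apply: lt_le_trans (hb _ (lap_time_ge0 n x Yx)).
  have h1 : `|b| < n%:R * e by rewrite -ltr_pdivrMr//; exact: truncnS_gt.
  have h2 : a * (n%:R * c) <= a * birkhoff F H n x by rewrite ler_wpM2l ?(ltW a0)// lap_time_ge.
  have h3 : a * (n%:R * c) = n%:R * e + n%:R * e by rewrite /e; field.
  have h4 := ler_norm b; lra.
have := maximal_ergodic muY Ft measurable_total_return total_return_invariant phi iphi
  (~` growth_set a) (measurableC mG) G0 gpos.
have -> : (\int[muY]_x (phi x)%:E = (- e)%:E)%E.
  transitivity (\int[muY]_(y in Y) (V y - e)%:E)%E.
    by rewrite [RHS]integral_mkcond -ephi.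
  under eq_integral do rewrite EFinB.
  have ic : (\int[muY]_(y in Y) (EFin \o (cst e : M -> R)) y = e%:E)%E.
    transitivity (\int[muY]_(y in Y) (cst e%:E y))%E; first by [].
    by rewrite integral_cst// -[RHS]mule1; congr (_ * _)%E; exact: muY1.
  by rewrite (integralB mY iV ie) ic [X in (X - _)%E]zero_mean sub0e.
by rewrite lee_fin; apply/negP; rewrite -ltNge oppr_lt0.
Qed.

End observable.

Section oscillation.
Variable w : M -> R.
Hypothesis mw : measurable_fun setT w.
Hypothesis w1 : forall x, `|w x| <= 1.
Local Notation W := (flow_int T w).

Let WD s t x : 0 <= s -> 0 <= t -> W (s + t) x = W s x + W t (T s x) := flow_intD T hT w mw w1 s t x.

(** Times are restricted to a common denominator [k + 1] to obtain a countable intersection; letting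
    [k] grow recovers all real times with the same bound [b]. *)
Definition osc_set (b : R) : set M :=
  Y `&` \bigcap_(k : nat) \bigcap_(i : nat) \bigcap_(j : nat)
    [set y | `|W (i%:R / k.+1%:R) y - W (j%:R / k.+1%:R) y| <= b].

Lemma measurable_osc_set b : measurable (osc_set b).
Proof.
apply: measurableI => //; do 3!apply: bigcapT_measurable => ?.
set s := _ / _; set t := _ / _.
rewrite (_ : [set y | _] = (fun y => `|W s y - W t y|) @^-1` `]-oo, b]%classic); last first.
  by apply/seteqP; split => y /=; rewrite in_itv.
rewrite -[X in measurable X]setTI.
have m : measurable_fun setT (fun y => `|W s y - W t y|).
  apply: measurableT_comp => //; apply: measurable_funB;
    exact: (measurable_flow_int1 T hT w _ mw).
exact: m.
Qed.

Lemma osc_setP b y : Y y ->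
  osc_set b y <-> forall s t, 0 <= s -> 0 <= t -> `|W s y - W t y| <= b.
Proof.
move=> Yy; split; last first.
  by move=> h; split => // k _ i _ j _ /=; apply: h; exact: divr_ge0.
move=> [_ h] s t s0 t0.
suff hk k : `|W s y - W t y| <= b + 2 / k.+1%:R.
  rewrite leNgt; apply/negP => hb.
  pose e := `|W s y - W t y| - b; have e0 : 0 < e by rewrite subr_gt0.
  pose m := Num.trunc (2 / e); pose K : R := m.+1%:R.
  have h1 : `|W s y - W t y| <= b + 2 / K := hk m; have h2 : 2 / e < K := truncnS_gt (2 / e).
  have K0 : 0 < K by rewrite /K ltr0n.
  have h3 : 2 < K * e by rewrite -ltr_pdivrMr.
  have h4 : 2 / K < e by rewrite ltr_pdivrMr// mulrC.
  by move: h1; rewrite leNgt => /negP; apply; rewrite addrC -ltrBrDr.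
have K0 : 0 < k.+1%:R :> R by rewrite ltr0n.
have app r : 0 <= r -> exists i : nat, `|W r y - W (i%:R / k.+1%:R) y| <= 1 / k.+1%:R.
  move=> r0; have rk0 : 0 <= r * k.+1%:R by exact: mulr_ge0.
  exists (Num.trunc (r * k.+1%:R)); have /andP[h1 h2] := truncn_itv rk0.
  move: h1 h2; set n := Num.trunc _ => h1 h2.
  have n0 : 0 <= n%:R / k.+1%:R :> R by exact: divr_ge0.
  have nr : n%:R / k.+1%:R <= r by rewrite ler_pdivrMr.
  apply: (le_trans (flow_int_lip T hT w mw w1 _ _ y n0 nr)).
  by rewrite ler_pdivlMr// mulrBl mulfVK ?gt_eqF// lerBlDr addrC natr1 ltW.
have [i hi] := app s s0; have [j hj] := app t t0.
have hij := h k I i I j I; rewrite /= in hij.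
have -> : W s y - W t y = (W s y - W (i%:R / k.+1%:R) y) +
   ((W (i%:R / k.+1%:R) y - W (j%:R / k.+1%:R) y) - (W t y - W (j%:R / k.+1%:R) y)) by ring.
apply: (le_trans (ler_normD _ _)); apply: (le_trans (lerD hi (ler_normB _ _))).
rewrite (_ : 2 / k.+1%:R = 1 / k.+1%:R + 1 / k.+1%:R); last by rewrite -mulrDl.
by rewrite addrCA; apply: lerD => //; exact: lerD.
Qed.

Lemma osc_set_forward b y : osc_set b y -> osc_set b (F y).
Proof.
move=> oy; have [Yy _] := oy; move/(osc_setP _ _ Yy) : oy => h.
apply/osc_setP; first exact: FY.
move=> s t s0 t0; have Hy := H0 y Yy.
have := h (H y + s) (H y + t) (addr_ge0 Hy s0) (addr_ge0 Hy t0).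
rewrite !WD// -F_flow//; congr (`|_| <= _); ring.
Qed.

(** The preimages of [osc_set b] under the iterates increase, because the set is mapped into itself,
    and all have its measure. Their union is invariant and contains [E], so it is full, and so is
    the set itself. *)
Lemma osc_set_full (b : R) (E : set M) : measurable E -> E `<=` Y -> (0 < muY E)%E ->
  (forall y, E y -> exists n, osc_set b (iter n F y)) -> muY (osc_set b) = 1%E.
Proof.
move=> mE EY E0 hE; have mQ := measurable_osc_set b.
have QY : osc_set b `<=` Y by move=> y [].
pose A n := Y `&` (iter n F) @^-1` osc_set b.
have mA n : measurable (A n) by exact: (measurable_iter_F n).
have AY n : A n `<=` Y by move=> y [].
have mu0 n : muY (A n) = muY (osc_set b).
  elim: n => [|n ih]; first by congr (muY _); apply/seteqP; split => y /= => [[]|h] //; split => //; exact: QY.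
  rewrite -ih -(inv (A n))//; congr (muY _); apply/seteqP; split => y.
    by move=> [Yy]; rewrite /= -iterS iterSr => h; split => //; split => //; exact: FY.
  by move=> [Yy [_]]; rewrite /= -iterSr.
pose A0 := \bigcup_n A n.
have mA0 : measurable A0 by exact: bigcupT_measurable.
have A0Y : A0 `<=` Y by move=> y [n _ [Yy _]].
have invA0 : Y `&` F @^-1` A0 = A0.
  apply/seteqP; split => y.
    move=> [Yy [n _ [_ h]]]; exists n.+1 => //; split => //.
    by rewrite /= -iterS iterSr.
  move=> [n _ [Yy h]]; split => //; exists n => //; split; first exact: FY.
  by rewrite /= -iterSr iterS; exact: osc_set_forward.
have EA : E `<=` A0 by move=> y Ey; have [n hn] := hE y Ey; exists n => //; split => //; exact: EY.
have ndA : nondecreasing_seq A.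
  apply/nondecreasing_seqP => n; rewrite subsetEset => y [Yy h]; split => //=.
  exact: osc_set_forward.
have A01 : muY A0 = 1%E.
  have [z|//] := erg _ mA0 A0Y invA0.
  by move: E0; rewrite ltNge -z le_measure ?inE.
have cv : (fun n => muY (A n)) @ \oo --> muY A0 := @nondecreasing_cvg_mu _ _ R muY A mA mA0 ndA.
have e1 : (fun n => muY (A n)) = (fun=> muY (osc_set b)) by apply/funext => n; exact: mu0.
rewrite e1 in cv; rewrite -A01; apply/esym.
exact: (cvg_unique _ cv (cvg_cst _)).
Qed.

End oscillation.

Section degenerate.
Context {Yb : Type}.
Variables (pib : M -> Yb) (sec : Yb -> M) (dist : M -> M -> R) (C g0 eta : R).
Hypothesis hmet : is_metric dist.
Hypothesis secY : forall z, Y (sec z).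
Hypothesis secK : forall z, pib (sec z) = z.
Hypothesis pibF : forall y y', Y y -> Y y' -> pib y = pib y' -> pib (F y) = pib (F y').
Hypotheses (C1 : 1 <= C) (g0_gt0 : 0 < g0) (g0_lt1 : g0 < 1) (eta0 : 0 < eta) (eta1 : eta <= 1).
Hypothesis stable : forall y y' t, Y y -> Y y' -> pib y' = pib y -> 0 <= t ->
  dist (T t y) (T t y') <= C * g0 `^ t.
Local Notation Hh := (fun y => H (sec (pib y))).
Hypothesis mHh : measurable_fun Y Hh.
Local Notation g1 := (contr_rate g0 eta).

Let Hh0 y : 0 <= Hh y. Proof. exact: H0. Qed.

(* If the return times of [y] and of its projection along the stable leaf
   differ by [delta], comparing the two orbits before and after the return
   shows that the orbit of [y] is asymptotically [delta]-periodic. *)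
Lemma asymptotic_period y : Y y -> exists2 a, 0 <= a & forall t, 0 <= t ->
  dist (T (t + `|H y - Hh y|) (T a y)) (T t (T a y)) <= 2 * C * g0 `^ t.
Proof.
move=> Yy; have [_ _ dC dT] := hmet.
set y' := sec (pib y); have Y'y : Y y' := secY _.
have e : pib y' = pib y := secK _.
have F1 t : 0 <= t -> dist (T (t + H y) y) (T (t + H y') y') <= C * g0 `^ t.
  move=> t0; rewrite !Tadd ?H0// -!F_flow//; apply: stable => //; try exact: FY.
  exact: pibF.
have F2 t r : 0 <= t -> 0 <= r -> dist (T (t + r) y') (T (t + r) y) <= C * g0 `^ t.
  move=> t0 r0; rewrite dC; apply: (le_trans (stable _ _ _ Yy Y'y e (addr_ge0 t0 r0))).
  rewrite ler_wpM2l ?(le_trans ler01 C1)//; apply: ger_powR; first by rewrite g0_gt0 ltW.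
  by rewrite lerDl.
have [h|h] := leP (H y') (H y).
  exists (H y'); first exact: H0.
  move=> t t0; rewrite ger0_norm ?subr_ge0// -!Tadd ?H0//; last by rewrite addr_ge0// subr_ge0.
  have -> : t + (H y - H y') + H y' = t + H y by ring.
  apply: (le_trans (dT _ (T (t + H y') y') _)).
  by have := F1 t t0; have := F2 t (H y') t0 (H0 _ Y'y); lra.
exists (H y); first exact: H0.
move=> t t0; rewrite distrC ger0_norm ?subr_ge0 ?(ltW h)// -!Tadd ?H0//; last by rewrite addr_ge0// subr_ge0 ltW.
have -> : t + (H y' - H y) + H y = t + H y' by ring.
apply: (le_trans (dT _ (T (t + H y') y') _)).
have := F1 t t0; have := F2 t (H y') t0 (H0 _ Y'y).
by rewrite [dist (T (t + H y) y) _]dC [dist (T _ y') (T _ y)]dC; lra.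
Qed.

(** The cap [k] bounds the approximate period, which makes the final oscillation bound the same for
    all observables. *)
Definition mismatch_set (k : nat) : set M := Y `&` [set y | 0 < `|H y - Hh y| <= k%:R].

Lemma measurable_mismatch_set k : measurable (mismatch_set k).
Proof.
have m : measurable_fun Y (fun y => `|H y - Hh y|).
  by apply: measurableT_comp => //; exact: measurable_funB.
have := m mY `]0, k%:R]%classic (measurable_itv _); congr (measurable (_ `&` _)).
Qed.

Section mismatch_observable.
Variable w : M -> R.
Hypothesis mw : measurable_fun setT w.
Hypothesis w1 : forall x, `|w x| <= 1.
Hypothesis w_hol : forall x y, `|w x - w y| <= dist x y `^ eta.
Local Notation W := (flow_int T w).

Let WD s t x : 0 <= s -> 0 <= t -> W (s + t) x = W s x + W t (T s x) := flow_intD T hT w mw w1 s t x.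

Lemma periodic_observable y a delta : 0 <= a -> 0 <= delta ->
  (forall t, 0 <= t -> dist (T (t + delta) (T a y)) (T t (T a y)) <= 2 * C * g0 `^ t) ->
  forall t, 0 <= t -> `|w (T (t + delta) (T a y)) - w (T t (T a y))| <= 2 * C * g1 `^ t.
Proof.
move=> a0 d0 h t t0; apply: (le_trans (w_hol _ _)).
have [dist0 _ _ _] := hmet; have c1 := C1; have CC : 0 <= 2 * C by lra.
apply: (@le_trans _ _ ((2 * C * g0 `^ t) `^ eta)).
  apply: ge0_ler_powR; rewrite ?nnegrE ?(ltW eta0)//; last exact: h.
  by apply: mulr_ge0 => //; exact: powR_ge0.
rewrite (powRM eta CC (powR_ge0 g0 t)) powRAC.
apply: ler_wpM2r; first exact: powR_ge0.
by apply: ler1_powR => //; lra.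
Qed.

Lemma growth_from y a p b : 0 < p -> Y y -> 0 <= a ->
  (forall t, 0 <= t -> p * t - b <= W t (T a y)) -> growth_set w p y.
Proof.
move=> p0 Yy a0 h; apply/growth_set_real => //; exists (a + p * a + `|b|) => t t0.
have pa : 0 <= p * a by rewrite mulr_ge0// ltW.
have hb := ler_norm b; have nb := normr_ge0 b.
have [ta|ta] := leP t a.
  have := flow_int_le T hT w mw w1 _ y t0; rewrite ler_norml => /andP[h1 _].
  have : p * t <= p * a by rewrite ler_wpM2l// ltW.
  lra.
have e : t = a + (t - a) by rewrite addrC subrK.
have tp : 0 <= t - a by lra.
rewrite [in W t y]e WD//; have := h _ tp.
have := flow_int_le T hT w mw w1 _ y a0; rewrite ler_norml => /andP[h1 _].
rewrite mulrBr; lra.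
Qed.

Lemma growth_set_homo p q : 0 < p -> p <= q -> growth_set w q `<=` growth_set w p.
Proof.
move=> p0 pq y gy; have [Yy _] := gy.
have q0 := lt_le_trans p0 pq.
move: gy => /(growth_set_real w mw w1 _ _ q0 Yy)[b h].
apply/growth_set_real => //; exists b => t t0; apply: le_trans (h t t0).
by rewrite lerB// ler_wpM2r.
Qed.

End mismatch_observable.

Lemma flow_intN (w : M -> R) s x : measurable_fun setT w -> (forall x, `|w x| <= 1) ->
  flow_int T (fun x => - w x) s x = - flow_int T w s x.
Proof.
move=> mw w1; rewrite !flow_int_clip -mulN1r -RintegralZl//.
  by apply: eq_Rintegral => r _; rewrite mulN1r.
apply: (bounded_integrable (fun r => w (clip T (r, x))) 1); first exact: measurable_orbit.
by [].
Qed.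

Definition no_growth (w : M -> R) y := forall j, ~ growth_set w j.+1%:R^-1 y /\
  ~ growth_set (fun x => - w x) j.+1%:R^-1 y.

(** Since neither [w] nor [- w] grows linearly, [periodic_growth] forces the integral over a period
    starting at any time [t] to be at most [B * g1 ^ t] in absolute value, which is the hypothesis
    of [periodic_oscillation]. *)
Lemma mismatch_osc (w : M -> R) k y : measurable_fun setT w -> (forall x, `|w x| <= 1) ->
  (forall x y, `|w x - w y| <= dist x y `^ eta) ->
  mismatch_set k y -> no_growth w y -> exists n, osc_set w (k%:R + 1) (iter n F y).
Proof.
move=> mw w1 w_hol [Yy /= /andP[d0 dk]] ng.
set delta := `|H y - Hh y| in d0 dk.
have [a a0 ha] := asymptotic_period y Yy; rewrite -/delta in ha.
have mwN : measurable_fun setT (fun x => - w x) by exact: measurable_funN.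
have w1N x : `|- w x| <= 1 by rewrite normrN.
have c1 := C1; have CC : 0 <= 2 * C by lra.
have g10 : 0 < g1 := contr_rate_gt0 g0 eta g0_gt0.
have g11 : g1 < 1 := contr_rate_lt1 g0 eta g0_gt0 g0_lt1 eta0.
have asw := periodic_observable w w_hol y a delta a0 (ltW d0) ha.
have aswN t : 0 <= t ->
    `|- w (T (t + delta) (T a y)) - - w (T t (T a y))| <= 2 * C * g1 `^ t.
  by move=> t0; rewrite -opprD normrN; exact: asw.
have small (p : R) : 0 < p -> exists j : nat, j.+1%:R^-1 <= p.
  move=> p0; exists (Num.trunc p^-1); rewrite -[leRHS]invrK lef_pV2 ?posrE ?invr_gt0 ?ltr0n//.
  exact: ltW (truncnS_gt _).
set p := T a y in asw aswN ha.
set B := delta * (2 * C) / (1 - g1 `^ delta).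
have inc_le t : 0 <= t -> `|flow_int T w (t + delta) p - flow_int T w t p| <= B * g1 `^ t.
  move=> t0; rewrite ler_norml; apply/andP; split; rewrite leNgt; apply/negP => hlt.
    have [|q q0 [b hb]] := periodic_growth T hT _ mwN w1N p delta (2 * C) g1 d0 CC g10 g11 aswN t t0.
      by rewrite !flow_intN// -/B; lra.
    have [j hj] := small q q0; have [_] := ng j; apply.
    by apply: (growth_set_homo _ mwN w1N _ _ _ hj); [rewrite invr_gt0|exact: growth_from hb].
  have [|q q0 [b hb]] := periodic_growth T hT _ mw w1 p delta (2 * C) g1 d0 CC g10 g11 asw t t0.
    by rewrite -/B.
  have [j hj] := small q q0; have [+ _] := ng j; apply.
  by apply: (growth_set_homo _ mw w1 _ _ _ hj); [rewrite invr_gt0|exact: growth_from hb].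
have osc := periodic_oscillation T hT w mw w1 p delta (2 * C) g1 d0 CC g10 g11 inc_le.
rewrite -/B in osc; set D := B / _ in osc.
have [t1 t10 ht1'] : exists2 t1 : R, 0 <= t1 & forall t, t1 <= t -> D * g1 `^ t <= 1.
  pose n := (Num.trunc (`|D| / (1 - g1))).+1; exists n%:R => // t nt.
  have h1 := natr_mul_exp_le g1 n (ltW g10) g11.
  have h2 : `|D| / (1 - g1) < n%:R := truncnS_gt _.
  have q0 : 0 < 1 - g1 by rewrite subr_gt0.
  have e0 : 0 <= g1 ^+ n by rewrite exprn_ge0// ltW.
  apply: (@le_trans _ _ (`|D| * g1 `^ n%:R)).
    apply: (@le_trans _ _ (`|D| * g1 `^ t)); first by rewrite ler_wpM2r ?powR_ge0 ?ler_norm.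
    by rewrite ler_wpM2l//; apply: ger_powR => //; rewrite g10 ltW.
  rewrite powR_mulrn ?(ltW g10)//.
  have h3 : `|D| <= n%:R * (1 - g1) by rewrite -ler_pdivrMr// ltW.
  have h4 : `|D| * g1 ^+ n <= n%:R * (1 - g1) * g1 ^+ n by rewrite ler_wpM2r.
  apply: (le_trans h4); rewrite mulrAC -ler_pdivlMr// mul1r; exact: h1.
(* Laps last at least [c], so after [N] of them the orbit is past time [t1 + a]. There the decaying
   part of the oscillation is at most 1 and the rest is at most the period, hence the bound
   [k + 1]. *)
pose N := (Num.trunc ((t1 + a) / c)).+1; pose h := birkhoff F H N y.
have hN : t1 + a <= h.
  apply: le_trans (lap_time_ge N y Yy); rewrite -ler_pdivrMr//.
  exact: ltW (truncnS_gt _).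
exists N; apply/osc_setP => //; first exact: iter_F_Y.
have h0 : 0 <= h := lap_time_ge0 N y Yy.
have e s : 0 <= s -> flow_int T w s (iter N F y) =
    flow_int T w a y + flow_int T w (h + s - a) p - flow_int T w h y.
  move=> s0; have hs : 0 <= h + s - a by lra.
  rewrite -(flow_intD T hT w mw w1 a _ y a0 hs) iter_F_flow// -/h.
  rewrite [a + _]addrC subrK (flow_intD T hT w mw w1 h s y h0 s0); ring.
have main s t : 0 <= t -> t <= s ->
    `|flow_int T w s (iter N F y) - flow_int T w t (iter N F y)| <= k%:R + 1.
  move=> t0 ts; have s0 := le_trans t0 ts; rewrite !e//.
  have -> (x u v z : R) : x + u - z - (x + v - z) = u - v by ring.
  have ht : 0 <= h + t - a by lra.
  have hts : h + t - a <= h + s - a by lra.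
  have ht1 : t1 <= h + t - a by lra.
  by have := osc _ _ ht hts; have := ht1' _ ht1; lra.
move=> s t s0 t0; have [ts|st] := leP t s; first exact: main.
by rewrite distrC; apply: main => //; exact: ltW.
Qed.

(* The bound on the oscillation depends only on the return times, not on the
   observable. *)
Theorem degenerate_case : (0 < muY (Y `&` [set y | H y <> Hh y]))%E ->
  exists2 b : R, 0 < b & forall w : M -> R, measurable_fun setT w -> (forall x, `|w x| <= 1) ->
    (forall x y, `|w x - w y| <= dist x y `^ eta) ->
    (\int[muY]_(y in Y) (flow_int T w (H y) y)%:E = 0)%E ->
    exists N : set M, [/\ measurable N, muY N = 0%E &
      forall y, Y y -> ~ N y -> forall s t, 0 <= s -> 0 <= t ->
        `|flow_int T w s y - flow_int T w t y| <= b].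
Proof.
move=> D0.
have [k hk] : exists k, (0 < muY (mismatch_set k))%E.
  apply: contrapT => /forallNP hall; move: D0; apply/negP; rewrite -leNgt.
  have e : Y `&` [set y | H y <> Hh y] = \bigcup_k mismatch_set k.
    apply/seteqP; split => y.
      move=> [Yy /= ne]; exists (Num.trunc `|H y - Hh y|).+1 => //; split => //=.
      rewrite normr_gt0 subr_eq0; apply/andP; split; first exact/eqP.
      exact: ltW (truncnS_gt _).
    move=> [n _ [Yy /= /andP[]]]; rewrite normr_gt0 subr_eq0 => /eqP ne _.
    by split.
  rewrite e; have -> : muY (\bigcup_k mismatch_set k) = 0%E; last by [].
  apply: measure_bigcup0 => [n|n]; first exact: measurable_mismatch_set.
  by have := hall n; rewrite lt0e measure_ge0 andbT => /negP; rewrite negbK => /eqP.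
have k0 : 0 < k%:R + 1 :> R by rewrite ltr_wpDl.
exists (k%:R + 1) => // w mw w1 w_hol w0.
have mwN : measurable_fun setT (fun x => - w x) by exact: measurable_funN.
have w1N x : `|- w x| <= 1 by rewrite normrN.
have w0N : (\int[muY]_(y in Y) (flow_int T (fun x => - w x) (H y) y)%:E = 0)%E.
  have iW : muY.-integrable Y (fun y => (flow_int T w (H y) y)%:E).
    apply: (le_integrable mY _ _ iH).
      apply/measurable_EFinP; exact: flow_int_measurable_comp.
    by move=> y Yy; rewrite /= lee_fin [leRHS]ger0_norm ?H0// flow_int_le ?H0.
  under eq_integral do rewrite flow_intN// EFinN.
  by rewrite integralN ?w0 ?oppe0//; exact: integrable_add_def.
have j0 j : 0 < j.+1%:R^-1 :> R by rewrite invr_gt0.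
pose Gr := \bigcup_j (growth_set w j.+1%:R^-1 `|` growth_set (fun x => - w x) j.+1%:R^-1).
have mGj j : measurable (growth_set w j.+1%:R^-1 `|` growth_set (fun x => - w x) j.+1%:R^-1).
  by apply: measurableU; exact: measurable_growth_set.
have mGr : measurable Gr by exact: bigcupT_measurable.
have Gr0 : muY Gr = 0%E.
  apply: measure_bigcup0 => // j; apply: null_set_setU; try exact: measurable_growth_set.
    exact: (growth_set_null w mw w1 w0 _ (j0 j)).
  exact: (growth_set_null _ mwN w1N w0N _ (j0 j)).
pose E := mismatch_set k `\` Gr.
have mE : measurable E by apply: measurableD => //; exact: measurable_mismatch_set.
have E0 : (0 < muY E)%E.
  rewrite lt0e measure_ge0 andbT; apply/eqP => z.
  have zU : muY (E `|` Gr) = 0%E by exact: null_set_setU.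
  move: hk; rewrite (_ : muY (mismatch_set k) = 0%E) ?ltxx//.
  apply: subset_measure0 zU; [exact: measurable_mismatch_set|exact: measurableU|].
  by move=> y my; have [gy|gy] := pselect (Gr y); [right|left].
have EY : E `<=` Y by move=> y [[]].
have hE y : E y -> exists n, osc_set w (k%:R + 1) (iter n F y).
  move=> [my ngy]; apply: mismatch_osc => // j; split => gj; apply: ngy; exists j => //; by [left|right].
have o1 := osc_set_full w mw w1 (k%:R + 1) E mE EY E0 hE.
have mO := measurable_osc_set w mw (k%:R + 1).
exists (~` osc_set w (k%:R + 1)); split.
- exact: measurableC.
- by have := probability_setC muY mO; rewrite [muY (osc_set w _)]o1 => ->; rewrite subee.
- by move=> y Yy /contrapT /(osc_setP w mw w1 _ _ Yy).
Qed.

End degenerate.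
End section_return.

(** * Roofs that are constant along stable leaves *)

(** Jensen's inequality for the counting measure, from the tangent inequality at each [x i] divided
    by the mean. *)
Lemma power_mean {R : realType} (N : nat) (x : nat -> R) (q : R) : 1 <= q ->
  (forall i, 0 <= x i) -> (\sum_(i < N) x i) `^ q <= N%:R `^ (q - 1) * \sum_(i < N) x i `^ q.
Proof.
move=> q1 x0; set S := \sum_(i < N) x i.
have S0 : 0 <= S by apply: sumr_ge0.
have rhs0 : 0 <= N%:R `^ (q - 1) * \sum_(i < N) x i `^ q.
  by rewrite mulr_ge0 ?powR_ge0// sumr_ge0// => i _; exact: powR_ge0.
have [e|Sn0] := eqVneq S 0; first by rewrite e powR0 ?gt_eqF//; lra.
have Sp : 0 < S by rewrite lt_neqAle eq_sym Sn0.
have Np : 0 < N%:R :> R.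
  by rewrite ltr0n lt0n; apply: contra_neq Sn0 => N0; rewrite /S N0 big_ord0.
pose a := S / N%:R; have ap : 0 < a by rewrite divr_gt0.
have h : N%:R <= \sum_(i < N) (x i / a) `^ q.
  apply: (@le_trans _ _ (\sum_(i < N) (q * (x i / a) - (q - 1)))).
    rewrite sumrB sumr_const card_ord -mulr_sumr -mulr_suml -/S -[X in _ <= _ - X]mulr_natl.
    have -> : S / a = N%:R by rewrite /a; field; rewrite !gt_eqF.
    by lra.
  by apply: ler_sum => i _; apply: bernoulli_powR => //; rewrite divr_ge0// ltW.
have h2 : \sum_(i < N) (x i / a) `^ q = (\sum_(i < N) x i `^ q) * (a `^ q)^-1.
  rewrite mulr_suml; apply: eq_bigr => i _.
  by rewrite powRM ?invr_ge0 ?(ltW ap)// -powR_inv1 ?(ltW ap)// -powRrM mulN1r powRN.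
rewrite h2 ler_pdivlMr ?powR_gt0// in h.
have e1 : S `^ q = N%:R `^ (q - 1) * (N%:R * a `^ q).
  rewrite mulrA [_ * N%:R]mulrC mulr_powRB1 ?(ltW Np)//; last lra.
  rewrite -powRM ?(ltW ap) ?(ltW Np)//; congr (_ `^ _); rewrite /a; field.
  by rewrite gt_eqF.
by rewrite e1 ler_wpM2l ?powR_ge0.
Qed.

(** Here [y] will be a sum of [n] martingale differences, typically of order [sqrt n]. Dividing it
    by [sqrt n] before applying [powR_mix_le] balances the two moments. *)
Lemma powRM_sqrt_le {R : realType} (x y n q : R) : 0 <= x -> 0 <= y -> 0 < n -> 0 < q ->
  (x * y) `^ q <= n `^ (q / 2) * (x `^ (2 * q) + (n `^ q)^-1 * y `^ (2 * q)).
Proof.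
move=> x0 y0 n0 q0; pose r := n `^ 2^-1; have r0 : 0 < r by rewrite powR_gt0.
have h := powR_mix_le x (y / r) q q x0 (divr_ge0 y0 (ltW r0)) (ltW q0) (ltW q0).
have {h} h := h (addr_gt0 q0 q0).
have e : (x * y) `^ q = r `^ q * (x `^ q * (y / r) `^ q).
  have e0 : x * y = r * (x * (y / r)) by field; rewrite gt_eqF.
  have yr : 0 <= y / r by rewrite divr_ge0// ltW.
  by rewrite e0 (powRM q (ltW r0) (mulr_ge0 x0 yr)) (powRM q x0 yr).
have rq : r `^ q = n `^ (q / 2) by rewrite /r -powRrM mulrC.
rewrite e rq ler_wpM2l ?powR_ge0//.
have -> : 2 * q = q + q by ring.
apply: (le_trans h); rewrite lerD2l.
rewrite powRM ?invr_ge0 ?(ltW r0)// mulrC ler_wpM2r ?powR_ge0//.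
rewrite -powR_inv1 ?(ltW r0)// -powRrM mulN1r powRN /r -powRrM.
by rewrite (_ : 2^-1 * (q + q) = q)//; field.
Qed.

(** * Moments of Birkhoff sums and of iterated sums *)

Section base_moments.
Context {R : realType} {d : measure_display} {T : measurableType d}.
Variables (mu : probability T R) (F : T -> T).
Hypothesis mF : measurable_fun setT F.
Hypothesis invF : forall A, measurable A -> mu (F @^-1` A) = mu A.

Lemma measurable_iter_map k : measurable_fun setT (iter k F).
Proof. by elim: k => [|k ih] /=; [exact: measurable_id|exact: measurableT_comp]. Qed.

Lemma measurable_birkhoff (u : T -> R) k : measurable_fun setT u ->
  measurable_fun setT (birkhoff F u k).
Proof.
move=> mu_; apply: measurable_sum => i.
by apply: measurableT_comp => //; exact: measurable_iter_map.
Qed.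

Lemma integral_birkhoff (u : T -> R) (Z : R) N : measurable_fun setT u -> (forall x, 0 <= u x) ->
  (\int[mu]_x (u x)%:E <= Z%:E)%E -> (\int[mu]_x (birkhoff F u N x)%:E <= (N%:R * Z)%:E)%E.
Proof.
move=> mu_ u0 hZ; elim: N => [|N ih].
  by under eq_integral do rewrite birkhoff0; rewrite integral0 mul0r.
under eq_integral do rewrite birkhoffSl.
have mb := measurable_birkhoff u N mu_.
have b0 x : 0 <= birkhoff F u N x by exact: sumr_ge0.
rewrite (integral_sum2 mu u (fun x => birkhoff F u N (F x)))//; last exact: measurableT_comp.
rewrite (integral_invariantR mu F mF invF)//.
by rewrite -natr1 mulrDl mul1r addrC EFinD; exact: leeD.
Qed.

Lemma moment_birkhoff (u : T -> R) (q Z : R) N : 1 <= q -> measurable_fun setT u ->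
  (forall x, 0 <= u x) -> (\int[mu]_x (u x `^ q)%:E <= Z%:E)%E ->
  (\int[mu]_x (birkhoff F u N x `^ q)%:E <= (N%:R `^ q * Z)%:E)%E.
Proof.
move=> q1 mu_ u0 hZ.
have mq := measurable_powRf q u mu_.
have q0 x : 0 <= u x `^ q by exact: powR_ge0.
apply: (@le_trans _ _ (\int[mu]_x (N%:R `^ (q - 1) * birkhoff F (fun x => u x `^ q) N x)%:E)%E).
  apply: integral_mono.
  - by apply: measurable_powRf; exact: measurable_birkhoff.
  - by apply: measurable_scalef; exact: measurable_birkhoff.
  - by move=> x; exact: powR_ge0.
  - by move=> x; exact: (power_mean N (fun i => u (iter i F x))).
rewrite integral_scale ?powR_ge0//; first last.
- by move=> x; exact: sumr_ge0.
- exact: measurable_birkhoff.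
have h := integral_birkhoff _ Z N mq q0 hZ.
apply: (@le_trans _ _ ((N%:R `^ (q - 1))%:E * (N%:R * Z)%:E)%E).
  by rewrite lee_wpmul2l ?lee_fin ?powR_ge0.
rewrite -EFinM lee_fin mulrA [_ * N%:R]mulrC mulr_powRB1//; lra.
Qed.

Variables (Hh : T -> R) (p Z Cm : R).
Hypotheses (mHh : measurable_fun setT Hh) (Hh0 : forall x, 0 <= Hh x).
Hypotheses (Cm0 : 0 <= Cm) (Z0 : 0 <= Z).
Hypothesis hZ : (\int[mu]_x (Hh x `^ p)%:E <= Z%:E)%E.

Definition dominated_diff (m : T -> R) := mart_diff mu F m /\ forall x, `|m x| <= Cm * Hh x.

Lemma dominated_moment m : 0 <= p -> dominated_diff m ->
  (\int[mu]_x (`|m x| `^ p)%:E <= (Cm `^ p * Z)%:E)%E.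
Proof.
move=> p0 [[mm _] hm].
apply: (@le_trans _ _ (\int[mu]_x (Cm `^ p * Hh x `^ p)%:E)%E).
  apply: integral_mono.
  - by apply: measurable_powRf; exact: measurable_normf.
  - by apply: measurable_scalef; exact: measurable_powRf.
  - by move=> x; exact: powR_ge0.
  - move=> x; rewrite -powRM//; apply: ge0_ler_powR; rewrite ?nnegrE//.
    exact: mulr_ge0.
have e := integral_scale mu (Cm `^ p) (fun x => Hh x `^ p) (powR_ge0 _ _)
  (measurable_powRf p Hh mHh) (fun x => powR_ge0 _ _).
rewrite e.
by rewrite EFinM lee_wpmul2l ?lee_fin ?powR_ge0.
Qed.

Lemma martingale_moment : 2 <= p -> exists2 K : R, 0 <= K & forall m n, dominated_diff m ->
  (forall k, (k <= n)%N -> (\int[mu]_x (`|birkhoff F m k x| `^ p)%:E <= (K * n%:R `^ (p / 2))%:E)%E) /\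
  (\int[mu]_x (tail_max F (birkhoff F m) n x `^ p)%:E <= (K * n%:R `^ (p / 2))%:E)%E.
Proof.
move=> p2; have p0 : 0 <= p by lra.
have [K1 K10 h1] := mart_moment mu F mF invF p p2.
have [K2 K20 h2] := mart_maximal mu F mF invF p p2.
pose s := Cm `^ p * Z; have s0 : 0 <= s by rewrite mulr_ge0 ?powR_ge0.
have A0 : 0 <= K1 * s by rewrite mulr_ge0// ltW.
exists (K1 * s + K2 * (K1 * s)); first by rewrite addr_ge0// mulr_ge0// ltW.
move=> m n hm; have [md _] := hm.
have b0 x : birkhoff F m 0 x = 0 by exact: birkhoff0.
have bS k x : birkhoff F m k.+1 x = m x + birkhoff F m k (F x) by exact: birkhoffSl.
have H1 := h1 n (fun=> m) (birkhoff F m) s s0 (fun=> md) b0 bS (fun k _ => dominated_moment m p0 hm).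
have np : 0 <= n%:R `^ (p / 2) by exact: powR_ge0.
split.
  move=> k kn; apply: (le_trans (H1 k kn)); rewrite lee_fin.
  rewrite (_ : K1 * _ * s = K1 * s * n%:R `^ (p / 2)); last by ring.
  by rewrite ler_wpM2r// lerDl mulr_ge0// ltW.
have H2 := h2 (fun=> m) (birkhoff F m) (fun=> md) b0 bS n _.
apply: (le_trans (H2 _)).
  by move=> k kn; apply: (le_lt_trans (H1 k kn)); exact: ltry.
apply: (@le_trans _ _ (K2%:E * (K1 * n%:R `^ (p / 2) * s)%:E)%E).
  by rewrite lee_wpmul2l ?lee_fin ?(ltW K20)// H1.
rewrite -EFinM lee_fin [leLHS](_ : _ = K2 * (K1 * s) * n%:R `^ (p / 2)); last by ring.
by rewrite ler_wpM2r// lerDr.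
Qed.

Definition iterated_sum (m1 m2 : T -> R) (k : nat) (x : T) : R :=
  \sum_(j < k) birkhoff F m1 j x * m2 (iter j F x).

Lemma iterated_sum0 m1 m2 x : iterated_sum m1 m2 0 x = 0.
Proof. exact: big_ord0. Qed.

Lemma iterated_sumSl m1 m2 k x :
  iterated_sum m1 m2 k.+1 x = m1 x * birkhoff F m2 k (F x) + iterated_sum m1 m2 k (F x).
Proof.
rewrite /iterated_sum big_ord_recl birkhoff0 mul0r add0r /birkhoff mulr_sumr -big_split /=.
by apply: eq_bigr => i _; rewrite -[\sum_(_ < _.+1) _]/(birkhoff F m1 i.+1 x) birkhoffSl mulrDl -iterSr.
Qed.

(** By [iterated_sumSl] the iterated sums form a reverse martingale: the difference is [m1 x] times
    a function of [F x], and multiplying a martingale difference by such a function preserves the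
    property. Moments of order [p] of both factors give order [p / 2] for the product. *)
Lemma iterated_moment : 4 <= p -> exists2 K : R, 0 <= K & forall m1 m2 n, (0 < n)%N ->
  dominated_diff m1 -> dominated_diff m2 ->
  (\int[mu]_x (tail_max F (iterated_sum m1 m2) n x `^ (p / 2))%:E <= (K * n%:R `^ (p / 2))%:E)%E.
Proof.
move=> p4; have p2 : 2 <= p by lra.
have p0 : 0 <= p by lra.
pose q := p / 2; have q2 : 2 <= q by rewrite /q; lra.
have q0 : 0 < q by lra.
have pq : p = 2 * q by rewrite /q; field.
have [K1 K10 h1] := mart_moment mu F mF invF q q2.
have [K2 K20 h2] := mart_maximal mu F mF invF q q2.
have [K3 K30 h3] := martingale_moment p2.
pose s := Cm `^ p * Z; have s0 : 0 <= s by rewrite mulr_ge0 ?powR_ge0.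
exists (K2 * (K1 * (s + K3))).
  by rewrite mulr_ge0 ?(ltW K20)// mulr_ge0 ?(ltW K10)// addr_ge0.
move=> m1 m2 n n0 hm1 hm2; have [md1 _] := hm1; have [md2 _] := hm2.
have nR : 0 < n%:R :> R by rewrite ltr0n.
have nq0 : 0 < n%:R `^ q :> R by exact: powR_gt0.
pose m k x := m1 x * birkhoff F m2 k (F x).
have mb k : measurable_fun setT (birkhoff F m2 k) by apply: measurable_birkhoff; case: md2.
have mbF k : measurable_fun setT (fun x => birkhoff F m2 k (F x)) by exact: measurableT_comp.
have mm1 : measurable_fun setT m1 by case: md1.
have md k : mart_diff mu F (m k).
  split; first exact: measurable_funM.
  move=> g mg; have [_ h] := md1.
  have -> : (fun x => (m k x * g (F x))%:E) = (fun x => (m1 x * (fun y => birkhoff F m2 k y * g y) (F x))%:E).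
    by apply/funext => x; rewrite /m mulrA.
  exact: (h (fun y => birkhoff F m2 k y * g y) (measurable_funM (mb k) mg)).
pose s' := n%:R `^ (q / 2) * (s + K3).
have s'0 : 0 <= s' by rewrite mulr_ge0 ?powR_ge0// addr_ge0.
have mom k : (k < n)%N -> (\int[mu]_x (`|m k x| `^ q)%:E <= s'%:E)%E.
  move=> kn.
  pose B x := `|m1 x| `^ (2 * q) + (n%:R `^ q)^-1 * `|birkhoff F m2 k (F x)| `^ (2 * q).
  have mB1 : measurable_fun setT (fun x => `|m1 x| `^ (2 * q)).
    by apply: measurable_powRf; exact: measurable_normf.
  have mB2 : measurable_fun setT (fun x => `|birkhoff F m2 k x| `^ (2 * q)).
    by apply: measurable_powRf; exact: measurable_normf.
  have mB3 : measurable_fun setT (fun x => `|birkhoff F m2 k (F x)| `^ (2 * q)).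
    exact: (measurableT_comp mB2).
  have mB4 : measurable_fun setT (fun x => (n%:R `^ q)^-1 * `|birkhoff F m2 k (F x)| `^ (2 * q)).
    exact: measurable_scalef.
  have B40 x : 0 <= (n%:R `^ q)^-1 * `|birkhoff F m2 k (F x)| `^ (2 * q).
    by rewrite mulr_ge0 ?powR_ge0// invr_ge0 ltW.
  apply: (@le_trans _ _ (\int[mu]_x (n%:R `^ (q / 2) * B x)%:E)%E).
    apply: integral_mono.
    - by apply: measurable_powRf; apply: measurable_normf; case: (md k).
    - by apply: measurable_scalef; exact: measurable_funD.
    - by move=> x; exact: powR_ge0.
    - by move=> x; rewrite /m normrM; exact: powRM_sqrt_le.
  rewrite integral_scale ?powR_ge0//; first last.
  - by move=> x; rewrite addr_ge0 ?powR_ge0.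
  - exact: measurable_funD.
  rewrite /s' EFinM lee_wpmul2l ?lee_fin ?powR_ge0//.
  rewrite (integral_sum2 mu (fun x => `|m1 x| `^ (2 * q)))//.
  rewrite EFinD; apply: leeD.
    by rewrite -pq; exact: dominated_moment.
  rewrite integral_scale ?invr_ge0 ?(ltW nq0)//.
  rewrite (integral_invariantR mu F mF invF (fun y => `|birkhoff F m2 k y| `^ (2 * q)))//.
  have [h _] := h3 m2 n hm2; have := h k (ltnW kn); rewrite -/q pq => hk.
  apply: (@le_trans _ _ (((n%:R `^ q)^-1)%:E * (K3 * n%:R `^ q)%:E)%E).
    by rewrite lee_wpmul2l ?lee_fin ?invr_ge0 ?(ltW nq0).
  by rewrite -EFinM lee_fin mulrC mulfK ?gt_eqF.
have H1 := h1 n m (iterated_sum m1 m2) s' s'0 md (iterated_sum0 m1 m2) (iterated_sumSl m1 m2) mom.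
have H2 := h2 m (iterated_sum m1 m2) md (iterated_sum0 m1 m2) (iterated_sumSl m1 m2) n _.
apply: (le_trans (H2 _)).
  by move=> k kn; apply: (le_lt_trans (H1 k kn)); exact: ltry.
apply: (@le_trans _ _ (K2%:E * (K1 * n%:R `^ (q / 2) * s')%:E)%E).
  by rewrite lee_wpmul2l ?lee_fin ?(ltW K20)// H1.
rewrite -EFinM lee_fin /s'.
have -> : n%:R `^ (p / 2) = n%:R `^ (q / 2) * n%:R `^ (q / 2) :> R.
  by rewrite -powR_split; [congr (_ `^ _); rewrite /q; field|lra..].
by rewrite le_eqVlt; apply/orP; left; apply/eqP; ring.
Qed.

End base_moments.

Section tail_bounds.
Context {R : realType} {d : measure_display} {T : measurableType d}.
Variable F : T -> T.

(** A sum over the first [k] points is the full sum minus the sum over the last [n - k], and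
    [tail_max] controls both. *)
Lemma birkhoff_tail_max (m : T -> R) n k x : (k <= n)%N ->
  `|birkhoff F m k x| <= 2 * tail_max F (birkhoff F m) n x.
Proof.
move=> kn; have h1 := tail_max_ge F (birkhoff F m) n x.
have h2 := tail_max_iter F (birkhoff F m) n k x kn.
have h3 := tail_max_ge F (birkhoff F m) (n - k) (iter k F x).
have e : birkhoff F m n x = birkhoff F m k x + birkhoff F m (n - k) (iter k F x).
  by rewrite -birkhoffD subnKC.
have -> : birkhoff F m k x = birkhoff F m n x - birkhoff F m (n - k) (iter k F x) by rewrite e addrK.
by apply: (le_trans (ler_normB _ _)); lra.
Qed.

Lemma iterated_sumD (m1 m2 : T -> R) k l x :
  iterated_sum F m1 m2 (k + l) x = iterated_sum F m1 m2 k x + iterated_sum F m1 m2 l (iter k F x)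
    + birkhoff F m1 k x * birkhoff F m2 l (iter k F x).
Proof.
elim: l => [|l ih]; first by rewrite addn0 iterated_sum0 birkhoff0 mulr0 !addr0.
rewrite addnS /iterated_sum !big_ord_recr /= -!/(iterated_sum _ _ _ _ _) ih.
by rewrite birkhoffD birkhoffSr -iterD [(l + k)%N]addnC; ring.
Qed.

Lemma iterated_tail_max (m1 m2 : T -> R) n k x : (k <= n)%N ->
  `|iterated_sum F m1 m2 k x| <= 2 * tail_max F (iterated_sum F m1 m2) n x +
     2 * (tail_max F (birkhoff F m1) n x * tail_max F (birkhoff F m2) n x).
Proof.
move=> kn; have h1 := tail_max_ge F (iterated_sum F m1 m2) n x.
have h2 := tail_max_iter F (iterated_sum F m1 m2) n k x kn.
have h3 := tail_max_ge F (iterated_sum F m1 m2) (n - k) (iter k F x).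
have h4 := birkhoff_tail_max m1 n k x kn.
have h5 := tail_max_iter F (birkhoff F m2) n k x kn.
have h6 := tail_max_ge F (birkhoff F m2) (n - k) (iter k F x).
set xk := iter k F x in h2 h3 h5 h6 *.
have -> : iterated_sum F m1 m2 k x = iterated_sum F m1 m2 n x -
   (iterated_sum F m1 m2 (n - k) xk + birkhoff F m1 k x * birkhoff F m2 (n - k) xk).
  have e : iterated_sum F m1 m2 n x = iterated_sum F m1 m2 k x + iterated_sum F m1 m2 (n - k) xk
      + birkhoff F m1 k x * birkhoff F m2 (n - k) xk.
    by rewrite -iterated_sumD subnKC.
  by rewrite e; ring.
apply: (le_trans (ler_normB _ _)); apply: (le_trans (lerD (lexx _) (ler_normD _ _))).
have h7 : `|birkhoff F m1 k x * birkhoff F m2 (n - k) xk| <=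
   2 * tail_max F (birkhoff F m1) n x * tail_max F (birkhoff F m2) n x.
  by rewrite normrM; exact: ler_pM.
lra.
Qed.

End tail_bounds.

Lemma summation_by_parts {R : realType} (a b : nat -> R) k :
  \sum_(j < k) a j * (b j.+1 - b j) = a k * b k - a 0%N * b 0%N - \sum_(j < k) (a j.+1 - a j) * b j.+1.
Proof.
elim: k => [|k ih]; first by rewrite !big_ord0; ring.
by rewrite !big_ord_recr /= ih; ring.
Qed.

(** * Pathwise bounds along orbits whose laps match the section *)

Section pathwise.
Context {R : realType} {dM : measure_display} {M : measurableType dM}.
Context {dY : measure_display} {Yb : measurableType dY}.
Variables (T : R -> M -> M) (Y : set M) (F : M -> M) (H : M -> R) (c : R).
Variables (pib : M -> Yb) (Fb : Yb -> Yb) (Hh : Yb -> R).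
Hypothesis hT : measurable_semiflow T.
Hypothesis FY : forall y, Y y -> Y (F y).
Hypothesis F_flow : forall y, Y y -> F y = T (H y) y.
Hypotheses (c0 : 0 < c) (Hc : forall y, Y y -> c <= H y) (Hhc : forall z, c <= Hh z).
Hypothesis pibF : forall y, Y y -> pib (F y) = Fb (pib y).

Let H0 y : Y y -> 0 <= H y. Proof. by move=> Yy; apply: le_trans (Hc _ Yy); exact: ltW. Qed.
Let Hh0 z : 0 <= Hh z. Proof. by apply: le_trans (Hhc z); exact: ltW. Qed.

Let Tadd s t x : 0 <= s -> 0 <= t -> T (s + t) x = T s (T t x).
Proof. by move=> *; have [_ h _] := hT; exact: h. Qed.

Definition matching_laps (y : M) : Prop := forall i, H (iter i F y) = Hh (pib (iter i F y)).

Lemma pib_iter i y : Y y -> pib (iter i F y) = iter i Fb (pib y).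
Proof.
move=> Yy; elim: i => //= i ih; rewrite pibF ?ih//.
exact: iter_F_Y.
Qed.

Local Notation sig := (birkhoff Fb Hh).

Lemma matching_birkhoff k y : Y y -> matching_laps y -> birkhoff F H k y = sig k (pib y).
Proof. by move=> Yy my; apply: eq_bigr => i _; rewrite my pib_iter. Qed.

Lemma iter_F_sig k y : Y y -> matching_laps y -> iter k F y = T (sig k (pib y)) y.
Proof.
move=> Yy my; rewrite -(matching_birkhoff k y Yy my).
exact: (iter_F_flow T Y F H c hT FY F_flow c0 Hc).
Qed.

(** The lap in progress at time [t + u]. The first lap is at least as long as [u], and time [t]
    allows at most [t / c] further complete laps, whence the condition on [n]. *)
Lemma lap_index z (t u : R) n : 0 <= t -> 0 <= u -> u <= Hh z -> 1 + t / c <= n%:R ->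
  exists k, [/\ (k <= n)%N, sig k z <= t + u & t + u <= sig k z + Hh (iter k Fb z)].
Proof.
move=> t0 u0 uH hn.
have n0 : (0 < n)%N.
  by rewrite -(ltr0n R); apply: lt_le_trans hn; rewrite ltr_pwDl// divr_ge0// ltW.
have hbig : t + u < sig n.+1 z.
  rewrite -(prednK n0) birkhoffSr birkhoffSl.
  have h1 := birkhoff_ge Fb Hh c n.-1 (Fb z) (fun i => Hhc _).
  have h2 := Hhc (iter n.-1.+1 Fb z).
  have h3 : t <= n.-1%:R * c.
    by rewrite -ler_pdivrMr// -(lerD2l 1) [1 + _%:R]addrC natr1 prednK.
  have cc := c0; lra.
have ex : exists k, t + u < sig k z by exists n.+1.
case: (ex_minnP ex) => [[|k] hk hmin].
  by rewrite birkhoff0 in hk; lra.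
exists k; split.
- by rewrite -ltnS; exact: hmin.
- by rewrite leNgt; apply/negP => /hmin; rewrite ltnn.
- by rewrite -birkhoffSr ltW.
Qed.

Section first_integral.
Variables (w : M -> R) (m : Yb -> R) (C6 : R) (n : nat).
Hypothesis mw : measurable_fun setT w.
Hypothesis w1 : forall x, `|w x| <= 1.
Local Notation W := (flow_int T w).
Hypothesis shadow : forall y k, Y y -> (k <= n)%N ->
  `|W (sig k (pib y)) y - birkhoff Fb m k (pib y)| <= C6.
Local Notation U := (tail_max Fb (birkhoff Fb m) n).

Let WD s t x : 0 <= s -> 0 <= t -> W (s + t) x = W s x + W t (T s x) := flow_intD T hT w mw w1 s t x.

Lemma lap_integral_bound y k : Y y -> (k <= n)%N -> `|W (sig k (pib y)) y| <= 2 * U (pib y) + C6.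
Proof.
move=> Yy kn; have h1 := shadow y k Yy kn; have h2 := birkhoff_tail_max Fb m n k (pib y) kn.
rewrite -[W _ _](subrK (birkhoff Fb m k (pib y))).
by apply: (le_trans (ler_normD _ _)); lra.
Qed.

(** The integral is a difference of two integrals from the base point. The piece before height [u]
    and the incomplete last lap cost at most the roofs of their laps. *)
Lemma path_bound1 y (t u : R) : Y y -> matching_laps y -> 0 <= t -> 0 <= u -> u <= H y ->
  1 + t / c <= n%:R ->
  exists2 k, (k <= n)%N & `|W t (T u y)| <=
    2 * U (pib y) + C6 + Hh (pib y) + Hh (iter k Fb (pib y)).
Proof.
move=> Yy my t0 u0 uH hn; set z := pib y.
have eH : H y = Hh z := my 0%N.
have uH' : u <= Hh z by rewrite -eH.
have [k [kn k1 k2]] := lap_index z t u n t0 u0 uH' hn.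
exists k => //.
have sk0 : 0 <= sig k z by exact: sumr_ge0.
have h1 := lap_integral_bound y k Yy kn; rewrite -/z in h1.
have h2 := flow_int_lip T hT w mw w1 _ _ y sk0 k1.
have h3 := flow_int_le T hT w mw w1 _ y u0.
have e : W (t + u) y = W u y + W t (T u y) by rewrite addrC WD.
have -> : W t (T u y) = W (sig k z) y + (W (t + u) y - W (sig k z) y) - W u y by rewrite e; ring.
apply: (le_trans (ler_normB _ _)); apply: (le_trans (lerD (ler_normD _ _) (lexx _))).
lra.
Qed.

End first_integral.

Section second_integral.
Variables (w1 w2 : M -> R) (m1 m2 : Yb -> R) (C6 Cm : R) (n : nat).
Hypothesis mw1 : measurable_fun setT w1.
Hypothesis mw2 : measurable_fun setT w2.
Hypothesis w11 : forall x, `|w1 x| <= 1.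
Hypothesis w21 : forall x, `|w2 x| <= 1.
Hypotheses (C60 : 0 <= C6) (Cm0 : 0 <= Cm).
Local Notation W1 := (flow_int T w1).
Local Notation W2 := (flow_int T w2).
Local Notation S := (flow_int2 T w1 w2).
Hypothesis shadow1 : forall y k, Y y -> (k <= n)%N ->
  `|W1 (sig k (pib y)) y - birkhoff Fb m1 k (pib y)| <= C6.
Hypothesis shadow2 : forall y k, Y y -> (k <= n)%N ->
  `|W2 (sig k (pib y)) y - birkhoff Fb m2 k (pib y)| <= C6.
Hypothesis m1_le : forall z, `|m1 z| <= Cm * Hh z.
Local Notation U1 := (tail_max Fb (birkhoff Fb m1) n).
Local Notation U2 := (tail_max Fb (birkhoff Fb m2) n).
Local Notation UI := (tail_max Fb (iterated_sum Fb m1 m2) n).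
Local Notation Q := (birkhoff Fb (fun z => Hh z ^+ 2) n.+1).

Let SD s t x : 0 <= s -> 0 <= t ->
  S (s + t) x = S s x + S t (T s x) + W1 s x * W2 t (T s x) := flow_int2D T hT w1 w2 mw1 mw2 w11 w21 s t x.

Let sig0 k z : 0 <= sig k z. Proof. exact: sumr_ge0. Qed.

Let Qge k z : (k <= n)%N -> Hh (iter k Fb z) ^+ 2 <= Q z.
Proof.
move=> kn; rewrite -[n.+1](subnKC (leqW kn)) birkhoffD subSn// birkhoffSl -/(iter k Fb z).
have a1 : 0 <= birkhoff Fb (fun z => Hh z ^+ 2) k z by apply: sumr_ge0 => i _; exact: sqr_ge0.
have a2 : 0 <= birkhoff Fb (fun z => Hh z ^+ 2) (n - k) (Fb (iter k Fb z)).
  by apply: sumr_ge0 => i _; exact: sqr_ge0.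
lra.
Qed.

Let Qsum k z : (k <= n)%N -> birkhoff Fb (fun z => Hh z ^+ 2) k z <= Q z.
Proof. by move=> kn; apply: birkhoff_homo; [move=> i; exact: sqr_ge0|exact: leqW]. Qed.

Let sig_le k z : (k <= n)%N -> sig k z <= Q z / c.
Proof.
move=> kn; rewrite ler_pdivlMr//; apply: le_trans (Qsum k z kn).
rewrite mulr_suml; apply: ler_sum => i _; rewrite expr2.
by rewrite ler_wpM2l.
Qed.

Lemma lap_expansion k y : Y y -> matching_laps y ->
  S (sig k (pib y)) y = \sum_(j < k) (S (Hh (iter j Fb (pib y))) (iter j F y) +
     W1 (sig j (pib y)) y * (W2 (sig j.+1 (pib y)) y - W2 (sig j (pib y)) y)).
Proof.
move=> Yy my; elim: k => [|k ih].
  by rewrite birkhoff0 big_ord0 /flow_int2 set_itv1 Rintegral_set1.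
rewrite big_ord_recr /= -ih birkhoffSr SD// -iter_F_sig// -birkhoffSr.
rewrite birkhoffSr (flow_intD T hT w2 mw2 w21)// -iter_F_sig//; ring.
Qed.

Lemma lap_increment j y : Y y -> matching_laps y ->
  `|W2 (sig j.+1 (pib y)) y - W2 (sig j (pib y)) y| <= Hh (iter j Fb (pib y)).
Proof.
move=> Yy my; rewrite birkhoffSr (flow_intD T hT w2 mw2 w21)// addrAC subrr add0r.
exact: flow_int_le.
Qed.

(** In each lap the first integral is replaced by its martingale sum, at the cost of [C6] times the
    increment of the second, and then the second integral is replaced. What remains is the discrete
    iterated sum. *)
Lemma lap_second_bound k y : Y y -> matching_laps y -> (k <= n)%N ->
  `|S (sig k (pib y)) y| <= Q (pib y) + C6 * (Q (pib y) / c) +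
    (C6 * (2 * U1 (pib y)) + C6 * Cm * (Q (pib y) / c)) +
    (2 * UI (pib y) + 2 * (U1 (pib y) * U2 (pib y))).
Proof.
move=> Yy my kn; set z := pib y.
have U10 := tail_max_ge0 Fb (birkhoff Fb m1) n z.
pose a j := W1 (sig j z) y; pose b j := W2 (sig j z) y.
pose A j := birkhoff Fb m1 j z; pose B j := birkhoff Fb m2 j z; pose r j := b j - B j.
have -> : S (sig k z) y = \sum_(j < k) S (Hh (iter j Fb z)) (iter j F y) +
   \sum_(j < k) (a j - A j) * (b j.+1 - b j) +
   (A k * r k - \sum_(j < k) m1 (iter j Fb z) * r j.+1) + iterated_sum Fb m1 m2 k z.
  rewrite lap_expansion// big_split /= -!addrA; congr (_ + _).
  (* The remainder [r] is bounded, but its increments need not be small; summation by parts moves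
     the difference onto [A], whose increments are values of [m1]. *)
  have e1 : A k * r k - \sum_(j < k) m1 (iter j Fb z) * r j.+1 = \sum_(j < k) A j * (r j.+1 - r j).
    rewrite summation_by_parts /A birkhoff0 mul0r subr0; congr (_ - _).
    by apply: eq_bigr => j _; rewrite birkhoffSr addrAC subrr add0r.
  rewrite [A k * r k + _]addrA e1 /iterated_sum -!big_split /=; apply: eq_bigr => j _.
  by rewrite -/z -/(a j) -/(b j) -/(b j.+1) -/(A j) /r /B birkhoffSr; ring.
have h1 : `|\sum_(j < k) S (Hh (iter j Fb z)) (iter j F y)| <= Q z.
  apply: (le_trans (ler_norm_sum _ _ _)); apply: le_trans (Qsum k z kn).
  by apply: ler_sum => j _; exact: flow_int2_sqr_le.
have jn (j : 'I_k) : (j <= n)%N by apply: leq_trans kn; exact: ltnW.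
have jn1 (j : 'I_k) : (j.+1 <= n)%N by apply: leq_trans kn.
have h2 : `|\sum_(j < k) (a j - A j) * (b j.+1 - b j)| <= C6 * (Q z / c).
  apply: (le_trans (ler_norm_sum _ _ _)).
  apply: (@le_trans _ _ (C6 * sig k z)); last by rewrite ler_wpM2l// sig_le.
  rewrite mulr_sumr; apply: ler_sum => j _; rewrite normrM; apply: ler_pM => //.
    exact: shadow1.
  exact: lap_increment.
have h3 : `|A k * r k| <= C6 * (2 * U1 z).
  rewrite normrM mulrC; apply: ler_pM => //; first exact: shadow2.
  exact: birkhoff_tail_max.
have h4 : `|\sum_(j < k) m1 (iter j Fb z) * r j.+1| <= C6 * Cm * (Q z / c).
  apply: (le_trans (ler_norm_sum _ _ _)).
  apply: (@le_trans _ _ (C6 * Cm * sig k z)); last by rewrite ler_wpM2l ?mulr_ge0// sig_le.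
  rewrite mulr_sumr; apply: ler_sum => j _; rewrite normrM.
  rewrite -mulrA mulrC; apply: ler_pM => //; exact: shadow2.
have h5 := iterated_tail_max Fb m1 m2 n k z kn.
apply: (le_trans (ler_normD _ _)); apply: lerD => //.
apply: (le_trans (ler_normD _ _)); apply: lerD; last first.
  by apply: (le_trans (ler_normB _ _)); exact: lerD.
by apply: (le_trans (ler_normD _ _)); exact: lerD.
Qed.

(** Chen's relation removes the piece before height [u] and splits off the incomplete last lap. The
    arithmetic-geometric mean inequality turns every cross term into squares, whose moments of order
    [p / 2] are moments of order [p] of the factors. *)
Lemma path_bound2 y (t u : R) : Y y -> matching_laps y -> 0 <= t -> 0 <= u -> u <= H y ->
  1 + t / c <= n%:R ->
  `|S t (T u y)| <= (20 + 2 * C6 / c + 2 * C6 * Cm / c + 4 * C6 ^+ 2) *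
     (1 + Q (pib y) + U1 (pib y) ^+ 2 + U2 (pib y) ^+ 2 + UI (pib y)).
Proof.
move=> Yy my t0 u0 uH hn; set z := pib y.
have eH : H y = Hh z := my 0%N.
have uH' : u <= Hh z by rewrite -eH.
have [k [kn k1 k2]] := lap_index z t u n t0 u0 uH' hn.
have U10 := tail_max_ge0 Fb (birkhoff Fb m1) n z.
have U20 := tail_max_ge0 Fb (birkhoff Fb m2) n z.
have UI0 := tail_max_ge0 Fb (iterated_sum Fb m1 m2) n z.
have [k' kn' b2] := path_bound1 w2 m2 C6 n mw2 w21 shadow2 y t u Yy my t0 u0 uH hn.
have bk := lap_second_bound k y Yy my kn.
have w1k := lap_integral_bound w1 m1 C6 n shadow1 y k Yy kn.
rewrite -/z in b2 bk w1k.
have q0 := Qge 0 z (leq0n n); rewrite /= in q0.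
have qk := Qge k z kn; have qk' := Qge k' z kn'.
set zk := iter k Fb z in k2 qk *; set zk' := iter k' Fb z in qk' b2.
have r0 : 0 <= t + u - sig k z by lra.
have es : t + u = sig k z + (t + u - sig k z) by rewrite [RHS]addrC subrK.
have e1 : S (t + u) y = S u y + S t (T u y) + W1 u y * W2 t (T u y) by rewrite addrC SD.
have e2 := SD (sig k z) (t + u - sig k z) y (sig0 k z) r0; rewrite -es in e2.
set x := T (sig k z) y in e2.
have rH : t + u - sig k z <= Hh zk by lra.
have s1 : `|S (t + u - sig k z) x| <= Hh zk ^+ 2.
  apply: (le_trans (flow_int2_sqr_le T hT w1 w2 mw1 mw2 w11 w21 _ x r0)).
  by rewrite lerXn2r// nnegrE.
have s2 : `|W2 (t + u - sig k z) x| <= Hh zk.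
  by apply: le_trans rH; exact: flow_int_le.
have s3 : `|S u y| <= Hh z ^+ 2.
  apply: (le_trans (flow_int2_sqr_le T hT w1 w2 mw1 mw2 w11 w21 _ y u0)).
  by rewrite lerXn2r// nnegrE.
have s4 : `|W1 u y| <= Hh z by apply: le_trans uH'; exact: flow_int_le.
have p1 : `|W1 (sig k z) y * W2 (t + u - sig k z) x| <= (2 * U1 z + C6) * Hh zk.
  by rewrite normrM; apply: ler_pM.
have p2 : `|W1 u y * W2 t (T u y)| <= Hh z * (2 * U2 z + C6 + Hh z + Hh zk').
  by rewrite normrM; apply: ler_pM.
have bound : `|S t (T u y)| <= `|S (sig k z) y| + Hh zk ^+ 2 + (2 * U1 z + C6) * Hh zk + Hh z ^+ 2
    + Hh z * (2 * U2 z + C6 + Hh z + Hh zk').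
  have -> : S t (T u y) = S (sig k z) y + S (t + u - sig k z) x + W1 (sig k z) y * W2 (t + u - sig k z) x
     - S u y - W1 u y * W2 t (T u y) by rewrite -e2 e1; ring.
  apply: (le_trans (ler_normB _ _)); apply: lerD => //.
  apply: (le_trans (ler_normB _ _)); apply: lerD => //.
  apply: (le_trans (ler_normD _ _)); apply: lerD => //.
  by apply: (le_trans (ler_normD _ _)); apply: lerD.
have amgm (p q : R) : 2 * (p * q) <= p ^+ 2 + q ^+ 2.
  by rewrite -subr_ge0 [X in 0 <= X](_ : _ = (p - q) ^+ 2) ?sqr_ge0//; ring.
have i1 := amgm (U1 z) (Hh zk); have i2 := amgm C6 (Hh zk).
have i3 := amgm (U2 z) (Hh z); have i4 := amgm C6 (Hh z).
have i5 := amgm (Hh z) (Hh zk'); have i6 := amgm C6 (U1 z).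
have i7 := amgm (U1 z) (U2 z).
have Q0 : 0 <= Q z by apply: le_trans q0; exact: sqr_ge0.
apply: (le_trans bound).
set E := 1 + Q z + U1 z ^+ 2 + U2 z ^+ 2 + UI z.
have u1 := sqr_ge0 (U1 z); have u2 := sqr_ge0 (U2 z); have c6 := sqr_ge0 C6.
have E1 : 1 <= E by rewrite /E -!addrA lerDl !addr_ge0.
have E0 : 0 <= E by exact: le_trans E1.
have EQ : Q z <= E by rewrite /E [1 + _]addrC -!addrA lerDl !addr_ge0.
have f1 : C6 * (Q z / c) <= C6 / c * E.
  by rewrite mulrA mulrAC ler_wpM2l// divr_ge0// ltW.
have f2 : C6 * Cm * (Q z / c) <= C6 * Cm / c * E.
  by rewrite mulrA mulrAC ler_wpM2l// divr_ge0 ?mulr_ge0// ltW.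
have f3 : C6 ^+ 2 <= C6 ^+ 2 * E by rewrite ler_peMr.
have f4 : 0 <= C6 / c * E by rewrite mulr_ge0 ?divr_ge0 ?(ltW c0).
have f5 : 0 <= C6 * Cm / c * E by rewrite mulr_ge0 ?divr_ge0 ?mulr_ge0 ?(ltW c0).
have -> : (20 + 2 * C6 / c + 2 * C6 * Cm / c + 4 * C6 ^+ 2) * E =
  20 * E + 2 * (C6 / c * E) + 2 * (C6 * Cm / c * E) + 4 * (C6 ^+ 2 * E) by ring.
have f6 : 20 * E = 20 + 20 * Q z + 20 * U1 z ^+ 2 + 20 * U2 z ^+ 2 + 20 * UI z by rewrite /E; ring.
rewrite f6; lra.
Qed.

End second_integral.
End pathwise.

Lemma exp_small {R : realType} (q A e : R) : 0 <= q -> q < 1 -> 0 <= A -> 0 < e ->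
  exists n : nat, forall m, (n <= m)%N -> A * q ^+ m < e.
Proof.
move=> q0 q1 A0 e0; have d0 : 0 < 1 - q by rewrite subr_gt0.
pose n := (Num.trunc (A / (e * (1 - q)))).+1; exists n => m nm.
have n0 : 0 < m%:R :> R by rewrite ltr0n; apply: leq_trans nm.
have h1 := natr_mul_exp_le q m q0 q1.
have h2 : A / (e * (1 - q)) < m%:R.
  by apply: lt_le_trans (truncnS_gt _) _; rewrite ler_nat.
rewrite ltr_pdivrMr ?mulr_gt0// in h2.
have qm : 0 <= q ^+ m by rewrite exprn_ge0.
have h3 : q ^+ m <= (m%:R * (1 - q))^-1.
  by rewrite invfM -ler_pdivrMl ?invr_gt0// invrK.
apply: (@le_lt_trans _ _ (A * (m%:R * (1 - q))^-1)); first by rewrite ler_wpM2l.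
by rewrite ltr_pdivrMr ?mulr_gt0//; move: h2; rewrite mulrCA mulrA.
Qed.

(** If the integral [e] were positive, [e / 2 - f] would have a negative integral, yet its Birkhoff
    sums [n * e / 2] minus a bounded amount become positive, against the maximal ergodic theorem. *)
Lemma bounded_birkhoff_integral {R : realType} {d} {T : measurableType d} (mu : probability T R)
    (F : T -> T) (f : T -> R) (N : set T) : measurable_fun setT F ->
  (forall A, measurable A -> mu (F @^-1` A) = mu A) ->
  mu.-integrable setT (EFin \o f) -> measurable N -> mu N = 0%E ->
  (forall x, ~ N x -> exists B : R, forall n, birkhoff F f n x <= B) ->
  (\int[mu]_x (f x)%:E <= 0)%E.
Proof.
move=> mF invF if_ mN N0 hB.
have ffin := integrable_fin_num measurableT if_.
rewrite -(fineK ffin) lee_fin leNgt; apply/negP; set e := fine _ => e0.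
pose phi x := e / 2 - f x.
have ic : mu.-integrable setT (EFin \o (cst (e / 2) : T -> R)).
  apply: measurable_bounded_integrable => //.
  - by apply: le_lt_trans (ltry 1); exact: probability_le1.
  - exists `|e / 2|; split; first exact: num_real.
    by move=> x ex y _; rewrite /= ltW.
have iphi : mu.-integrable setT (EFin \o phi).
  by have := integrableB measurableT ic if_; apply: eq_integrable.
have pos x : ~ N x -> exists n, 0 < birkhoff F phi n x.
  move=> Nx; have [B hb] := hB x Nx.
  pose n := (Num.trunc (`|B| / (e / 2))).+1; exists n.
  have -> : birkhoff F phi n x = n%:R * (e / 2) - birkhoff F f n x.
    by rewrite /birkhoff sumrB sumr_const card_ord -[X in X - _]mulr_natl.
  have h1 : `|B| < n%:R * (e / 2) by rewrite -ltr_pdivrMr ?divr_gt0//; exact: truncnS_gt.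
  by have := hb n; have := ler_norm B; lra.
have := maximal_ergodic mu F mF invF phi iphi N mN N0 pos.
have -> : (\int[mu]_x (phi x)%:E = (e / 2 - e)%:E)%E.
  under eq_integral do rewrite EFinB.
  rewrite (integralB measurableT ic if_) EFinB; congr (_ - _)%E.
    transitivity (\int[mu]_x (cst (e / 2)%:E x))%E; first by [].
    by rewrite integral_cst// -[RHS]mule1; congr (_ * _)%E; exact: probability_setT.
  by rewrite /e fineK.
by rewrite lee_fin; lra.
Qed.

(** * Integrals on the quotient by stable leaves *)

Section factor.
Context {R : realType} {d d' : measure_display} {T : measurableType d} {T' : measurableType d'}.
Variables (mu : probability T R) (nu : probability T' R) (Y : set T) (pib : T -> T').
Hypothesis mY : measurable Y.
Hypothesis mpib : measurable_fun Y pib.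
Hypothesis nuE : forall B, measurable B -> nu B = mu (Y `&` pib @^-1` B).

Lemma factor_integral_ge0 (g : T' -> \bar R) : measurable_fun setT g -> (forall z, 0 <= g z)%E ->
  (\int[mu]_(y in Y) g (pib y) = \int[nu]_z g z)%E.
Proof.
move=> mg g0; pose ka y : {measure set T' -> \bar R} := dirac (pib y).
have kaE y (A : set T') : ka y A = ((\1_A (pib y))%:E : \bar R) by [].
have [] := @integral_mixture _ _ _ _ _ mu Y mY ka nu _ _ g mg g0.
- move=> A mA; under eq_fun do rewrite kaE.
  apply/measurable_EFinP; apply: measurableT_comp => //; exact: measurable_indic.
- move=> A mA; apply: (etrans (nuE A mA)).
  have mp : measurable (Y `&` pib @^-1` A) by exact: mpib.
  transitivity (\int[mu]_(y in Y) ((\1_(Y `&` pib @^-1` A) y)%:E : \bar R))%E.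
    by rewrite integral_indic// setIAC setIid.
  apply: eq_integral => y /set_mem Yy; rewrite kaE !indicE; congr ((_ : bool)%:R)%:E.
  by apply/idP/idP => /set_mem; [case=> _ Ay; rewrite mem_set|move=> Ay; rewrite mem_set].
move=> _ ->; apply: eq_integral => y _.
by rewrite integral_dirac// diracT mul1e.
Qed.

Lemma factor_integral (g : T' -> \bar R) : measurable_fun setT g ->
  (\int[mu]_(y in Y) g (pib y) = \int[nu]_z g z)%E.
Proof.
move=> mg; rewrite integralE [RHS]integralE.
rewrite -(factor_integral_ge0 _ (measurable_funepos mg) (funepos_ge0 g)).
rewrite -(factor_integral_ge0 _ (measurable_funeneg mg) (funeneg_ge0 g)).
by congr (_ - _)%E; apply: eq_integral => y _; rewrite ?funeposE ?funenegE.
Qed.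

End factor.

Section moment_algebra.
Context {R : realType} {d : measure_display} {T : measurableType d}.
Variables (mu : probability T R) (q : R).
Hypothesis q0 : 0 <= q.

Definition moment_le (f : T -> R) (A : R) : Prop :=
  [/\ measurable_fun setT f, (forall x, 0 <= f x) & (\int[mu]_x (f x `^ q)%:E <= A%:E)%E].

Lemma moment_leD f g A B : moment_le f A -> moment_le g B ->
  moment_le (fun x => f x + g x) (2 `^ q * (A + B)).
Proof.
move=> [mf f0 hf] [mg g0 hg]; split.
- exact: measurable_funD.
- by move=> x; rewrite addr_ge0.
have pf x : 0 <= f x `^ q by exact: powR_ge0.
have pg x : 0 <= g x `^ q by exact: powR_ge0.
have mpf := measurable_powRf q f mf; have mpg := measurable_powRf q g mg.
apply: (@le_trans _ _ (\int[mu]_x (2 `^ q * (f x `^ q + g x `^ q))%:E)%E).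
  apply: integral_mono.
  - by apply: measurable_powRf; exact: measurable_funD.
  - by apply: measurable_scalef; exact: measurable_funD.
  - by move=> x; exact: powR_ge0.
  - by move=> x; exact: powRD_le.
have e := integral_scale mu (2 `^ q) (fun x => f x `^ q + g x `^ q) (powR_ge0 _ _)
  (measurable_funD mpf mpg) (fun x => addr_ge0 (pf x) (pg x)).
rewrite e EFinM lee_wpmul2l ?lee_fin ?powR_ge0//.
by rewrite (integral_sum2 mu (fun x => f x `^ q))// EFinD; exact: leeD.
Qed.

Lemma moment_leZ k f A : 0 <= k -> moment_le f A -> moment_le (fun x => k * f x) (k `^ q * A).
Proof.
move=> k0 [mf f0 hf]; split.
- exact: measurable_scalef.
- by move=> x; rewrite mulr_ge0.
have e : (fun x => ((k * f x) `^ q)%:E) = (fun x => (k `^ q * f x `^ q)%:E).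
  by apply/funext => x; rewrite powRM.
have e2 := integral_scale mu (k `^ q) (fun x => f x `^ q) (powR_ge0 _ _)
  (measurable_powRf q f mf) (fun x => powR_ge0 _ _).
by rewrite e e2 EFinM lee_wpmul2l ?lee_fin ?powR_ge0.
Qed.

Lemma moment_le_cst k : 0 <= k -> moment_le (cst k) (k `^ q).
Proof.
move=> k0; split => //.
have e : (\int[mu]_x (cst (k `^ q)%:E x) = (k `^ q)%:E)%E.
  by rewrite integral_cst// -[RHS]mule1; congr (_ * _)%E; exact: probability_setT.
by rewrite -[leRHS]e.
Qed.

End moment_algebra.

Section lap_number.
Context {M : Type} {R : realType}.
Variables (T : R -> M -> M) (h : M -> R) (tau : M -> nat) (Y : set M) (c : R).
Local Notation F := (induced_F T h tau).
Local Notation H := (roofH T h tau).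
Hypotheses (c0 : 0 < c) (Hc : forall y, Y y -> c <= H y).
Hypothesis FY : forall y, Y y -> Y (F y).

Let iterY i y : Y y -> Y (iter i F y). Proof. by move=> Yy; elim: i => //= i; exact: FY. Qed.

Lemma lapJ_le (B t : R) y : 0 <= t -> (forall n : nat, birkhoff F H n y <= t -> n%:R <= B) ->
  lapJ T h tau t y <= B.
Proof.
move=> t0 hB; apply: ge_sup.
  by exists 0; exists 0%N => //; rewrite /= /roofHn big_ord0.
by move=> _ [n hn <-]; apply: hB.
Qed.

Lemma lapJ_le_time K t y : Y y -> 0 <= t -> t <= K -> lapJ T h tau t y <= K / c.
Proof.
move=> Yy t0 tK; apply: lapJ_le => // n hn; rewrite ler_pdivlMr//.
apply: le_trans tK; apply: le_trans hn.
by apply: birkhoff_ge => i; apply: Hc; exact: iterY.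
Qed.

(** The first lap is counted separately, with its full length [H y]; only the later ones are
    estimated by [c]. *)
Lemma lapJ_le_lap K t y : Y y -> 0 <= K -> 0 <= t -> t <= K + H y -> lapJ T h tau t y <= 1 + K / c.
Proof.
move=> Yy K0 t0 tK; apply: lapJ_le => // -[|n] hn.
  by rewrite addr_ge0// divr_ge0// ltW.
rewrite birkhoffSl in hn; rewrite -natr1 addrC lerD2l ler_pdivlMr//.
have := birkhoff_ge F H c n (F y) (fun i => Hc _ (iterY i _ (FY _ Yy))); lra.
Qed.

End lap_number.

Lemma gpow_sep_le {R : realType} {Yb : Type} (g : R) (part : Yb -> nat) (Fb : Yb -> Yb) y y' n :
  0 <= g -> sep_ge part Fb y y' n -> gpow_sep g part Fb y y' <= g ^+ n.
Proof.
move=> g0 s; apply: ge_inf; last by exists n.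
by exists 0 => _ [m _ <-]; rewrite exprn_ge0.
Qed.

Section coboundary.
Context {R : realType} {dY : measure_display} {Yb : measurableType dY}.
Variables (Fb : Yb -> Yb) (part : Yb -> nat) (mub : probability Yb R).
Hypothesis hGM : gibbs_markov Fb mub part.
Hypothesis invFb : forall B, measurable B -> mub (Fb @^-1` B) = mub B.
Hypothesis ergFb : forall B, measurable B -> Fb @^-1` B = B -> mub B = 0%E \/ mub B = 1%E.
Variables (Hh : Yb -> R) (c C t0 : R).
Hypotheses (c0 : 0 < c) (Hhc : forall z, c <= Hh z) (C0 : 0 <= C).
Hypothesis Hh_comp : forall z z', part z = part z' -> Hh z <= C * Hh z'.
Hypothesis mHh : measurable_fun setT Hh.
Hypothesis iHh : (\int[mub]_z (Hh z)%:E < +oo)%E.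
Hypotheses (t00 : 0 < t0) (t01 : t0 < 1).

(** The regularity rate [t0] and the distortion rate [gam] of the map are merged into their maximum
    [th]. The Jacobian [zeta] is measurable because its logarithm is continuous in the separation
    time. *)
Lemma gibbs_markov_coboundary : exists2 th : R, t0 <= th < 1 &
  exists2 K : R, 0 < K &
  forall (V : Yb -> R) (eps : R), 0 < eps -> eps <= 1 -> measurable_fun setT V ->
  (forall z, `|V z| <= Hh z) ->
  (forall z z' n, (0 < n)%N -> sep_ge part Fb z z' n -> `|V z - V z'| <= Hh z * th ^+ n) ->
  (\int[mub]_z (V z)%:E = 0)%E ->
  exists m g e : Yb -> R, [/\ mart_diff mub Fb m, (forall z, `|m z| <= K * Hh z),
    (forall z, `|g z| <= K), (forall z, `|e z| <= eps) &
    forall z, V z = m z + g (Fb z) - g z + e (Fb z)].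
Proof.
have [mFb [mpart [injF [mimg [markov [[cb cb0 big] [[zeta [K0 [gam /andP[gam0 gam1] [zeta0 jac dis]]]] sepn]]]]]]] := hGM.
have distortion y y' n g : 0 < g -> gam <= g -> part y = part y' -> sep_ge part Fb y y' n ->
    `|ln (zeta y) - ln (zeta y')| <= `|K0| * g ^+ n.
  move=> g0 gg pe s; apply: (le_trans (dis y y' pe)).
  have gp0 : 0 <= gpow_sep gam part Fb y y'.
    apply: lb_le_inf; first by exists 1; exists 0%N.
    by move=> _ [k _ <-]; rewrite exprn_ge0// ltW.
  apply: (@le_trans _ _ (`|K0| * gpow_sep gam part Fb y y')).
    by rewrite ler_wpM2r// ler_norm.
  rewrite ler_wpM2l//; apply: (le_trans (gpow_sep_le gam part Fb y y' n (ltW gam0) s)).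
  by rewrite lerXn2r// nnegrE ltW.
have mzeta : measurable_fun setT zeta.
  have ml : measurable_fun setT (fun z => ln (zeta z)).
    apply: (measurable_sep_continuous Fb part mFb mpart setT) => // z e _ e0.
    have [n hn] := exp_small gam `|K0| e (ltW gam0) gam1 (normr_ge0 _) e0.
    exists n.+1 => z' _ s; apply: le_lt_trans (hn n.+1 (leqnSn n)).
    by apply: distortion => //; exact: (s 0%N).
  rewrite (_ : zeta = expR \o (fun z => ln (zeta z))).
    exact: measurableT_comp.
  by apply/funext => z /=; rewrite lnK// posrE.
pose th := Num.max t0 gam.
have th0 : 0 < th by rewrite lt_max t00.
have th1 : th < 1 by rewrite gt_max t01 gam1.
exists th; first by rewrite th1 le_max lexx.
have mk j z z' : cell_image Fb part j z -> part z = part z' -> cell_image Fb part j z'.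
  by move=> Iz e; apply: (markov j z Iz); rewrite /= e.
have gth : gam <= th by rewrite le_max lexx orbT.
exact: (martingale_coboundary mub Fb part mFb mpart injF mimg zeta zeta0 mzeta jac mk
  th `|K0| cb th0 th1 (normr_ge0 _) cb0 (fun y y' n => distortion y y' n th th0 gth) big invFb
  Hh c C mHh c0 Hhc C0 Hh_comp iHh ergFb).
Qed.

End coboundary.

(** Young's inequality with exponents [p] and [p / (p - 1)]: [a] is the roof gained from the
    suspension, [x] a pathwise bound on the base, and [l] its typical size. *)
Lemma young_scaled {R : realType} (a x l p rho : R) : 0 <= a -> 0 <= x -> 0 < l -> 1 < p -> 0 < rho ->
  a * x `^ (rho / p * (p - 1)) <= l `^ (rho / p * (p - 1)) * (a `^ p + (l `^ rho)^-1 * x `^ rho).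
Proof.
move=> a0 x0 l0 p1 rho0; pose y := (x / l) `^ (rho / p).
have xl0 : 0 <= x / l by rewrite divr_ge0// ltW.
have pp : 0 < 1 + (p - 1) by lra.
have p10 : 0 <= p - 1 by lra.
have h := powR_mix_le a y 1 (p - 1) a0 (powR_ge0 _ _) ler01 p10 pp.
rewrite powRr1// (_ : 1 + (p - 1) = p) in h; last by ring.
have e1 : x `^ (rho / p * (p - 1)) = l `^ (rho / p * (p - 1)) * y `^ (p - 1).
  rewrite /y -powRrM -powRM ?(ltW l0)//; congr (_ `^ _); field.
  by rewrite gt_eqF.
have e2 : y `^ p = (l `^ rho)^-1 * x `^ rho.
  rewrite /y -powRrM (_ : rho / p * p = rho); last by field; rewrite gt_eqF//; lra.
  rewrite powRM ?invr_ge0 ?(ltW l0)// mulrC -powR_inv1 ?(ltW l0)// -powRrM mulN1r powRN.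
  by [].
rewrite e1 mulrCA -e2; apply: ler_wpM2l; first exact: powR_ge0.
exact: h.
Qed.

Lemma measurable_tail_max {R : realType} {d} {T : measurableType d} (F : T -> T) (M : nat -> T -> R) n :
  measurable_fun setT F -> (forall k, measurable_fun setT (M k)) ->
  measurable_fun setT (tail_max F M n).
Proof.
move=> mF mM; elim: n => [|n ih] /=; first exact: measurable_normf.
apply: measurable_maxr; first exact: measurable_normf.
exact: measurableT_comp.
Qed.

(** * Moment bounds for scalar observables *)

Section assembly.
Context {R : realType} {dM : measure_display} {M : measurableType dM}.
Context {dY : measure_display} {Yb : measurableType dY}.
Variables (T : R -> M -> M) (Y : set M) (F : M -> M) (H : M -> R) (muY : probability M R).
Variables (muM : {measure set M -> \bar R}) (dist : M -> M -> R).
Variables (pib : M -> Yb) (Fb : Yb -> Yb) (part : Yb -> nat) (sec : Yb -> M) (mub : probability Yb R).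
Variables (C g0 eta c ks : R).
Hypothesis hT : measurable_semiflow T.
Hypothesis hmet : is_metric dist.
Hypothesis mY : measurable Y.
Hypothesis muY1 : muY Y = 1%E.
Hypothesis FY : forall y, Y y -> Y (F y).
Hypothesis F_flow : forall y, Y y -> F y = T (H y) y.
Hypotheses (c0 : 0 < c) (Hc : forall y, Y y -> c <= H y).
Hypothesis mF : measurable_fun Y F.
Hypothesis mH : measurable_fun Y H.
Hypothesis iH : muY.-integrable Y (EFin \o H).
Hypothesis inv : forall A, measurable A -> A `<=` Y -> muY (Y `&` F @^-1` A) = muY A.
Hypothesis erg : forall A, measurable A -> A `<=` Y -> Y `&` F @^-1` A = A ->
  muY A = 0%E \/ muY A = 1%E.
Hypothesis mpib : measurable_fun Y pib.
Hypothesis pibF : forall y, Y y -> pib (F y) = Fb (pib y).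
Hypothesis secY : forall z, Y (sec z).
Hypothesis secK : forall z, pib (sec z) = z.
Hypothesis mubE : forall B, measurable B -> mub B = muY (Y `&` pib @^-1` B).
Hypothesis invFb : forall B, measurable B -> mub (Fb @^-1` B) = mub B.
Hypothesis ergFb : forall B, measurable B -> Fb @^-1` B = B -> mub B = 0%E \/ mub B = 1%E.
Hypothesis hGM : gibbs_markov Fb mub part.
Hypotheses (C1 : 1 <= C) (g0_gt0 : 0 < g0) (g0_lt1 : g0 < 1) (eta0 : 0 < eta) (eta1 : eta <= 1).
Local Notation Hh := (fun z => H (sec z)).
Local Notation sep := (sep_ge part Fb).
Hypothesis Hh_lip : forall z z' n, part z = part z' -> sep z z' n ->
  `|Hh z - Hh z'| <= C * Hh z * g0 ^+ n.
Hypothesis stable : forall y y' t, Y y -> Y y' -> pib y' = pib y -> 0 <= t ->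
  dist (T t y) (T t y') <= C * g0 `^ t.
Hypothesis unstable : forall z z' n K t, part z = part z' -> sep z z' n ->
  0 <= K -> 0 <= t -> t <= K ->
  dist (T t (sec z)) (T t (sec z')) <= C * g0 `^ (n%:R - K / c).
Hypothesis unstable_lap : forall z z' n K t, part z = part z' -> sep z z' n.+1 ->
  0 <= K -> 0 <= t -> t <= K + Hh z ->
  dist (T t (sec z)) (T t (sec z')) <= C * g0 `^ (n%:R - K / c).
Hypothesis ks0 : 0 < ks.
Hypothesis suspension : forall (g B : M -> R) (N : set M),
  measurable_fun setT g -> (forall x, 0 <= g x) -> measurable_fun Y B ->
  measurable N -> muY N = 0%E ->
  (forall y u, Y y -> ~ N y -> 0 <= u <= H y -> g (T u y) <= B y) ->
  (\int[muM]_x (g x)%:E <= ks%:E * \int[muY]_(y in Y `\` N) (H y * B y)%:E)%E.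

Definition normalized (w : M -> R) : Prop :=
  [/\ measurable_fun setT w, (forall x, `|w x| <= 1),
      (forall x y, `|w x - w y| <= dist x y `^ eta) &
      (\int[muY]_(y in Y) (flow_int T w (H y) y)%:E = 0)%E].

Let dist_ge0 : forall x y, 0 <= dist x y. Proof. by have [] := hmet. Qed.

Let Hhc z : c <= Hh z. Proof. exact: Hc. Qed.
Let Hh0 z : 0 <= Hh z. Proof. by apply: le_trans (Hhc z); exact: ltW. Qed.
Let mFb : measurable_fun setT Fb. Proof. by have [] := hGM. Qed.
Let mpart : measurable_fun setT part. Proof. by have [_ []] := hGM. Qed.
Local Notation g1 := (contr_rate g0 eta).
Let CC : 0 <= C. Proof. exact: le_trans C1. Qed.

(** The section [sec] comes from a pointwise choice, so measurability is deduced from the Lipschitz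
    bound in the separation time. *)
Lemma measurable_Hh : measurable_fun setT Hh.
Proof.
apply: (measurable_sep_continuous Fb part mFb mpart setT) => // z e _ e0.
have [n hn] := exp_small g0 (C * Hh z) e (ltW g0_gt0) g0_lt1 (mulr_ge0 CC (Hh0 z)) e0.
exists n.+1 => z' _ s; apply: le_lt_trans (hn n.+1 (leqnSn n)).
by apply: Hh_lip => //; exact: (s 0%N).
Qed.

Lemma Hh_comparable z z' : part z = part z' -> Hh z <= (1 + C) * Hh z'.
Proof.
move=> e; have := Hh_lip z' z 0%N (esym e) _; rewrite expr0 mulr1 => /(_ _)/wrap[|h].
  by move=> k; rewrite ltn0.
by move: h; rewrite distrC ler_norml => /andP[_]; lra.
Qed.

Let th0 : R := Num.max (Num.max g0 (g1 `^ (c / 2))) (g1 `^ 4^-1).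

Let g1_0 : 0 < g1 := contr_rate_gt0 g0 eta g0_gt0.
Let g1_1 : g1 < 1 := contr_rate_lt1 g0 eta g0_gt0 g0_lt1 eta0.

Let th0_lt1 : th0 < 1.
Proof.
rewrite /th0 !gt_max g0_lt1 !powR_lt1 ?invr_gt0//.
by rewrite divr_gt0.
Qed.

Let th0_gt0 : 0 < th0.
Proof. by rewrite /th0 !lt_max g0_gt0. Qed.

Section observable.
Variable w : M -> R.
Hypothesis nw : normalized w.
Let mw : measurable_fun setT w. Proof. by case: nw. Qed.
Let w1 : forall x, `|w x| <= 1. Proof. by case: nw. Qed.
Let w_hol : forall x y, `|w x - w y| <= dist x y `^ eta. Proof. by case: nw. Qed.
Local Notation V := (Vhat T F H pib sec C g0 eta w).
Local Notation L := (lip_const C g0 eta c).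

Lemma Vhat_sep_lip th z z' m : th0 <= th -> th < 1 -> sep z z' m.+1 ->
  `|V z - V z'| <= L * Hh z * th ^+ m.
Proof.
move=> tt t1 s.
have : [&& g0 <= th, g1 `^ (c / 2) <= th & g1 `^ 4^-1 <= th].
  by move: tt; rewrite /th0 !ge_max -andbA.
case/and3P => a1 a2 a3; have t0 := lt_le_trans th0_gt0 tt.
exact: (Vhat_lip T Y F H pib Fb part sec dist C g0 eta c hT dist_ge0 FY F_flow c0 Hc pibF secY
  secK C1 g0_gt0 g0_lt1 eta0 eta1 Hh_lip stable unstable unstable_lap w mw w1 w_hol).
Qed.

Lemma lip_const_ge0 : 0 <= L.
Proof.
have b0 := contr_const_ge0 C g0 eta C1 g0_gt0 g0_lt1 eta0.
rewrite /lip_const; apply: addr_ge0; first apply: addr_ge0.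
- by apply: divr_ge0; [exact: mulr_ge0|exact: ltW].
- exact: mulr_ge0.
- by rewrite divr_ge0// subr_ge0 ltW// powR_lt1.
Qed.

Lemma measurable_Vhat : measurable_fun setT V.
Proof.
apply: (measurable_sep_continuous Fb part mFb mpart setT) => // z e _ e0.
have [n hn] := exp_small th0 (L * Hh z) e (ltW th0_gt0) th0_lt1 (mulr_ge0 lip_const_ge0 (Hh0 z)) e0.
exists n.+1 => z' _ s; apply: le_lt_trans (hn n (leqnn n)).
exact: Vhat_sep_lip.
Qed.

Lemma Vhat_le z : `|V z| <= Hh z + contr_const C g0 eta.
Proof.
exact: (Vhat_bound T Y F H pib Fb sec dist C g0 eta c hT dist_ge0 FY F_flow c0 Hc pibF secY secK
  C1 g0_gt0 g0_lt1 eta0 eta1 stable w mw w1 w_hol).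
Qed.

Lemma Vhat_shadow k y s : Y y -> birkhoff Fb Hh k (pib y) <= s ->
  `|flow_int T w s y - birkhoff Fb V k (pib y)| <=
    orbit_const C g0 eta c + (s - birkhoff Fb Hh k (pib y)).
Proof.
exact: (orbit_shadow T Y F H pib Fb sec dist C g0 eta c hT dist_ge0 FY F_flow c0 Hc pibF secY secK
  C1 g0_gt0 g0_lt1 eta0 eta1 stable w mw w1 w_hol).
Qed.

End observable.

Section matching.
Hypothesis matching : muY (Y `&` [set y | H y <> Hh (pib y)]) = 0%E.

Let mismatch := Y `&` [set y | H y <> Hh (pib y)].

Let mHhpib : measurable_fun Y (fun y => Hh (pib y)).
Proof. by apply: (measurableT_comp measurable_Hh); exact: mpib. Qed.

Let m_mismatch : measurable mismatch.
Proof.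
have m : measurable_fun Y (fun y => H y - Hh (pib y)) by exact: measurable_funB.
have := m mY (~` [set 0]) (measurableC (measurable_set1 0)); congr (measurable (_ `&` _)).
by apply/seteqP; split => y /=; move=> h e; apply: h; [rewrite e subrr|apply/eqP; rewrite -subr_eq0; apply/eqP].
Qed.

Definition bad_set : set M := \bigcup_i (Y `&` (iter i F) @^-1` mismatch).

Let mbad i : measurable (Y `&` (iter i F) @^-1` mismatch).
Proof. exact: (measurable_iter_F Y F mY FY mF i). Qed.

Lemma measurable_bad_set : measurable bad_set.
Proof. exact: bigcupT_measurable. Qed.

Lemma bad_set_null : muY bad_set = 0%E.
Proof.
apply: measure_bigcup0 => //; elim=> [|i ih].
  by rewrite -matching; congr (muY _); apply/seteqP; split => y /= => [[]|[]].
have e := inv _ (mbad i) (fun y => @proj1 _ _).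
apply: (etrans _ (etrans e ih)).
congr (muY _); apply/seteqP; split => y.
  by move=> [Yy]; rewrite /= -iterS iterSr => h; split => //; split => //; exact: FY.
by move=> [Yy [_]]; rewrite /= -iterSr.
Qed.

Lemma good_matching y : Y y -> ~ bad_set y -> matching_laps F H pib Hh y.
Proof.
move=> Yy nb i; apply: contrapT => ne; apply: nb; exists i => //; split => //; split => //.
exact: (iter_F_Y Y F FY).
Qed.

Lemma good_integral_le (G : Yb -> R) : measurable_fun setT G -> (forall z, 0 <= G z) ->
  (\int[muY]_(y in Y `\` bad_set) (H y * G (pib y))%:E <= \int[mub]_z (Hh z * G z)%:E)%E.
Proof.
move=> mG G0; have mb := measurable_bad_set.
have mHG : measurable_fun setT (fun z => (Hh z * G z)%:E).
  by apply/measurable_EFinP; apply: measurable_funM => //; exact: measurable_Hh.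
have HG0 z : (0 <= (Hh z * G z)%:E)%E by rewrite lee_fin mulr_ge0.
rewrite -(factor_integral_ge0 muY mub Y pib mY mpib mubE _ mHG HG0).
have -> : (\int[muY]_(y in Y `\` bad_set) (H y * G (pib y))%:E =
    \int[muY]_(y in Y `\` bad_set) (Hh (pib y) * G (pib y))%:E)%E.
  apply: eq_integral => y /set_mem [Yy nb].
  by have := good_matching y Yy nb 0%N; rewrite /= => ->.
apply: ge0_subset_integral => //.
- exact: measurableD.
- by apply: (measurableT_comp mHG); exact: mpib.
Qed.

Lemma Hh_moment_le (p : R) :
  (\int[mub]_z (Hh z `^ p)%:E <= \int[muY]_(y in Y) (`|H y| `^ p)%:E)%E.
Proof.
have mb := measurable_bad_set.
have mp : measurable_fun setT (fun z => (Hh z `^ p)%:E).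
  by apply/measurable_EFinP; exact: measurable_powRf measurable_Hh.
have p0 z : (0 <= (Hh z `^ p)%:E)%E by rewrite lee_fin powR_ge0.
rewrite -(factor_integral_ge0 muY mub Y pib mY mpib mubE _ mp p0).
have mY' : measurable_fun Y (fun y => (Hh (pib y) `^ p)%:E).
  by apply: (measurableT_comp mp); exact: mpib.
rewrite (ge0_negligible_integral mb mY mY' _ bad_set_null)//.
have -> : (\int[muY]_(y in Y `\` bad_set) (Hh (pib y) `^ p)%:E =
    \int[muY]_(y in Y `\` bad_set) (`|H y| `^ p)%:E)%E.
  apply: eq_integral => y /set_mem [Yy nb].
  have := good_matching y Yy nb 0%N; rewrite /= => <-.
  by rewrite ger0_norm// (le_trans (ltW c0)) ?Hc.
apply: ge0_subset_integral => //.
- exact: measurableD.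
- apply/measurable_EFinP; apply: (measurableT_comp (measurable_powR p)).
  exact: measurableT_comp.
Qed.

Lemma Hh_integrable : (\int[mub]_z (Hh z)%:E < +oo)%E.
Proof.
have h := Hh_moment_le 1.
have -> : (\int[mub]_z (Hh z)%:E = \int[mub]_z (Hh z `^ 1)%:E)%E.
  by apply: eq_integral => z _; rewrite powRr1.
apply: (le_lt_trans h).
have /integrableP[_ hH] := iH; apply: le_lt_trans hH.
rewrite le_eqVlt; apply/orP; left; apply/eqP; apply: eq_integral => y _ /=.
by rewrite powRr1.
Qed.

Lemma Vhat_integrable w : normalized w ->
  mub.-integrable setT (EFin \o Vhat T F H pib sec C g0 eta w).
Proof.
move=> nw; pose k := 1 + contr_const C g0 eta / c.
have b0 := contr_const_ge0 C g0 eta C1 g0_gt0 g0_lt1 eta0.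
have k0 : 0 <= k by rewrite addr_ge0// divr_ge0// ltW.
have mHk : measurable_fun setT (fun z => k * Hh z) by apply: measurable_scalef; exact: measurable_Hh.
apply: (integrable_dominated mub _ (fun z => k * Hh z)) => //.
- exact: measurable_Vhat.
- move=> z; apply: (le_trans (Vhat_le w nw z)); rewrite /k mulrDl mul1r lerD2l.
  by rewrite mulrAC -mulrA ler_peMr// ler_pdivlMr// mul1r.
have e := integral_scale mub k Hh k0 measurable_Hh Hh0.
rewrite e; apply: lte_mul_pinfty => //; exact: Hh_integrable.
Qed.

(** By shadowing, the Birkhoff sums of [Vhat] along projected orbits and the integrals of [w] over
    successive laps differ by a bounded amount. The difference of the two functions therefore has
    integral zero, by [bounded_birkhoff_integral] applied to both signs. *)
Lemma Vhat_mean_zero w : normalized w ->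
  (\int[mub]_z (Vhat T F H pib sec C g0 eta w z)%:E = 0)%E.
Proof.
move=> nw; have [mw w1 w_hol iw] := nw.
set V := Vhat T F H pib sec C g0 eta w.
have iV := Vhat_integrable w nw; rewrite -/V in iV.
have mV := measurable_Vhat w nw; rewrite -/V in mV.
have mV' : measurable_fun setT (EFin \o V) by exact/measurable_EFinP.
rewrite -(factor_integral muY mub Y pib mY mpib mubE _ mV').
have mVp : measurable_fun Y (fun y => V (pib y)) by exact: measurableT_comp.
have iVp : muY.-integrable Y (fun y => (V (pib y))%:E).
  apply/integrableP; split; first exact/measurable_EFinP.
  have /integrableP[_ hV] := iV.
  have ma : measurable_fun setT (fun z => `|(V z)%:E|%E) by exact: measurableT_comp.
  by rewrite (factor_integral_ge0 muY mub Y pib mY mpib mubE _ ma (fun z => abse_ge0 _)).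
pose v y := flow_int T w (H y) y.
have H0 y : Y y -> 0 <= H y by move=> Yy; apply: le_trans (Hc _ Yy); exact: ltW.
have mv : measurable_fun Y v by exact: flow_int_measurable_comp.
have iv : muY.-integrable Y (fun y => (v y)%:E).
  apply: (le_integrable mY _ _ iH); first exact/measurable_EFinP.
  by move=> y Yy; rewrite /= lee_fin [leRHS]ger0_norm ?H0// flow_int_le ?H0.
pose f y : R := if `[< Y y >] then V (pib y) - v y else 0.
have fE y : Y y -> f y = V (pib y) - v y by move=> Yy; rewrite /f; case: asboolP.
have ef : EFin \o f = (fun y => (V (pib y) - v y)%:E) \_ Y.
  apply/funext => y; rewrite patchE /f /=.
  by case: asboolP => Yy; [rewrite mem_set|rewrite memNset].
have if_ : muY.-integrable setT (EFin \o f).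
  rewrite ef; apply/(integrable_mkcond _ mY).
  by have := integrableB mY iVp iv; apply: eq_integrable.
have ifN : muY.-integrable setT (EFin \o (fun y => - f y)).
  by have := integrableN if_; apply: eq_integrable.
have Ev : (\int[muY]_y (f y)%:E = \int[muY]_(y in Y) (V (pib y))%:E)%E.
  transitivity (\int[muY]_(y in Y) (V (pib y) - v y)%:E)%E.
    by rewrite [RHS]integral_mkcond -ef.
  under eq_integral do rewrite EFinB.
  by rewrite (integralB mY iVp iv) [X in (_ - X)%E]iw sube0.
pose Ft := total_return Y F.
have mFt := measurable_total_return Y F mY mF.
have invFt := total_return_invariant Y F muY mY muY1 FY mF inv.
pose N := bad_set `|` ~` Y.
have mN : measurable N by apply: measurableU; [exact: measurable_bad_set|exact: measurableC].
have N0 : muY N = 0%E.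
  apply: null_set_setU; [exact: measurable_bad_set|exact: measurableC|exact: bad_set_null|].
  exact: muY_compl.
have bound n y : ~ N y -> `|birkhoff Ft f n y| <= orbit_const C g0 eta c.
  move=> nN; have Yy : Y y by apply: contrapT => nY; apply: nN; right.
  have ng : ~ bad_set y by move=> b; apply: nN; left.
  have my := good_matching y Yy ng.
  have -> : birkhoff Ft f n y = birkhoff Fb V n (pib y) - flow_int T w (birkhoff Fb Hh n (pib y)) y.
    rewrite (birkhoff_total_return Y F FY f (fun y => V (pib y) - v y) n y Yy fE).
    rewrite /birkhoff sumrB; congr (_ - _).
      by apply: eq_bigr => i _; rewrite (pib_iter Y F pib Fb FY pibF).
    rewrite -/(birkhoff Fb Hh n (pib y)) -(matching_birkhoff Y F H pib Fb Hh FY pibF n y Yy my).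
    exact: (birkhoff_flow_int T Y F H c hT FY F_flow c0 Hc w mw w1).
  have := Vhat_shadow w nw n y _ Yy (lexx _); rewrite subrr addr0 distrC.
  by [].
have h1 := bounded_birkhoff_integral muY Ft f N mFt invFt if_ mN N0 _.
have h2 := bounded_birkhoff_integral muY Ft (fun y => - f y) N mFt invFt ifN mN N0 _.
have ffin := integrable_fin_num measurableT if_.
apply/eqP; rewrite -Ev eq_le h1 /=; last first.
  move=> y Ny; exists (orbit_const C g0 eta c) => n.
  by apply: (le_trans _ (bound n y Ny)); exact: ler_norm.
have : (\int[muY]_x (- f x)%:E <= 0)%E.
  apply: h2 => y Ny; exists (orbit_const C g0 eta c) => n.
  apply: (le_trans _ (bound n y Ny)).
  have -> : birkhoff Ft (fun y => - f y) n y = - birkhoff Ft f n y by rewrite /birkhoff sumrN.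
  by rewrite -normrN; exact: ler_norm.
under eq_integral do rewrite EFinN.
by rewrite integralN ?oppe_le0//; exact: integrable_add_def.
Qed.

(** The martingale difference depends on the number of laps [n], since the remainder is taken of
    size [1 / n]: over at most [n] laps it adds up to at most 1. The constants depend neither on [n]
    nor on [w]. *)
Lemma martingale_approximation : exists2 Cm : R, 0 <= Cm & exists2 C6 : R, 0 <= C6 &
  forall w, normalized w -> forall n, (0 < n)%N -> exists m : Yb -> R,
    dominated_diff mub Fb Hh Cm m /\
    forall y k, Y y -> (k <= n)%N ->
      `|flow_int T w (birkhoff Fb Hh k (pib y)) y - birkhoff Fb m k (pib y)| <= C6.
Proof.
have b0 := contr_const_ge0 C g0 eta C1 g0_gt0 g0_lt1 eta0.
have l0 := lip_const_ge0.
(* The second term turns the additive constant of [Vhat_le] into a multiple of [Hh]; dividing by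
   [th0] in the third pays for the power of [th] lost in [Vhat_sep_lip]. *)
pose L := 1 + contr_const C g0 eta / c + lip_const C g0 eta c / th0.
have a1 : 0 <= contr_const C g0 eta / c by rewrite divr_ge0// ltW.
have a2 : 0 <= lip_const C g0 eta c / th0 by rewrite divr_ge0// ltW.
have L0 : 0 < L by rewrite /L; lra.
pose HL z := L * Hh z.
have mHL : measurable_fun setT HL by apply: measurable_scalef; exact: measurable_Hh.
have HLc z : L * c <= HL z by rewrite ler_wpM2l// ltW.
have HLcomp z z' : part z = part z' -> HL z <= (1 + C) * HL z'.
  by move=> e; rewrite /HL mulrCA ler_wpM2l ?(ltW L0)//; exact: Hh_comparable.
have iHL : (\int[mub]_z (HL z)%:E < +oo)%E.
  rewrite (integral_scale mub L Hh (ltW L0) measurable_Hh Hh0).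
  by apply: lte_mul_pinfty; rewrite ?lee_fin ?(ltW L0)//; exact: Hh_integrable.
have C10 : 0 <= 1 + C by rewrite addr_ge0.
have [th /andP[tt t1] [K K0 hK]] := gibbs_markov_coboundary Fb part mub hGM invFb ergFb HL (L * c)
  (1 + C) th0 (mulr_gt0 L0 c0) HLc C10 HLcomp mHL iHL th0_gt0 th0_lt1.
have th_gt0 : 0 < th := lt_le_trans th0_gt0 tt.
have o0 : 0 <= orbit_const C g0 eta c.
  by rewrite addr_ge0// (shadow_const_ge0 C g0 eta c)//.
exists (K * L); first by rewrite mulr_ge0 ?ltW.
exists (orbit_const C g0 eta c + 2 * K + 1); first by have := ltW K0; lra.
move=> w nw n n0; set V := Vhat T F H pib sec C g0 eta w.
have nR : 0 < n%:R :> R by rewrite ltr0n.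
have e0 : 0 < n%:R^-1 :> R by rewrite invr_gt0.
have e1 : n%:R^-1 <= 1 :> R by rewrite invf_le1// ler1n.
have Vb z : `|V z| <= HL z.
  apply: (le_trans (Vhat_le w nw z)); rewrite [leRHS](_ : _ = Hh z +
    (contr_const C g0 eta / c * Hh z + lip_const C g0 eta c / th0 * Hh z)); last by rewrite /HL /L; ring.
  rewrite lerD2l; apply: ler_wpDr; first exact: mulr_ge0.
  rewrite mulrAC -mulrA ler_peMr// ler_pdivlMr// mul1r.
  exact: Hhc.
have Vl z z' k : (0 < k)%N -> sep z z' k -> `|V z - V z'| <= HL z * th ^+ k.
  case: k => // k _ s; apply: (le_trans (Vhat_sep_lip w nw th z z' k tt t1 s)).
  rewrite exprS mulrA ler_wpM2r ?exprn_ge0 ?(ltW th_gt0)//.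
  have h1 : lip_const C g0 eta c <= L * th.
    rewrite /L [(_ + _) * th]mulrDl; apply: (@le_trans _ _ (lip_const C g0 eta c / th0 * th)).
      by rewrite mulrAC -mulrA ler_peMr// ler_pdivlMr// mul1r.
    by rewrite lerDr mulr_ge0 ?(ltW th_gt0)//; lra.
  by rewrite /HL mulrAC ler_wpM2r.
have [m [g [e [md mK gK eE VE]]]] := hK V n%:R^-1 e0 e1 (measurable_Vhat w nw) Vb Vl (Vhat_mean_zero w nw).
exists m; split; first by split => // z; rewrite -mulrA; exact: mK.
move=> y k Yy kn; set z := pib y.
have h1 := Vhat_shadow w nw k y _ Yy (lexx _); rewrite subrr addr0 -/z -/V in h1.
have h2 : birkhoff Fb V k z = birkhoff Fb m k z + (g (iter k Fb z) - g z) + \sum_(i < k) e (iter i.+1 Fb z).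
  elim: (k) => [|j ih]; first by rewrite !birkhoff0 big_ord0 /=; ring.
  by rewrite !birkhoffSr big_ord_recr /= ih VE; ring.
have h3 : `|\sum_(i < k) e (iter i.+1 Fb z)| <= 1.
  apply: (le_trans (ler_norm_sum _ _ _)).
  apply: (@le_trans _ _ (\sum_(i < k) (n%:R^-1 : R))); first by apply: ler_sum.
  rewrite sumr_const card_ord -[X in X <= _]mulr_natl ler_pdivrMr// mul1r.
  by rewrite ler_nat.
have g1' := gK (iter k Fb z); have g2' := gK z.
have -> : flow_int T w (birkhoff Fb Hh k z) y - birkhoff Fb m k z =
  (flow_int T w (birkhoff Fb Hh k z) y - birkhoff Fb V k z) + (g (iter k Fb z) - g z)
   + \sum_(i < k) e (iter i.+1 Fb z) by rewrite h2; ring.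
apply: (le_trans (ler_normD _ _)); apply: lerD => //.
apply: (le_trans (ler_normD _ _)); apply: lerD => //.
by apply: (le_trans (ler_normB _ _)); lra.
Qed.

Section transfer.
Variables (p Z : R).
Hypotheses (p1 : 1 < p) (Z0 : 0 <= Z).
Hypothesis hZ : (\int[mub]_z (Hh z `^ p)%:E <= Z%:E)%E.

(** A moment of order [rho] of the base bound [G] yields one of order [rho * (p - 1) / p] on the
    flow. With [rho = p] and [rho = p / 2] these are the exponents [p - 1] and [(p - 1) / 2]. *)
Lemma moment_transfer (rho A l : R) (g : M -> R) (G : Yb -> R) : 0 < rho -> 0 < l ->
  measurable_fun setT g -> (forall x, 0 <= g x) ->
  moment_le mub rho G (A * l `^ rho) ->
  (forall y u, Y y -> ~ bad_set y -> 0 <= u <= H y -> g (T u y) <= G (pib y)) ->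
  (\int[muM]_x (g x `^ (rho / p * (p - 1)))%:E <=
     (ks * (l `^ (rho / p * (p - 1)) * (Z + A)))%:E)%E.
Proof.
move=> rho0 l0 mg g_ge0 [mG G0 hG] hgG; set r := rho / p * (p - 1).
have pp := p1.
have r0 : 0 <= r by apply: mulr_ge0; [apply: divr_ge0; lra|lra].
have mGr : measurable_fun setT (fun z => G z `^ r) by exact: measurable_powRf.
have mgr : measurable_fun setT (fun x => g x `^ r) by exact: measurable_powRf.
have mB : measurable_fun Y (fun y => G (pib y) `^ r).
  by apply: (measurableT_comp mGr); exact: mpib.
have hb y u : Y y -> ~ bad_set y -> 0 <= u <= H y -> g (T u y) `^ r <= G (pib y) `^ r.
  by move=> Yy nb hu; apply: ge0_ler_powR; rewrite ?nnegrE// hgG.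
have h1 := suspension (fun x => g x `^ r) (fun y => G (pib y) `^ r) bad_set mgr
  (fun x => powR_ge0 _ _) mB measurable_bad_set bad_set_null hb.
apply: (le_trans h1); rewrite EFinM lee_wpmul2l ?lee_fin ?(ltW ks0)//.
apply: (le_trans (good_integral_le (fun z => G z `^ r) mGr (fun z => powR_ge0 _ _))).
pose D z := Hh z `^ p + (l `^ rho)^-1 * G z `^ rho.
have lr0 : 0 < l `^ rho by exact: powR_gt0.
have mHp : measurable_fun setT (fun z => Hh z `^ p) by apply: measurable_powRf; exact: measurable_Hh.
have mGp : measurable_fun setT (fun z => (l `^ rho)^-1 * G z `^ rho).
  by apply: measurable_scalef; exact: measurable_powRf.
have Hp0 z : 0 <= Hh z `^ p by exact: powR_ge0.
have Gp0 z : 0 <= (l `^ rho)^-1 * G z `^ rho by rewrite mulr_ge0 ?powR_ge0// invr_ge0 ltW.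
have mD : measurable_fun setT D by exact: measurable_funD.
have D0 z : 0 <= D z by rewrite addr_ge0.
apply: (@le_trans _ _ (\int[mub]_z (l `^ r * D z)%:E)%E).
  apply: integral_mono.
  - by apply: measurable_funM => //; exact: measurable_Hh.
  - exact: measurable_scalef.
  - by move=> z; rewrite mulr_ge0 ?powR_ge0.
  - by move=> z; exact: young_scaled.
rewrite (integral_scale mub (l `^ r) D (powR_ge0 _ _) mD D0) EFinM.
rewrite lee_wpmul2l ?lee_fin ?powR_ge0//.
rewrite (integral_sum2 mub _ _ mHp mGp Hp0 Gp0) EFinD; apply: leeD => //.
have i0 : 0 <= (l `^ rho)^-1 by rewrite invr_ge0 ltW.
rewrite (integral_scale mub _ (fun z => G z `^ rho) i0 (measurable_powRf rho G mG) (fun z => powR_ge0 _ _)).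
apply: (@le_trans _ _ (((l `^ rho)^-1)%:E * (A * l `^ rho)%:E)%E).
  by rewrite lee_wpmul2l ?lee_fin.
by rewrite -EFinM lee_fin mulrC mulfK ?gt_eqF.
Qed.

Let lap_count (t : R) : 1 <= t -> exists n : nat, [/\ (0 < n)%N, 1 + t / c <= n%:R &
  n%:R <= (2 + c^-1) * t].
Proof.
move=> t1; exists (Num.trunc (1 + t / c)).+1.
have x0 : 0 <= 1 + t / c by rewrite addr_ge0// divr_ge0 ?(ltW c0)//; lra.
split => //; first exact: ltW (truncnS_gt _).
have /andP[h _] := truncn_itv x0; rewrite -natr1.
have -> : (2 + c^-1) * t = 2 * t + t / c by ring.
lra.
Qed.

Theorem matching_first_moment : 2 <= p -> exists2 K : R, 0 <= K & forall w t, normalized w -> 1 <= t ->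
  (\int[muM]_x (`|flow_int T w t x| `^ (p - 1))%:E <= (K * t `^ ((p - 1) / 2))%:E)%E.
Proof.
move=> p2; have p0 : 0 < p by lra.
have [Cm Cm0 [C6 C60 hm]] := martingale_approximation.
have [K1 K10 hK1] := martingale_moment mub Fb mFb invFb Hh p Z Cm measurable_Hh Hh0 Cm0 Z0 hZ p2.
(* The moment constant that [moment_leD] and [moment_leZ] produce for
   [2 * U + (C6 + 2 * P ^ (1 / p))]. *)
pose A := 2 `^ p * (2 `^ p * K1 + 2 `^ p * (C6 `^ p + 2 `^ p * (2 * Z))).
have A0 : 0 <= A.
  rewrite mulr_ge0 ?powR_ge0// addr_ge0 ?mulr_ge0 ?powR_ge0// addr_ge0 ?powR_ge0//.
  by rewrite mulr_ge0 ?powR_ge0// mulr_ge0.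
have c2 : 0 <= 2 + c^-1 by rewrite addr_ge0// invr_ge0 ltW.
exists (ks * ((2 + c^-1) `^ ((p - 1) / 2) * (Z + A))).
  by rewrite mulr_ge0 ?(ltW ks0)// mulr_ge0 ?powR_ge0// addr_ge0.
move=> w t nw t1; have [mw w1 _ _] := nw.
have t0 : 0 <= t by lra.
have [n [n0 hn hn2]] := lap_count t t1.
have nR : 0 < n%:R :> R by rewrite ltr0n.
have n1 : 1 <= n%:R :> R by rewrite ler1n.
have [m [hd hs]] := hm w nw n n0.
have [md _] := hd; have [mm _] := md.
pose U := tail_max Fb (birkhoff Fb m) n.
(* A sum of powers replaces the maximum of the roofs over the laps. Its mean is at most
   [(n + 1) * Z], which is within [2 * Z * n ^ (p / 2)] because [p >= 2]. *)
pose P := birkhoff Fb (fun z => Hh z `^ p) n.+1.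
have Hp0 z : 0 <= Hh z `^ p by exact: powR_ge0.
have mHp : measurable_fun setT (fun z => Hh z `^ p) by apply: measurable_powRf; exact: measurable_Hh.
have P0 z : 0 <= P z by apply: sumr_ge0.
have mP : measurable_fun setT P by exact: measurable_birkhoff.
pose np := n%:R `^ (p / 2) : R.
have np1 : 1 <= np by rewrite /np -[leLHS](@powRr0 _ n%:R) ler_powR//; lra.
have npn : n%:R <= np.
  by rewrite /np -[leLHS](@powRr1 _ n%:R) ?(ltW nR)// ler_powR//; lra.
have mU : moment_le mub p U (K1 * np).
  split.
  - by apply: measurable_tail_max => // k; exact: measurable_birkhoff.
  - by move=> z; exact: tail_max_ge0.
  - by have [_] := hK1 m n hd.
have mP' : moment_le mub p (fun z => P z `^ p^-1) (2 * Z * np).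
  split.
  - exact: measurable_powRf.
  - by move=> z; exact: powR_ge0.
  have -> : (fun z => ((P z `^ p^-1) `^ p)%:E) = (fun z => (P z)%:E).
    by apply/funext => z; rewrite -powRrM mulVf ?gt_eqF// powRr1.
  apply: (le_trans (integral_birkhoff mub Fb mFb invFb _ Z n.+1 mHp Hp0 hZ)).
  rewrite lee_fin mulrAC; apply: ler_wpM2r => //; rewrite -natr1; lra.
have mC : moment_le mub p (cst C6) (C6 `^ p * np).
  have [a1 a2 a3] := moment_le_cst mub p C6 C60; split => //.
  by apply: (le_trans a3); rewrite lee_fin ler_peMr ?powR_ge0.
have pge : 0 <= p by lra.
have two0 : 0 <= 2 :> R by [].
have mG := moment_leD mub p pge _ _ _ _ (moment_leZ mub p _ _ _ two0 mU)
   (moment_leD mub p pge _ _ _ _ mC (moment_leZ mub p _ _ _ two0 mP')).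
have eA : A * (n%:R `^ 2^-1) `^ p = 2 `^ p * (2 `^ p * (K1 * np) + 2 `^ p * (C6 `^ p * np + 2 `^ p * (2 * Z * np))).
  rewrite -powRrM [2^-1 * p]mulrC -/np /A; ring.
rewrite -eA in mG.
have l0 : 0 < n%:R `^ 2^-1 :> R by exact: powR_gt0.
have mg : measurable_fun setT (fun x => `|flow_int T w t x|).
  by apply: measurable_normf; exact: measurable_flow_int1.
have Hkp k z : (k <= n)%N -> Hh (iter k Fb z) <= P z `^ p^-1.
  move=> kn; rewrite -[leLHS](@powRr1 _ _)// -(@mulfV _ p) ?gt_eqF// powRrM.
  apply: ge0_ler_powR; rewrite ?nnegrE ?invr_ge0 ?powR_ge0 ?(ltW p0)//.
  rewrite /P -[n.+1](subnKC (leqW kn)) birkhoffD subSn// birkhoffSl.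
  have x1 : 0 <= birkhoff Fb (fun z => Hh z `^ p) k z by exact: sumr_ge0.
  have x2 : 0 <= birkhoff Fb (fun z => Hh z `^ p) (n - k) (Fb (iter k Fb z)) by exact: sumr_ge0.
  lra.
have hb y u : Y y -> ~ bad_set y -> 0 <= u <= H y ->
    `|flow_int T w t (T u y)| <= 2 * U (pib y) + (cst C6 (pib y) + 2 * P (pib y) `^ p^-1).
  move=> Yy nb /andP[u0 uH].
  have my := good_matching y Yy nb.
  have [k kn hk] := path_bound1 T Y F H c pib Fb Hh hT c0 Hhc w m C6 n mw w1 hs y t u Yy my t0 u0 uH hn.
  apply: (le_trans hk); have := Hkp k (pib y) kn; have := Hkp 0%N (pib y) (leq0n n).
  rewrite /= -/U; lra.
have := moment_transfer p A (n%:R `^ 2^-1) _ _ p0 l0 mg (fun x => normr_ge0 _) mG hb.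
have -> : p / p * (p - 1) = p - 1 by rewrite mulfV ?gt_eqF// mul1r.
move=> h; apply: (le_trans h); rewrite lee_fin -!mulrA ler_wpM2l ?(ltW ks0)//.
rewrite mulrA [leRHS](_ : _ = ((2 + c^-1) `^ ((p - 1) / 2) * t `^ ((p - 1) / 2)) * (Z + A)); last by ring.
rewrite ler_wpM2r ?addr_ge0//.
rewrite -powRM// -powRrM mulrC; apply: ge0_ler_powR; rewrite ?nnegrE ?(ltW nR) ?mulr_ge0//.
lra.
Qed.

Theorem matching_second_moment : 4 <= p -> exists2 K : R, 0 <= K & forall w1 w2 t,
  normalized w1 -> normalized w2 -> 1 <= t ->
  (\int[muM]_x (`|flow_int2 T w1 w2 t x| `^ ((p - 1) / 2))%:E <= (K * t `^ ((p - 1) / 2))%:E)%E.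
Proof.
move=> p4; have p0 : 0 < p by lra.
have p2 : 2 <= p by lra.
have [Cm Cm0 [C6 C60 hm]] := martingale_approximation.
have [K1 K10 hK1] := martingale_moment mub Fb mFb invFb Hh p Z Cm measurable_Hh Hh0 Cm0 Z0 hZ p2.
have [K2 K20 hK2] := iterated_moment mub Fb mFb invFb Hh p Z Cm measurable_Hh Hh0 Cm0 Z0 hZ p4.
pose q := p / 2; have q2 : 2 <= q by rewrite /q; lra.
have q0 : 0 <= q by lra.
have q1 : 1 <= q by lra.
have pq : p = 2 * q by rewrite /q; field.
pose k := 20 + 2 * C6 / c + 2 * C6 * Cm / c + 4 * C6 ^+ 2.
have k0 : 0 <= k.
  rewrite /k !addr_ge0 ?divr_ge0 ?mulr_ge0 ?sqr_ge0 ?(ltW c0)//.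
(* The moment constant of [k * (1 + Q + U1 ^ 2 + U2 ^ 2 + UI)], with one factor [2 ^ q] for each
   addition. *)
pose A := k `^ q * (2 `^ q * (2 `^ q * (2 `^ q * (2 `^ q * (1 + 2 `^ q * Z) + K1) + K1) + K2)).
have A0 : 0 <= A.
  by rewrite /A; do ?[rewrite ?mulr_ge0 ?addr_ge0 ?powR_ge0//].
have c2 : 0 <= 2 + c^-1 by rewrite addr_ge0// invr_ge0 ltW.
exists (ks * ((2 + c^-1) `^ ((p - 1) / 2) * (Z + A))).
  by rewrite mulr_ge0 ?(ltW ks0)// mulr_ge0 ?powR_ge0// addr_ge0.
move=> w1 w2 t nw1 nw2 t1; have [mw1 w11 _ _] := nw1; have [mw2 w21 _ _] := nw2.
have t0 : 0 <= t by lra.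
have [n [n0 hn hn2]] := lap_count t t1.
have nR : 0 < n%:R :> R by rewrite ltr0n.
have n1 : 1 <= n%:R :> R by rewrite ler1n.
have [m1 [hd1 hs1]] := hm w1 nw1 n n0; have [m2 [hd2 hs2]] := hm w2 nw2 n n0.
have [md1 m1le] := hd1; have [mm1 _] := md1; have [md2 _] := hd2; have [mm2 _] := md2.
pose np := n%:R `^ q : R.
have np1 : 1 <= np by rewrite /np -[leLHS](@powRr0 _ n%:R) ler_powR.
have np0 : 0 <= np by lra.
have tail_sqr m : dominated_diff mub Fb Hh Cm m ->
    moment_le mub q (fun z => tail_max Fb (birkhoff Fb m) n z ^+ 2) (K1 * np).
  move=> hd; have [[mm _] _] := hd.
  have mt : measurable_fun setT (tail_max Fb (birkhoff Fb m) n).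
    by apply: measurable_tail_max => // j; exact: measurable_birkhoff.
  split.
  - exact: measurable_funX.
  - by move=> z; exact: sqr_ge0.
  have -> : (fun z => ((tail_max Fb (birkhoff Fb m) n z ^+ 2) `^ q)%:E) =
      (fun z => (tail_max Fb (birkhoff Fb m) n z `^ p)%:E).
    apply/funext => z; rewrite pq powRrM powR_mulrn//; exact: tail_max_ge0.
  by have [_] := hK1 m n hd.
have mU1 := tail_sqr m1 hd1; have mU2 := tail_sqr m2 hd2.
have mI j : measurable_fun setT (iterated_sum Fb m1 m2 j).
  apply: measurable_sum => i; apply: measurable_funM; first exact: measurable_birkhoff.
  by apply: measurableT_comp => //; exact: measurable_iter_map.
have mUI : moment_le mub q (tail_max Fb (iterated_sum Fb m1 m2) n) (K2 * np).
  split; first exact: measurable_tail_max.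
    by move=> z; exact: tail_max_ge0.
  exact: hK2.
have mHs : measurable_fun setT (fun z => Hh z ^+ 2) by apply: measurable_funX; exact: measurable_Hh.
have mQ : moment_le mub q (birkhoff Fb (fun z => Hh z ^+ 2) n.+1) (2 `^ q * Z * np).
  split; first exact: measurable_birkhoff.
    by move=> z; apply: sumr_ge0 => i _; exact: sqr_ge0.
  have hZ' : (\int[mub]_z ((Hh z ^+ 2) `^ q)%:E <= Z%:E)%E.
    by under eq_integral do rewrite -powR_mulrn// -powRrM -pq.
  apply: (le_trans (moment_birkhoff mub Fb mFb invFb _ q Z n.+1 q1 mHs (fun z => sqr_ge0 _) hZ')).
  have h9 : n.+1%:R `^ q <= (2 * n%:R) `^ q :> R.
    have hnn : n.+1%:R <= 2 * n%:R :> R by rewrite -natr1; lra.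
    by apply: ge0_ler_powR => //; rewrite ?nnegrE ?mulr_ge0//; lra.
  rewrite lee_fin mulrAC ler_wpM2r// /np -powRM//.
have m1' : moment_le mub q (cst 1) np.
  have [a1 a2 a3] := moment_le_cst mub q 1 ler01; split => //.
  by apply: (le_trans a3); rewrite powR1 lee_fin.
have mG := moment_leZ mub q _ _ _ k0 (moment_leD mub q q0 _ _ _ _ (moment_leD mub q q0 _ _ _ _
   (moment_leD mub q q0 _ _ _ _ (moment_leD mub q q0 _ _ _ _ m1' mQ) mU1) mU2) mUI).
have eA : A * n%:R `^ q = k `^ q * (2 `^ q * (2 `^ q * (2 `^ q * (2 `^ q * (np + 2 `^ q * Z * np) +
    K1 * np) + K1 * np) + K2 * np)) by rewrite -/np /A; ring.
rewrite -eA in mG.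
have mg : measurable_fun setT (fun x => `|flow_int2 T w1 w2 t x|).
  by apply: measurable_normf; exact: measurable_flow_int2.
have hb y u : Y y -> ~ bad_set y -> 0 <= u <= H y -> `|flow_int2 T w1 w2 t (T u y)| <=
    k * (cst 1 (pib y) + birkhoff Fb (fun z => Hh z ^+ 2) n.+1 (pib y)
      + tail_max Fb (birkhoff Fb m1) n (pib y) ^+ 2 + tail_max Fb (birkhoff Fb m2) n (pib y) ^+ 2
      + tail_max Fb (iterated_sum Fb m1 m2) n (pib y)).
  move=> Yy nb /andP[u0 uH]; have my := good_matching y Yy nb.
  exact: (path_bound2 T Y F H c pib Fb Hh hT FY F_flow c0 Hc Hhc pibF w1 w2 m1 m2 C6 Cm n
    mw1 mw2 w11 w21 C60 Cm0 hs1 hs2 m1le y t u Yy my t0 u0 uH hn).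
have qp : 0 < q by lra.
have := moment_transfer q A n%:R _ _ qp nR mg (fun x => normr_ge0 _) mG hb.
have -> : q / p * (p - 1) = (p - 1) / 2 by rewrite /q; field; rewrite gt_eqF.
move=> h; apply: (le_trans h); rewrite lee_fin -!mulrA ler_wpM2l ?(ltW ks0)//.
rewrite mulrA [leRHS](_ : _ = ((2 + c^-1) `^ ((p - 1) / 2) * t `^ ((p - 1) / 2)) * (Z + A)); last by ring.
rewrite ler_wpM2r ?addr_ge0//.
rewrite -powRM//; apply: ge0_ler_powR; rewrite ?nnegrE ?(ltW nR) ?mulr_ge0//.
lra.
Qed.

End transfer.
End matching.

Let Y_H0 y : Y y -> 0 <= H y.
Proof. by move=> Yy; apply: le_trans (Hc y Yy); exact: ltW. Qed.

Lemma suspension_cst : exists2 hb : R, 0 <= hb & forall (g : M -> R) (B : R) (N : set M),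
  measurable_fun setT g -> (forall x, 0 <= g x) -> 0 <= B -> measurable N -> muY N = 0%E ->
  (forall y u, Y y -> ~ N y -> 0 <= u <= H y -> g (T u y) <= B) ->
  (\int[muM]_x (g x)%:E <= (hb * B)%:E)%E.
Proof.
pose e := (\int[muY]_(y in Y) (H y)%:E)%E.
have e0 : (0 <= e)%E by apply: integral_ge0 => y /Y_H0; rewrite lee_fin.
have ef : e \is a fin_num by exact: integrable_fin_num.
have fe0 : 0 <= fine e by exact: fine_ge0.
exists (ks * fine e); first by rewrite mulr_ge0// ltW.
move=> g B N mg gg0 B0 mN N0 hg.
have mB : measurable_fun Y (fun _ : M => B) by exact: measurable_cst.
have h := suspension g (fun=> B) N mg gg0 mB mN N0 hg.
apply: (le_trans h); rewrite -mulrA EFinM lee_wpmul2l ?lee_fin ?(ltW ks0)//.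
have mHB : measurable_fun Y (fun y => (H y * B)%:E).
  by apply/measurable_EFinP; exact: measurable_funM.
apply: (@le_trans _ _ (\int[muY]_(y in Y) (H y * B)%:E)%E).
  apply: ge0_subset_integral => //; first exact: measurableD.
  by move=> y Yy; rewrite lee_fin mulr_ge0// Y_H0.
under eq_integral do rewrite EFinM.
rewrite ge0_integralZr//.
- by rewrite EFinM fineK.
- exact/measurable_EFinP.
Qed.

Lemma bounded_growth : muY (Y `&` [set y | H y <> Hh (pib y)]) <> 0%E ->
  exists2 b : R, 0 < b & forall w, normalized w ->
    exists N, [/\ measurable N, muY N = 0%E & forall y u s, Y y -> ~ N y -> 0 <= u -> 0 <= s ->
      `|flow_int T w s (T u y)| <= b].
Proof.
move=> nm.
have pos : (0 < muY (Y `&` [set y | H y <> Hh (pib y)]))%E by rewrite lt0e measure_ge0 andbT; apply/eqP.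
have mHh' : measurable_fun Y (fun y => Hh (pib y)).
  by apply: (measurableT_comp measurable_Hh); exact: mpib.
have pibF' y y' : Y y -> Y y' -> pib y = pib y' -> pib (F y) = pib (F y').
  by move=> Yy Yy' e; rewrite !pibF// e.
have [b b0 hb] := degenerate_case T Y F H muY c hT mY muY1 FY F_flow c0 Hc mF mH iH inv erg pib sec
  dist C g0 eta hmet secY secK pibF' C1 g0_gt0 g0_lt1 eta0 eta1 stable mHh' pos.
exists b => // w [mw w1 wh wi]; have [N [mN N0 hN]] := hb w mw w1 wh wi.
exists N; split => // y u s Yy nN u0 s0.
have e := flow_intD T hT w mw w1 u s y u0 s0.
have -> : flow_int T w s (T u y) = flow_int T w (u + s) y - flow_int T w u y by rewrite e; ring.
by apply: hN => //; exact: addr_ge0.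
Qed.

Section moments.
Variable p : R.
Hypothesis mom : (\int[muY]_(y in Y) (`|H y| `^ p)%:E < +oo)%E.

Let matching_moment : muY (Y `&` [set y | H y <> Hh (pib y)]) = 0%E ->
  exists2 Z : R, 0 <= Z & (\int[mub]_z (Hh z `^ p)%:E <= Z%:E)%E.
Proof.
move=> m0; have mom' := mom; set e := (\int[muY]_(y in Y) (`|H y| `^ p)%:E)%E in mom'.
have e0 : (0 <= e)%E by apply: integral_ge0 => y _; rewrite lee_fin powR_ge0.
exists (fine e); first exact: fine_ge0.
by rewrite fineK ?ge0_fin_numE//; exact: Hh_moment_le.
Qed.

(** Long times are counted in laps, and the bound of this count by a multiple of [t] uses [1 <= t].
    For [t < 1] a pointwise bound is integrated over the finite measure [muM]. *)
Let moment_split (r : R) (J : (M -> R) -> (M -> R) -> R -> M -> R) : 0 < r ->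
  (forall w1 w2 t, normalized w1 -> normalized w2 -> measurable_fun setT (J w1 w2 t)) ->
  (forall w1 w2 t x, normalized w1 -> normalized w2 -> 0 < t -> t < 1 ->
    `|J w1 w2 t x| `^ r <= t `^ ((p - 1) / 2)) ->
  (exists2 K : R, 0 <= K & forall w1 w2 t, normalized w1 -> normalized w2 -> 1 <= t ->
    (\int[muM]_x (`|J w1 w2 t x| `^ r)%:E <= (K * t `^ ((p - 1) / 2))%:E)%E) ->
  exists2 K : R, 0 < K & forall w1 w2 t, normalized w1 -> normalized w2 -> 0 < t ->
    (\int[muM]_x (`|J w1 w2 t x| `^ r)%:E <= (K * t `^ ((p - 1) / 2))%:E)%E.
Proof.
move=> r0 mJ short [K K0 long]; have [hb hb0 hs] := suspension_cst.
exists (K + hb + 1); first lra.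
move=> w1 w2 t n1 n2 t0; have tr0 := powR_ge0 t ((p - 1) / 2).
have [t1|t1] := leP 1 t.
  apply: (le_trans (long w1 w2 t n1 n2 t1)); rewrite lee_fin ler_wpM2r//; lra.
apply: (le_trans (hs _ (t `^ ((p - 1) / 2)) set0 _ _ tr0 _ _ _)) => //.
- by apply: measurable_powRf; apply: measurable_normf; exact: mJ.
- by move=> y u _ _ _; exact: short.
- by rewrite lee_fin ler_wpM2r//; lra.
Qed.

Let degenerate_first : 2 <= p ->
  muY (Y `&` [set y | H y <> Hh (pib y)]) <> 0%E ->
  exists2 K : R, 0 <= K & forall w t, normalized w -> 1 <= t ->
    (\int[muM]_x (`|flow_int T w t x| `^ (p - 1))%:E <= (K * t `^ ((p - 1) / 2))%:E)%E.
Proof.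
move=> p2 nm; have [b b0 hb] := bounded_growth nm; have [hk hk0 hs] := suspension_cst.
exists (hk * b `^ (p - 1)); first by rewrite mulr_ge0 ?powR_ge0.
move=> w t nw t1; have [N [mN N0 hN]] := hb w nw; have [mw _ _ _] := nw.
have tt : 1 <= t `^ ((p - 1) / 2).
  by rewrite -[leLHS](powRr0 t) ler_powR//; lra.
apply: (le_trans (hs _ (b `^ (p - 1)) N _ _ _ mN N0 _)).
- by apply: measurable_powRf; apply: measurable_normf; exact: measurable_flow_int1.
- by move=> x; exact: powR_ge0.
- exact: powR_ge0.
- move=> y u Yy nN /andP[u0 _]; apply: ge0_ler_powR; rewrite ?nnegrE ?(ltW b0)//; first lra.
  by apply: hN => //; lra.
- by rewrite lee_fin ler_peMr// mulr_ge0 ?powR_ge0.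
Qed.

(** Only the inner integral has to stay bounded: the outer one then contributes at most the factor
    [t]. *)
Let degenerate_second : 4 <= p ->
  muY (Y `&` [set y | H y <> Hh (pib y)]) <> 0%E ->
  exists2 K : R, 0 <= K & forall w1 w2 t, normalized w1 -> normalized w2 -> 1 <= t ->
    (\int[muM]_x (`|flow_int2 T w1 w2 t x| `^ ((p - 1) / 2))%:E <= (K * t `^ ((p - 1) / 2))%:E)%E.
Proof.
move=> p4 nm; have [b b0 hb] := bounded_growth nm; have [hk hk0 hs] := suspension_cst.
exists (hk * b `^ ((p - 1) / 2)); first by rewrite mulr_ge0 ?powR_ge0.
move=> w1 w2 t n1 n2 t1; have [N [mN N0 hN]] := hb w1 n1.
have [mw1 _ _ _] := n1; have [mw2 w21 _ _] := n2; have t0 : 0 <= t by lra.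
apply: (le_trans (hs _ ((b * t) `^ ((p - 1) / 2)) N _ _ _ mN N0 _)).
- by apply: measurable_powRf; apply: measurable_normf; exact: measurable_flow_int2.
- by move=> x; exact: powR_ge0.
- exact: powR_ge0.
- move=> y u Yy nN /andP[u0 _]; have b0' := ltW b0.
  have h : `|flow_int2 T w1 w2 t (T u y)| <= b * t.
    rewrite mulrC; apply: (flow_int2_le T hT w1 w2 mw1 mw2 w21 b t) => // r /andP[r0 _].
    exact: hN.
  by apply: ge0_ler_powR => //; rewrite ?nnegrE ?mulr_ge0//; lra.
- by rewrite lee_fin powRM ?(ltW b0)// mulrA.
Qed.

Theorem first_moment : 2 <= p -> exists2 K : R, 0 < K & forall w t, normalized w -> 0 < t ->
  (\int[muM]_x (`|flow_int T w t x| `^ (p - 1))%:E <= (K * t `^ ((p - 1) / 2))%:E)%E.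
Proof.
move=> p2; have r0 : 0 < p - 1 by lra.
have [|||K K0 hK] := moment_split (p - 1) (fun w _ t => flow_int T w t) r0.
- by move=> w _ t [mw _ _ _] _; exact: measurable_flow_int1.
- move=> w _ t x [mw w1 _ _] _ t0 t1; have h := flow_int_le T hT w mw w1 t x (ltW t0).
  apply: (@le_trans _ _ (t `^ (p - 1))).
    by apply: ge0_ler_powR => //; rewrite ?nnegrE ltW.
  by apply: ger_powR; [apply/andP; split; lra|lra].
- have [m0|nm] := pselect (muY (Y `&` [set y | H y <> Hh (pib y)]) = 0%E).
    have [Z Z0 hZ] := matching_moment m0; have p1 : 1 < p by lra.
    have [K K0 hK] := matching_first_moment m0 p Z p1 Z0 hZ p2.
    by exists K => // w1 _ t n1 _; exact: hK.
  have [K K0 hK] := degenerate_first p2 nm.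
  by exists K => // w1 _ t n1 _; exact: hK.
- by exists K => // w t nw t0; exact: (hK w w).
Qed.

Theorem second_moment : 4 <= p -> exists2 K : R, 0 < K & forall w1 w2 t,
  normalized w1 -> normalized w2 -> 0 < t ->
  (\int[muM]_x (`|flow_int2 T w1 w2 t x| `^ ((p - 1) / 2))%:E <= (K * t `^ ((p - 1) / 2))%:E)%E.
Proof.
move=> p4; have r0 : 0 < (p - 1) / 2 by lra.
apply: (moment_split ((p - 1) / 2) (flow_int2 T) r0).
- by move=> w1 w2 t [mw1 _ _ _] [mw2 _ _ _]; exact: measurable_flow_int2.
- move=> w1 w2 t x [mw1 w11 _ _] [mw2 w21 _ _] t0 t1.
  have h := flow_int2_sqr_le T hT w1 w2 mw1 mw2 w11 w21 t x (ltW t0).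
  have h2 : t ^+ 2 <= t by rewrite expr2 ger_pMl// ltW.
  by apply: ge0_ler_powR; rewrite ?nnegrE ?(ltW r0) ?(ltW t0)//; exact: le_trans h2.
- have [m0|nm] := pselect (muY (Y `&` [set y | H y <> Hh (pib y)]) = 0%E).
    have [Z Z0 hZ] := matching_moment m0; have p1 : 1 < p by lra.
    exact: (matching_second_moment m0 p Z p1 Z0 hZ p4).
  exact: degenerate_second.
Qed.

End moments.

End assembly.

(** * Vector-valued observables *)

Section observables.
Context {R : realType} {dM : measure_display} {M : measurableType dM}.
Variable T : R -> M -> M.
Hypothesis hT : measurable_semiflow T.

Lemma flow_intZ (k : R) (w : M -> R) t x : measurable_fun setT w -> (forall x, `|w x| <= 1) ->
  flow_int T (fun x => k * w x) t x = k * flow_int T w t x.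
Proof.
move=> mw w1; rewrite !(flow_int_clip T) -RintegralZl//.
apply: (bounded_integrable (fun r => w (clip T (r, x))) 1); last by [].
exact: measurable_orbit.
Qed.

Lemma flow_int2Z (k : R) (w1 w2 : M -> R) t x : measurable_fun setT w1 -> measurable_fun setT w2 ->
  (forall x, `|w1 x| <= 1) -> (forall x, `|w2 x| <= 1) ->
  flow_int2 T (fun x => k * w1 x) (fun x => k * w2 x) t x = k ^+ 2 * flow_int2 T w1 w2 t x.
Proof.
move=> mw1 mw2 w11 w21; rewrite !(flow_int2_clip T) -RintegralZl//.
  apply: eq_Rintegral => r _; rewrite /= flow_intZ//; ring.
have mi : measurable_fun setT (fun r => flow_int T w1 r x * w2 (clip T (r, x))).
  have mo := measurable_orbit T hT w2 x mw2.
  apply: measurable_funM => //.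
  by have := flow_int_measurable_comp T hT w1 mw1 setT id (cst x) measurableT (@measurable_id _ _ _) (measurable_cst _).
apply: (bounded_integrable (fun r => flow_int T w1 r x * w2 (clip T (r, x))) t t mi) => // r /andP[r0 rt].
rewrite normrM; apply: (@le_trans _ _ (`|flow_int T w1 r x| * 1)); first by rewrite ler_wpM2l.
by rewrite mulr1; apply: le_trans rt; exact: flow_int_le.
Qed.

End observables.

Section matrix_norm.
Context {R : realType} {m n : nat}.

Lemma mnorm_ge0 (A : 'M[R]_(m, n)) : 0 <= mnorm A.
Proof. exact: sqrtr_ge0. Qed.

Lemma mnorm_entry (A : 'M[R]_(m, n)) i j : `|A i j| <= mnorm A.
Proof.
rewrite -sqrtr_sqr /mnorm ler_sqrt; last first.
  by apply: sumr_ge0 => k _; apply: sumr_ge0 => l _; exact: sqr_ge0.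
rewrite (bigD1 i)//= (bigD1 j)//= -addrA lerDl addr_ge0//.
  by apply: sumr_ge0 => l _; exact: sqr_ge0.
by apply: sumr_ge0 => k _; apply: sumr_ge0 => l _; exact: sqr_ge0.
Qed.

Lemma mnorm_le_sum (A : 'M[R]_(m, n)) :
  mnorm A <= \sum_(p : 'I_m * 'I_n) `|A p.1 p.2|.
Proof.
have s0 : 0 <= \sum_(p : 'I_m * 'I_n) `|A p.1 p.2| by apply: sumr_ge0.
rewrite -[leRHS]ger0_norm// -sqrtr_sqr /mnorm ler_sqrt ?sqr_ge0//.
rewrite (pair_bigA _ (fun i j => A i j ^+ 2))/=.
elim: (index_enum _) => [|p r ih]; first by rewrite !big_nil expr0n.
rewrite !big_cons sqrrD real_normK ?num_real//.
have r0 : 0 <= \sum_(j <- r) `|A j.1 j.2| by apply: sumr_ge0.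
rewrite -addrA lerD2l; apply: (le_trans ih); rewrite lerDr mulrn_wge0// mulr_ge0//.
Qed.

Lemma mnorm0_entry (A : 'M[R]_(m, n)) i j : mnorm A <= 0 -> A i j = 0.
Proof. by move=> h; apply/normr0_eq0/le_anti; rewrite normr_ge0 andbT (le_trans (mnorm_entry A i j)). Qed.

End matrix_norm.

Section holder.
Context {R : realType} {dM : measure_display} {M : measurableType dM}.
Variables (dist : M -> M -> R) (eta : R).
Hypotheses (hmet : is_metric dist) (hborel : borel_for dist) (eta0 : 0 < eta).

Lemma holder_measurable (w : M -> R) : (forall x y, `|w x - w y| <= dist x y `^ eta) ->
  measurable_fun setT w.
Proof.
move=> hw; apply: (measurability _ (RGenOInfty.measurableE R)) => _ [_ [a ->] <-].
rewrite setTI; apply/hborel; apply: sub_sigma_algebra => x /=.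
rewrite in_itv /= andbT => ax; have d0 : 0 < w x - a by rewrite subr_gt0.
exists ((w x - a) `^ eta^-1); first exact: powR_gt0.
move=> y xy; rewrite /= in_itv /= andbT.
have [dge _ _ _] := hmet.
have : `|w x - w y| < w x - a.
  apply: (le_lt_trans (hw x y)); have -> : w x - a = ((w x - a) `^ eta^-1) `^ eta.
    by rewrite -powRrM mulVf ?gt_eqF// powRr1// ltW.
  by apply: gt0_ltr_powR; rewrite ?nnegrE ?powR_ge0.
by have := ler_norm (w x - w y); lra.
Qed.

Lemma holder_normP {d} (v : M -> 'cV[R]_d) : (holder_norm dist eta v < +oo)%E ->
  exists N : R, [/\ 0 <= N, holder_norm dist eta v = N%:E, (forall x, mnorm (v x) <= N) &
    forall x y, x <> y -> mnorm (v x - v y) <= N * dist x y `^ eta].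
Proof.
rewrite /holder_norm; set A := ereal_sup _; set B := ereal_sup _ => fin.
have A0 : (0 <= A)%E by apply: ereal_sup_ubound; left.
have B0 : (0 <= B)%E by apply: ereal_sup_ubound; left.
have [a Ea] : exists a, A = a%:E.
  case: A A0 fin => [a| |]//= _; first by exists a.
  by case: B B0.
have [b Eb] : exists b, B = b%:E.
  case: B B0 fin => [b| |]//= _; first by exists b.
  by rewrite Ea.
have a0 : 0 <= a by rewrite -lee_fin -Ea.
have b0 : 0 <= b by rewrite -lee_fin -Eb.
exists (a + b); split => //; first exact: addr_ge0.
- by rewrite Ea Eb.
- move=> x; have : ((mnorm (v x))%:E <= A)%E by apply: ereal_sup_ubound; right; exists x.
  by rewrite Ea lee_fin; lra.
- move=> x y xy; have [dge d0 _ _] := hmet.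
  have dp : 0 < dist x y.
    by rewrite lt_neqAle dge andbT eq_sym; apply/eqP => /d0.
  have : ((mnorm (v x - v y) / dist x y `^ eta)%:E <= B)%E.
    by apply: ereal_sup_ubound; right; exists (x, y).
  rewrite Eb lee_fin ler_pdivrMr ?powR_gt0// => h; apply: (le_trans h).
  by rewrite ler_wpM2r ?powR_ge0// lerDr.
Qed.

(** For [N = 0] the observable vanishes and division by 0 returns 0, so the identities still hold
    and later arguments need no case distinction. *)
Lemma holder_rescale {d} (v : M -> 'cV[R]_d) N i : 0 <= N ->
  (forall x, mnorm (v x) <= N) ->
  (forall x y, x <> y -> mnorm (v x - v y) <= N * dist x y `^ eta) ->
  [/\ forall x, v x i 0 = N * (v x i 0 / N), forall x, `|v x i 0 / N| <= 1 &
      forall x y, `|v x i 0 / N - v y i 0 / N| <= dist x y `^ eta].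
Proof.
move=> N0 vN vL; have [e|Nn0] := eqVneq N 0.
  have v0 x : v x i 0 = 0 by apply: mnorm0_entry; rewrite -e.
  split=> [x|x|x y]; first by rewrite v0 e mul0r.
    by rewrite v0 mul0r normr0.
  by rewrite !v0 mul0r subr0 normr0 powR_ge0.
have Np : 0 < N by rewrite lt_neqAle eq_sym Nn0.
split=> [x|x|x y]; first by rewrite mulrC divfK.
  rewrite normrM (gtr0_norm (_ : 0 < N^-1)) ?invr_gt0// ler_pdivrMr// mul1r.
  exact: le_trans (mnorm_entry _ _ _) (vN x).
rewrite -mulrBl normrM (gtr0_norm (_ : 0 < N^-1)) ?invr_gt0// ler_pdivrMr// mulrC.
have [->|/eqP xy] := eqVneq x y; first by rewrite subrr normr0 mulr_ge0// powR_ge0.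
have := mnorm_entry (v x - v y) i 0; rewrite !mxE => h.
by apply: (le_trans h); exact: vL.
Qed.

End holder.

Section lebesgue_norm.
Context {R : realType} {dM : measure_display} {M : measurableType dM}.
Variable mu : {measure set M -> \bar R}.

Lemma integralZ_eq0 (k N : R) (f : M -> R) : (mu setT < +oo)%E -> measurable_fun setT f ->
  (forall x, `|f x| <= N) -> (\int[mu]_x (f x)%:E = 0)%E -> (\int[mu]_x (k * f x)%:E = 0)%E.
Proof.
move=> fin mf fN f0.
have if_ : mu.-integrable setT (EFin \o f).
  apply: measurable_bounded_integrable => //; exists `|N|; split; first exact: num_real.
  by move=> x Nx y _; rewrite /= (le_trans (fN y))// (le_trans (ler_norm N))// ltW.
under eq_integral do rewrite EFinM.
by rewrite (integralZl measurableT if_) f0 mule0.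
Qed.

(** The matrix norm is at most the sum of the absolute values of the entries, and [power_mean] over
    [d = m * n] entries costs the factor [D = d ^ (q - 1) * d]. *)
Lemma Lnorm_mnorm_le (q : R) (m n : nat) : 1 <= q -> exists2 D : R, 0 <= D &
  forall (A : M -> 'M[R]_(m, n)) (W : 'I_m -> 'I_n -> M -> R) (N B : R),
  0 <= N -> 0 <= B -> (forall x i j, A x i j = N * W i j x) ->
  (forall i j, measurable_fun setT (W i j)) ->
  (forall i j, \int[mu]_x (`|W i j x| `^ q)%:E <= B%:E)%E ->
  (Lnorm mu q%:E (fun x => (mnorm (A x))%:E) <= (N * (D * B) `^ q^-1)%:E)%E.
Proof.
move=> q1; set I : finType := ('I_m * 'I_n)%type; pose d := #|I|.
have q0 : 0 < q by lra.
exists (d%:R `^ (q - 1) * d%:R); first by rewrite mulr_ge0 ?powR_ge0.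
move=> A W N B N0 B0 AW mW hW.
pose S x := \sum_(p : I) `|W p.1 p.2 x|.
have mWp (p : I) : measurable_fun setT (fun x => `|W p.1 p.2 x|) by exact: measurable_normf.
have mWq (p : I) : measurable_fun setT (fun x => `|W p.1 p.2 x| `^ q) by exact: measurable_powRf.
have Wq0 (p : I) x : 0 <= `|W p.1 p.2 x| `^ q by exact: powR_ge0.
have mA : measurable_fun setT (fun x => mnorm (A x)).
  rewrite (_ : (fun x => _) = fun x => (\sum_(i < m) \sum_(j < n) (A x i j) ^+ 2) `^ 2^-1).
    apply: measurable_powRf; apply: measurable_sum => i; apply: measurable_sum => j.
    apply: measurable_funX; rewrite (_ : (fun x => _) = fun x => N * W i j x).
      exact: measurable_scalef.
    by apply/funext => x; rewrite AW.
  apply/funext => x; rewrite /mnorm powR12_sqrt//.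
  by apply: sumr_ge0 => i _; apply: sumr_ge0 => j _; exact: sqr_ge0.
have AS x : mnorm (A x) <= N * S x.
  apply: (le_trans (mnorm_le_sum _)); rewrite /S mulr_sumr; apply: ler_sum => p _.
  by rewrite AW normrM (ger0_norm N0).
have Sq x : S x `^ q <= d%:R `^ (q - 1) * \sum_(p : I) `|W p.1 p.2 x| `^ q.
  pose a k := if insub k is Some k' then `|W (enum_val (k' : 'I_d)).1 (enum_val k').2 x| else 0.
  have a0 k : 0 <= a k by rewrite /a; case: insub.
  have e (f : R -> R) : \sum_(p : I) f `|W p.1 p.2 x| = \sum_(k < d) f (a k).
    rewrite (reindex (@enum_val I (fun=> true))) /=; last first.
      exact/onW_bij/enum_val_bij.
    by apply: eq_bigr => k _; rewrite /a valK.
  by rewrite /S (e id) (e (fun y => y `^ q)); exact: power_mean.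
have S0 x : 0 <= S x by apply: sumr_ge0.
have hI : (\int[mu]_x (mnorm (A x) `^ q)%:E <= (N `^ q * (d%:R `^ (q - 1) * d%:R * B))%:E)%E.
  pose G x := N `^ q * (d%:R `^ (q - 1) * \sum_(p : I) `|W p.1 p.2 x| `^ q).
  have ms : measurable_fun setT (fun x => \sum_(p : I) `|W p.1 p.2 x| `^ q).
    exact: measurable_sum.
  have s0 x : 0 <= \sum_(p : I) `|W p.1 p.2 x| `^ q by apply: sumr_ge0.
  apply: (@le_trans _ _ (\int[mu]_x (G x)%:E)%E).
    apply: ge0_le_integral => //.
    - by move=> x _; rewrite lee_fin powR_ge0.
    - by apply/measurable_EFinP; exact: measurable_powRf.
    - by apply/measurable_EFinP; apply: measurable_scalef; exact: measurable_scalef.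
    - move=> x _; rewrite lee_fin; apply: (@le_trans _ _ ((N * S x) `^ q)).
        by apply: ge0_ler_powR; rewrite ?nnegrE ?mnorm_ge0 ?mulr_ge0 ?(ltW q0).
      by rewrite powRM// /G ler_wpM2l ?powR_ge0.
  rewrite /G; under eq_integral do rewrite mulrA EFinM.
  rewrite ge0_integralZl_EFin//; last 3 first.
  - by move=> x _; rewrite lee_fin.
  - exact/measurable_EFinP.
  - by rewrite mulr_ge0 ?powR_ge0.
  rewrite [leRHS](_ : _ = ((N `^ q * d%:R `^ (q - 1))%:E * (d%:R * B)%:E)%E); last by rewrite -EFinM; congr _%:E; ring.
  rewrite lee_wpmul2l ?lee_fin ?mulr_ge0 ?powR_ge0//.
  under eq_integral do rewrite -sumEFin.
  rewrite ge0_integral_sum//.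
  - apply: (@le_trans _ _ (\sum_(p : I) B%:E)%E); first by apply: lee_sum => p _; exact: hW.
    rewrite (sumEFin _ (fun=> true) (fun=> B)) lee_fin.
    by have -> : \sum_(p : I) B = d%:R * B by rewrite (sumr_const (mem I)) mulr_natl.
  - by move=> p; apply/measurable_EFinP; exact: mWq.
rewrite unlock /=.
have -> : (fun x => (`|(mnorm (A x))%:E| `^ q)%E) = (fun x => (mnorm (A x) `^ q)%:E).
  by apply/funext => x; rewrite /= ger0_norm// mnorm_ge0.
set E := (\int[mu]_x _)%E in hI *.
have E0 : (0 <= E)%E by apply: integral_ge0 => x _; rewrite lee_fin powR_ge0.
case: E E0 hI => [e| |]// e0; rewrite !lee_fin in e0 * => h.
have R0 : 0 <= d%:R `^ (q - 1) * d%:R * B by rewrite !mulr_ge0 ?powR_ge0.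
apply: (@le_trans _ _ ((N `^ q * (d%:R `^ (q - 1) * d%:R * B)) `^ q^-1)).
  by apply: ge0_ler_powR; rewrite ?nnegrE ?invr_ge0 ?(ltW q0) ?mulr_ge0 ?powR_ge0.
by rewrite powRM ?powR_ge0// -powRrM mulfV ?gt_eqF// powRr1.
Qed.

End lebesgue_norm.

Lemma lap_contraction {R : realType} (g G J b : R) (k : nat) : 0 < g -> g < 1 ->
  G <= g ^+ k -> J <= b -> G * g `^ (- J) <= g `^ (k%:R - b).
Proof.
move=> g0 g1 hG hJ; apply: (@le_trans _ _ (g ^+ k * g `^ (- J))).
  by rewrite ler_wpM2r ?powR_ge0.
rewrite powRD; last by rewrite (gt_eqF g0) implybT.
rewrite powR_mulrn ?(ltW g0)// ler_wpM2l ?exprn_ge0 ?(ltW g0)//.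
by apply: ger_powR; [rewrite g0 ltW|rewrite lerN2].
Qed.

Theorem theorem4p5
  (R : realType) (dM : measure_display) (M : measurableType dM)
  (dist : M -> M -> R) (X Y : set M) (T : R -> M -> M) (h : M -> R)
  (tau : M -> nat) (muY : probability M R) (muX muM : {measure set M -> \bar R})
  (dY : measure_display) (Yb : measurableType dY) (pib : M -> Yb)
  (Fb : Yb -> Yb) (part : Yb -> nat) (mub : probability Yb R)
  (Yhat : set M) (C g0 eta : R) (d : nat)
  (* (M,dist) bounded metric space with its Borel sigma-algebra *)
  (hmet : is_metric dist) (hbdd : metric_bounded dist) (hborel : borel_for dist)
  (* Y ⊂ X ⊂ M Borel, measurable semiflow T *)
  (hX : measurable X) (hY : measurable Y) (hYX : Y `<=` X)
  (hT : measurable_semiflow T)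
  (* roof function h : X -> (0,oo), f = T_h : X -> X *)
  (hh : forall x, X x -> 0 < h x) (hhm : measurable_fun X h)
  (hfX : forall x, X x -> X (flow_f T h x))
  (* return time tau : Y -> Z^+, F = f^tau : Y -> Y *)
  (htau : forall y, Y y -> (0 < tau y)%N)
  (htaum : measurable_fun Y (fun y => (tau y)%:R : R))
  (hFY : forall y, Y y -> Y (induced_F T h tau y))
  (* mu_Y : ergodic F-invariant probability on Y, tau integrable *)
  (hmuY : muY Y = 1%E)
  (hinv : forall A, measurable A -> A `<=` Y ->
            muY (Y `&` induced_F T h tau @^-1` A) = muY A)
  (herg : forall A, measurable A -> A `<=` Y ->
            Y `&` induced_F T h tau @^-1` A = A -> muY A = 0%E \/ muY A = 1%E)
  (htauint : muY.-integrable Y (fun y => ((tau y)%:R : R)%:E))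
  (* mu_X = pi_* mu^tau *)
  (hmuX : forall A, measurable A ->
     muX A = (\int[muY]_(y in Y)
                 (\sum_(l < tau y) \1_A (iter l (flow_f T h) y))%:E
              * ((fine (\int[muY]_(y in Y) ((tau y)%:R : R)%:E))^-1)%:E)%E)
  (* h in L^1(mu_X) *)
  (hhint : muX.-integrable X (EFin \o h))
  (* mu_M = image of (mu_X x Leb)/int h on {(x,u) : 0 <= u <= h(x)} under (x,u) |-> T_u x *)
  (hmuM : forall A, measurable A ->
     muM A = (\int[muX]_(x in X)
                 (@lebesgue_measure R) ([set u : R | (0 <= u <= h x)%R] `&` [set u : R | A (T u x)])
              * ((fine (\int[muX]_(x in X) (h x)%:E))^-1)%:E)%E)
  (* quotient by the stable leaves W^s_y = {y' in Y | pib y' = pib y} *)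
  (hpib : measurable_fun Y pib)
  (hpib_onto : forall z, exists2 y, Y y & pib y = z)
  (hleafF : forall y y', Y y -> Y y' -> pib y = pib y' ->
              pib (induced_F T h tau y) = pib (induced_F T h tau y'))
  (hFb : forall y, Y y -> Fb (pib y) = pib (induced_F T h tau y))
  (htau_leaf : forall y y', Y y -> Y y' -> pib y = pib y' -> tau y = tau y')
  (hmub : forall B, measurable B -> mub B = muY (Y `&` pib @^-1` B))
  (hmub_inv : forall B, measurable B -> mub (Fb @^-1` B) = mub B)
  (hmub_erg : forall B, measurable B -> Fb @^-1` B = B -> mub B = 0%E \/ mub B = 1%E)
  (hGM : gibbs_markov Fb mub part)
  (* H integrable, inf H > 0 *)
  (hHint : muY.-integrable Y (EFin \o roofH T h tau))
  (hHinf : exists2 c : R, 0 < c & forall y, Y y -> c <= roofH T h tau y)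
  (* Yhat meets each stable leaf in exactly one point *)
  (hYhat_m : measurable Yhat) (hYhat_sub : Yhat `<=` Y)
  (hYhat_leaf : forall y, Y y -> exists! y', Yhat y' /\ pib y' = pib y)
  (* constants *)
  (hC : 1 <= C) (hg0 : 0 < g0 < 1) (heta : 0 < eta <= 1)
  (hH_lip : forall y y', Yhat y -> Yhat y' -> part (pib y) = part (pib y') ->
     `|roofH T h tau y - roofH T h tau y'|
       <= C * inf [set roofH T h tau z | z in [set z | Y z /\ part (pib z) = part (pib y)]]
            * gpow_sep g0 part Fb (pib y) (pib y'))
  (hflow_hol : forall y t t', Yhat y -> 0 <= t -> 0 <= t' ->
     dist (T t y) (T t' y) <= C * `|t - t'| `^ eta)
  (hstable : forall y y' t, Y y -> Y y' -> pib y' = pib y -> 0 <= t ->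
     dist (T t y) (T t y') <= C * g0 `^ t)
  (hunstable : forall y y' t, Yhat y -> Yhat y' -> part (pib y) = part (pib y') -> 0 <= t ->
     dist (T t y) (T t y')
       <= C * (gpow_sep g0 part Fb (pib y) (pib y') * g0 `^ (- lapJ T h tau t y))) :
  (* (a) *)
  (forall p : R, 2 <= p ->
     (\int[muY]_(y in Y) (`|roofH T h tau y| `^ p)%:E < +oo)%E ->
     exists2 K : R, 0 < K &
       forall (v : M -> 'cV[R]_d) (t : R),
         (holder_norm dist eta v < +oo)%E ->
         (forall i, \int[muM]_x (v x i 0)%:E = 0)%E ->
         0 < t ->
         (Lnorm muM (p - 1)%:E (fun x => (mnorm (vint T v t x))%:E)
            <= (K * t `^ (2^-1))%:E * holder_norm dist eta v)%E)
  /\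
  (* (b) *)
  (forall p : R, 4 <= p ->
     (\int[muY]_(y in Y) (`|roofH T h tau y| `^ p)%:E < +oo)%E ->
     exists2 K : R, 0 < K &
       forall (v : M -> 'cV[R]_d) (t : R),
         (holder_norm dist eta v < +oo)%E ->
         (forall i, \int[muM]_x (v x i 0)%:E = 0)%E ->
         0 < t ->
         (Lnorm muM ((p - 1) / 2)%:E (fun x => (mnorm (Sint T v t x))%:E)
            <= (K * t)%:E * (holder_norm dist eta v * holder_norm dist eta v))%E).
Proof.
have [c c0 Hc] := hHinf; have /andP[g0_gt0 g0_lt1] := hg0; have /andP[eta0 eta1] := heta.
set H := roofH T h tau; set F := induced_F T h tau.
have [dist_ge0 dist0 _ _] := hmet.
have secE z : exists y, Yhat y /\ pib y = z.
  have [y Yy <-] := hpib_onto z.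
  by have [y' [[h1 h2] _]] := hYhat_leaf y Yy; exists y'.
have [sec secP] := choice secE.
have secY z : Y (sec z) by apply: hYhat_sub; have [] := secP z.
have secK z : pib (sec z) = z by have [] := secP z.
have F_flow : forall y, Y y -> F y = T (H y) y by exact: (induced_F_flow T h tau X Y).
have mF : measurable_fun Y F by exact: (measurable_induced_F T h tau X Y muY).
have mH : measurable_fun Y H by exact: (measurable_roofH T h tau Y muY).
have pibF y : Y y -> pib (F y) = Fb (pib y) by move=> Yy; rewrite hFb.
have Hh_lip z z' n : part z = part z' -> sep_ge part Fb z z' n ->
    `|H (sec z) - H (sec z')| <= C * H (sec z) * g0 ^+ n.
  move=> e s; have [Yz _] := secP z; have [Yz' _] := secP z'.
  have := hH_lip _ _ Yz Yz'; rewrite !secK => /(_ e) h1; apply: (le_trans h1).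
  have gs := gpow_sep_le g0 part Fb z z' n (ltW g0_gt0) s.
  have C0 : 0 <= C by exact: le_trans hC.
  have Hz0 : 0 <= H (sec z) by apply: le_trans (Hc _ (secY z)); exact: ltW.
  have hi : inf [set H y | y in [set y | Y y /\ part (pib y) = part z]] <= H (sec z).
    apply: ge_inf; last by exists (sec z) => //; split; rewrite ?secK.
    by exists c => _ [y [Yy _] <-]; exact: Hc.
  apply: (@le_trans _ _ (C * H (sec z) * gpow_sep g0 part Fb z z')).
    rewrite ler_wpM2r//; last by rewrite ler_wpM2l.
    apply: lb_le_inf; first by exists (g0 ^+ 0); exists 0%N => // k; rewrite ltn0.
    by move=> _ [m _ <-]; rewrite exprn_ge0 ?(ltW g0_gt0).
  by rewrite ler_wpM2l ?mulr_ge0.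
have unstable z z' n K t : part z = part z' -> sep_ge part Fb z z' n ->
    0 <= K -> 0 <= t -> t <= K ->
    dist (T t (sec z)) (T t (sec z')) <= C * g0 `^ (n%:R - K / c).
  move=> e s K0 t0 tK; have [Yz _] := secP z; have [Yz' _] := secP z'.
  have := hunstable _ _ t Yz Yz'; rewrite !secK => /(_ e t0) h1; apply: (le_trans h1).
  rewrite ler_wpM2l ?(le_trans ler01)//; apply: lap_contraction => //.
    exact: gpow_sep_le (ltW g0_gt0) s.
  exact: (lapJ_le_time T h tau Y c c0 Hc hFY).
have unstable_lap z z' n K t : part z = part z' -> sep_ge part Fb z z' n.+1 ->
    0 <= K -> 0 <= t -> t <= K + H (sec z) ->
    dist (T t (sec z)) (T t (sec z')) <= C * g0 `^ (n%:R - K / c).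
  move=> e s K0 t0 tK; have [Yz _] := secP z; have [Yz' _] := secP z'.
  have := hunstable _ _ t Yz Yz'; rewrite !secK => /(_ e t0) h1; apply: (le_trans h1).
  rewrite ler_wpM2l ?(le_trans ler01)//.
  (* One of the [n + 1] steps of separation pays for the additional lap in [1 + K / c]. *)
  have -> : n%:R - K / c = n.+1%:R - (1 + K / c) by rewrite -natr1; ring.
  apply: lap_contraction => //; first exact: gpow_sep_le (ltW g0_gt0) s.
  exact: (lapJ_le_lap T h tau Y c c0 Hc hFY).
have [ks ks0 susp] := suspension_bound T h tau X Y muY muX muM hT hX hY hYX hh hhm hfX htau htaum
  hmuY htauint hmuX hmuM hHint hHinf.
(* Finiteness comes from the suspension bound for the constant function 1. *)
have finM : (muM setT < +oo)%E.
  have [hb _ hs] := suspension_cst T Y H muY muM c ks hY c0 Hc mH hHint ks0 susp.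
  have := hs (cst 1) 1 set0 (measurable_cst _) (fun=> ler01) ler01 measurable0 (measure0 _)
    (fun y u _ _ _ => lexx _).
  have -> : (\int[muM]_x (cst 1 x)%:E = muM setT)%E.
    by transitivity (\int[muM]_x (cst 1%E x))%E => //; rewrite integral_cst// mul1e.
  by move=> hle; apply: le_lt_trans hle (ltry _).
have normalize (v : M -> 'cV[R]_d) N i : 0 <= N -> (forall x, mnorm (v x) <= N) ->
    (forall x y, x <> y -> mnorm (v x - v y) <= N * dist x y `^ eta) ->
    (\int[muM]_x (v x i 0)%:E = 0)%E ->
    normalized T Y H muY dist eta (fun x => v x i 0 / N) /\ (forall x, v x i 0 = N * (v x i 0 / N)).
  move=> N0 vN vL v0; have [vE w1 wh] := holder_rescale dist eta v N i N0 vN vL.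
  have mw : measurable_fun setT (fun x => v x i 0 / N) := holder_measurable dist eta hmet hborel eta0 _ wh.
  have mv : measurable_fun setT (fun x => v x i 0).
    by rewrite (_ : (fun x => _) = fun x => N * (v x i 0 / N)); [exact: measurable_scalef|exact/funext].
  split => //; split => //.
  apply: (suspension_mean_zero T h tau X Y muY muX muM hT hX hY hYX hh hhm hfX htau htaum hmuY
    htauint hmuX hmuM hHint hHinf _ mw w1).
  have := integralZ_eq0 muM N^-1 N (fun x => v x i 0) finM mv _ v0.
  rewrite (_ : (fun x => (N^-1 * v x i 0)%:E) = fun x => (v x i 0 / N)%:E); last first.
    by apply/funext => x; rewrite mulrC.
  by apply => x; exact: le_trans (mnorm_entry _ _ _) (vN x).
have first p : 2 <= p -> (\int[muY]_(y in Y) (`|H y| `^ p)%:E < +oo)%E ->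
    exists2 K : R, 0 < K & forall w t, normalized T Y H muY dist eta w -> 0 < t ->
    (\int[muM]_x (`|flow_int T w t x| `^ (p - 1))%:E <= (K * t `^ ((p - 1) / 2))%:E)%E.
  move=> p2 mom; exact: (first_moment T Y F H muY muM dist pib Fb part sec mub C g0 eta c ks hT
    hmet hY hmuY hFY F_flow c0 Hc mF mH hHint hinv herg hpib pibF secY secK hmub hmub_inv hmub_erg
    hGM hC g0_gt0 g0_lt1 eta0 eta1 Hh_lip hstable unstable unstable_lap ks0 susp p mom p2).
have second p : 4 <= p -> (\int[muY]_(y in Y) (`|H y| `^ p)%:E < +oo)%E ->
    exists2 K : R, 0 < K & forall w1 w2 t, normalized T Y H muY dist eta w1 ->
    normalized T Y H muY dist eta w2 -> 0 < t ->
    (\int[muM]_x (`|flow_int2 T w1 w2 t x| `^ ((p - 1) / 2))%:E <= (K * t `^ ((p - 1) / 2))%:E)%E.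
  move=> p4 mom; exact: (second_moment T Y F H muY muM dist pib Fb part sec mub C g0 eta c ks hT
    hmet hY hmuY hFY F_flow c0 Hc mF mH hHint hinv herg hpib pibF secY secK hmub hmub_inv hmub_erg
    hGM hC g0_gt0 g0_lt1 eta0 eta1 Hh_lip hstable unstable unstable_lap ks0 susp p mom p4).
split => p hp mom.
- have [K K0 hK] := first p hp mom.
  have q1 : 1 <= p - 1 by rewrite lerBrDr.
  have [D D0 hD] := Lnorm_mnorm_le muM (p - 1) d 1 q1.
  exists ((D * K) `^ (p - 1)^-1 + 1); first by rewrite ltr_wpDl ?powR_ge0.
  move=> v t vfin v0 t0.
  have [N [N0 eN vN vL]] := holder_normP dist eta hmet v vfin.
  have nw i := normalize v N i N0 vN vL (v0 i).
  have Bt : 0 <= K * t `^ ((p - 1) / 2) by rewrite mulr_ge0 ?powR_ge0// ltW.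
  have hL := hD (vint T v t) (fun i _ => flow_int T (fun x => v x i 0 / N) t) N _ N0 Bt.
  rewrite eN; apply: (le_trans (hL _ _ _)) => [x i j|i j|i j|].
  - have [[mw w1 _ _] vE] := nw i.
    by rewrite mxE -(flow_intZ T hT N _ t x mw w1); apply: eq_Rintegral => s _; rewrite -vE.
  - by have [[mw _ _ _] _] := nw i; exact: measurable_flow_int1.
  - by apply: hK => //; exact: (nw i).1.
  rewrite -EFinM lee_fin mulrC ler_wpM2r//.
  rewrite mulrA powRM ?mulr_ge0 ?powR_ge0 ?(ltW K0)// -powRrM.
  have -> : (p - 1) / 2 * (p - 1)^-1 = 2^-1 by rewrite mulrAC mulfV ?mul1r// gt_eqF// (lt_le_trans ltr01).
  by rewrite ler_wpM2r ?powR_ge0// lerDl.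
- have [K K0 hK] := second p hp mom.
  have q1 : 1 <= (p - 1) / 2 by lra.
  have [D D0 hD] := Lnorm_mnorm_le muM ((p - 1) / 2) d d q1.
  exists ((D * K) `^ ((p - 1) / 2)^-1 + 1); first by rewrite ltr_wpDl ?powR_ge0.
  move=> v t vfin v0 t0.
  have [N [N0 eN vN vL]] := holder_normP dist eta hmet v vfin.
  have nw i := normalize v N i N0 vN vL (v0 i).
  have Bt : 0 <= K * t `^ ((p - 1) / 2) by rewrite mulr_ge0 ?powR_ge0// ltW.
  have hL := hD (Sint T v t)
    (fun i j => flow_int2 T (fun x => v x i 0 / N) (fun x => v x j 0 / N) t) (N ^+ 2) _ (sqr_ge0 N) Bt.
  rewrite eN; apply: (le_trans (hL _ _ _)) => [x i j|i j|i j|].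
  - have [[mw1 w11 _ _] vE1] := nw i; have [[mw2 w21 _ _] vE2] := nw j.
    rewrite mxE -(flow_int2Z T hT N _ _ t x mw1 mw2 w11 w21); apply: eq_Rintegral => s _.
    by rewrite -vE2; congr (_ * _); apply: eq_Rintegral => r _; rewrite -vE1.
  - by have [[mw1 _ _ _] _] := nw i; have [[mw2 _ _ _] _] := nw j; exact: measurable_flow_int2.
  - by apply: hK => //; [exact: (nw i).1|exact: (nw j).1].
  rewrite -!EFinM lee_fin mulrC -expr2 ler_wpM2r ?sqr_ge0//.
  have r0 : (p - 1) / 2 != 0 by rewrite gt_eqF// (lt_le_trans ltr01).
  rewrite mulrA powRM ?mulr_ge0 ?powR_ge0 ?(ltW K0)// -powRrM mulfV// powRr1 ?(ltW t0)//.
  by rewrite ler_wpM2r ?(ltW t0)// lerDl.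
Qed.
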